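(* Let $M$ be the closed unit disc in $\mathbb{R}^2$ with polar coordinates $(r,\theta)$, let $u=\omega\,\frac{\partial}{\partial\theta}$ be a rigid rotation for some constant $\omega$, and suppose the barotropic fluid has pressure function $p(\rho)=c^2\rho^2/2$ for some constant $c>0$, so that the steady density is $$\rho(r)=\rho_0-\frac{\omega^2}{2c^2}+\frac{\omega^2r^2}{2c^2},\qquad \rho_0>\frac{\omega^2}{2c^2}.$$ Assume the boundary conditions are such that the density is a prescribed constant on the boundary but the velocity is unconstrained; i.e. for the linearized equations the boundary condition is $\sigma=0$ at $r=1$. Then all solutions $(\sigma,v)$ of the linearized equations $$\frac{\partial\sigma}{\partial t}+\operatorname{div}(\sigma u)+\operatorname{div}(\rho v)=0,\qquad\frac{\partial v}{\partial t}+\nabla_uv+\nabla_vu+c^2\operatorname{grad}\sigma=0$$ are bounded in time, and the solutions can be written explicitly as sums of functions of the form $Q(t,r,\theta)=e^{iyt}q(r)e^{in(\theta-\omega t)}$ for some real $y$, some $n\in\mathbb{Z}$, and some function $q$.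
   Context: The barotropic Euler equations are $u_t+\nabla_uu=-\frac1\rho\operatorname{grad}p(\rho)$, $\rho_t+\operatorname{div}(\rho u)=0$; with $p(\rho)=c^2\rho^2/2$ the first reads $u_t+\nabla_uu=-c^2\operatorname{grad}\rho$, and the given $(u,\rho)$ is a steady solution, with boundary density $\rho(1)=\rho_0$. The unknowns of the linearized equations are a time-dependent function $\sigma$ (density perturbation) and a time-dependent vector field $v$ (velocity perturbation) on the disc; all objects are smooth. $\nabla$ is the flat connection on $\mathbb{R}^2$. *)

(* Defs.v *)
From Stdlib Require Import Reals ZArith List.
From Coquelicot Require Import Coquelicot.
Open Scope R_scope.

(* Vector fields on the plane are given by their Cartesian components. *)
Definition scalar_field := R -> R -> R.
Record vector_field := VectorField { vx : scalar_field; vy : scalar_field }.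

Definition in_disc (x y : R) : Prop := x ^ 2 + y ^ 2 <= 1.
Definition on_circle (x y : R) : Prop := x ^ 2 + y ^ 2 = 1.

Inductive coord := coord_t | coord_x | coord_y.

Definition slice (i : coord) (f : R -> scalar_field) (t x y : R) : R -> R :=
  match i with
  | coord_t => fun s => f s x y
  | coord_x => fun s => f t s y
  | coord_y => fun s => f t x s
  end.

Definition coord_val (i : coord) (t x y : R) : R :=
  match i with coord_t => t | coord_x => x | coord_y => y end.

Definition partial (i : coord) (f : R -> scalar_field) : R -> scalar_field :=
  fun t x y => Derive (slice i f t x y) (coord_val i t x y).

Definition iter_partial (l : list coord) (f : R -> scalar_field) :
  R -> scalar_field := fold_right partial f l.

(* C^oo on R^3: all iterated partial derivatives exist and are jointly
   continuous.  The existence clause is needed because [Derive] is total. *)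
Definition smooth (f : R -> scalar_field) : Prop :=
  forall (l : list coord) (t x y : R),
    (forall i : coord,
       ex_derive (slice i (iter_partial l f) t x y) (coord_val i t x y)) /\
    continuous
      (fun p : R * (R * R) => iter_partial l f (fst p) (fst (snd p)) (snd (snd p)))
      (t, (x, y)).

Definition pdx (f : scalar_field) : scalar_field :=
  fun x y => Derive (fun s => f s y) x.
Definition pdy (f : scalar_field) : scalar_field :=
  fun x y => Derive (fun s => f x s) y.

Definition grad (f : scalar_field) : vector_field :=
  VectorField (pdx f) (pdy f).

Definition div (X : vector_field) : scalar_field :=
  fun x y => pdx (vx X) x y + pdy (vy X) x y.

Definition smul (f : scalar_field) (X : vector_field) : vector_field :=
  VectorField (fun x y => f x y * vx X x y) (fun x y => f x y * vy X x y).

(* The flat connection: [nabla X Y] is the derivative of Y along X. *)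
Definition nabla (X Y : vector_field) : vector_field :=
  VectorField
    (fun x y => vx X x y * pdx (vx Y) x y + vy X x y * pdy (vx Y) x y)
    (fun x y => vx X x y * pdx (vy Y) x y + vy X x y * pdy (vy Y) x y).

(* omega d/dtheta, where d/dtheta = - y d/dx + x d/dy. *)
Definition rotation (omega : R) : vector_field :=
  VectorField (fun x y => - omega * y) (fun x y => omega * x).

(* With r^2 = x^2 + y^2. *)
Definition density (omega c rho0 : R) : scalar_field :=
  fun x y => rho0 - omega ^ 2 / (2 * c ^ 2)
             + omega ^ 2 * (x ^ 2 + y ^ 2) / (2 * c ^ 2).

(* Smoothness up to the boundary of the closed disc is expressed by taking
   sigma and v defined and smooth on the whole plane; their values outside the
   disc are unconstrained.  The equations at boundary points do not depend on
   the extension, since the derivatives are continuous. *)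
Definition linearized_solution (omega c rho0 : R)
    (sigma : R -> scalar_field) (v : R -> vector_field) : Prop :=
  let u := rotation omega in
  let rho := density omega c rho0 in
  smooth sigma /\
  smooth (fun t => vx (v t)) /\
  smooth (fun t => vy (v t)) /\
  (forall t x y, in_disc x y ->
     Derive (fun s => sigma s x y) t
     + div (smul (sigma t) u) x y + div (smul rho (v t)) x y = 0) /\
  (forall t x y, in_disc x y ->
     Derive (fun s => vx (v s) x y) t
     + vx (nabla u (v t)) x y + vx (nabla (v t) u) x y
     + c ^ 2 * vx (grad (sigma t)) x y = 0) /\
  (forall t x y, in_disc x y ->
     Derive (fun s => vy (v s) x y) t
     + vy (nabla u (v t)) x y + vy (nabla (v t) u) x y
     + c ^ 2 * vy (grad (sigma t)) x y = 0) /\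
  (forall t x y, on_circle x y -> sigma t x y = 0).

Definition bounded_in_time
    (sigma : R -> scalar_field) (v : R -> vector_field) : Prop :=
  exists K : R, forall t x y, in_disc x y ->
    Rabs (sigma t x y) <= K /\
    sqrt (vx (v t) x y ^ 2 + vy (v t) x y ^ 2) <= K.

(* Polar expressions.  The components of a vector field are taken in the
   orthonormal frame d/dr, (1/r) d/dtheta, so that they make sense (as
   functions of (r, theta)) and are smooth down to r = 0. *)
Definition polar (f : scalar_field) (r theta : R) : R :=
  f (r * cos theta) (r * sin theta).

Definition radial_comp (X : vector_field) (r theta : R) : R :=
  cos theta * polar (vx X) r theta + sin theta * polar (vy X) r theta.

Definition angular_comp (X : vector_field) (r theta : R) : R :=
  - sin theta * polar (vx X) r theta + cos theta * polar (vy X) r theta.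

(* exp (i a) *)
Definition cis (a : R) : C := (cos a, sin a).

Definition mode (omega y : R) (n : Z) (q : R -> C) (t r theta : R) : C :=
  (cis (y * t) * q r * cis (IZR n * (theta - omega * t)))%C.

(* C^oo on [0,1] with one-sided derivatives at the endpoints: the k-th
   derivative on (0,1) extends continuously to [0,1] by [d k]. *)
Definition smooth_on_unit (f : R -> R) : Prop :=
  exists d : nat -> R -> R,
    (forall r, 0 <= r <= 1 -> d O r = f r) /\
    (forall k r, continuous (d k) r) /\
    (forall k r, 0 < r < 1 -> is_derive (d k) r (d (S k) r)).

Definition smooth_profile (q : R -> C) : Prop :=
  smooth_on_unit (fun r => Re (q r)) /\ smooth_on_unit (fun r => Im (q r)).

(* Convergence is uniform over all times and the whole closed disc.  Merely
   locally uniform convergence in t would be vacuous, as every continuous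
   function is a locally uniform sum of exponentials in t. *)
Definition uniform_sum (term : nat -> R -> R -> R -> C) (f : R -> R -> R -> R)
  : Prop :=
  forall eps : R, 0 < eps ->
  exists N : nat, forall m : nat, (N <= m)%nat ->
  forall t r theta, 0 <= r <= 1 ->
    Cmod (sum_n (fun j => term j t r theta) m - RtoC (f t r theta))%C < eps.

Definition sum_of_modes (omega : R)
    (sigma : R -> scalar_field) (v : R -> vector_field) : Prop :=
  exists (y : nat -> R) (n : nat -> Z) (q qr qtheta : nat -> R -> C),
    (forall j, smooth_profile (q j) /\ smooth_profile (qr j) /\
               smooth_profile (qtheta j)) /\
    uniform_sum (fun j => mode omega (y j) (n j) (q j))
                (fun t => polar (sigma t)) /\
    uniform_sum (fun j => mode omega (y j) (n j) (qr j))
                (fun t => radial_comp (v t)) /\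
    uniform_sum (fun j => mode omega (y j) (n j) (qtheta j))
                (fun t => angular_comp (v t)).

(* Main.v *)
(** In the frame of the rotating fluid, Fourier expansion in the angle splits the linearized
    equations into radial systems, one for each angular number n >= 0.  The density coefficient is
    expanded in the Dirichlet eigenfunctions r^n psi_k of - div (rho grad), which are complete
    because the inverse operator is compact, and the coefficients of v_x + i v_y and v_x - i v_y,
    which have angular numbers n + 1 and n - 1, in the corresponding derivatives.  For each k this
    leaves a 3 x 3 system with constant coefficients; the eigenvalues satisfy nu_k > 2 n omega^2 / c^2,
    so its characteristic cubic has three distinct imaginary roots and it conserves a positive
    quadratic form.  Hence truncation errors at time t are controlled by the initial data,
    uniformly in time.  The only part of the velocity not seen by the eigenfunctions is the
    irrotational field of profile r^(n-1), whose amplitude simply rotates with frequency 2 omega.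

    Angular smoothness of the initial data makes the coefficients O(n^-2) uniformly in time, so
    Fejer's theorem resums them and the solution is a uniform limit, for all times, of finite sums
    of modes.  This gives boundedness; running many times through small multiples of the successive
    differences of these finite sums turns the limit into a series. *)

Require Import Defs.
From Stdlib Require Import Reals ZArith List Lra Lia Psatz ClassicalEpsilon FunctionalExtensionality Classical.
From Coquelicot Require Import Coquelicot.
Open Scope R_scope.

(** * Integrals of continuous functions *)

(** The eigenfunctions control divergence and vorticity in mean square, while the claims are uniform
    in the radius; most of the work is this passage. The velocity is recovered by integrating the
    expansions of divergence plus or minus vorticity once, the density by integrating that of
    [nu_k s_k] twice, where [s_k] is its coefficient. The conserved form bounds the former at once.
    The time derivative of a triple solves the same 3 x 3 system, and its conserved form bounds
    [nu_k s_k]. Both need the ratio of the coupling constants [c^2 nu_k] and [c^2 (nu_k - 4 n B)],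
    with [B = omega^2 / (2 c^2)], bounded independently of [n] and [k]: hence the quantitative gap
    [nu_gap].

    For n = 1 one of these integrations diverges logarithmically at the origin. There absolute
    summability against the profiles takes the place of square sums, and the boundary values of the
    initial data have to be treated by hand.

    All Fourier data are real and carry a phase [al]; the phases 0 and pi/2 together form a complex
    amplitude, and every estimate is uniform in [al], so that [al = - n (theta - omega t)] may be
    substituted at the end. *)

Definition cont (f : R -> R) : Prop := forall x, continuous f x.

Lemma cont_const (c : R) : cont (fun _ => c).
Proof. intro x. apply continuous_const. Qed.
Lemma cont_id : cont (fun x => x).
Proof. intro x. apply continuous_id. Qed.
Lemma cont_plus (f g : R -> R) : cont f -> cont g -> cont (fun x => f x + g x).
Proof. intros Hf Hg x. apply (continuous_plus f g x); auto. Qed.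
Lemma cont_minus (f g : R -> R) : cont f -> cont g -> cont (fun x => f x - g x).
Proof. intros Hf Hg x. apply (continuous_minus f g x); auto. Qed.
Lemma cont_opp (f : R -> R) : cont f -> cont (fun x => - f x).
Proof. intros Hf x. apply (continuous_opp f x); auto. Qed.
Lemma cont_mult (f g : R -> R) : cont f -> cont g -> cont (fun x => f x * g x).
Proof. intros Hf Hg x. apply (continuous_mult f g x); auto. Qed.
Lemma cont_comp (f g : R -> R) : cont f -> cont g -> cont (fun x => f (g x)).
Proof. intros Hf Hg x. apply (continuous_comp g f x); auto. Qed.
Lemma cont_pow (f : R -> R) (n : nat) : cont f -> cont (fun x => f x ^ n).
Proof.
  intro Hf. induction n; simpl.
  - apply cont_const.
  - apply cont_mult; auto.
Qed.
Lemma cont_inv (f : R -> R) : cont f -> (forall x, f x <> 0) -> cont (fun x => / f x).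
Proof.
  intros Hf Hn x. apply (continuous_comp f Rinv x); [auto|].
  apply continuity_pt_filterlim. apply continuity_pt_inv; [|auto].
  apply continuity_pt_id.
Qed.
Lemma cont_div (f g : R -> R) :
  cont f -> cont g -> (forall x, g x <> 0) -> cont (fun x => f x / g x).
Proof. intros Hf Hg Hn. apply cont_mult; auto. apply cont_inv; auto. Qed.
Lemma cont_abs (f : R -> R) : cont f -> cont (fun x => Rabs (f x)).
Proof.
  intros Hf x. apply (continuous_comp f Rabs x); [auto|]. apply continuous_Rabs.
Qed.
Lemma cont_sin (f : R -> R) : cont f -> cont (fun x => sin (f x)).
Proof. intros Hf x. apply (continuous_comp f sin x); [auto|]. apply continuous_sin. Qed.
Lemma cont_cos (f : R -> R) : cont f -> cont (fun x => cos (f x)).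
Proof. intros Hf x. apply (continuous_comp f cos x); [auto|]. apply continuous_cos. Qed.
Lemma cont_derive (f f' : R -> R) : (forall x, is_derive f x (f' x)) -> cont f.
Proof. intros H x. apply (ex_derive_continuous (V := R_NormedModule) f x). exists (f' x). apply H. Qed.
Lemma cont_ext (f g : R -> R) : (forall x, f x = g x) -> cont f -> cont g.
Proof. intros E H x. apply (continuous_ext f g x E). apply H. Qed.
Lemma cont_eps (f : R -> R) (x eps : R) : cont f -> 0 < eps ->
  exists d, 0 < d /\ forall y, Rabs (y - x) < d -> Rabs (f y - f x) < eps.
Proof.
  intros Hf He. specialize (Hf x).
  apply continuity_pt_filterlim in Hf.
  destruct (Hf eps He) as [d [Hd H]]. exists d. split; [exact Hd|].
  intros y Hy. destruct (Req_dec y x) as [->|Hne].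
  - rewrite Rminus_diag. rewrite Rabs_R0. lra.
  - apply H. split; [|exact Hy]. split; [exact I|congruence].
Qed.
Lemma cont_of_eps (f : R -> R) :
  (forall x eps, 0 < eps -> exists d, 0 < d /\
     forall y, Rabs (y - x) < d -> Rabs (f y - f x) < eps) -> cont f.
Proof.
  intros H x. apply continuity_pt_filterlim. intros eps He.
  destruct (H x eps He) as [d [Hd Hy]]. exists d. split; [exact Hd|].
  intros y [_ Hy']. apply Hy. exact Hy'.
Qed.

Ltac rring := cbv beta; match goal with |- @eq _ ?a ?b => change (@eq R a b) end; ring.
Ltac rfield := cbv beta; match goal with |- @eq _ ?a ?b => change (@eq R a b) end; field.

Ltac cont_tac := repeat first
  [ assumption
  | lazymatch goal with
    | |- cont (fun _ => ?c) => apply (cont_const c)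
    | |- cont (fun x => x) => apply cont_id
    | |- cont (Rmult ?c) => apply (cont_mult (fun _ => c) (fun x => x))
    | |- cont (Rplus ?c) => apply (cont_plus (fun _ => c) (fun x => x))
    | |- cont (fun x => @?f x + @?g x) => apply (cont_plus f g)
    | |- cont (fun x => @?f x - @?g x) => apply (cont_minus f g)
    | |- cont (fun x => - @?f x) => apply (cont_opp f)
    | |- cont (fun x => @?f x * @?g x) => apply (cont_mult f g)
    | |- cont (fun x => @?f x / @?g x) => apply (cont_div f g)
    | |- cont (fun x => @?f x ^ ?n) => apply (cont_pow f n)
    | |- cont (fun x => cos (@?f x)) => apply (cont_cos f)
    | |- cont (fun x => sin (@?f x)) => apply (cont_sin f)
    | |- cont (fun x => Rabs (@?f x)) => apply (cont_abs f)
    end ].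

Lemma cont_ex_RInt (f : R -> R) (a b : R) : cont f -> ex_RInt f a b.
Proof. intro H. apply (ex_RInt_continuous (V := R_CompleteNormedModule)). auto. Qed.

Lemma RInt_cplus (f g : R -> R) (a b : R) : cont f -> cont g ->
  RInt (fun x => f x + g x) a b = RInt f a b + RInt g a b.
Proof.
  intros. apply (RInt_plus (V := R_CompleteNormedModule)); now apply cont_ex_RInt.
Qed.
Lemma RInt_cminus (f g : R -> R) (a b : R) : cont f -> cont g ->
  RInt (fun x => f x - g x) a b = RInt f a b - RInt g a b.
Proof.
  intros. apply (RInt_minus (V := R_CompleteNormedModule)); now apply cont_ex_RInt.
Qed.
Lemma RInt_cscal (f : R -> R) (c a b : R) : cont f ->
  RInt (fun x => c * f x) a b = c * RInt f a b.
Proof.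
  intros. apply (RInt_scal (V := R_CompleteNormedModule)); now apply cont_ex_RInt.
Qed.
Lemma RInt_copp (f : R -> R) (a b : R) : cont f ->
  RInt (fun x => - f x) a b = - RInt f a b.
Proof.
  intros. apply (RInt_opp (V := R_CompleteNormedModule)); now apply cont_ex_RInt.
Qed.
Lemma RInt_cext (f g : R -> R) (a b : R) : a <= b ->
  (forall x, a <= x <= b -> f x = g x) -> RInt f a b = RInt g a b.
Proof.
  intros Hab H. apply RInt_ext. rewrite Rmin_left, Rmax_right by lra.
  intros x Hx. apply H. lra.
Qed.
Lemma RInt_rext (f g : R -> R) (a b : R) :
  (forall x : R, f x = g x) -> RInt f a b = RInt g a b.
Proof. intro H. apply RInt_ext. intros x _. apply H. Qed.
Lemma RInt_cle (f g : R -> R) (a b : R) : a <= b -> cont f -> cont g ->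
  (forall x, a <= x <= b -> f x <= g x) -> RInt f a b <= RInt g a b.
Proof.
  intros Hab Hf Hg H. apply RInt_le; auto using cont_ex_RInt.
  intros x Hx. apply H. lra.
Qed.
Lemma RInt_cge0 (f : R -> R) (a b : R) : a <= b -> cont f ->
  (forall x, a <= x <= b -> 0 <= f x) -> 0 <= RInt f a b.
Proof.
  intros Hab Hf H. apply RInt_ge_0; auto using cont_ex_RInt.
  intros x Hx. apply H. lra.
Qed.
Lemma RInt_cabs_le (f g : R -> R) (a b : R) : a <= b -> cont f -> cont g ->
  (forall x, a <= x <= b -> Rabs (f x) <= g x) -> Rabs (RInt f a b) <= RInt g a b.
Proof.
  intros Hab Hf Hg H. apply Rle_trans with (RInt (fun x => Rabs (f x)) a b).
  - apply abs_RInt_le; auto using cont_ex_RInt.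
  - apply RInt_cle; cont_tac; auto.
Qed.
Lemma RInt_cconst (c a b : R) : RInt (fun _ => c) a b = c * (b - a).
Proof. rewrite RInt_const. unfold scal; simpl; unfold mult; simpl. ring. Qed.
Lemma RInt_cabs_const (f : R -> R) (c a b : R) : a <= b -> cont f ->
  (forall x, a <= x <= b -> Rabs (f x) <= c) -> Rabs (RInt f a b) <= c * (b - a).
Proof.
  intros. rewrite <- RInt_cconst. apply RInt_cabs_le; cont_tac; auto.
Qed.
Lemma RInt_cChasles (f : R -> R) (a b c : R) : cont f ->
  RInt f a b + RInt f b c = RInt f a c.
Proof.
  intro. apply (RInt_Chasles (V := R_CompleteNormedModule)); now apply cont_ex_RInt.
Qed.
Lemma RInt_cpoint (f : R -> R) (a : R) : RInt f a a = 0.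
Proof. apply (RInt_point (V := R_CompleteNormedModule)). Qed.
Lemma RInt_cderive (f F : R -> R) (a b : R) : cont f ->
  (forall x, is_derive F x (f x)) -> RInt f a b = F b - F a.
Proof.
  intros Hf HF. apply is_RInt_unique.
  apply (is_RInt_derive F f a b); intros; auto.
Qed.
Lemma is_derive_RInt_up (f : R -> R) (a x : R) : cont f ->
  is_derive (fun y => RInt f a y) x (f x).
Proof.
  intro Hf. apply (is_derive_RInt f (fun y => RInt f a y) a x); [|apply Hf].
  apply filter_forall. intro y. apply (RInt_correct (V := R_CompleteNormedModule)).
  now apply cont_ex_RInt.
Qed.
Lemma is_derive_RInt_low (f : R -> R) (b x : R) : cont f ->
  is_derive (fun y => RInt f y b) x (- f x).
Proof.
  intro Hf.
  apply (is_derive_RInt' f (fun y => RInt f y b) x b); [|apply Hf].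
  apply filter_forall. intro y. apply (RInt_correct (V := R_CompleteNormedModule)).
  now apply cont_ex_RInt.
Qed.
Lemma RInt_cpos (f : R -> R) (a b c : R) : a < b -> cont f ->
  (forall x, a <= x <= b -> 0 <= f x) -> a <= c <= b -> 0 < f c -> 0 < RInt f a b.
Proof.
  intros Hab Hf H0 Hc Hp.
  destruct (cont_eps f c (f c / 2) Hf) as [d [Hd H]]; [lra|].
  set (l := Rmax a (c - d / 2)). set (u := Rmin b (c + d / 2)).
  assert (Hl : a <= l <= c) by (unfold l; split; [apply Rmax_l|apply Rmax_lub; lra]).
  assert (Hu : c <= u <= b) by (unfold u; split; [apply Rmin_glb; lra|apply Rmin_l]).
  assert (Hl' : c - d / 2 <= l) by apply Rmax_r.
  assert (Hu' : u <= c + d / 2) by apply Rmin_r.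
  assert (Hlu : l < u).
  { unfold l, u. apply Rmax_lub_lt; apply Rmin_glb_lt; lra. }
  rewrite <- (RInt_cChasles f a l b Hf), <- (RInt_cChasles f l u b Hf).
  assert (0 <= RInt f a l) by (apply RInt_cge0; auto; [lra|intros; apply H0; lra]).
  assert (0 <= RInt f u b) by (apply RInt_cge0; auto; [lra|intros; apply H0; lra]).
  assert (RInt (fun _ => f c / 2) l u <= RInt f l u).
  { apply RInt_cle; cont_tac; [lra|]. intros x Hx.
    assert (Rabs (f x - f c) < f c / 2) by (apply H; apply Rabs_def1; lra).
    apply Rabs_def2 in H3. lra. }
  rewrite RInt_cconst in H3. assert (0 < f c / 2 * (u - l)) by (apply Rmult_lt_0_compat; lra).
  lra.
Qed.

(** Common source of the Cauchy-Schwarz inequalities for integrals and for finite sums. Allowing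
    [c = 0] avoids a case distinction on a vanishing norm there. *)
Lemma discr_nonpos (a b c : R) :
  (forall x, 0 <= a + 2 * b * x + c * x ^ 2) -> b ^ 2 <= a * c.
Proof.
  intro H. destruct (Req_dec c 0) as [->|Hc].
  - destruct (Req_dec b 0) as [->|Hb]; [nra|].
    (* At this point the affine function takes the value -1. *)
    specialize (H (- (a + 1) / (2 * b))).
    replace (a + 2 * b * (- (a + 1) / (2 * b)) + 0 * (- (a + 1) / (2 * b)) ^ 2)
      with (-1) in H by (field; auto). lra.
  - assert (0 < c).
    { destruct (Rlt_le_dec 0 c) as [|Hn]; auto. exfalso.
      assert (Hc' : 0 < - c) by lra.
      pose proof (H 0) as H0.
      (* Adding the values at [x] and [- x] cancels the linear term and leaves [a + c x^2 >= 0],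
         which is false for this large [x]. *)
      set (x := (Rabs b + a + 1) / (- c) + 1).
      assert (Hx : (-c) * (x - 1) = Rabs b + a + 1) by (unfold x; field; lra).
      assert (0 <= Rabs b) by apply Rabs_pos.
      assert (Hx1 : 1 <= x) by nra.
      pose proof (H x) as Hp. pose proof (H (-x)) as Hm.
      nra. }
    specialize (H (- b / c)).
    replace (a + 2 * b * (- b / c) + c * (- b / c) ^ 2) with ((a * c - b ^ 2) / c) in H
      by (field; auto).
    assert (0 <= (a * c - b ^ 2)).
    { replace (a * c - b ^ 2) with ((a * c - b ^ 2) / c * c) by (field; auto).
      apply Rmult_le_pos; lra. }
    lra.
Qed.

Lemma RInt_cauchy_schwarz (w f g : R -> R) (a b : R) : a <= b ->
  cont w -> cont f -> cont g -> (forall x, a <= x <= b -> 0 <= w x) ->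
  (RInt (fun x => w x * (f x * g x)) a b) ^ 2 <=
  RInt (fun x => w x * f x ^ 2) a b * RInt (fun x => w x * g x ^ 2) a b.
Proof.
  intros Hab Hw Hf Hg H0. apply discr_nonpos. intro x.
  replace (RInt (fun x => w x * f x ^ 2) a b
           + 2 * RInt (fun x => w x * (f x * g x)) a b * x
           + RInt (fun x => w x * g x ^ 2) a b * x ^ 2)
    with (RInt (fun y => w y * (f y + x * g y) ^ 2) a b).
  - apply RInt_cge0; auto; [cont_tac|]. intros y Hy.
    apply Rmult_le_pos; auto. apply pow2_ge_0.
  - rewrite (RInt_rext _ (fun y => (w y * f y ^ 2 + 2 * x * (w y * (f y * g y)))
                         + x ^ 2 * (w y * g y ^ 2))).
    2:{ intro y. ring. }
    rewrite RInt_cplus, RInt_cplus, !RInt_cscal by cont_tac. rring.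
Qed.

Lemma RInt_cs_abs (w f g : R -> R) (a b F G : R) : a <= b ->
  cont w -> cont f -> cont g -> (forall x, a <= x <= b -> 0 <= w x) ->
  0 <= F -> 0 <= G ->
  RInt (fun x => w x * f x ^ 2) a b <= F ^ 2 ->
  RInt (fun x => w x * g x ^ 2) a b <= G ^ 2 ->
  Rabs (RInt (fun x => w x * (f x * g x)) a b) <= F * G.
Proof.
  intros Hab Hw Hf Hg H0 HF HG H1 H2.
  pose proof (RInt_cauchy_schwarz w f g a b Hab Hw Hf Hg H0) as H.
  assert (0 <= RInt (fun x => w x * f x ^ 2) a b).
  { apply RInt_cge0; auto; [cont_tac|]. intros; apply Rmult_le_pos; auto; apply pow2_ge_0. }
  assert (0 <= RInt (fun x => w x * g x ^ 2) a b).
  { apply RInt_cge0; auto; [cont_tac|]. intros; apply Rmult_le_pos; auto; apply pow2_ge_0. }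
  apply Rsqr_incr_0_var; [|nra]. rewrite <- Rsqr_abs. unfold Rsqr.
  assert (RInt (fun x => w x * f x ^ 2) a b * RInt (fun x => w x * g x ^ 2) a b
          <= F ^ 2 * G ^ 2) by (apply Rmult_le_compat; auto).
  nra.
Qed.

(** Tube lemma: the neighbourhoods given by joint continuity along [{p0} x [a, b]] have a common
    size by compactness of the segment. *)
Lemma compact_locally_uniform (U : UniformSpace) (g : U -> R -> R) (p0 : U) (a b : R) :
  (forall th, a <= th <= b -> continuous (fun q : U * R => g (fst q) (snd q)) (p0, th)) ->
  forall eps, 0 < eps ->
  locally p0 (fun p => forall th, a <= th <= b -> Rabs (g p th - g p0 th) < eps).
Proof.
  intros Hc eps He.
  assert (Hd : forall th, { d : posreal | a <= th <= b -> forall p x, ball p0 d p ->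
             Rabs (x - th) < d -> Rabs (g p x - g p0 th) < eps / 2 }).
  { intro th. apply constructive_indefinite_description.
    destruct (classic (a <= th <= b)) as [H|H].
    - assert (He2 : 0 < eps / 2) by lra.
      destruct (Hc th H (ball (g p0 th) (mkposreal _ He2))) as [d Hd].
      { apply locally_ball. }
      exists d. intros _ p x Hp Hx.
      apply (Hd (p, x)). split; simpl; auto.
    - exists (mkposreal 1 Rlt_0_1). intro; contradiction. }
  set (delta := fun th => pos_div_2 (proj1_sig (Hd th))).
  destruct (compactness_value_1d a b delta) as [d Hd0].
  exists d. intros p Hp th Hth.
  apply NNPP. intro Hn. apply (Hd0 th Hth). intros [t [Ht [Hxt Hdt]]]. apply Hn.
  unfold delta in Hxt, Hdt. destruct (Hd t) as [dt Hdt']; simpl in *.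
  assert (Hb : ball p0 dt p).
  { apply ball_le with d; auto. pose proof (cond_pos dt). lra. }
  pose proof (cond_pos dt).
  assert (H1 := Hdt' Ht p th Hb ltac:(lra)).
  assert (H2 := Hdt' Ht p0 th (ball_center _ _) ltac:(lra)).
  apply Rabs_def2 in H1. apply Rabs_def2 in H2. apply Rabs_def1; lra.
Qed.

(** The parameter ranges over a general uniform space because it is a radius in one use and a pair
    of time and radius in another. *)
Lemma continuous_RInt_param (U : UniformSpace) (g : U -> R -> R) (p0 : U) (a b : R) :
  a <= b -> (forall p, cont (g p)) ->
  (forall th, a <= th <= b -> continuous (fun q : U * R => g (fst q) (snd q)) (p0, th)) ->
  continuous (fun p => RInt (g p) a b) p0.
Proof.
  intros Hab Hg Hc. apply filterlim_locally. intro eps.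
  assert (He : 0 < eps / (b - a + 1)).
  { apply Rdiv_lt_0_compat; [apply cond_pos|lra]. }
  generalize (compact_locally_uniform U g p0 a b Hc _ He). apply filter_imp.
  intros p Hp. unfold ball; simpl; unfold AbsRing_ball, abs, minus, plus, opp; simpl.
  replace (RInt (g p) a b + - RInt (g p0) a b) with (RInt (fun x => g p x - g p0 x) a b).
  2:{ rewrite RInt_cminus; auto. }
  apply Rle_lt_trans with (eps / (b - a + 1) * (b - a)).
  - apply RInt_cabs_const; auto; [apply cont_minus; auto|].
    intros x Hx. apply Rlt_le, Hp; auto.
  - pose proof (cond_pos eps).
    replace (eps / (b - a + 1) * (b - a)) with (eps - eps / (b - a + 1)) by (field; lra).
    lra.
Qed.

Lemma is_derive_RInt_2d (f f' : R -> R -> R) (x a b : R) :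
  (forall x th, is_derive (fun u => f u th) x (f' x th)) ->
  (forall x th, continuity_2d_pt f' x th) ->
  (forall x, cont (f x)) ->
  is_derive (fun x => RInt (f x) a b) x (RInt (f' x) a b).
Proof.
  intros Hd Hc Hf.
  rewrite (RInt_rext (f' x) (fun t => Derive (fun u => f u t) x)).
  2:{ intro th. symmetry. apply is_derive_unique, Hd. }
  apply (is_derive_RInt_param f a b x).
  - apply filter_forall. intros y t _. exists (f' y t). apply Hd.
  - intros t _. apply (continuity_2d_pt_ext f').
    + intros u v. symmetry. apply is_derive_unique, Hd.
    + apply Hc.
  - apply filter_forall. intro y. apply cont_ex_RInt. apply Hf.
Qed.

(** * The Sturm-Liouville operator *)
Lemma is_derive_eq (f : R -> R) (x d d' : R) : is_derive f x d -> d = d' -> is_derive f x d'.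
Proof. now intros H <-. Qed.
Lemma is_derive_rmult (f g : R -> R) (x f' g' : R) :
  is_derive f x f' -> is_derive g x g' ->
  is_derive (fun x => f x * g x) x (f' * g x + f x * g').
Proof. intros Hf Hg. apply (is_derive_mult f g x f' g'); auto. intros; apply Rmult_comm. Qed.
Lemma is_derive_rplus (f g : R -> R) (x f' g' : R) :
  is_derive f x f' -> is_derive g x g' -> is_derive (fun x => f x + g x) x (f' + g').
Proof. intros. apply (is_derive_plus f g); auto. Qed.
Lemma is_derive_rminus (f g : R -> R) (x f' g' : R) :
  is_derive f x f' -> is_derive g x g' -> is_derive (fun x => f x - g x) x (f' - g').
Proof. intros. apply (is_derive_minus f g); auto. Qed.
Lemma is_derive_rscal (f : R -> R) (c x f' : R) :
  is_derive f x f' -> is_derive (fun x => c * f x) x (c * f').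
Proof. intros. apply (is_derive_scal f x c); auto. Qed.
Lemma is_derive_rpow (n : nat) (x : R) : is_derive (fun x => x ^ n) x (INR n * x ^ pred n).
Proof. auto_derive; auto. rring. Qed.

Lemma RInt_pow (n : nat) (a b : R) :
  RInt (fun x => x ^ n) a b = (b ^ S n - a ^ S n) / INR (S n).
Proof.
  rewrite (RInt_cderive (fun x => x ^ n) (fun x => x ^ S n / INR (S n))).
  - rfield. apply not_0_INR; lia.
  - cont_tac.
  - intro x. eapply is_derive_eq.
    + apply (is_derive_ext (fun x => / INR (S n) * x ^ S n)).
      { intro t. unfold Rdiv. apply Rmult_comm. }
      apply is_derive_rscal, is_derive_rpow.
    + simpl pred. field. apply not_0_INR; lia.
Qed.

(** The pointwise estimates below divide by powers of the radius; continuity then supplies the value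
    at the origin. *)
Lemma cont_le_at_0 (f : R -> R) (K : R) : cont f ->
  (forall r, 0 < r <= 1 -> Rabs (f r) <= K) -> forall r, 0 <= r <= 1 -> Rabs (f r) <= K.
Proof.
  intros Hf H r Hr. destruct (Req_dec r 0) as [->|]; [|apply H; lra].
  destruct (Rle_lt_dec (Rabs (f 0)) K) as [|Hlt]; auto. exfalso.
  destruct (cont_eps f 0 (Rabs (f 0) - K) Hf ltac:(lra)) as [d [Hd Hy]].
  set (y := Rmin 1 (d / 2)).
  assert (0 < y <= 1 /\ y <= d / 2).
  { unfold y. split; [split; [apply Rmin_pos; lra|apply Rmin_l]|apply Rmin_r]. }
  specialize (Hy y). rewrite Rminus_0_r in Hy.
  assert (Rabs y < d) by (rewrite Rabs_pos_eq; lra). specialize (Hy H1).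
  assert (Rabs (f y) <= K) by (apply H; lra).
  pose proof (Rabs_triang_inv (f 0) (f y)). rewrite Rabs_minus_sym in Hy. lra.
Qed.

Lemma pow_01 (x : R) (n : nat) : 0 <= x <= 1 -> 0 <= x ^ n <= 1.
Proof.
  intro H. split; [apply pow_le; lra|].
  rewrite <- (pow1 n). apply pow_incr; lra.
Qed.

Lemma cont_exp (f : R -> R) : cont f -> cont (fun x => exp (f x)).
Proof.
  intro Hf. apply (cont_comp exp f); auto. apply (cont_derive exp exp). intro; apply is_derive_exp.
Qed.
Lemma cont_bounded_max (f : R -> R) : cont f ->
  exists c, 0 <= c <= 1 /\ forall r, 0 <= r <= 1 -> f r <= f c.
Proof.
  intro Hf. destruct (continuity_ab_maj f 0 1) as [c [H1 H2]]; [lra| |].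
  - intros x _. apply continuity_pt_filterlim. apply Hf.
  - exists c. auto.
Qed.

Section SturmLiouville.
Variables (n : nat) (A B : R).
Variable (HA : 0 < A).
Variable (HB : 0 <= B).

(** The steady density: [A] is its value at the centre and [B = omega^2 / (2 c^2)]. *)
Definition rho (s : R) : R := A + B * s ^ 2.
Lemma rho_ge (s : R) : A <= rho s.
Proof. unfold rho. pose proof (pow2_ge_0 s). nra. Qed.
Lemma rho_neq (s : R) : rho s <> 0.
Proof. pose proof (rho_ge s). lra. Qed.
Lemma cont_rho : cont rho.
Proof. unfold rho. cont_tac. Qed.

(** Writing a radial function of angular number n as r^n h turns the measure r dr into r^(2n+1) dr
    and removes the singular potential n^2 / r^2 from - div (rho grad); since rho' = 2 B r, what
    remains of it is the constant - 2 n B. *)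
Definition wt (r : R) : R := r ^ (2 * n + 1).
Lemma cont_wt : cont wt. Proof. unfold wt; cont_tac. Qed.
Lemma wt_ge0 (r : R) : 0 <= r -> 0 <= wt r.
Proof. intro. now apply pow_le. Qed.
Lemma wt_01 (r : R) : 0 <= r <= 1 -> 0 <= wt r <= 1.
Proof. apply pow_01. Qed.
Lemma wt_0 : wt 0 = 0.
Proof. unfold wt. apply pow_ne_zero. lia. Qed.

(* [flux h s = s ^ -(2n+1) * int_0^s tau^(2n+1) h tau], free of the singularity at 0 *)
Definition flux (h : R -> R) (s : R) : R :=
  s * RInt (fun u => wt u * h (s * u)) 0 1.

Lemma flux_wt (h : R -> R) (s : R) : cont h ->
  wt s * flux h s = RInt (fun t => wt t * h t) 0 s.
Proof.
  intro Hh.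
  assert (Hc : cont (fun t => wt t * h t)) by (cont_tac; apply cont_wt).
  pose proof (RInt_comp_lin (V := R_CompleteNormedModule) (fun t => wt t * h t) s 0 0 1) as E.
  replace (s * 0 + 0) with 0 in E by ring. replace (s * 1 + 0) with s in E by ring.
  rewrite <- E by (now apply cont_ex_RInt).
  rewrite (RInt_rext _ (fun y => (s * wt s) * (wt y * h (s * y)))).
  - rewrite RInt_cscal. { unfold flux. rring. }
    apply cont_mult; [apply cont_wt|]. apply (cont_comp h); [auto|cont_tac].
  - intro y. unfold scal; simpl; unfold mult; simpl. rewrite Rplus_0_r.
    unfold wt. rewrite Rpow_mult_distr. ring.
Qed.

Lemma cont_flux (h : R -> R) : cont h -> cont (flux h).
Proof.
  intro Hh. unfold flux. apply cont_mult; [apply cont_id|]. intro s.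
  apply (continuous_RInt_param R_UniformSpace (fun s u => wt u * h (s * u)) s 0 1).
  - lra.
  - intro p. apply cont_mult; [apply cont_wt|]. apply (cont_comp h); [auto|cont_tac].
  - intros th _. apply (continuous_mult (K := R_AbsRing) (fun q : R * R => wt (snd q)) (fun q : R * R => h (fst q * snd q))).
    + apply (continuous_comp snd wt); [apply continuous_snd|apply cont_wt].
    + apply (continuous_comp (fun q : R * R => fst q * snd q) h); [|apply Hh].
      apply (continuous_mult (K := R_AbsRing) (fun q : R * R => fst q) snd);
        [apply continuous_fst|apply continuous_snd].
Qed.

Lemma is_derive_wt_flux (h : R -> R) (s : R) : cont h ->
  is_derive (fun s => wt s * flux h s) s (wt s * h s).
Proof.
  intro Hh. apply (is_derive_ext (fun s => RInt (fun t => wt t * h t) 0 s)).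
  - intro t. now rewrite flux_wt.
  - apply (is_derive_RInt_up (fun t => wt t * h t)). apply cont_mult; [apply cont_wt|auto].
Qed.

Lemma flux_lin (f g : R -> R) (a b s : R) : cont f -> cont g ->
  flux (fun x => a * f x + b * g x) s = a * flux f s + b * flux g s.
Proof.
  intros Hf Hg. unfold flux.
  assert (Hc : forall h, cont h -> cont (fun u => wt u * h (s * u))).
  { intros h Hh. apply cont_mult; [apply cont_wt|]. apply (cont_comp h); [auto|cont_tac]. }
  rewrite (RInt_rext _ (fun u => a * (wt u * f (s * u)) + b * (wt u * g (s * u)))).
  2:{ intro u. ring. }
  pose proof (Hc f Hf). pose proof (Hc g Hg).
  rewrite RInt_cplus, !RInt_cscal by cont_tac. rring.
Qed.

Lemma flux_ext (f g : R -> R) (s : R) : 0 <= s <= 1 ->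
  (forall x, 0 <= x <= 1 -> f x = g x) -> flux f s = flux g s.
Proof.
  intros Hs H. unfold flux. f_equal. apply RInt_cext; [lra|].
  intros u Hu. rewrite H; auto. nra.
Qed.

Lemma flux_bound (d : R -> R) (K s : R) : cont d -> 0 <= s <= 1 ->
  (forall x, 0 <= x <= s -> Rabs (d x) <= K) -> Rabs (flux d s) <= K.
Proof.
  intros Hd Hs H.
  assert (HK : 0 <= K) by (apply Rle_trans with (Rabs (d 0)); [apply Rabs_pos|apply H; lra]).
  unfold flux. rewrite Rabs_mult, (Rabs_pos_eq s) by lra.
  assert (Rabs (RInt (fun u => wt u * d (s * u)) 0 1) <= K * (1 - 0)).
  { apply RInt_cabs_const; [lra| |].
    - apply cont_mult; [apply cont_wt|]. apply (cont_comp d); [auto|cont_tac].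
    - intros x Hx. rewrite Rabs_mult. pose proof (wt_01 x Hx).
      rewrite (Rabs_pos_eq (wt x)) by lra.
      assert (Rabs (d (s * x)) <= K) by (apply H; nra).
      pose proof (Rabs_pos (d (s * x))). nra. }
  pose proof (Rabs_pos (RInt (fun u => wt u * d (s * u)) 0 1)). nra.
Qed.

(** Inverse of the Sturm-Liouville operator: the solution y, regular at 0, of - (wt rho y')' = wt h
    with y(1) = 0. *)
Definition green (h : R -> R) (r : R) : R := RInt (fun s => flux h s / rho s) r 1.

Lemma cont_flux_rho (h : R -> R) : cont h -> cont (fun s => flux h s / rho s).
Proof. intro. apply cont_div; [now apply cont_flux|apply cont_rho|apply rho_neq]. Qed.

Lemma is_derive_green (h : R -> R) (r : R) : cont h ->
  is_derive (green h) r (- (flux h r / rho r)).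
Proof. intro. apply (is_derive_RInt_low (fun s => flux h s / rho s)). now apply cont_flux_rho. Qed.

Lemma cont_green (h : R -> R) : cont h -> cont (green h).
Proof.
  intro. apply (cont_derive _ (fun r => - (flux h r / rho r))). intro; now apply is_derive_green.
Qed.
Lemma green_1 (h : R -> R) : green h 1 = 0.
Proof. apply RInt_cpoint. Qed.
Lemma green_lin (f g : R -> R) (a b r : R) : cont f -> cont g ->
  green (fun x => a * f x + b * g x) r = a * green f r + b * green g r.
Proof.
  intros Hf Hg. unfold green.
  rewrite (RInt_rext _ (fun s => a * (flux f s / rho s) + b * (flux g s / rho s))).
  2:{ intro u. rewrite flux_lin by auto. field. apply rho_neq. }
  pose proof (cont_flux_rho f Hf). pose proof (cont_flux_rho g Hg).
  rewrite RInt_cplus, !RInt_cscal by cont_tac. reflexivity.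
Qed.
Lemma green_ext (f g : R -> R) (r : R) : 0 <= r <= 1 ->
  (forall x, 0 <= x <= 1 -> f x = g x) -> green f r = green g r.
Proof.
  intros Hr H. unfold green. apply RInt_cext; [lra|].
  intros s Hs. rewrite (flux_ext f g); auto. lra.
Qed.
Lemma div_rho_le (x K s : R) : Rabs x <= K -> Rabs (x / rho s) <= K / A.
Proof.
  intro H. pose proof (rho_ge s). unfold Rdiv. rewrite Rabs_mult, Rabs_inv.
  rewrite (Rabs_pos_eq (rho s)) by lra.
  assert (/ rho s <= / A) by (apply Rinv_le_contravar; lra).
  pose proof (Rabs_pos x).
  assert (0 < / rho s) by (apply Rinv_0_lt_compat; lra).
  apply Rmult_le_compat; lra.
Qed.
Lemma green_bound (d : R -> R) (K r : R) : cont d -> 0 <= r <= 1 ->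
  (forall x, 0 <= x <= 1 -> Rabs (d x) <= K) -> Rabs (green d r) <= K / A.
Proof.
  intros Hd Hr H. unfold green.
  assert (0 <= K / A).
  { apply Rle_trans with (Rabs (0 / rho 0)); [apply Rabs_pos|].
    apply div_rho_le. rewrite Rabs_R0. apply Rle_trans with (Rabs (d 0)); [apply Rabs_pos|apply H; lra]. }
  apply Rle_trans with (K / A * (1 - r)).
  - apply RInt_cabs_const; [lra|now apply cont_flux_rho|].
    intros s Hs. apply div_rho_le. apply flux_bound; auto; [lra|]. intros; apply H; lra.
  - nra.
Qed.

Definition ip (f g : R -> R) : R := RInt (fun r => wt r * (f r * g r)) 0 1.

Lemma cont_ip (f g : R -> R) : cont f -> cont g -> cont (fun r => wt r * (f r * g r)).
Proof. intros. apply cont_mult; [apply cont_wt|cont_tac]. Qed.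
Lemma ip_sym (f g : R -> R) : ip f g = ip g f.
Proof. apply RInt_rext. intro; ring. Qed.
Lemma ip_ext (f f' g g' : R -> R) :
  (forall x, 0 <= x <= 1 -> f x = f' x) -> (forall x, 0 <= x <= 1 -> g x = g' x) ->
  ip f g = ip f' g'.
Proof. intros H H'. apply RInt_cext; [lra|]. intros x Hx. rewrite H, H'; auto. Qed.
Lemma ip_lin (f g h : R -> R) (a b : R) : cont f -> cont g -> cont h ->
  ip (fun x => a * f x + b * g x) h = a * ip f h + b * ip g h.
Proof.
  intros Hf Hg Hh. unfold ip.
  rewrite (RInt_rext _ (fun s => a * (wt s * (f s * h s)) + b * (wt s * (g s * h s)))).
  2:{ intro; ring. }
  pose proof cont_wt.
  rewrite RInt_cplus, !RInt_cscal by cont_tac. reflexivity.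
Qed.
Lemma ip_linr (f g h : R -> R) (a b : R) : cont f -> cont g -> cont h ->
  ip h (fun x => a * f x + b * g x) = a * ip h f + b * ip h g.
Proof. intros. rewrite ip_sym, ip_lin, (ip_sym f), (ip_sym g); auto. Qed.
Lemma ip_ge0 (f : R -> R) : cont f -> 0 <= ip f f.
Proof.
  intro. apply RInt_cge0; [lra|now apply cont_ip|].
  intros x Hx. apply Rmult_le_pos; [apply wt_ge0; lra|]. apply Rle_0_sqr.
Qed.
Lemma ip_pos (f : R -> R) (c : R) : cont f -> 0 < c <= 1 -> f c <> 0 -> 0 < ip f f.
Proof.
  intros Hf Hc Hn. apply (RInt_cpos _ 0 1 c); [lra|now apply cont_ip| |lra|].
  - intros x Hx. apply Rmult_le_pos; [apply wt_ge0; lra|]. apply Rle_0_sqr.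
  - apply Rmult_lt_0_compat; [apply pow_lt; lra|].
    destruct (Rlt_or_le (f c) 0); nra.
Qed.
Lemma ip_cs (f g : R -> R) : cont f -> cont g -> ip f g ^ 2 <= ip f f * ip g g.
Proof.
  intros Hf Hg. unfold ip.
  pose proof (RInt_cauchy_schwarz wt f g 0 1 ltac:(lra) cont_wt Hf Hg) as H.
  rewrite (RInt_rext (fun x => wt x * (f x * f x)) (fun x => wt x * f x ^ 2)) by (intro; ring).
  rewrite (RInt_rext (fun x => wt x * (g x * g x)) (fun x => wt x * g x ^ 2)) by (intro; ring).
  apply H. intros; apply wt_ge0; lra.
Qed.

Definition nrm (f : R -> R) : R := sqrt (ip f f).
Lemma nrm_ge0 f : 0 <= nrm f. Proof. apply sqrt_pos. Qed.
Lemma nrm_sq f : cont f -> nrm f ^ 2 = ip f f.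
Proof. intro. apply pow2_sqrt. now apply ip_ge0. Qed.
Lemma nrm_le (f : R -> R) (K : R) : 0 <= K -> ip f f <= K ^ 2 -> nrm f <= K.
Proof.
  intros HK H. unfold nrm. rewrite <- (sqrt_pow2 K) by auto. now apply sqrt_le_1_alt.
Qed.
Lemma ip_abs (f g : R -> R) : cont f -> cont g -> Rabs (ip f g) <= nrm f * nrm g.
Proof.
  intros Hf Hg. pose proof (ip_cs f g Hf Hg). pose proof (nrm_ge0 f). pose proof (nrm_ge0 g).
  apply Rsqr_incr_0_var; [|nra]. rewrite <- Rsqr_abs. unfold Rsqr.
  rewrite <- (nrm_sq f), <- (nrm_sq g) in H; auto. nra.
Qed.
Lemma nrm_bound (f : R -> R) (K : R) : cont f -> 0 <= K ->
  (forall x, 0 <= x <= 1 -> Rabs (f x) <= K) -> nrm f <= K.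
Proof.
  intros Hf HK H. apply nrm_le; auto. unfold ip.
  apply Rle_trans with (RInt (fun _ => K ^ 2) 0 1).
  - apply RInt_cle; [lra|now apply cont_ip|cont_tac|].
    intros x Hx. pose proof (wt_01 x Hx). specialize (H x Hx).
    assert (f x * f x <= K ^ 2).
    { pose proof (Rabs_pos (f x)).
      replace (f x * f x) with (Rabs (f x) * Rabs (f x)) by (rewrite <- Rabs_mult; apply Rabs_pos_eq, Rle_0_sqr).
      nra. }
    pose proof (Rle_0_sqr (f x)). unfold Rsqr in *. nra.
  - rewrite RInt_cconst. lra.
Qed.

(** Integration by parts with [wt h = (wt flux h)']; the boundary terms vanish because
    [green f 1 = 0] and [wt 0 = 0]. The right side displays symmetry and positivity at once. *)
Lemma green_ip (f g : R -> R) : cont f -> cont g ->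
  ip (green f) g = RInt (fun s => wt s * (flux f s * flux g s) / rho s) 0 1.
Proof.
  intros Hf Hg.
  assert (E : RInt (fun r => wt r * (green f r * g r) - wt r * (flux f r * flux g r) / rho r) 0 1
          = green f 1 * (wt 1 * flux g 1) - green f 0 * (wt 0 * flux g 0)).
  { pose proof (cont_flux f Hf). pose proof (cont_flux g Hg).
    apply (RInt_cderive _ (fun r => green f r * (wt r * flux g r))).
    - apply cont_minus; [apply cont_ip; auto; now apply cont_green|].
      apply cont_div; [cont_tac; apply cont_wt|apply cont_rho|apply rho_neq].
    - intro x. eapply is_derive_eq.
      + apply is_derive_rmult; [now apply is_derive_green|now apply is_derive_wt_flux].
      + unfold Rdiv. rring. }
  rewrite green_1, wt_0, RInt_cminus in E.
  - unfold ip. change (@eq R (RInt (fun r => wt r * (green f r * g r)) 0 1) (RInt (fun s => wt s * (flux f s * flux g s) / rho s) 0 1)).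
    lra.
  - apply cont_ip; auto. now apply cont_green.
  - pose proof (cont_flux f Hf). pose proof (cont_flux g Hg).
    apply cont_div; [cont_tac; apply cont_wt|apply cont_rho|apply rho_neq].
Qed.
Lemma green_sym (f g : R -> R) : cont f -> cont g -> ip (green f) g = ip f (green g).
Proof.
  intros. rewrite (ip_sym f), !green_ip by auto. apply RInt_rext. intro; unfold Rdiv; ring.
Qed.

(** Cauchy-Schwarz on [0, s], where the weight has mass s^(2n+2) / (2n+2). A mean-square bound thus
    becomes a pointwise one at the price of the factor s^n. *)
Lemma flux_nrm (h : R -> R) (s : R) : cont h -> 0 < s <= 1 ->
  Rabs (s ^ n * flux h s) <= nrm h.
Proof.
  intros Hh Hs.
  assert (H : Rabs (wt s * flux h s) <= nrm h * s ^ (n + 1)).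
  { rewrite flux_wt by auto.
    rewrite (RInt_rext _ (fun t => wt t * (h t * 1))) by (intro; ring).
    apply RInt_cs_abs; [lra|apply cont_wt|auto|apply cont_const| |apply nrm_ge0|apply pow_le; lra| |].
    - intros; apply wt_ge0; lra.
    - rewrite nrm_sq by auto. unfold ip.
      rewrite <- (RInt_cChasles (fun r => wt r * (h r * h r)) 0 s 1) by (now apply cont_ip).
      rewrite (RInt_rext (fun x => wt x * h x ^ 2) (fun r => wt r * (h r * h r))) by (intro; ring).
      assert (0 <= RInt (fun r => wt r * (h r * h r)) s 1).
      { apply RInt_cge0; [lra|now apply cont_ip|]. intros; apply Rmult_le_pos; [apply wt_ge0; lra|apply Rle_0_sqr]. }
      lra.
    - rewrite (RInt_rext _ (fun x => x ^ (2 * n + 1))) by (intro; unfold wt; ring).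
      rewrite RInt_pow. rewrite <- pow_mult.
      replace ((n + 1) * 2)%nat with (S (2 * n + 1)) by lia.
      rewrite (pow_ne_zero (S (2 * n + 1))) by lia.
      pose proof (pow_lt s (S (2 * n + 1)) ltac:(lra)).
      assert (1 <= INR (S (2 * n + 1))) by (change 1 with (INR 1); apply le_INR; lia).
      apply (Rmult_le_reg_r (INR (S (2 * n + 1)))); [lra|].
      unfold Rdiv. rewrite Rmult_assoc, Rinv_l by lra. nra. }
  unfold wt in H. replace (2 * n + 1)%nat with (n + (n + 1))%nat in H by lia.
  rewrite pow_add in H.
  pose proof (pow_lt s (n + 1) ltac:(lra)).
  replace (s ^ n * s ^ (n + 1) * flux h s) with (s ^ (n + 1) * (s ^ n * flux h s)) in H by ring.
  rewrite Rabs_mult, (Rabs_pos_eq (s ^ (n + 1))) in H by lra.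
  apply (Rmult_le_reg_l (s ^ (n + 1))); lra.
Qed.

Lemma green_weighted (h : R -> R) (a : nat) (K : R) : cont h ->
  (forall s, 0 < s <= 1 -> Rabs (s ^ a * flux h s) <= K) ->
  forall r, 0 < r <= 1 -> Rabs (r ^ a * green h r) <= K / A.
Proof.
  intros Hh H r Hr. unfold green.
  pose proof (cont_flux_rho h Hh).
  rewrite <- RInt_cscal by auto.
  assert (0 <= K) by (apply Rle_trans with (Rabs (1 ^ a * flux h 1)); [apply Rabs_pos|apply H; lra]).
  assert (0 <= K / A) by (apply Rdiv_le_0_compat; lra).
  apply Rle_trans with (K / A * (1 - r)); [|nra].
  apply RInt_cabs_const; [lra|cont_tac|].
  intros s Hs. unfold Rdiv. rewrite <- Rmult_assoc. apply div_rho_le.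
  apply Rle_trans with (Rabs (s ^ a * flux h s)); [|apply H; lra].
  rewrite !Rabs_mult. apply Rmult_le_compat_r; [apply Rabs_pos|].
  rewrite !Rabs_pos_eq by (apply pow_le; lra). apply pow_incr; lra.
Qed.

(** Each flux lowers the singular exponent by one: the weight r^(2n+1) absorbs r^-(a+1), and one
    integration gains a factor r. *)
Lemma flux_weighted (h : R -> R) (a : nat) (K : R) : cont h -> (S a <= n)%nat ->
  (forall r, 0 < r <= 1 -> Rabs (r ^ S a * h r) <= K) ->
  forall s, 0 < s <= 1 -> Rabs (s ^ a * flux h s) <= K.
Proof.
  intros Hh Ha H s Hs.
  assert (0 <= K) by (apply Rle_trans with (Rabs (1 ^ S a * h 1)); [apply Rabs_pos|apply H; lra]).
  assert (H1 : Rabs (wt s * flux h s) <= K * s ^ (2 * n - a) * (s - 0)).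
  { rewrite flux_wt by auto. apply RInt_cabs_const; [lra|cont_tac; apply cont_wt|].
    intros x Hx. unfold wt.
    replace (2 * n + 1)%nat with ((2 * n - a) + S a)%nat by lia. rewrite pow_add.
    rewrite Rmult_assoc, Rabs_mult, (Rabs_pos_eq (x ^ (2 * n - a))) by (apply pow_le; lra).
    rewrite Rmult_comm. apply Rmult_le_compat; [apply Rabs_pos|apply pow_le; lra| |apply pow_incr; lra].
    destruct (Req_dec x 0) as [->|]; [|apply H; lra].
    rewrite pow_ne_zero by lia. rewrite Rmult_0_l, Rabs_R0. auto. }
  unfold wt in H1. replace (2 * n + 1)%nat with (S (2 * n - a) + a)%nat in H1 by lia.
  rewrite pow_add, Rmult_assoc, Rabs_mult in H1.
  pose proof (pow_lt s (S (2 * n - a)) ltac:(lra)).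
  rewrite (Rabs_pos_eq (s ^ S (2 * n - a))) in H1 by lra.
  apply (Rmult_le_reg_l (s ^ S (2 * n - a))); [lra|].
  simpl pow in *. lra.
Qed.

Fixpoint greens (m : nat) (h : R -> R) : R -> R :=
  match m with O => h | S m => green (greens m h) end.

Lemma cont_greens m h : cont h -> cont (greens m h).
Proof. intro. induction m; simpl; auto using cont_green. Qed.
Lemma greens_lin (m : nat) (f g : R -> R) (a b r : R) : cont f -> cont g -> 0 <= r <= 1 ->
  greens m (fun x => a * f x + b * g x) r = a * greens m f r + b * greens m g r.
Proof.
  intros Hf Hg. revert r. induction m; simpl; intros r Hr; auto.
  rewrite (green_ext _ (fun x => a * greens m f x + b * greens m g x)) by auto.
  apply green_lin; now apply cont_greens.
Qed.
Lemma greens_comm (m : nat) (h : R -> R) : greens m (green h) = green (greens m h).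
Proof. induction m; simpl; auto. now rewrite IHm. Qed.

(** The first application of [green] leaves the weight r^n and each further one removes a factor r,
    so n + 1 applications map weighted mean square into the supremum norm. This smoothing is the
    source of compactness. *)
Lemma greens_weighted (h : R -> R) (j : nat) : cont h -> (j <= n)%nat ->
  forall r, 0 < r <= 1 -> Rabs (r ^ (n - j) * greens (S j) h r) <= nrm h / A ^ S j.
Proof.
  intros Hh. induction j; intros Hj r Hr.
  - replace (n - 0)%nat with n by lia. simpl greens. simpl pow at 2. rewrite Rmult_1_r.
    apply green_weighted; auto. intros; now apply flux_nrm.
  - assert (E : nrm h / A ^ S (S j) = nrm h / A ^ S j / A).
    { simpl. field. split; [|lra]. apply pow_nonzero; lra. }
    rewrite E. change (greens (S (S j)) h) with (green (greens (S j) h)).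
    apply green_weighted; [now apply cont_greens| |auto].
    apply flux_weighted; [now apply cont_greens|lia|].
    replace (S (n - S j)) with (n - j)%nat by lia. apply IHj. lia.
Qed.
Lemma greens_sup (h : R -> R) : cont h ->
  forall r, 0 <= r <= 1 -> Rabs (greens (S n) h r) <= nrm h / A ^ S n.
Proof.
  intros Hh. apply cont_le_at_0; [now apply cont_greens|].
  intros r Hr. pose proof (greens_weighted h n Hh (Nat.le_refl _) r Hr).
  rewrite Nat.sub_diag in H. now rewrite Rmult_1_l in H.
Qed.
Lemma green_nrm (h : R -> R) : cont h -> nrm (green h) <= nrm h / A.
Proof.
  intro Hh. assert (HK : 0 <= nrm h / A) by (apply Rdiv_le_0_compat; [apply nrm_ge0|lra]).
  apply nrm_le; auto. unfold ip.
  apply Rle_trans with (RInt (fun _ => (nrm h / A) ^ 2) 0 1).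
  - apply RInt_cle; [lra|apply cont_ip; now apply cont_green|cont_tac|].
    intros r Hr. unfold wt.
    replace (r ^ (2 * n + 1) * (green h r * green h r)) with (r * (r ^ n * green h r) ^ 2).
    2:{ replace (2 * n + 1)%nat with (S (n + n)) by lia. simpl. rewrite pow_add. ring. }
    destruct (Req_dec r 0) as [->|Hn].
    + rewrite Rmult_0_l. apply pow2_ge_0.
    + assert (Rabs (r ^ n * green h r) <= nrm h / A).
      { apply green_weighted; auto; [|lra]. intros; now apply flux_nrm. }
      assert ((r ^ n * green h r) ^ 2 <= (nrm h / A) ^ 2).
      { rewrite <- (pow2_abs (r ^ n * green h r)). apply pow_incr. split; [apply Rabs_pos|auto]. }
      pose proof (pow2_ge_0 (r ^ n * green h r)). nra.
  - rewrite RInt_cconst. lra.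
Qed.

(** Gronwall argument: [green d r - green d 0] is minus an integral from 0 to r. In the supremum
    norm weighted by exp (- K r) with K = 2 / (A lam) this Volterra operator has norm at most lam /
    2 and is absorbed by [lam * d]. *)
Lemma volterra_bound (lam e : R) (d : R -> R) : 0 < lam -> 0 <= e -> cont d ->
  (forall r, 0 <= r <= 1 -> Rabs (lam * d r - (green d r - green d 0)) <= e) ->
  forall r, 0 <= r <= 1 -> Rabs (d r) <= 2 * e / lam * exp (2 / (A * lam)).
Proof.
  intros Hl He Hd H.
  set (K := 2 / (A * lam)).
  assert (HK : 0 < K) by (apply Rdiv_lt_0_compat; nra).
  set (f := fun r => Rabs (d r) * exp (- (K * r))).
  assert (Hf : cont f) by (apply cont_mult; [cont_tac|apply cont_exp; cont_tac]).
  destruct (cont_bounded_max f Hf) as [c [Hc Hmax]].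
  set (N := f c).
  assert (HN : 0 <= N) by (apply Rmult_le_pos; [apply Rabs_pos|apply Rlt_le, exp_pos]).
  assert (Hexp : forall s, exp (- (K * s)) * exp (K * s) = 1).
  { intro s. rewrite <- exp_plus. replace (- (K * s) + K * s) with 0 by ring. apply exp_0. }
  assert (Hd' : forall s, 0 <= s <= 1 -> Rabs (d s) <= N * exp (K * s)).
  { intros s Hs. specialize (Hmax s Hs). fold N in Hmax. unfold f in Hmax.
    replace (Rabs (d s)) with (Rabs (d s) * exp (- (K * s)) * exp (K * s))
      by (rewrite Rmult_assoc, Hexp; ring).
    apply Rmult_le_compat_r; auto. apply Rlt_le, exp_pos. }
  assert (Hg : Rabs (green d c - green d 0) <= lam / 2 * (N * exp (K * c))).
  { replace (green d c - green d 0) with (- RInt (fun s => flux d s / rho s) 0 c).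
    2:{ unfold green. rewrite <- (RInt_cChasles _ 0 c 1) by now apply cont_flux_rho. rring. }
    rewrite Rabs_Ropp.
    apply Rle_trans with (RInt (fun s => N / A * exp (K * s)) 0 c).
    - apply RInt_cabs_le; [lra|now apply cont_flux_rho|apply cont_mult; [cont_tac|apply cont_exp; cont_tac]|].
      intros s Hs. replace (N / A * exp (K * s)) with (N * exp (K * s) / A) by (field; lra).
      apply div_rho_le. apply flux_bound; auto; [lra|].
      intros x Hx. apply Rle_trans with (N * exp (K * x)); [apply Hd'; lra|].
      apply Rmult_le_compat_l; auto.
      destruct (Req_dec x s) as [->|]; [lra|]. apply Rlt_le, exp_increasing. nra.
    - rewrite (RInt_cderive _ (fun s => N / (A * K) * exp (K * s))).
      + rewrite Rmult_0_r, exp_0.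
        replace (N / (A * K)) with (lam / 2 * N) by (unfold K; field; lra).
        assert (0 <= lam / 2 * N) by nra. pose proof (exp_pos (K * c)). nra.
      + apply cont_mult; [cont_tac|apply cont_exp; cont_tac].
      + intro x. auto_derive; auto. rfield. lra. }
  specialize (H c Hc).
  assert (HNc : Rabs (d c) = N * exp (K * c)).
  { unfold N, f. rewrite Rmult_assoc, Hexp. ring. }
  assert (H3 : lam * Rabs (d c) <= e + lam / 2 * (N * exp (K * c))).
  { rewrite <- (Rabs_pos_eq lam) at 1 by lra. rewrite <- Rabs_mult.
    replace (lam * d c) with ((lam * d c - (green d c - green d 0)) + (green d c - green d 0)) by ring.
    eapply Rle_trans; [apply Rabs_triang|]. lra. }
  rewrite HNc in H3.
  assert (1 <= exp (K * c)).
  { destruct (Req_dec c 0) as [->|]; [rewrite Rmult_0_r, exp_0; lra|].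
    rewrite <- exp_0. apply Rlt_le, exp_increasing. nra. }
  assert (HNe : N <= 2 * e / lam).
  { apply (Rmult_le_reg_l lam); auto. replace (lam * (2 * e / lam)) with (2 * e) by (field; lra).
    assert (lam * N <= lam * (N * exp (K * c))).
    { apply Rmult_le_compat_l; [lra|]. nra. }
    lra. }
  intros r Hr. eapply Rle_trans; [apply Hd'; auto|].
  apply Rmult_le_compat; auto; [apply Rlt_le, exp_pos|].
  destruct (Req_dec r 1) as [->|]; [rewrite Rmult_1_r; lra|]. apply Rlt_le, exp_increasing. nra.
Qed.

Definition eigen (psi : R -> R) (lam : R) : Prop :=
  cont psi /\ 0 < lam /\ ip psi psi = 1 /\
  forall r, 0 <= r <= 1 -> green psi r = lam * psi r.

(** Two bumps with disjoint supports in the halves of the interval, each orthogonal to the tail of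
    the list, have a nonzero combination that is orthogonal to the head as well. It keeps the
    orthogonal complements below from being trivial. *)
Lemma exists_orthogonal_bump (l : list (R -> R)) : (forall f, In f l -> cont f) ->
  forall a b, 0 < a < b -> b < 1 -> exists x, cont x /\
    (forall r, r <= a \/ b <= r -> x r = 0) /\ 0 < ip x x /\
    forall f, In f l -> ip x f = 0.
Proof.
  induction l as [|f l IH]; intros Hl a b Hab Hb.
  - set (x := fun r => Rmax 0 ((r - a) * (b - r))).
    assert (Hx : cont x).
    { apply (cont_ext (fun r => / 2 * ((r - a) * (b - r) + Rabs ((r - a) * (b - r))))).
      - intro r. unfold x, Rmax, Rabs.
        destruct (Rle_dec 0 ((r - a) * (b - r))), (Rcase_abs ((r - a) * (b - r))); lra.
      - cont_tac. }
    exists x. split; [auto|]. split; [|split; [|intros f []]].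
    + intros r Hr. unfold x. apply Rmax_left. destruct Hr; nra.
    + apply (ip_pos x ((a + b) / 2)); auto; [lra|]. unfold x. rewrite Rmax_right.
      * apply Rgt_not_eq. apply Rmult_lt_0_compat; lra.
      * apply Rmult_le_pos; lra.
  - set (c := (a + b) / 2).
    assert (Hl' : forall g, In g l -> cont g) by (intros; apply Hl; now right).
    assert (Hf : cont f) by (apply Hl; now left).
    destruct (IH Hl' a c) as [x1 [C1 [S1 [P1 O1]]]]; [unfold c; lra|unfold c; lra|].
    destruct (IH Hl' c b) as [x2 [C2 [S2 [P2 O2]]]]; [unfold c; lra|unfold c; lra|].
    destruct (Req_dec (ip x1 f) 0) as [E|Hne].
    + exists x1. split; [auto|]. split; [intros r Hr; apply S1; unfold c; lra|].
      split; auto. intros g [<-|Hg]; auto.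
    + exists (fun r => ip x2 f * x1 r + (- ip x1 f) * x2 r).
      split; [cont_tac|]. split; [|split].
      * intros r Hr. rewrite S1, S2 by (unfold c; lra). ring.
      * rewrite ip_lin, !ip_linr by cont_tac.
        assert (E12 : ip x1 x2 = 0).
        { unfold ip. rewrite (RInt_rext _ (fun _ => 0)); [rewrite RInt_cconst; lra|].
          intro r. destruct (Rle_lt_dec r c).
          - rewrite (S2 r) by lra. ring.
          - rewrite (S1 r) by lra. ring. }
        rewrite (ip_sym x2 x1), E12.
        assert (0 < ip x1 f ^ 2) by (rewrite <- Rsqr_pow2; now apply Rsqr_pos_lt).
        pose proof (pow2_ge_0 (ip x2 f)). nra.
      * intros g [<-|Hg].
        -- rewrite ip_lin by auto. ring.
        -- rewrite ip_lin by (try assumption; apply Hl'; assumption).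
           rewrite (O1 g Hg), (O2 g Hg). ring.
Qed.

Lemma uniform_limit (f : nat -> R -> R) : (forall j, cont (f j)) ->
  (forall eps, 0 < eps -> exists N, forall j l r, (N <= j)%nat -> (N <= l)%nat ->
     0 <= r <= 1 -> Rabs (f j r - f l r) <= eps) ->
  exists z, cont z /\ forall eps, 0 < eps -> exists N, forall j r, (N <= j)%nat ->
     0 <= r <= 1 -> Rabs (f j r - z r) <= eps.
Proof.
  intros Hf Hc.
  (* Precomposition with the clamp to [0, 1] extends the uniform limit continuously to the whole
     line. *)
  set (k := fun r => Rmax 0 (Rmin 1 r)).
  assert (Hk : forall r, 0 <= k r <= 1).
  { intro r. unfold k. split; [apply Rmax_l|]. apply Rmax_lub; [lra|apply Rmin_l]. }
  assert (Hk' : forall r, 0 <= r <= 1 -> k r = r).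
  { intros r Hr. unfold k. rewrite Rmin_right, Rmax_right; lra. }
  assert (Hkl : forall x y, Rabs (k x - k y) <= Rabs (x - y)).
  { intros x y. unfold k, Rmin. destruct (Rle_dec 1 x), (Rle_dec 1 y); unfold Rmax;
    repeat (match goal with |- context [Rle_dec ?a ?b] => destruct (Rle_dec a b) end);
    unfold Rabs; repeat (match goal with |- context [Rcase_abs ?a] => destruct (Rcase_abs a) end); lra. }
  assert (Hlim : forall r, { l : R | Un_cv (fun j => f j (k r)) l }).
  { intro r. apply Rcomplete.R_complete. intros eps He.
    destruct (Hc (eps / 2)) as [N HN]; [lra|]. exists N. intros j l Hj Hl.
    unfold Rdist. specialize (HN j l (k r) Hj Hl (Hk r)). lra. }
  set (z := fun r => proj1_sig (Hlim r)).
  assert (Hz : forall eps, 0 < eps -> exists N, forall j r, (N <= j)%nat ->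
     Rabs (f j (k r) - z r) <= eps).
  { intros eps He. destruct (Hc (eps / 2)) as [N HN]; [lra|]. exists N. intros j r Hj.
    unfold z. destruct (Hlim r) as [l Hl]; simpl.
    destruct (Hl (eps / 2)) as [N2 HN2]; [lra|].
    specialize (HN2 (max N N2) ltac:(lia)).
    specialize (HN j (max N N2) (k r) Hj ltac:(lia) (Hk r)).
    unfold Rdist in HN2.
    replace (f j (k r) - l) with ((f j (k r) - f (max N N2) (k r)) + (f (max N N2) (k r) - l)) by ring.
    eapply Rle_trans; [apply Rabs_triang|]. lra. }
  exists z. split.
  - apply cont_of_eps. intros x eps He.
    destruct (Hz (eps / 4)) as [N HN]; [lra|].
    destruct (cont_eps (f N) (k x) (eps / 4) (Hf N)) as [d [Hd Hy]]; [lra|].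
    exists d. split; auto. intros y Hxy.
    assert (H1 := HN N y (Nat.le_refl _)). assert (H2 := HN N x (Nat.le_refl _)).
    assert (H3 : Rabs (f N (k y) - f N (k x)) < eps / 4).
    { apply Hy. eapply Rle_lt_trans; [apply Hkl|auto]. }
    apply Rabs_def2 in H3. apply Rabs_le_between in H1. apply Rabs_le_between in H2.
    apply Rabs_def1; lra.
  - intros eps He. destruct (Hz eps He) as [N HN]. exists N. intros j r Hj Hr.
    rewrite <- (Hk' r Hr) at 1. now apply HN.
Qed.

(** Cauchy-Schwarz for the positive form of [green], that is, for the fluxes with weight wt /
    rho. *)
Lemma green_cs (x y : R -> R) : cont x -> cont y ->
  ip (green x) y ^ 2 <= ip (green x) x * ip (green y) y.
Proof.
  intros Hx Hy. rewrite !green_ip by auto.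
  pose proof (cont_flux x Hx) as Fx. pose proof (cont_flux y Hy) as Fy.
  assert (Hw : cont (fun s => wt s / rho s)).
  { apply cont_div; [apply cont_wt|apply cont_rho|apply rho_neq]. }
  pose proof (RInt_cauchy_schwarz (fun s => wt s / rho s) (flux x) (flux y) 0 1 ltac:(lra) Hw Fx Fy) as H.
  rewrite (RInt_rext (fun s => wt s * (flux x s * flux y s) / rho s)
    (fun s => wt s / rho s * (flux x s * flux y s))) by (intro; unfold Rdiv; ring).
  rewrite (RInt_rext (fun s => wt s * (flux x s * flux x s) / rho s)
    (fun s => wt s / rho s * flux x s ^ 2)) by (intro; unfold Rdiv; ring).
  rewrite (RInt_rext (fun s => wt s * (flux y s * flux y s) / rho s)
    (fun s => wt s / rho s * flux y s ^ 2)) by (intro; unfold Rdiv; ring).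
  apply H. intros s Hs. pose proof (rho_ge s). apply Rdiv_le_0_compat; [apply wt_ge0|]; lra.
Qed.

Lemma nrm_lin_le (x y : R -> R) (a b : R) : cont x -> cont y ->
  nrm (fun r => a * x r + b * y r) <= Rabs a * nrm x + Rabs b * nrm y.
Proof.
  intros Hx Hy. pose proof (nrm_ge0 x). pose proof (nrm_ge0 y).
  pose proof (Rabs_pos a). pose proof (Rabs_pos b).
  apply nrm_le; [nra|]. rewrite ip_lin, !ip_linr, (ip_sym y x) by cont_tac.
  pose proof (ip_abs x y Hx Hy). pose proof (nrm_sq x Hx). pose proof (nrm_sq y Hy).
  replace ((Rabs a * nrm x + Rabs b * nrm y) ^ 2) with
    (Rabs a ^ 2 * nrm x ^ 2 + Rabs b ^ 2 * nrm y ^ 2 + 2 * (Rabs a * Rabs b) * (nrm x * nrm y)) by ring.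
  rewrite !pow2_abs, H4, H5, <- Rabs_mult.
  assert (a * b * ip x y <= Rabs (a * b) * (nrm x * nrm y)).
  { eapply Rle_trans; [apply Rle_abs|]. rewrite Rabs_mult. apply Rmult_le_compat_l; auto. apply Rabs_pos. }
  nra.
Qed.

(** [green^m - lam^m] is [green - lam] composed with a bounded operator. Hence applying powers of
    [green] to an approximate eigenvector of norm 1 cannot make it tend to 0. *)
Lemma greens_near_eigen (m : nat) (lam : R) : 0 < lam -> exists C, 0 <= C /\
  forall x, cont x ->
  nrm (fun r => 1 * greens m x r + (- lam ^ m) * x r)
    <= C * nrm (fun r => 1 * green x r + (- lam) * x r).
Proof.
  intro Hl. induction m as [|m [C [HC IH]]].
  - exists 0. split; [lra|]. intros x Hx. rewrite Rmult_0_l.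
    apply nrm_le; [lra|]. simpl greens.
    rewrite (ip_ext _ (fun _ => 0) _ (fun _ => 0)); [|intros; simpl; ring|intros; simpl; ring].
    unfold ip. rewrite (RInt_rext _ (fun _ => 0)); [rewrite RInt_cconst; lra|intro; ring].
  - exists (C / A + lam ^ m). split.
    { pose proof (pow_lt lam m Hl). assert (0 <= C / A) by (apply Rdiv_le_0_compat; lra). lra. }
    intros x Hx. set (d := fun r => 1 * green x r + - lam * x r).
    set (f := fun r => 1 * greens m x r + - lam ^ m * x r).
    pose proof (cont_green x Hx) as C1. pose proof (cont_greens m x Hx) as C2.
    assert (Cd : cont d) by (unfold d; cont_tac). assert (Cf : cont f) by (unfold f; cont_tac).
    pose proof (cont_green f Cf) as C3.
    assert (E : nrm (fun r => 1 * greens (S m) x r + - lam ^ S m * x r)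
              = nrm (fun r => 1 * green f r + lam ^ m * d r)).
    { unfold nrm. f_equal. apply ip_ext; intros r Hr; unfold f at 1; simpl greens;
      rewrite green_lin by auto; unfold d; simpl; ring. }
    rewrite E. eapply Rle_trans; [apply nrm_lin_le; auto|].
    rewrite Rabs_R1, (Rabs_pos_eq (lam ^ m)) by (apply pow_le; lra).
    pose proof (green_nrm f Cf). specialize (IH x Hx). fold d in IH. fold f in IH.
    assert (nrm f / A <= C * nrm d / A).
    { unfold Rdiv. apply Rmult_le_compat_r; auto. apply Rlt_le, Rinv_0_lt_compat; lra. }
    replace ((C / A + lam ^ m) * nrm d) with (C * nrm d / A + lam ^ m * nrm d) by (field; lra). lra.
Qed.

(** * Maximizing the quadratic form of [green] on an orthogonal complement *)

Section NextEigen.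
Variable (l : list ((R -> R) * R)).
Variable (Hl : forall p, In p l -> eigen (fst p) (snd p)).

Definition compl (x : R -> R) : Prop := cont x /\ forall p, In p l -> ip x (fst p) = 0.

Lemma compl_green (x : R -> R) : compl x -> compl (green x).
Proof.
  intros [Hx H]. split; [now apply cont_green|]. intros p Hp.
  destruct (Hl p Hp) as [Hc [_ [_ He]]].
  rewrite green_sym by auto.
  rewrite (ip_ext x x (green (fst p)) (fun r => snd p * fst p r + 0 * fst p r)); auto.
  - rewrite ip_linr by auto. rewrite H by auto. ring.
  - intros r Hr. rewrite He by auto. ring.
Qed.
Lemma compl_lin (x y : R -> R) (a b : R) : compl x -> compl y ->
  compl (fun r => a * x r + b * y r).
Proof.
  intros [Hx H] [Hy H']. split; [cont_tac|]. intros p Hp.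
  destruct (Hl p Hp) as [Hc _].
  rewrite ip_lin by auto. rewrite H, H' by auto. ring.
Qed.

Lemma ip_green_ge0 (x : R -> R) : cont x -> 0 <= ip (green x) x.
Proof.
  intro Hx. rewrite green_ip by auto. pose proof (cont_flux x Hx).
  apply RInt_cge0; [lra| |].
  - apply cont_div; [apply cont_ip; auto|apply cont_rho|apply rho_neq].
  - intros s Hs. pose proof (rho_ge s). apply Rdiv_le_0_compat; [|lra].
    apply Rmult_le_pos; [apply wt_ge0; lra|apply Rle_0_sqr].
Qed.
(** If the form vanishes, so does the flux on (0, 1], and differentiating [wt * flux] gives back
    [wt * x = 0]. *)
Lemma ip_green_pos (x : R -> R) : cont x -> 0 < ip x x -> 0 < ip (green x) x.
Proof.
  intros Hx Hp. pose proof (ip_green_ge0 x Hx) as H0.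
  destruct H0 as [|H0]; auto. exfalso.
  pose proof (cont_flux x Hx) as Hfx.
  assert (Hc : cont (fun s => wt s * (flux x s * flux x s) / rho s)).
  { apply cont_div; [apply cont_ip; auto|apply cont_rho|apply rho_neq]. }
  assert (Hfl : forall s, 0 < s <= 1 -> flux x s = 0).
  { intros s Hs. apply NNPP. intro Hn.
    assert (0 < RInt (fun s => wt s * (flux x s * flux x s) / rho s) 0 1).
    { apply (RInt_cpos _ 0 1 s); auto; try lra.
      - intros t Ht. pose proof (rho_ge t). apply Rdiv_le_0_compat; [|lra].
        apply Rmult_le_pos; [apply wt_ge0; lra|apply Rle_0_sqr].
      - pose proof (rho_ge s). apply Rdiv_lt_0_compat; [|lra].
        apply Rmult_lt_0_compat; [apply pow_lt; lra|].
        destruct (Rlt_or_le (flux x s) 0); nra. }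
    rewrite green_ip in H0 by auto. lra. }
  assert (E : ip x x = 0); [|lra].
  assert (Hx1 : forall r, 0 < r < 1 -> x r = 0).
  { intros r Hr.
    assert (D : is_derive (fun s => wt s * flux x s) r 0).
    { apply (is_derive_ext_loc (fun _ => 0)).
      - assert (Hd : 0 < Rmin r (1 - r)) by (apply Rmin_pos; lra).
        exists (mkposreal _ Hd). intros y Hy.
        unfold ball in Hy; simpl in Hy; unfold AbsRing_ball, abs, minus, plus, opp in Hy; simpl in Hy.
        apply Rabs_def2 in Hy.
        pose proof (Rmin_l r (1 - r)). pose proof (Rmin_r r (1 - r)).
        change (0 = wt y * flux x y). rewrite Hfl by lra. ring.
      - apply (is_derive_const (K := R_AbsRing) (V := R_NormedModule) 0). }
    pose proof (is_derive_unique _ _ _ (is_derive_wt_flux x r Hx)) as U.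
    rewrite (is_derive_unique _ _ _ D) in U.
    assert (0 < wt r) by (apply pow_lt; lra).
    destruct (Rmult_integral _ _ (eq_sym U)); lra. }
  unfold ip. rewrite (RInt_ext _ (fun _ => 0)); [rewrite RInt_cconst; lra|].
  intros r Hr. rewrite Rmin_left, Rmax_right in Hr by lra. rewrite Hx1 by lra.
  change (wt r * (0 * 0) = 0). ring.
Qed.

Definition values (y : R) : Prop := exists x, compl x /\ ip x x = 1 /\ ip (green x) x = y.

Lemma ip_zero_green (x : R -> R) : cont x -> ip x x = 0 -> ip (green x) x = 0.
Proof.
  intros Hx H. pose proof (ip_cs (green x) x (cont_green x Hx) Hx).
  rewrite H in H0. rewrite Rmult_0_r in H0.
  pose proof (pow2_ge_0 (ip (green x) x)).
  apply Rsqr_0_uniq. rewrite Rsqr_pow2. lra.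
Qed.

Lemma unit_scale (x : R -> R) : compl x -> 0 < ip x x ->
  exists y, compl y /\ ip y y = 1 /\ ip (green y) y = ip (green x) x / ip x x /\
    y = (fun r => / nrm x * x r + 0 * x r).
Proof.
  intros Hx Hp. assert (Hc := proj1 Hx).
  assert (Hn : 0 < nrm x) by now apply sqrt_lt_R0.
  assert (Hn2 := nrm_sq x Hc).
  exists (fun r => / nrm x * x r + 0 * x r). split; [now apply compl_lin|]. split; [|split; auto].
  - rewrite ip_lin, !ip_linr by cont_tac. rewrite <- Hn2. field. lra.
  - rewrite (ip_ext (green (fun r => / nrm x * x r + 0 * x r)) (fun r => / nrm x * green x r + 0 * green x r)
       _ (fun r => / nrm x * x r + 0 * x r)); auto.
    2:{ intros r Hr. now apply green_lin. }
    pose proof (cont_green x Hc).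
    rewrite ip_lin, !ip_linr by cont_tac. rewrite <- Hn2. field. lra.
Qed.

(** [lam] is the supremum of the form on the unit sphere of the complement: finite by [green_nrm],
    positive because the complement contains a bump. *)
Lemma values_lub : exists lam, 0 < lam /\
  (forall x, compl x -> ip (green x) x <= lam * ip x x) /\
  (forall e, 0 < e -> exists x, compl x /\ ip x x = 1 /\ lam - e < ip (green x) x).
Proof.
  assert (Hb : bound values).
  { exists (/ A). intros y [x [[Hx _] [H1 <-]]].
    eapply Rle_trans; [apply Rle_abs|]. eapply Rle_trans; [apply ip_abs; [now apply cont_green|exact Hx]|].
    pose proof (green_nrm x Hx) as H2. unfold nrm at 2. unfold nrm at 2 in H2.
    rewrite H1, sqrt_1 in *. unfold Rdiv in H2. lra. }
  destruct (exists_orthogonal_bump (map fst l)) with (a := / 4) (b := / 2) as [x0 [C0 [_ [P0 O0]]]]; try lra.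
  { intros f Hf. apply in_map_iff in Hf. destruct Hf as [p [<- Hp]]. apply (Hl p Hp). }
  assert (Hx0 : compl x0).
  { split; auto. intros p Hp. apply O0. apply in_map_iff. now exists p. }
  destruct (unit_scale x0 Hx0 P0) as [y0 [Y1 [Y2 [Y3 _]]]].
  destruct (completeness values Hb) as [lam [Hub Hlub]].
  { exists (ip (green y0) y0). exists y0. auto. }
  exists lam. split; [|split].
  - apply Rlt_le_trans with (ip (green y0) y0).
    + rewrite Y3. apply Rdiv_lt_0_compat; auto. now apply ip_green_pos.
    + apply Hub. exists y0. auto.
  - intros x Hx. destruct (ip_ge0 x (proj1 Hx)) as [Hp|Hz].
    + destruct (unit_scale x Hx Hp) as [y [Z1 [Z2 [Z3 _]]]].
      assert (ip (green y) y <= lam) by (apply Hub; exists y; auto).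
      rewrite Z3 in H. apply (Rmult_le_reg_r (/ ip x x)); [now apply Rinv_0_lt_compat|].
      rewrite Rmult_assoc, Rinv_r by lra. unfold Rdiv in H. lra.
    + pose proof (proj1 Hx) as Cx. rewrite <- Hz, ip_zero_green by auto. lra.
  - intros e He. apply NNPP. intro Hn.
    assert (lam <= lam - e); [|lra]. apply Hlub. intros y [x [Hx [H1 <-]]].
    apply Rnot_lt_le. intro Hlt. apply Hn. exists x. auto.
Qed.

(** Almost maximizing vectors are almost eigenvectors. [green_cs] gives |G x|^2 <= lam (G x, x),
    hence |G x - lam x|^2 <= lam (lam - (G x, x)) for a unit vector x, with G standing for
    [green]. *)
Lemma near_eigen (lam : R) : 0 < lam ->
  (forall x, compl x -> ip (green x) x <= lam * ip x x) ->
  (forall e, 0 < e -> exists x, compl x /\ ip x x = 1 /\ lam - e < ip (green x) x) ->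
  forall e, 0 < e -> exists x, compl x /\ ip x x = 1 /\
    nrm (fun r => 1 * green x r + (- lam) * x r) <= e.
Proof.
  intros Hlam Hub Hex e He.
  destruct (Hex (e ^ 2 / lam)) as [x [Hx [H1 Hq]]].
  { apply Rdiv_lt_0_compat; auto. apply pow_lt; auto. }
  exists x. split; [auto|split; [auto|]]. assert (Hc := proj1 Hx).
  pose proof (cont_green x Hc) as Cg.
  assert (H2 : ip (green x) (green x) <= lam * ip (green x) x).
  { pose proof (green_cs x (green x) Hc Cg) as H.
    pose proof (Hub (green x) (compl_green x Hx)) as H'.
    pose proof (ip_green_ge0 x Hc).
    destruct (ip_ge0 (green x) Cg) as [Hp|Hz].
    - apply (Rmult_le_reg_r (ip (green x) (green x))); [exact Hp|].
      assert (ip (green x) x * ip (green (green x)) (green x) <= ip (green x) x * (lam * ip (green x) (green x)))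
        by (apply Rmult_le_compat_l; auto). nra.
    - rewrite <- Hz. nra. }
  apply nrm_le; [lra|]. rewrite ip_lin, !ip_linr, (ip_sym x (green x)), H1 by cont_tac.
  assert (lam * (lam - ip (green x) x) <= e ^ 2); [|nra].
  apply (Rmult_le_reg_r (/ lam)); [now apply Rinv_0_lt_compat|].
  replace (lam * (lam - ip (green x) x) * / lam) with (lam - ip (green x) x) by (field; lra).
  unfold Rdiv in Hq. lra.
Qed.

(** A maximizing sequence becomes compact after n + 1 applications of [green]: the resulting [y j]
    solve the eigenvalue equation up to a uniformly small error. Up to the constant [green (y j) 0]
    this is a Volterra equation with a unique solution, so normalizing that constant forces uniform
    convergence. *)
Lemma next_eigen : exists psi lam, eigen psi lam /\ compl psi /\
  forall x, compl x -> ip (green x) x <= lam * ip x x.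
Proof.
  destruct values_lub as [lam [Hlam [Hub Hex]]].
  pose proof (near_eigen lam Hlam Hub Hex) as Hne.
  assert (Hinv : forall j, 0 < / (INR j + 1)).
  { intro j. apply Rinv_0_lt_compat. pose proof (pos_INR j). lra. }
  assert (Hx : forall j : nat, { x : R -> R | compl x /\ ip x x = 1 /\
     nrm (fun r => 1 * green x r + (- lam) * x r) <= / (INR j + 1) }).
  { intro j. apply constructive_indefinite_description. now apply Hne. }
  set (x := fun j => proj1_sig (Hx j)).
  set (eps := fun j => / (INR j + 1)).
  assert (Hxc : forall j, compl (x j)) by (intro j; apply (proj2_sig (Hx j))).
  assert (Hx1 : forall j, ip (x j) (x j) = 1) by (intro j; apply (proj2_sig (Hx j))).
  assert (Hxe : forall j, nrm (fun r => 1 * green (x j) r + (- lam) * x j r) <= eps j)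
    by (intro j; apply (proj2_sig (Hx j))).
  clearbody x. clear Hx.
  assert (Hcx : forall j, cont (x j)) by (intro j; apply (Hxc j)).
  assert (Heps0 : forall d, 0 < d -> exists J, forall j, (J <= j)%nat -> eps j <= d).
  { intros d Hd. destruct (archimed_cor1 d Hd) as [J [HJ HJ0]]. exists J. intros j Hj.
    unfold eps. apply Rle_trans with (/ INR J); [|lra]. apply Rinv_le_contravar; [apply lt_0_INR; auto|].
    apply le_INR in Hj. lra. }
  set (y := fun j => greens (S n) (x j)).
  assert (Cy : forall j, cont (y j)) by (intro j; now apply cont_greens).
  assert (Yc : forall j, compl (y j)).
  { intro j. unfold y. generalize (S n) as m. induction m; simpl; [apply Hxc|now apply compl_green]. }
  set (P := A ^ S n). assert (HP : 0 < P) by now apply pow_lt.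
  assert (Hy : forall j r, 0 <= r <= 1 -> Rabs (green (y j) r - lam * y j r) <= eps j / P).
  { intros j r Hr. unfold y.
    replace (green (greens (S n) (x j)) r - lam * greens (S n) (x j) r)
      with (greens (S n) (fun r => 1 * green (x j) r + (- lam) * x j r) r).
    2:{ rewrite greens_lin by auto using cont_green. rewrite greens_comm. ring. }
    eapply Rle_trans; [apply greens_sup; auto|].
    - pose proof (cont_green (x j) (Hcx j)). specialize (Hcx j). cont_tac.
    - unfold Rdiv. apply Rmult_le_compat_r; [apply Rlt_le, Rinv_0_lt_compat; auto|apply Hxe]. }
  (* By the Volterra bound the size of [y j] is governed by this one number; the next estimates keep
     it away from 0. *)
  set (a := fun j => green (y j) 0).
  set (C1 := 2 / lam * exp (2 / (A * lam))).
  assert (HC1 : 0 < C1).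
  { apply Rmult_lt_0_compat; [apply Rdiv_lt_0_compat; lra|apply exp_pos]. }
  assert (Hvol : forall d e, cont d -> 0 <= e ->
    (forall r, 0 <= r <= 1 -> Rabs (lam * d r - (green d r - green d 0)) <= e) ->
    forall r, 0 <= r <= 1 -> Rabs (d r) <= C1 * e).
  { intros d e Hd He H r Hr. pose proof (volterra_bound lam e d Hlam He Hd H r Hr) as V.
    replace (C1 * e) with (2 * e / lam * exp (2 / (A * lam))); [auto|unfold C1; field; lra]. }
  assert (HeP : forall j, 0 <= eps j / P).
  { intro j. apply Rdiv_le_0_compat; auto. apply Rlt_le, Hinv. }
  assert (Hya : forall j, nrm (y j) <= C1 * (eps j / P + Rabs (a j))).
  { intro j. apply nrm_bound; auto.
    - apply Rmult_le_pos; [lra|]. pose proof (Rabs_pos (a j)). pose proof (HeP j). lra.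
    - apply Hvol; auto.
      + pose proof (Rabs_pos (a j)). pose proof (HeP j). lra.
      + intros r Hr. replace (lam * y j r - (green (y j) r - green (y j) 0))
          with (- (green (y j) r - lam * y j r) + a j) by (unfold a; ring).
        eapply Rle_trans; [apply Rabs_triang|]. rewrite Rabs_Ropp.
        pose proof (Hy j r Hr). lra. }
  destruct (greens_near_eigen (S n) lam Hlam) as [C2 [HC2 Hnear]].
  (* [y j] is close to [lam ^ S n * x j], and [x j] has norm 1. *)
  assert (Hlow : forall j, lam ^ S n - C2 * eps j <= nrm (y j)).
  { intro j. specialize (Hnear (x j) (Hcx j)).
    set (w := fun r => 1 * greens (S n) (x j) r + (- lam ^ S n) * x j r) in *.
    assert (Cw : cont w).
    { unfold w. pose proof (Hcx j). pose proof (Cy j). unfold y in H0. cont_tac. }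
    assert (E : nrm (fun r => 1 * y j r + (-1) * w r) = lam ^ S n).
    { unfold nrm. rewrite (ip_ext _ (fun r => lam ^ S n * x j r + 0 * x j r) _ (fun r => lam ^ S n * x j r + 0 * x j r));
        [|intros; unfold w, y; ring|intros; unfold w, y; ring].
      rewrite ip_lin, !ip_linr by (specialize (Hcx j); cont_tac). rewrite Hx1.
      replace (_ + _) with ((lam ^ S n) ^ 2) by ring. apply sqrt_pow2. apply pow_le; lra. }
    pose proof (nrm_lin_le (y j) w 1 (-1) (Cy j) Cw) as T. rewrite E, Rabs_R1 in T.
    replace (Rabs (-1)) with 1 in T by (rewrite Rabs_left; lra).
    assert (C2 * nrm (fun r => 1 * green (x j) r + (- lam) * x j r) <= C2 * eps j)
      by (apply Rmult_le_compat_l; auto). lra. }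
  (* For large j the norm of [y j] is at least [lam ^ S n / 2] and at most [C1 * (c0 + Rabs (a j))],
     where [C1 * c0 = lam ^ S n / 4]. *)
  set (c0 := lam ^ S n / (4 * C1)).
  assert (Hls : 0 < lam ^ S n) by now apply pow_lt.
  assert (Hc0 : 0 < c0) by (apply Rdiv_lt_0_compat; lra).
  destruct (Heps0 (Rmin (c0 * P) (lam ^ S n / (2 * (C2 + 1))))) as [J HJ].
  { apply Rmin_pos; [apply Rmult_lt_0_compat; auto|apply Rdiv_lt_0_compat; lra]. }
  assert (Ha : forall j, (J <= j)%nat -> c0 <= Rabs (a j)).
  { intros j Hj. specialize (HJ j Hj).
    assert (E1 : eps j <= c0 * P) by (eapply Rle_trans; [apply HJ|apply Rmin_l]).
    assert (E2 : eps j <= lam ^ S n / (2 * (C2 + 1))) by (eapply Rle_trans; [apply HJ|apply Rmin_r]).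
    assert (E3 : eps j / P <= c0).
    { apply (Rmult_le_reg_r P); auto. unfold Rdiv. rewrite Rmult_assoc, Rinv_l; lra. }
    assert (E4 : C2 * eps j <= lam ^ S n / 2).
    { assert (0 <= eps j) by (apply Rlt_le, Hinv).
      apply Rle_trans with ((C2 + 1) * (lam ^ S n / (2 * (C2 + 1)))); [|right; field; lra].
      apply Rmult_le_compat; lra. }
    pose proof (Hya j). pose proof (Hlow j).
    apply (Rmult_le_reg_l C1); auto.
    assert (C1 * (eps j / P) <= C1 * c0) by (apply Rmult_le_compat_l; lra).
    assert (C1 * c0 = lam ^ S n / 4) by (unfold c0; field; lra). lra. }
  set (z := fun j r => / a (J + j)%nat * y (J + j)%nat r + 0 * y (J + j)%nat r).
  assert (Haj : forall j, a (J + j)%nat <> 0).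
  { intro j. pose proof (Ha (J + j)%nat ltac:(lia)). intro E. rewrite E, Rabs_R0 in H. lra. }
  assert (Zc : forall j, compl (z j)) by (intro j; apply compl_lin; apply Yc).
  assert (Cz : forall j, cont (z j)) by (intro j; apply (Zc j)).
  assert (Zg : forall j r, green (z j) r = / a (J + j)%nat * green (y (J + j)%nat) r).
  { intros j r. unfold z. rewrite green_lin by auto. ring. }
  assert (Z0 : forall j, green (z j) 0 = 1).
  { intro j. rewrite Zg. apply Rinv_l. apply Haj. }
  set (del := fun j => eps (J + j)%nat / P / c0).
  assert (Hz : forall j r, 0 <= r <= 1 -> Rabs (green (z j) r - lam * z j r) <= del j).
  { intros j r Hr. rewrite Zg. unfold z.
    replace (/ a (J + j)%nat * green (y (J + j)%nat) r - lam * (/ a (J + j)%nat * y (J + j)%nat r + 0 * y (J + j)%nat r))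
      with ((green (y (J + j)%nat) r - lam * y (J + j)%nat r) * / a (J + j)%nat) by ring.
    rewrite Rabs_mult, Rabs_inv. unfold del, Rdiv at 1.
    apply Rmult_le_compat; [apply Rabs_pos| |apply Hy; auto|].
    - apply Rlt_le, Rinv_0_lt_compat. apply Rabs_pos_lt, Haj.
    - apply Rinv_le_contravar; auto. apply Ha. lia. }
  assert (Hdel0 : forall d, 0 < d -> exists N, forall j, (N <= j)%nat -> del j <= d).
  { intros d Hd. destruct (Heps0 (d * c0 * P)) as [N HN].
    { apply Rmult_lt_0_compat; auto. apply Rmult_lt_0_compat; auto. }
    exists N. intros j Hj. specialize (HN (J + j)%nat ltac:(lia)).
    apply (Rmult_le_reg_r (c0 * P)); [apply Rmult_lt_0_compat; auto|].
    replace (del j * (c0 * P)) with (eps (J + j)%nat) by (unfold del; field; lra). lra. }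
  assert (Hdel : forall j, 0 <= del j).
  { intro j. unfold del. apply Rdiv_le_0_compat; auto. }
  (* All [z j] are normalized by [green (z j) 0 = 1], so the constant cancels in a difference and
     the Volterra bound applies to it. *)
  destruct (uniform_limit z Cz) as [w [Cw Hw]].
  { intros e He. destruct (Hdel0 (e / (2 * C1))) as [N HN]; [apply Rdiv_lt_0_compat; lra|].
    exists N. intros j k r Hj Hk Hr.
    replace (z j r - z k r) with (1 * z j r + (-1) * z k r) by ring.
    pose proof (Cz j). pose proof (Cz k).
    eapply Rle_trans.
    - apply (Hvol (fun r => 1 * z j r + (-1) * z k r) (del j + del k)); auto; [cont_tac|pose proof (Hdel j); pose proof (Hdel k); lra|].
      intros t Ht. rewrite !green_lin, !Z0 by auto.
      replace (_ - _) with (- (green (z j) t - lam * z j t) + (green (z k) t - lam * z k t)) by ring.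
      eapply Rle_trans; [apply Rabs_triang|]. rewrite Rabs_Ropp.
      pose proof (Hz j t Ht). pose proof (Hz k t Ht). lra.
    - replace e with (C1 * (e / (2 * C1) + e / (2 * C1))) by (field; lra).
      apply Rmult_le_compat_l; [lra|]. pose proof (HN j Hj). pose proof (HN k Hk). lra. }
  assert (Hgw : forall e, 0 < e -> exists j, del j <= e /\
     (forall r, 0 <= r <= 1 -> Rabs (z j r - w r) <= e) /\
     (forall r, 0 <= r <= 1 -> Rabs (green (z j) r - green w r) <= e / A)).
  { intros e He. destruct (Hw e He) as [N1 H1]. destruct (Hdel0 e He) as [N2 H2].
    exists (max N1 N2). split; [apply H2; lia|]. split; [intros; apply H1; auto; lia|].
    intros r Hr. set (j := max N1 N2). pose proof (Cz j).
    replace (green (z j) r - green w r) with (green (fun r => 1 * z j r + (-1) * w r) r)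
      by (rewrite green_lin by auto; ring).
    apply green_bound; auto; [cont_tac|]. intros t Ht.
    replace (1 * z j t + -1 * w t) with (z j t - w t) by ring. apply H1; auto. unfold j; lia. }
  assert (Hsmall : forall v, (forall e, 0 < e -> Rabs v <= e) -> v = 0).
  { intros v H. destruct (Req_dec v 0) as [|Hn]; auto. exfalso.
    pose proof (Rabs_pos_lt v Hn). specialize (H (Rabs v / 2) ltac:(lra)). lra. }
  assert (Heig : forall r, 0 <= r <= 1 -> green w r = lam * w r).
  { intros r Hr. apply Rminus_diag_uniq. apply Hsmall. intros e He.
    set (K := 1 + lam + / A). assert (0 < / A) by (apply Rinv_0_lt_compat; lra).
    destruct (Hgw (e / K)) as [j [J1 [J2 J3]]]; [apply Rdiv_lt_0_compat; unfold K; lra|].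
    replace (green w r - lam * w r) with
      (- (green (z j) r - green w r) + (green (z j) r - lam * z j r) + lam * (z j r - w r)) by ring.
    eapply Rle_trans; [apply Rabs_triang|].
    eapply Rle_trans; [apply Rplus_le_compat_r, Rabs_triang|].
    rewrite Rabs_Ropp, Rabs_mult, (Rabs_pos_eq lam) by lra.
    specialize (J2 r Hr). specialize (J3 r Hr). pose proof (Hz j r Hr).
    assert (lam * Rabs (z j r - w r) <= lam * (e / K)) by (apply Rmult_le_compat_l; lra).
    assert (HK : 0 < K) by (unfold K; lra).
    assert (EK : e = e / K * (1 + lam + / A)) by (fold K; field; lra).
    unfold Rdiv at 1 in J3. nra. }
  assert (Hw0 : green w 0 = 1).
  { apply Rminus_diag_uniq. apply Hsmall. intros e He.
    destruct (Hgw (e * A)) as [j [_ [_ J3]]]; [apply Rmult_lt_0_compat; auto|].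
    specialize (J3 0 ltac:(lra)). rewrite Z0 in J3. rewrite Rabs_minus_sym.
    replace (e * A / A) with e in J3 by (field; lra). auto. }
  assert (Wc : compl w).
  { split; auto. intros p Hp. apply Hsmall. intros e He.
    destruct (Hl p Hp) as [Cp [_ [Np _]]].
    destruct (Hgw e He) as [j [_ [J2 _]]]. pose proof (Cz j).
    pose proof (proj2 (Zc j) p Hp) as Z.
    replace (ip w (fst p)) with (ip (fun r => 1 * w r + (-1) * z j r) (fst p))
      by (rewrite ip_lin by auto; rewrite Z; ring).
    eapply Rle_trans; [apply ip_abs; auto; cont_tac|].
    replace (nrm (fst p)) with 1 by (unfold nrm; rewrite Np, sqrt_1; auto).
    rewrite Rmult_1_r. apply nrm_bound; [cont_tac|lra|].
    intros r Hr. replace (1 * w r + -1 * z j r) with (- (z j r - w r)) by ring.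
    rewrite Rabs_Ropp. auto. }
  assert (Wp : 0 < ip w w).
  { destruct (cont_eps w 0 (Rabs (w 0)) Cw) as [d [Hd Hy0]].
    { apply Rabs_pos_lt. intro E. rewrite Heig, E in Hw0 by lra. lra. }
    set (c := Rmin 1 (d / 2)).
    assert (0 < c <= 1 /\ c <= d / 2).
    { unfold c. split; [split; [apply Rmin_pos; lra|apply Rmin_l]|apply Rmin_r]. }
    apply (ip_pos w c); auto; [lra|]. intro E.
    specialize (Hy0 c). rewrite E, Rminus_0_r in Hy0.
    rewrite Rabs_pos_eq in Hy0 by lra. specialize (Hy0 ltac:(lra)).
    replace (0 - w 0) with (- w 0) in Hy0 by ring. rewrite Rabs_Ropp in Hy0. lra. }
  destruct (unit_scale w Wc Wp) as [psi [P1 [P2 [_ P4]]]].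
  exists psi, lam. split; [|split; auto].
  split; [apply P1|]. split; [auto|]. split; [auto|].
  intros r Hr. rewrite P4. rewrite green_lin by auto. rewrite Heig by auto. ring.
Qed.

End NextEigen.

End SturmLiouville.

(** * Polynomial approximation *)
Fixpoint ssum (f : nat -> R) (N : nat) : R :=
  match N with O => 0 | S N => ssum f N + f N end.

Lemma ssum_ext f g N : (forall k, (k < N)%nat -> f k = g k) -> ssum f N = ssum g N.
Proof.
  induction N; simpl; intro H; auto. rewrite IHN, H; auto.
Qed.
Lemma ssum_plus f g N : ssum (fun k => f k + g k) N = ssum f N + ssum g N.
Proof. induction N; simpl; [ring|rewrite IHN; ring]. Qed.
Lemma ssum_minus f g N : ssum (fun k => f k - g k) N = ssum f N - ssum g N.
Proof. induction N; simpl; [ring|rewrite IHN; ring]. Qed.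
Lemma ssum_scal c f N : ssum (fun k => c * f k) N = c * ssum f N.
Proof. induction N; simpl; [ring|rewrite IHN; ring]. Qed.
Lemma ssum_zero N : ssum (fun _ => 0) N = 0.
Proof. induction N; simpl; [ring|rewrite IHN; ring]. Qed.
Lemma ssum_le f g N : (forall k, (k < N)%nat -> f k <= g k) -> ssum f N <= ssum g N.
Proof.
  induction N; simpl; intro H; [lra|]. apply Rplus_le_compat; [apply IHN|apply H]; auto.
Qed.
Lemma ssum_ge0 f N : (forall k, (k < N)%nat -> 0 <= f k) -> 0 <= ssum f N.
Proof. intro H. rewrite <- (ssum_zero N). now apply ssum_le. Qed.
Lemma ssum_abs f N : Rabs (ssum f N) <= ssum (fun k => Rabs (f k)) N.
Proof.
  induction N; simpl; [rewrite Rabs_R0; lra|].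
  eapply Rle_trans; [apply Rabs_triang|]. lra.
Qed.
Lemma ssum_add f N M : ssum f (N + M) = ssum f N + ssum (fun k => f (N + k)%nat) M.
Proof.
  induction M; simpl; [rewrite Nat.add_0_r; ring|].
  rewrite Nat.add_succ_r. simpl. rewrite IHM. ring.
Qed.
Lemma ssum_mono f N M : (forall k, 0 <= f k) -> (N <= M)%nat -> ssum f N <= ssum f M.
Proof.
  intros H HNM. replace M with (N + (M - N))%nat by lia. rewrite ssum_add.
  assert (0 <= ssum (fun k => f (N + k)%nat) (M - N)) by (apply ssum_ge0; auto). lra.
Qed.
Lemma ssum_single f N j : (j < N)%nat -> (forall k, (k < N)%nat -> k <> j -> f k = 0) ->
  ssum f N = f j.
Proof.
  induction N; intros Hj H; [lia|]. simpl. destruct (Nat.eq_dec j N) as [->|Hn].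
  - rewrite (ssum_ext f (fun _ => 0)), ssum_zero; [ring|]. intros k Hk. apply H; lia.
  - rewrite IHN, (H N); [ring|lia|lia|lia|]. intros; apply H; lia.
Qed.
Lemma cont_ssum (f : nat -> R -> R) N : (forall k, cont (f k)) ->
  cont (fun x => ssum (fun k => f k x) N).
Proof. intro H. induction N; simpl; [apply cont_const|apply cont_plus; auto]. Qed.
Lemma RInt_ssum (f : nat -> R -> R) N a b : (forall k, cont (f k)) ->
  RInt (fun x => ssum (fun k => f k x) N) a b = ssum (fun k => RInt (f k) a b) N.
Proof.
  intro H. induction N; simpl; [rewrite RInt_cconst; rring|].
  rewrite RInt_cplus, IHN; auto. now apply cont_ssum.
Qed.
Lemma ssum_cs f g N : ssum (fun k => f k * g k) N ^ 2
  <= ssum (fun k => f k ^ 2) N * ssum (fun k => g k ^ 2) N.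
Proof.
  apply discr_nonpos. intro x.
  replace (_ + _) with (ssum (fun k => (f k + x * g k) ^ 2) N).
  - apply ssum_ge0. intros; apply pow2_ge_0.
  - rewrite (ssum_ext _ (fun k => (f k ^ 2 + (2 * x) * (f k * g k)) + x ^ 2 * g k ^ 2)) by (intros; ring).
    rewrite !ssum_plus, !ssum_scal. ring.
Qed.
Lemma ssum_cs_abs f g N F G : 0 <= F -> 0 <= G ->
  ssum (fun k => f k ^ 2) N <= F ^ 2 -> ssum (fun k => g k ^ 2) N <= G ^ 2 ->
  ssum (fun k => Rabs (f k) * Rabs (g k)) N <= F * G.
Proof.
  intros HF HG H1 H2. apply Rsqr_incr_0_var; [|nra].
  pose proof (ssum_cs (fun k => Rabs (f k)) (fun k => Rabs (g k)) N) as H. cbv beta in H.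
  rewrite (ssum_ext (fun k => Rabs (f k) ^ 2) (fun k => f k ^ 2)) in H by (intros; apply pow2_abs).
  rewrite (ssum_ext (fun k => Rabs (g k) ^ 2) (fun k => g k ^ 2)) in H by (intros; apply pow2_abs).
  assert (0 <= ssum (fun k => f k ^ 2) N) by (apply ssum_ge0; intros; apply pow2_ge_0).
  assert (0 <= ssum (fun k => g k ^ 2) N) by (apply ssum_ge0; intros; apply pow2_ge_0).
  assert (ssum (fun k => f k ^ 2) N * ssum (fun k => g k ^ 2) N <= F ^ 2 * G ^ 2)
    by (apply Rmult_le_compat; auto).
  unfold Rsqr. nra.
Qed.

Inductive polynomial : (R -> R) -> Prop :=
| polynomial_const c : polynomial (fun _ => c)
| polynomial_add p q : polynomial p -> polynomial q -> polynomial (fun x => p x + q x)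
| polynomial_scal c p : polynomial p -> polynomial (fun x => c * p x)
| polynomial_mulx p : polynomial p -> polynomial (fun x => x * p x).

(* [bern m g x] is the expectation of [g] at a binomial variable of parameters m, x. *)
Fixpoint bern (m : nat) (g : nat -> R) (x : R) : R :=
  match m with
  | O => g O
  | S m => x * bern m (fun k => g (S k)) x + (bern m g x + (-1) * (x * bern m g x))
  end.

Lemma poly_bern m g : polynomial (bern m g).
Proof.
  revert g. induction m; intro g; simpl; [constructor|].
  apply polynomial_add; [apply polynomial_mulx, IHm|].
  apply polynomial_add; [apply IHm|apply polynomial_scal, polynomial_mulx, IHm].
Qed.
Lemma bern_lin m f g a b x :
  bern m (fun k => a * f k + b * g k) x = a * bern m f x + b * bern m g x.
Proof.
  revert f g. induction m; intros f g; simpl; [ring|].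
  rewrite (IHm (fun k => f (S k)) (fun k => g (S k))), IHm. ring.
Qed.
Lemma bern_le m f g x : 0 <= x <= 1 -> (forall k, (k <= m)%nat -> f k <= g k) ->
  bern m f x <= bern m g x.
Proof.
  intro Hx. revert f g. induction m; intros f g H; simpl; [apply H; lia|].
  assert (bern m (fun k => f (S k)) x <= bern m (fun k => g (S k)) x) by (apply IHm; intros; apply H; lia).
  assert (bern m f x <= bern m g x) by (apply IHm; intros; apply H; lia).
  nra.
Qed.
Lemma bern_const m c x : bern m (fun _ => c) x = c.
Proof. induction m; simpl; [auto|rewrite IHm; ring]. Qed.
(** Variance of the binomial variable plus the squared bias, by conditioning on one trial. *)
Lemma bern_var m a x :
  bern m (fun k => (INR k - a) ^ 2) x = INR m * x * (1 - x) + (INR m * x - a) ^ 2.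
Proof.
  revert a. induction m; intro a; [simpl; ring|].
  change (bern (S m) (fun k => (INR k - a) ^ 2) x) with
   (x * bern m (fun k => (INR (S k) - a) ^ 2) x
    + (bern m (fun k => (INR k - a) ^ 2) x + (-1) * (x * bern m (fun k => (INR k - a) ^ 2) x))).
  assert (E : forall u, bern m (fun k => (INR (S k) - a) ^ 2) u = bern m (fun k => (INR k - (a - 1)) ^ 2) u).
  { intro u. assert (Ex : forall M f g, (forall k, f k = g k) -> bern M f u = bern M g u).
    { induction M; intros f g H; simpl; [apply H|].
      rewrite (IHM (fun k => f (S k)) (fun k => g (S k))), (IHM f g); auto. }
    apply Ex. intro k. rewrite S_INR. ring. }
  rewrite E, !IHm, S_INR. ring.
Qed.

(** Bernstein's proof: |g (k/m) - g x| is at most eps/2 + 2 M d^-2 (k/m - x)^2, by uniform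
    continuity within distance d and by the bound M of |g| beyond it; the expectation of the square
    is at most 1/m. *)
Lemma weierstrass (g : R -> R) (eps : R) : cont g -> 0 < eps ->
  exists p, polynomial p /\ forall x, 0 <= x <= 1 -> Rabs (p x - g x) <= eps.
Proof.
  intros Hg He.
  destruct (unifcont_1d g 0 1) with (eps := mkposreal (eps / 2) ltac:(lra)) as [d Hd].
  { intros x _. apply Hg. }
  destruct (cont_bounded_max (fun x => Rabs (g x))) as [c [Hc HM]]; [cont_tac|].
  cbv beta in HM. set (M := Rabs (g c)) in *. assert (HM0 : 0 <= M) by apply Rabs_pos.
  pose proof (cond_pos d) as Hd0.
  destruct (archimed_cor1 (eps * d ^ 2 / (4 * M + 1))) as [m [Hm Hm0]].
  { apply Rdiv_lt_0_compat; [|lra]. apply Rmult_lt_0_compat; auto. apply pow_lt; auto. }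
  assert (HmR : 0 < INR m) by (now apply lt_0_INR).
  exists (bern m (fun k => g (INR k / INR m))). split; [apply poly_bern|].
  intros x Hx.
  set (dev := fun k => eps / 2 * 1 + 2 * M / d ^ 2 / INR m ^ 2 * (INR k - INR m * x) ^ 2).
  assert (Hdev : forall k, (k <= m)%nat -> Rabs (g (INR k / INR m) - g x) <= dev k).
  { intros k Hk.
    assert (Hkm : 0 <= INR k / INR m <= 1).
    { split; [apply Rdiv_le_0_compat; [apply pos_INR|auto]|].
      apply (Rmult_le_reg_r (INR m)); auto. unfold Rdiv. rewrite Rmult_assoc, Rinv_l by lra.
      apply le_INR in Hk. lra. }
    assert (E : 2 * M / d ^ 2 / INR m ^ 2 * (INR k - INR m * x) ^ 2 = 2 * M / d ^ 2 * (INR k / INR m - x) ^ 2)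
      by (field; lra).
    unfold dev. rewrite E.
    assert (0 <= 2 * M / d ^ 2) by (apply Rdiv_le_0_compat; [lra|apply pow_lt; auto]).
    pose proof (pow2_ge_0 (INR k / INR m - x)).
    destruct (Rlt_le_dec (Rabs (INR k / INR m - x)) d) as [Hlt|Hge].
    - assert (Rabs (g (INR k / INR m) - g x) < eps / 2).
      { exact (NNPP _ (Hd x (INR k / INR m) Hx Hkm Hlt)). }
      nra.
    - assert (Rabs (g (INR k / INR m) - g x) <= 2 * M).
      { unfold Rminus. eapply Rle_trans; [apply Rabs_triang|]. rewrite Rabs_Ropp.
        pose proof (HM _ Hkm). pose proof (HM _ Hx). lra. }
      assert (d ^ 2 <= (INR k / INR m - x) ^ 2).
      { rewrite <- (pow2_abs (INR k / INR m - x)). apply pow_incr. lra. }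
      assert (2 * M = 2 * M / d ^ 2 * d ^ 2) by (field; lra).
      assert (2 * M / d ^ 2 * d ^ 2 <= 2 * M / d ^ 2 * (INR k / INR m - x) ^ 2)
        by (apply Rmult_le_compat_l; auto).
      lra. }
  assert (Hbd : bern m dev x <= eps).
  { unfold dev. rewrite (bern_lin m (fun _ => 1) (fun k => (INR k - INR m * x) ^ 2)).
    rewrite bern_const, bern_var.
    replace (INR m * x - INR m * x) with 0 by ring.
    assert (2 * M / d ^ 2 / INR m ^ 2 * (INR m * x * (1 - x) + 0 ^ 2) <= eps / 2); [|lra].
    replace (2 * M / d ^ 2 / INR m ^ 2 * (INR m * x * (1 - x) + 0 ^ 2))
      with (2 * M / d ^ 2 * (x * (1 - x)) * / INR m) by (field; lra).
    assert (0 <= 2 * M / d ^ 2) by (apply Rdiv_le_0_compat; [lra|apply pow_lt; auto]).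
    assert (0 <= x * (1 - x) <= 1) by nra.
    assert (0 < / INR m) by (now apply Rinv_0_lt_compat).
    apply Rle_trans with (2 * M / d ^ 2 * / INR m).
    { apply Rmult_le_compat_r; [lra|]. nra. }
    apply Rle_trans with (2 * M / d ^ 2 * (eps * d ^ 2 / (4 * M + 1))).
    { apply Rmult_le_compat_l; auto. lra. }
    replace (2 * M / d ^ 2 * (eps * d ^ 2 / (4 * M + 1))) with (eps * (2 * M / (4 * M + 1)))
      by (field; split; lra).
    assert (2 * M / (4 * M + 1) <= / 2).
    { apply (Rmult_le_reg_r (4 * M + 1)); [lra|]. unfold Rdiv. rewrite Rmult_assoc, Rinv_l by lra. lra. }
    nra. }
  assert (E : bern m (fun k => g (INR k / INR m)) x - g x = bern m (fun k => 1 * g (INR k / INR m) + (-1) * g x) x).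
  { rewrite (bern_lin m (fun k => g (INR k / INR m)) (fun _ => g x)), bern_const. ring. }
  rewrite E. apply Rabs_le. split.
  - apply Rle_trans with (bern m (fun k => (-1) * dev k + 0 * dev k) x).
    { rewrite bern_lin. lra. }
    apply bern_le; auto. intros k Hk. specialize (Hdev k Hk). apply Rabs_le_between in Hdev. lra.
  - apply Rle_trans with (bern m dev x); auto.
    apply bern_le; auto. intros k Hk. specialize (Hdev k Hk). apply Rabs_le_between in Hdev. lra.
Qed.

(** * Completeness of the eigenfunctions *)
Section Eigenbasis.
Variables (n : nat) (A B : R).
Variable (HA : 0 < A).
Variable (HB : 0 <= B).
Local Notation green := (green n A B).
Local Notation ip := (ip n).
Local Notation nrm := (nrm n).
Local Notation eigen := (eigen n A B).
Local Notation wt := (wt n).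

(** Dependent choice along the list of the eigenpairs found so far. The extremal property in the
    last clause is kept because completeness rests on it. *)
Lemma eigen_sequence : exists (psi : nat -> R -> R) (lam : nat -> R),
  (forall k, eigen (psi k) (lam k)) /\
  (forall i j, i <> j -> ip (psi i) (psi j) = 0) /\
  (forall k x, cont x -> (forall i, (i < k)%nat -> ip x (psi i) = 0) ->
     ip (green x) x <= lam k * ip x x).
Proof.
  set (E := ((R -> R) * R)%type).
  set (good := fun l : list E => forall p, In p l -> eigen (fst p) (snd p)).
  set (isnext := fun (l : list E) (p : E) => eigen (fst p) (snd p) /\
     compl n l (fst p) /\ forall x, compl n l x -> ip (green x) x <= snd p * ip x x).
  assert (Hn : forall l : list E, { p : E | good l -> isnext l p }).
  { intro l. apply constructive_indefinite_description.
    destruct (classic (good l)) as [Hg|Hg].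
    - destruct (next_eigen n A B HA HB l Hg) as [psi [lam [H1 [H2 H3]]]].
      exists (psi, lam). intros _. split; [auto|split; auto].
    - exists ((fun _ => 0), 0). intro; contradiction. }
  set (step := fun l => proj1_sig (Hn l)).
  set (st := fix st (k : nat) : list E := match k with O => nil | S k => step (st k) :: st k end).
  assert (Hgood : forall k, good (st k)).
  { induction k; simpl; intros p Hp; [contradiction|].
    destruct Hp as [<-|Hp]; [|auto]. apply (proj2_sig (Hn (st k)) IHk). }
  assert (Hnext : forall k, isnext (st k) (step (st k))).
  { intro k. apply (proj2_sig (Hn (st k)) (Hgood k)). }
  assert (Hin : forall k i, (i < k)%nat -> In (step (st i)) (st k)).
  { induction k; intros i Hi; [lia|]. simpl.
    destruct (Nat.eq_dec i k) as [->|]; [now left|right; apply IHk; lia]. }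
  assert (Hin' : forall k p, In p (st k) -> exists i, (i < k)%nat /\ p = step (st i)).
  { induction k; simpl; intros p Hp; [contradiction|]. destruct Hp as [<-|Hp].
    - exists k. auto.
    - destruct (IHk p Hp) as [i [Hi ->]]. exists i. auto. }
  exists (fun k => fst (step (st k))), (fun k => snd (step (st k))).
  split; [|split].
  - intro k. apply (Hnext k).
  - assert (Hlt : forall i j, (i < j)%nat -> ip (fst (step (st j))) (fst (step (st i))) = 0).
    { intros i j Hij. destruct (Hnext j) as [_ [Hc _]]. apply (proj2 Hc). now apply Hin. }
    intros i j Hij. destruct (Nat.lt_ge_cases i j); [rewrite ip_sym|]; apply Hlt; lia.
  - intros k x Hx H. apply (Hnext k). split; auto. intros p Hp.
    destruct (Hin' k p Hp) as [i [Hi ->]]. auto.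
Qed.

Variables (psi : nat -> R -> R) (lam : nat -> R).
Variable (Heig : forall k, eigen (psi k) (lam k)).
Variable (Horth : forall i j, i <> j -> ip (psi i) (psi j) = 0).
Variable (Hmax : forall k x, cont x -> (forall i, (i < k)%nat -> ip x (psi i) = 0) ->
     ip (green x) x <= lam k * ip x x).

Lemma cont_psi k : cont (psi k). Proof. apply (Heig k). Qed.
Lemma lam_pos k : 0 < lam k. Proof. apply (Heig k). Qed.
Lemma psi_norm k : ip (psi k) (psi k) = 1. Proof. apply (Heig k). Qed.
Lemma green_psi k r : 0 <= r <= 1 -> green (psi k) r = lam k * psi k r.
Proof. apply (Heig k). Qed.

Lemma ip_ssum_l (c : nat -> R) (N : nat) (g : R -> R) : cont g ->
  ip (fun x => ssum (fun k => c k * psi k x) N) g = ssum (fun k => c k * ip (psi k) g) N.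
Proof.
  intro Hg. induction N; simpl.
  - unfold ip. rewrite (RInt_rext _ (fun _ => 0)); [rewrite RInt_cconst; rring|intro; ring].
  - pose proof (cont_psi N).
    rewrite (ip_ext n _ (fun x => 1 * ssum (fun k => c k * psi k x) N + c N * psi N x) g g)
      by (auto; intros; ring).
    rewrite ip_lin; auto; [rewrite IHN; ring|].
    apply (cont_ssum (fun k x => c k * psi k x)). intro k. pose proof (cont_psi k). cont_tac.
Qed.
Lemma cont_combination (c : nat -> R) (N : nat) : cont (fun x => ssum (fun k => c k * psi k x) N).
Proof.
  apply (cont_ssum (fun k x => c k * psi k x)). intro k. pose proof (cont_psi k). cont_tac.
Qed.
Lemma ip_combination (c d : nat -> R) (N : nat) :
  ip (fun x => ssum (fun k => c k * psi k x) N) (fun x => ssum (fun k => d k * psi k x) N)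
  = ssum (fun k => c k * d k) N.
Proof.
  rewrite ip_ssum_l by apply cont_combination. apply ssum_ext. intros k Hk. f_equal.
  rewrite ip_sym, ip_ssum_l by apply cont_psi.
  rewrite (ssum_single _ N k Hk); [rewrite psi_norm; ring|].
  intros j _ Hj. rewrite Horth by auto. ring.
Qed.
Lemma green_combination (c : nat -> R) (N : nat) (r : R) : 0 <= r <= 1 ->
  green (fun x => ssum (fun k => c k * psi k x) N) r = ssum (fun k => c k * lam k * psi k r) N.
Proof.
  intro Hr. induction N; simpl.
  - rewrite (green_ext n A B (fun _ => 0) (fun _ => 0 * 1 + 0 * 1)) by (auto; intros; ring).
    rewrite (green_lin n A B HA HB (fun _ => 1) (fun _ => 1)) by apply cont_const. ring.
  - pose proof (cont_psi N). pose proof (cont_combination c N).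
    rewrite (green_ext n A B _ (fun x => 1 * ssum (fun k => c k * psi k x) N + c N * psi N x))
      by (auto; intros; ring).
    rewrite green_lin, IHN, green_psi by auto. ring.
Qed.

(** Hilbert-Schmidt bound. At fixed r the pointwise bound of [green] is applied to
    [h = sum lam_k psi_k(r) psi_k]: with [S = sum lam_k^2 psi_k(r)^2] one has [green h r = S] and
    [nrm h = sqrt S], so r^(2n) S <= A^-2. Integrating with the remaining factor r of the weight
    turns each [psi_k(r)^2] into 1. *)
Lemma lam_sq_sum K : ssum (fun k => lam k ^ 2) K <= (/ A) ^ 2.
Proof.
  assert (Hpt : forall r, 0 <= r <= 1 -> ssum (fun k => lam k ^ 2 * (wt r * (psi k r * psi k r))) K <= (/ A) ^ 2).
  { intros r Hr. set (c := fun k => lam k * psi k r). set (h := fun x => ssum (fun k => c k * psi k x) K).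
    assert (Ch : cont h) by apply cont_combination.
    set (S := ssum (fun k => c k * c k) K).
    assert (HS : 0 <= S) by (apply ssum_ge0; intros; apply Rle_0_sqr).
    assert (E1 : green h r = S).
    { unfold h. rewrite green_combination by auto. apply ssum_ext. intros; unfold c; ring. }
    assert (E2 : nrm h = sqrt S).
    { unfold nrm. f_equal. apply ip_combination. }
    destruct (Req_dec r 0) as [->|Hr0].
    { rewrite (ssum_ext _ (fun _ => 0)), ssum_zero; [apply pow2_ge_0|].
      intros. rewrite wt_0. ring. }
    pose proof (green_weighted n A B HA HB h n (nrm h) Ch) as W.
    specialize (W (fun s Hs => flux_nrm n h s Ch Hs) r ltac:(lra)). rewrite E1, E2 in W.
    assert (Hrn : 0 < r ^ n) by (apply pow_lt; lra).
    rewrite Rabs_pos_eq in W by nra.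
    assert (W2 : (r ^ n * S) ^ 2 <= (sqrt S / A) ^ 2) by (apply pow_incr; split; [nra|auto]).
    unfold Rdiv in W2. rewrite !Rpow_mult_distr, pow2_sqrt in W2 by auto.
    replace (ssum (fun k => lam k ^ 2 * (wt r * (psi k r * psi k r))) K) with (wt r * S).
    2:{ unfold S. rewrite <- ssum_scal. apply ssum_ext. intros; unfold c; ring. }
    assert (Hw : wt r = r * (r ^ n) ^ 2).
    { unfold wt. replace (2 * n + 1)%nat with (Datatypes.S (n + n)) by lia. simpl. rewrite pow_add. ring. }
    rewrite Hw. destruct HS as [HS|HS].
    - assert ((r ^ n) ^ 2 * S <= (/ A) ^ 2).
      { apply (Rmult_le_reg_r S); auto. nra. }
      assert (0 <= (r ^ n) ^ 2 * S) by (pose proof (pow2_ge_0 (r ^ n)); nra). nra.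
    - rewrite <- HS, Rmult_0_r. apply pow2_ge_0. }
  assert (Hc : forall k, cont (fun r => lam k ^ 2 * (wt r * (psi k r * psi k r)))).
  { intro k. pose proof (cont_psi k). pose proof (cont_wt n). cont_tac. }
  replace (ssum (fun k => lam k ^ 2) K) with
    (RInt (fun r => ssum (fun k => lam k ^ 2 * (wt r * (psi k r * psi k r))) K) 0 1).
  - replace ((/ A) ^ 2) with (RInt (fun _ => (/ A) ^ 2) 0 1) by (rewrite RInt_cconst; rring).
    apply RInt_cle; [lra| |apply cont_const|auto].
    now apply (cont_ssum (fun k r => lam k ^ 2 * (wt r * (psi k r * psi k r)))).
  - rewrite (RInt_ssum (fun k r => lam k ^ 2 * (wt r * (psi k r * psi k r)))) by auto.
    apply ssum_ext. intros k _.
    rewrite RInt_cscal by (pose proof (cont_psi k); pose proof (cont_wt n); cont_tac).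
    pose proof (psi_norm k) as E. unfold ip in E. rewrite E. ring.
Qed.

Lemma lam_small e : 0 < e -> exists k, lam k < e.
Proof.
  intro He. apply NNPP. intro Hn.
  assert (Hk : forall k, e <= lam k) by (intro k; apply Rnot_lt_le; intro; apply Hn; now exists k).
  destruct (INR_unbounded ((/ A) ^ 2 / e ^ 2)) as [K HK].
  pose proof (lam_sq_sum K) as HS.
  assert (He2 : 0 < e ^ 2) by now apply pow_lt.
  assert (H : INR K * e ^ 2 <= ssum (fun k => lam k ^ 2) K).
  { clear HK HS. induction K; [simpl; lra|]. rewrite S_INR. cbn [ssum].
    assert (e ^ 2 <= lam K ^ 2) by (apply pow_incr; specialize (Hk K); lra). lra. }
  apply (Rmult_lt_compat_r (e ^ 2)) in HK; auto.
  unfold Rdiv in HK. rewrite Rmult_assoc, Rinv_l in HK by lra. lra.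
Qed.

Lemma lam_le k : lam k <= / A.
Proof.
  pose proof (lam_sq_sum (S k)) as H. cbn [ssum] in H.
  assert (0 <= ssum (fun k => lam k ^ 2) k) by (apply ssum_ge0; intros; apply pow2_ge_0).
  apply Rsqr_incr_0_var; [unfold Rsqr; nra|]. apply Rlt_le, Rinv_0_lt_compat; auto.
Qed.

(** The part [z] of [x] orthogonal to the first N eigenfunctions stays orthogonal under [green], so
    the extremal property applies to both [z] and [green z]; [green_cs] combines the two. *)
Lemma green_residual (x : R -> R) (N : nat) : cont x ->
  let y := fun r => 1 * green x r + (-1) * ssum (fun k => ip x (psi k) * lam k * psi k r) N in
  ip y y <= lam N ^ 2 * ip x x.
Proof.
  intro Hx. set (c := fun k => ip x (psi k)).
  set (p := fun r => ssum (fun k => c k * psi k r) N).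
  set (z := fun r => 1 * x r + (-1) * p r).
  assert (Cp : cont p) by apply cont_combination.
  assert (Cz : cont z) by (unfold z; cont_tac).
  pose proof (cont_green n A B HA HB z Cz) as Cg.
  intro y. assert (E : ip y y = ip (green z) (green z)).
  { apply ip_ext; intros r Hr; unfold z, y; rewrite green_lin by auto;
    unfold p; rewrite green_combination by auto; reflexivity. }
  rewrite E. clear E y.
  assert (Hzo : forall i, (i < N)%nat -> ip z (psi i) = 0).
  { intros i Hi. unfold z. rewrite ip_lin by auto using cont_psi.
    unfold p. rewrite ip_ssum_l by apply cont_psi.
    rewrite (ssum_single _ N i Hi).
    - rewrite psi_norm. unfold c. ring.
    - intros j _ Hj. rewrite Horth by auto. ring. }
  assert (Hgo : forall i, (i < N)%nat -> ip (green z) (psi i) = 0).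
  { intros i Hi. rewrite green_sym by auto using cont_psi.
    rewrite (ip_ext n z z (green (psi i)) (fun r => lam i * psi i r + 0 * psi i r)); auto.
    - rewrite ip_linr by auto using cont_psi. rewrite Hzo by auto. ring.
    - intros r Hr. rewrite green_psi by auto. ring. }
  pose proof (Hmax N z Cz Hzo) as H1. pose proof (Hmax N (green z) Cg Hgo) as H2.
  pose proof (green_cs n A B HA HB z (green z) Cz Cg) as H3.
  pose proof (ip_green_ge0 n A B HA HB z Cz) as H4.
  assert (Hzz : ip z z <= ip x x).
  { assert (ip p z = 0).
    { unfold p. rewrite ip_ssum_l by auto. rewrite (ssum_ext _ (fun _ => 0)), ssum_zero; auto.
      intros k Hk. rewrite ip_sym, Hzo by auto. ring. }
    assert (E : ip x x = ip z z + ip p p).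
    { rewrite (ip_ext n x (fun r => 1 * z r + 1 * p r) x (fun r => 1 * z r + 1 * p r))
        by (intros; unfold z; ring).
      rewrite ip_lin, !ip_linr by cont_tac. rewrite (ip_sym n z p), H. ring. }
    pose proof (ip_ge0 n p Cp). lra. }
  pose proof (lam_pos N) as HL.
  assert (H5 : ip (green z) (green z) <= lam N * ip (green z) z).
  { destruct (ip_ge0 n (green z) Cg) as [Hp|Hz]; [|rewrite <- Hz; nra].
    apply (Rmult_le_reg_r (ip (green z) (green z))); [exact Hp|].
    assert (ip (green z) z * ip (green (green z)) (green z) <= ip (green z) z * (lam N * ip (green z) (green z)))
      by (apply Rmult_le_compat_l; auto). nra. }
  assert (lam N * ip (green z) z <= lam N * (lam N * ip z z)) by (apply Rmult_le_compat_l; lra).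
  assert (lam N * (lam N * ip z z) <= lam N * (lam N * ip x x)).
  { apply Rmult_le_compat_l; [lra|]. apply Rmult_le_compat_l; lra. }
  lra.
Qed.

Definition energy (f : R -> R) : R := RInt (fun r => r * f r ^ 2) 0 1.
Definition comb (c : nat -> R) (N : nat) (r : R) : R := ssum (fun k => c k * (r ^ n * psi k r)) N.
(** Closure of the span of the r^n psi_k in mean square for r dr. Completeness is the statement that
    it contains every continuous function; the range of [green] is enlarged to this in several
    steps. *)
Definition spanned (f : R -> R) : Prop := cont f /\
  forall e, 0 < e -> exists N c, energy (fun r => f r - comb c N r) <= e.

Lemma cont_energy f : cont f -> cont (fun r => r * f r ^ 2).
Proof. intro. cont_tac. Qed.
Lemma energy_ge0 f : cont f -> 0 <= energy f.
Proof.
  intro. apply RInt_cge0; [lra|now apply cont_energy|]. intros.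
  apply Rmult_le_pos; [lra|apply pow2_ge_0].
Qed.
Lemma energy_ext f g : (forall r, 0 <= r <= 1 -> f r = g r) -> energy f = energy g.
Proof. intro H. apply RInt_cext; [lra|]. intros r Hr. now rewrite H. Qed.
Lemma energy_add f g : cont f -> cont g -> energy (fun r => f r + g r) <= 2 * energy f + 2 * energy g.
Proof.
  intros Hf Hg. unfold energy.
  rewrite <- !RInt_cscal, <- RInt_cplus by cont_tac.
  apply RInt_cle; [lra|cont_tac|cont_tac|]. intros r Hr.
  assert (0 <= r * (f r - g r) ^ 2) by (apply Rmult_le_pos; [lra|apply pow2_ge_0]). nra.
Qed.
Lemma energy_scal c f : cont f -> energy (fun r => c * f r) = c ^ 2 * energy f.
Proof.
  intro. unfold energy. rewrite <- RInt_cscal by cont_tac. apply RInt_rext. intro; ring.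
Qed.
Lemma energy_bound f K : cont f -> (forall r, 0 <= r <= 1 -> Rabs (f r) <= K) -> energy f <= K ^ 2.
Proof.
  intros Hf H. assert (0 <= K) by (apply Rle_trans with (Rabs (f 0)); [apply Rabs_pos|apply H; lra]).
  unfold energy. replace (K ^ 2) with (RInt (fun _ => K ^ 2) 0 1) by (rewrite RInt_cconst; rring).
  apply RInt_cle; [lra|cont_tac|cont_tac|]. intros r Hr. rewrite <- (pow2_abs (f r)).
  assert (Rabs (f r) ^ 2 <= K ^ 2) by (apply pow_incr; split; [apply Rabs_pos|auto]).
  pose proof (pow2_ge_0 (Rabs (f r))). nra.
Qed.
Lemma cont_comb c N : cont (comb c N).
Proof.
  apply (cont_ssum (fun k r => c k * (r ^ n * psi k r))). intro k. pose proof (cont_psi k). cont_tac.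
Qed.
Lemma comb_pad c N M r : (N <= M)%nat ->
  comb (fun k => if (k <? N)%nat then c k else 0) M r = comb c N r.
Proof.
  intro H. unfold comb. replace M with (N + (M - N))%nat by lia. rewrite ssum_add.
  match goal with |- _ + ?s = _ => assert (E : s = 0) end.
  - transitivity (ssum (fun _ => 0) (M - N)); [|apply ssum_zero]. apply ssum_ext. intros k _.
    cbv beta. destruct (Nat.ltb_spec (N + k) N); [lia|apply Rmult_0_l].
  - rewrite E, Rplus_0_r. apply ssum_ext. intros k Hk. destruct (Nat.ltb_spec k N); [auto|lia].
Qed.
Lemma spanned_add f g : spanned f -> spanned g -> spanned (fun r => f r + g r).
Proof.
  intros [Hf Sf] [Hg Sg]. split; [cont_tac|]. intros e He.
  destruct (Sf (e / 4)) as [N [c H1]]; [lra|]. destruct (Sg (e / 4)) as [M [d H2]]; [lra|].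
  set (K := max N M).
  set (c' := fun k => if (k <? N)%nat then c k else 0). set (d' := fun k => if (k <? M)%nat then d k else 0).
  exists K, (fun k => c' k + d' k).
  pose proof (cont_comb c N). pose proof (cont_comb d M).
  rewrite (energy_ext _ (fun r => (f r - comb c N r) + (g r - comb d M r))).
  - eapply Rle_trans; [apply energy_add; cont_tac|]. lra.
  - intros r Hr. rewrite <- (comb_pad c N K r), <- (comb_pad d M K r) by (unfold K; lia).
    fold c' d'. unfold comb.
    rewrite (ssum_ext (fun k => (c' k + d' k) * _) (fun k => c' k * (r ^ n * psi k r) + d' k * (r ^ n * psi k r)))
      by (intros; ring).
    rewrite ssum_plus. ring.
Qed.
Lemma spanned_scal a f : spanned f -> spanned (fun r => a * f r).
Proof.
  intros [Hf Sf]. split; [cont_tac|]. intros e He.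
  assert (Ha : 0 < a ^ 2 + 1) by (pose proof (pow2_ge_0 a); lra).
  destruct (Sf (e / (a ^ 2 + 1))) as [N [c H1]]; [now apply Rdiv_lt_0_compat|].
  exists N, (fun k => a * c k). pose proof (cont_comb c N).
  rewrite (energy_ext _ (fun r => a * (f r - comb c N r))).
  - rewrite energy_scal by cont_tac.
    assert (0 <= energy (fun r => f r - comb c N r)) by (apply energy_ge0; cont_tac).
    apply Rle_trans with ((a ^ 2 + 1) * (e / (a ^ 2 + 1))); [|right; field; lra].
    apply Rmult_le_compat; auto; [apply pow2_ge_0|lra].
  - intros r _. unfold comb.
    rewrite (ssum_ext _ (fun k => a * (c k * (r ^ n * psi k r)))) by (intros; ring).
    rewrite ssum_scal. ring.
Qed.
Lemma spanned_lim f : cont f ->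
  (forall e, 0 < e -> exists g, spanned g /\ energy (fun r => f r - g r) <= e) -> spanned f.
Proof.
  intros Hf H. split; auto. intros e He.
  destruct (H (e / 4)) as [g [[Hg Sg] H1]]; [lra|].
  destruct (Sg (e / 4)) as [N [c H2]]; [lra|]. exists N, c. pose proof (cont_comb c N).
  rewrite (energy_ext _ (fun r => (f r - g r) + (g r - comb c N r))) by (intros; ring).
  eapply Rle_trans; [apply energy_add; cont_tac|]. lra.
Qed.
Lemma spanned_ext f g : cont g -> (forall r, 0 <= r <= 1 -> f r = g r) -> spanned f -> spanned g.
Proof.
  intros Hg H [Hf Sf]. split; auto. intros e He. destruct (Sf e He) as [N [c H1]]. exists N, c.
  rewrite (energy_ext _ (fun r => f r - comb c N r)); auto. intros r Hr. now rewrite H.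
Qed.
Lemma wt_split r : wt r = r * (r ^ n) ^ 2.
Proof. unfold wt. replace (2 * n + 1)%nat with (S (n + n)) by lia. simpl. rewrite pow_add. ring. Qed.
Lemma energy_ip h : energy (fun r => r ^ n * h r) = ip h h.
Proof. apply RInt_rext. intro r. rewrite wt_split. ring. Qed.

Lemma spanned_green x : cont x -> spanned (fun r => r ^ n * green x r).
Proof.
  intro Hx. pose proof (cont_green n A B HA HB x Hx). split; [cont_tac|]. intros e He.
  pose proof (ip_ge0 n x Hx) as H0.
  destruct (lam_small (Rmin 1 (e / (ip x x + 1)))) as [N HN].
  { apply Rmin_pos; [lra|apply Rdiv_lt_0_compat; lra]. }
  exists N, (fun k => ip x (psi k) * lam k).
  rewrite (energy_ext _ (fun r => r ^ n * (1 * green x r + (-1) * ssum (fun k => ip x (psi k) * lam k * psi k r) N))).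
  - rewrite energy_ip. eapply Rle_trans; [apply green_residual; auto|].
    pose proof (lam_pos N). pose proof (Rmin_l 1 (e / (ip x x + 1))). pose proof (Rmin_r 1 (e / (ip x x + 1))).
    apply Rle_trans with (lam N * (ip x x + 1)).
    { assert (lam N * (lam N * ip x x) <= lam N * (1 * ip x x)); [|nra].
      apply Rmult_le_compat_l; [lra|]. apply Rmult_le_compat_r; lra. }
    apply Rle_trans with (e / (ip x x + 1) * (ip x x + 1)); [|right; field; lra].
    apply Rmult_le_compat_r; lra.
  - intros r _. unfold comb.
    rewrite (ssum_ext _ (fun k => r ^ n * (ip x (psi k) * lam k * psi k r))) by (intros; ring).
    rewrite ssum_scal. ring.
Qed.

Lemma flux_pow m s : flux n (fun r => r ^ m) s = s ^ S m / INR (2 * n + 2 + m).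
Proof.
  unfold flux.
  rewrite (RInt_rext _ (fun u => s ^ m * u ^ (2 * n + 1 + m))).
  2:{ intro u. unfold wt. rewrite Rpow_mult_distr, (pow_add u (2 * n + 1) m). ring. }
  rewrite RInt_cscal, RInt_pow by cont_tac. rewrite pow1, (pow_ne_zero (S _)) by lia.
  replace (S (2 * n + 1 + m)) with (2 * n + 2 + m)%nat by lia. simpl. field.
  apply not_0_INR. lia.
Qed.

(** [x] is the image of 1 - r^(2i+2) under the Sturm-Liouville operator, computed explicitly; 1 -
    r^(2i+2) vanishes at the boundary and so equals [green x]. *)
Lemma spanned_one_minus i : spanned (fun r => r ^ n * (1 - r ^ (2 * i + 2))).
Proof.
  set (m := INR (2 * i + 2)).
  set (x := fun r => m * A * INR (2 * n + 2 + 2 * i) * r ^ (2 * i) + m * B * INR (2 * n + 2 + (2 * i + 2)) * r ^ (2 * i + 2)).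
  assert (Hx : cont x) by (unfold x; cont_tac).
  apply (spanned_ext (fun r => r ^ n * green x r)); [cont_tac| |now apply spanned_green].
  intros r Hr. f_equal. unfold green.
  rewrite (RInt_rext _ (fun s => m * s ^ (2 * i + 1))).
  - rewrite RInt_cscal, RInt_pow by cont_tac. rewrite pow1.
    replace (S (2 * i + 1)) with (2 * i + 2)%nat by lia. fold m. field.
    unfold m. apply not_0_INR. lia.
  - intro s. unfold x.
    rewrite (flux_lin n (fun r => r ^ (2 * i)) (fun r => r ^ (2 * i + 2))) by cont_tac.
    rewrite !flux_pow. replace (S (2 * i + 2)) with (2 * i + 1 + 2)%nat by lia.
    replace (S (2 * i)) with (2 * i + 1)%nat by lia. rewrite (pow_add s (2 * i + 1) 2).
    pose proof (rho_neq A B HA HB s) as Hr0. unfold rho in *.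
    field. repeat split; first [apply Hr0|apply not_0_INR; lia].
Qed.

(** The Dirichlet condition is invisible in mean square: r^(n + 2i + 2) tends to 0 as i grows, so
    r^n is a limit of functions that vanish at 1. *)
Lemma spanned_pow_even j : spanned (fun r => r ^ n * r ^ (2 * j)).
Proof.
  assert (H1 : spanned (fun r => r ^ n * 1)).
  { apply spanned_lim; [cont_tac|]. intros e He.
    destruct (archimed_cor1 e He) as [i [Hi Hi0]].
    exists (fun r => r ^ n * (1 - r ^ (2 * i + 2))). split; [apply spanned_one_minus|].
    unfold energy. rewrite (RInt_rext _ (fun r => r ^ (S (n + (2 * i + 2) + (n + (2 * i + 2)))))).
    2:{ intro r. simpl. rewrite !pow_add. ring. }
    rewrite RInt_pow, pow1, (pow_ne_zero (S _)) by lia. rewrite Rminus_0_r. unfold Rdiv. rewrite Rmult_1_l.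
    apply Rle_trans with (/ INR i); [|lra]. apply Rinv_le_contravar; [now apply lt_0_INR|].
    apply le_INR. lia. }
  destruct j as [|i].
  - apply (spanned_ext (fun r => r ^ n * 1)); [cont_tac|intros; simpl; ring|auto].
  - apply (spanned_ext (fun r => r ^ n * 1 + (-1) * (r ^ n * (1 - r ^ (2 * i + 2))))); [cont_tac| |].
    + intros r _. replace (2 * S i)%nat with (2 * i + 2)%nat by lia. ring.
    + apply spanned_add; auto. apply spanned_scal, spanned_one_minus.
Qed.

Lemma cont_poly p : polynomial p -> cont p.
Proof. induction 1; cont_tac. Qed.

Lemma spanned_poly p : polynomial p -> forall j, spanned (fun r => r ^ n * (r ^ (2 * j) * p (r ^ 2))).
Proof.
  induction 1 as [c|p q _ IHp _ IHq|c p _ IHp|p Hp IHp]; intro j.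
  - apply (spanned_ext (fun r => c * (r ^ n * r ^ (2 * j)))); [cont_tac|intros; ring|].
    apply spanned_scal, spanned_pow_even.
  - apply (spanned_ext (fun r => r ^ n * (r ^ (2 * j) * p (r ^ 2)) + r ^ n * (r ^ (2 * j) * q (r ^ 2)))).
    + destruct (spanned_add _ _ (IHp j) (IHq j)) as [H _]. revert H. apply cont_ext. intro; ring.
    + intros; ring.
    + apply spanned_add; auto.
  - apply (spanned_ext (fun r => c * (r ^ n * (r ^ (2 * j) * p (r ^ 2))))).
    + destruct (spanned_scal c _ (IHp j)) as [H _]. revert H. apply cont_ext. intro; ring.
    + intros; ring.
    + apply spanned_scal; auto.
  - assert (E : forall r, r ^ n * (r ^ (2 * S j) * p (r ^ 2)) = r ^ n * (r ^ (2 * j) * (r ^ 2 * p (r ^ 2)))).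
    { intro r. replace (2 * S j)%nat with (2 * j + 2)%nat by lia. rewrite pow_add. ring. }
    apply (spanned_ext (fun r => r ^ n * (r ^ (2 * S j) * p (r ^ 2)))); [|intros; apply E|apply IHp].
    destruct (IHp (S j)) as [H _]. revert H. apply cont_ext. exact E.
Qed.

(** Weierstrass is applied to h o sqrt, so that only even powers of the radius occur. *)
Lemma spanned_weighted h : cont h -> spanned (fun r => r ^ n * h r).
Proof.
  intro Hh. apply spanned_lim; [cont_tac|]. intros e He.
  assert (Hs : cont (fun x => h (sqrt x))).
  { apply (cont_comp h sqrt); auto. intro x. apply continuous_sqrt. }
  destruct (weierstrass (fun x => h (sqrt x)) (Rmin 1 e) Hs) as [p [Hp HH]]; [apply Rmin_pos; lra|].
  exists (fun r => r ^ n * (r ^ (2 * 0) * p (r ^ 2))). split; [now apply spanned_poly|].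
  assert (Cp : cont (fun r => p (r ^ 2))).
  { apply (cont_comp p (fun r => r ^ 2)); [now apply cont_poly|cont_tac]. }
  apply Rle_trans with ((Rmin 1 e) ^ 2).
  - apply energy_bound.
    + apply cont_minus; [cont_tac|]. apply cont_mult; [cont_tac|]. apply cont_mult; [cont_tac|auto].
    + intros r Hr. replace (r ^ n * h r - r ^ n * (r ^ (2 * 0) * p (r ^ 2)))
        with (- (r ^ n * (p (r ^ 2) - h r))) by (simpl; ring).
      specialize (HH (r ^ 2) (pow_01 r 2 Hr)). rewrite sqrt_pow2 in HH by lra.
      rewrite Rabs_Ropp, Rabs_mult. pose proof (pow_01 r n Hr).
      rewrite (Rabs_pos_eq (r ^ n)) by lra. pose proof (Rabs_pos (p (r ^ 2) - h r)). nra.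
  - pose proof (Rmin_l 1 e). pose proof (Rmin_r 1 e).
    assert (0 < Rmin 1 e) by (apply Rmin_pos; lra). nra.
Qed.

(** A continuous [f] need not be divisible by r^n, so f / r^n is regularized to f r^n / (r^(2n) +
    del). The error is at most M below the radius [eta] and at most M eta above it. *)
Lemma spanned_cont f : cont f -> spanned f.
Proof.
  intro Hf. apply spanned_lim; auto. intros e He.
  destruct (cont_bounded_max (fun x => Rabs (f x))) as [c [Hc HM]]; [cont_tac|].
  cbv beta in HM. set (M := Rabs (f c)) in *. assert (HM0 : 0 <= M) by apply Rabs_pos.
  set (eta := Rmin (/ 2) (e / (2 * (M ^ 2 + 1)))).
  assert (HM2 : 0 < M ^ 2 + 1) by (pose proof (pow2_ge_0 M); lra).
  assert (Heta : 0 < eta) by (apply Rmin_pos; [lra|apply Rdiv_lt_0_compat; lra]).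
  assert (Heta1 : eta <= / 2) by apply Rmin_l.
  assert (Heta2 : eta <= e / (2 * (M ^ 2 + 1))) by apply Rmin_r.
  (* With this choice del / (r^(2n) + del) <= eta for all r >= eta. *)
  set (del := eta * eta ^ (2 * n)).
  assert (Hen : 0 < eta ^ (2 * n)) by now apply pow_lt.
  assert (Hdel : 0 < del) by (apply Rmult_lt_0_compat; auto).
  set (h := fun r => f r * r ^ n / ((r ^ n) ^ 2 + del)).
  assert (Hden : forall r, 0 < (r ^ n) ^ 2 + del) by (intro r; pose proof (pow2_ge_0 (r ^ n)); lra).
  assert (Hh : cont h).
  { unfold h. apply cont_div; [cont_tac|cont_tac|]. intro r. specialize (Hden r). lra. }
  exists (fun r => r ^ n * h r). split; [now apply spanned_weighted|].
  set (g := fun r => f r - r ^ n * h r).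
  assert (Cg : cont g) by (unfold g; cont_tac).
  assert (Hg : forall r, g r = f r * (del / ((r ^ n) ^ 2 + del))).
  { intro r. unfold g, h. field. specialize (Hden r). lra. }
  assert (Hq : forall r, 0 <= del / ((r ^ n) ^ 2 + del) <= 1).
  { intro r. specialize (Hden r). split; [apply Rdiv_le_0_compat; lra|].
    apply (Rmult_le_reg_r ((r ^ n) ^ 2 + del)); auto. unfold Rdiv.
    rewrite Rmult_assoc, Rinv_l by lra. pose proof (pow2_ge_0 (r ^ n)). lra. }
  assert (Hg1 : forall r, 0 <= r <= 1 -> Rabs (g r) <= M).
  { intros r Hr. rewrite Hg, Rabs_mult, (Rabs_pos_eq (del / _)) by apply Hq.
    specialize (HM r Hr). specialize (Hq r). pose proof (Rabs_pos (f r)). nra. }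
  assert (Hg2 : forall r, eta <= r <= 1 -> Rabs (g r) <= M * eta).
  { intros r Hr. rewrite Hg, Rabs_mult, (Rabs_pos_eq (del / _)) by apply Hq.
    apply Rmult_le_compat; [apply Rabs_pos|apply Hq|apply HM; lra|].
    specialize (Hden r). apply (Rmult_le_reg_r ((r ^ n) ^ 2 + del)); auto. unfold Rdiv.
    rewrite Rmult_assoc, Rinv_l by lra. rewrite Rmult_1_r. unfold del at 1.
    apply Rmult_le_compat_l; [lra|]. replace ((r ^ n) ^ 2) with (r ^ (2 * n)) by (rewrite Nat.mul_comm, pow_mult; reflexivity).
    assert (eta ^ (2 * n) <= r ^ (2 * n)) by (apply pow_incr; lra). lra. }
  unfold energy. change (RInt (fun r => r * g r ^ 2) 0 1 <= e).
  rewrite <- (RInt_cChasles _ 0 eta 1) by cont_tac.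
  assert (I1 : RInt (fun r => r * g r ^ 2) 0 eta <= M ^ 2 * (eta - 0)).
  { rewrite <- RInt_cconst. apply RInt_cle; [lra|cont_tac|cont_tac|]. intros r Hr.
    rewrite <- (pow2_abs (g r)).
    assert (Rabs (g r) ^ 2 <= M ^ 2) by (apply pow_incr; split; [apply Rabs_pos|apply Hg1; lra]).
    pose proof (pow2_ge_0 (Rabs (g r))). nra. }
  assert (I2 : RInt (fun r => r * g r ^ 2) eta 1 <= (M * eta) ^ 2 * (1 - eta)).
  { rewrite <- RInt_cconst. apply RInt_cle; [lra|cont_tac|cont_tac|]. intros r Hr.
    rewrite <- (pow2_abs (g r)).
    assert (Rabs (g r) ^ 2 <= (M * eta) ^ 2) by (apply pow_incr; split; [apply Rabs_pos|apply Hg2; lra]).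
    pose proof (pow2_ge_0 (Rabs (g r))). nra. }
  assert (I3 : (M * eta) ^ 2 * (1 - eta) <= M ^ 2 * eta).
  { pose proof (pow2_ge_0 M). replace ((M * eta) ^ 2 * (1 - eta)) with (M ^ 2 * (eta * (eta * (1 - eta)))) by ring.
    apply Rmult_le_compat_l; auto. nra. }
  assert (I4 : 2 * (M ^ 2 + 1) * eta <= e).
  { apply Rle_trans with (2 * (M ^ 2 + 1) * (e / (2 * (M ^ 2 + 1)))); [|right; field; lra].
    apply Rmult_le_compat_l; lra. }
  change (RInt (fun r => r * g r ^ 2) 0 eta + RInt (fun r => r * g r ^ 2) eta 1 <= e).
  lra.
Qed.

Definition coef (f : R -> R) (k : nat) : R := RInt (fun r => r ^ (n + 1) * (f r * psi k r)) 0 1.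

Lemma cont_coef f k : cont f -> cont (fun r => r ^ (n + 1) * (f r * psi k r)).
Proof. intro. pose proof (cont_psi k). cont_tac. Qed.

(** Pythagoras for an arbitrary combination. The choice [c = coef f] yields the residual and
    Bessel's inequality; comparison with any good combination yields Parseval. *)
Lemma energy_comb f c N : cont f ->
  energy (fun r => f r - comb c N r)
  = energy f - ssum (fun k => coef f k ^ 2) N + ssum (fun k => (c k - coef f k) ^ 2) N.
Proof.
  intro Hf. set (q := fun r => ssum (fun k => c k * psi k r) N).
  assert (Cq : cont q) by apply cont_combination.
  assert (E1 : energy (fun r => f r - comb c N r) =
    RInt (fun r => (r * f r ^ 2 - 2 * ssum (fun k => c k * (r ^ (n + 1) * (f r * psi k r))) N) + wt r * (q r * q r)) 0 1).
  { apply RInt_rext. intro r.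
    assert (Eq : comb c N r = r ^ n * q r).
    { unfold comb, q. rewrite <- ssum_scal. apply ssum_ext. intros; ring. }
    rewrite Eq.
    rewrite (ssum_ext _ (fun k => (r ^ (n + 1) * f r) * (c k * psi k r))) by (intros; ring).
    rewrite ssum_scal. fold (q r). rewrite wt_split, pow_add. ring. }
  rewrite E1.
  assert (C1 : cont (fun r => ssum (fun k => c k * (r ^ (n + 1) * (f r * psi k r))) N)).
  { apply (cont_ssum (fun k r => c k * (r ^ (n + 1) * (f r * psi k r)))). intro k. pose proof (cont_psi k). cont_tac. }
  pose proof (cont_ip n q q Cq Cq) as C2.
  rewrite RInt_cplus, RInt_cminus, RInt_cscal by cont_tac.
  rewrite (RInt_ssum (fun k r => c k * (r ^ (n + 1) * (f r * psi k r)))).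
  2:{ intro k. pose proof (cont_psi k). cont_tac. }
  fold (ip q q). unfold q at 1 2. rewrite ip_combination.
  rewrite (ssum_ext (fun k => RInt _ 0 1) (fun k => c k * coef f k)).
  2:{ intros k _. rewrite RInt_cscal by now apply cont_coef. reflexivity. }
  rewrite (ssum_ext (fun k => (c k - coef f k) ^ 2) (fun k => (c k * c k + coef f k ^ 2) + (-2) * (c k * coef f k)))
    by (intros; ring).
  rewrite !ssum_plus, ssum_scal. unfold energy. rring.
Qed.
Lemma energy_residual f N : cont f ->
  energy (fun r => f r - comb (coef f) N r) = energy f - ssum (fun k => coef f k ^ 2) N.
Proof.
  intro Hf. rewrite energy_comb by auto.
  rewrite (ssum_ext (fun k => (coef f k - coef f k) ^ 2) (fun _ => 0)), ssum_zero by (intros; ring). ring.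
Qed.
Lemma bessel f N : cont f -> ssum (fun k => coef f k ^ 2) N <= energy f.
Proof.
  intro Hf. pose proof (energy_residual f N Hf).
  assert (0 <= energy (fun r => f r - comb (coef f) N r)); [|lra].
  apply energy_ge0. pose proof (cont_comb (coef f) N). cont_tac.
Qed.
Lemma parseval f e : cont f -> 0 < e ->
  exists N, forall M, (N <= M)%nat -> energy f - ssum (fun k => coef f k ^ 2) M <= e.
Proof.
  intros Hf He. destruct (spanned_cont f Hf) as [_ H]. destruct (H e He) as [N [c Hc]].
  exists N. intros M HM. rewrite energy_comb in Hc by auto.
  assert (0 <= ssum (fun k => (c k - coef f k) ^ 2) N) by (apply ssum_ge0; intros; apply pow2_ge_0).
  assert (ssum (fun k => coef f k ^ 2) N <= ssum (fun k => coef f k ^ 2) M)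
    by (apply ssum_mono; auto; intros; apply pow2_ge_0).
  lra.
Qed.

End Eigenbasis.

(** The eigenvalue equation holds only on the open interval, and several primitives below are
    differentiable only there while continuous on the line. *)
Lemma RInt_cderive_open (f F : R -> R) (a b : R) : a <= b -> cont f -> cont F ->
  (forall x, a < x < b -> is_derive F x (f x)) -> RInt f a b = F b - F a.
Proof.
  intros Hab Hf HF Hd.
  set (D := fun x => F x - RInt f a x).
  assert (HD : forall x, a < x < b -> is_derive D x 0).
  { intros x Hx. eapply is_derive_eq; [apply is_derive_rminus; [now apply Hd|now apply is_derive_RInt_up]|]. rring. }
  assert (CD : cont D).
  { apply cont_minus; auto. apply (cont_derive _ f). intro; now apply is_derive_RInt_up. }
  destruct (MVT_gen D a b (fun _ => 0)) as [c [_ H]].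
  - rewrite Rmin_left, Rmax_right by lra. apply HD.
  - intros x _. apply continuity_pt_filterlim. apply CD.
  - unfold D in H. rewrite RInt_cpoint in H. unfold zero in H; simpl in H.
    change (RInt f a b = F b - F a :> R). lra.
Qed.

(* Eigenfunctions psi_k of - (r^(2n+1) rho psi')' = nu r^(2n+1) psi with psi(1) = 0, where
   rho = A + B r^2; then r^n psi_k(r) cos (n theta) is an eigenfunction of - div (rho grad). *)
Record eigenbasis (n : nat) (A B : R) (psi dpsi : nat -> R -> R) (nu : nat -> R) : Prop := {
  eb_derive : forall k r, is_derive (psi k) r (dpsi k r);
  eb_cont : forall k, cont (dpsi k);
  eb_end : forall k, psi k 1 = 0;
  eb_eq : forall k r, 0 < r < 1 ->
    is_derive (fun r => wt n r * (rho A B r * dpsi k r)) r (- (nu k * (wt n r * psi k r)));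
  eb_norm : forall k, ip n (psi k) (psi k) = 1;
  eb_orth : forall i j, i <> j -> ip n (psi i) (psi j) = 0;
  eb_nu : forall k, A <= nu k;
  eb_residual : forall f N, cont f ->
    energy (fun r => f r - comb n psi (coef n psi f) N r)
    = energy f - ssum (fun k => coef n psi f k ^ 2) N;
  eb_bessel : forall f N, cont f -> ssum (fun k => coef n psi f k ^ 2) N <= energy f;
  eb_parseval : forall f e, cont f -> 0 < e -> exists N, forall M, (N <= M)%nat ->
    energy f - ssum (fun k => coef n psi f k ^ 2) M <= e }.

Lemma eigenbasis_exists (n : nat) (A B : R) : 0 < A -> 0 <= B ->
  exists psi dpsi nu, eigenbasis n A B psi dpsi nu.
Proof.
  intros HA HB.
  destruct (eigen_sequence n A B HA HB) as [psi [lam [Heig [Horth Hmax]]]].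
  assert (Hlam : forall k, 0 < lam k) by (intro k; apply (Heig k)).
  assert (Cpsi : forall k, cont (psi k)) by (intro k; apply (Heig k)).
  (* Outside [0, 1] nothing beyond continuity is known of [psi k]. Its rescaled image under [green]
     agrees with it on [0, 1] and is differentiable on the whole line. *)
  set (Psi := fun k r => / lam k * green n A B (psi k) r).
  assert (E : forall k r, 0 <= r <= 1 -> Psi k r = psi k r).
  { intros k r Hr. unfold Psi. destruct (Heig k) as [_ [_ [_ H]]]. rewrite H by auto.
    field. specialize (Hlam k). lra. }
  assert (Ecoef : forall f k, coef n Psi f k = coef n psi f k).
  { intros f k. apply RInt_cext; [lra|]. intros r Hr. now rewrite E. }
  assert (Ecomb : forall c N r, 0 <= r <= 1 -> comb n Psi c N r = comb n psi c N r).
  { intros c N r Hr. apply ssum_ext. intros k _. now rewrite E. }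
  assert (Esum : forall f N, ssum (fun k => coef n Psi f k ^ 2) N = ssum (fun k => coef n psi f k ^ 2) N).
  { intros f N. apply ssum_ext. intros k _. now rewrite Ecoef. }
  exists Psi, (fun k r => / lam k * - (flux n (psi k) r / rho A B r)), (fun k => / lam k).
  constructor.
  - intros k r. apply is_derive_rscal. now apply is_derive_green.
  - intro k. pose proof (cont_flux_rho n A B HA HB (psi k) (Cpsi k)). cont_tac.
  - intro k. unfold Psi. rewrite green_1. ring.
  - intros k r Hr. apply (is_derive_ext (fun r => - / lam k * (wt n r * flux n (psi k) r))).
    + intro t. change (- / lam k * (wt n t * flux n (psi k) t) = wt n t * (rho A B t * (/ lam k * - (flux n (psi k) t / rho A B t)))).
      field. split; [apply rho_neq; auto|]. specialize (Hlam k). lra.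
    + eapply is_derive_eq; [apply is_derive_rscal; now apply is_derive_wt_flux|].
      rewrite E by lra. rring.
  - intro k. rewrite (ip_ext n _ (psi k) _ (psi k)) by (intros; now apply E). apply (Heig k).
  - intros i j Hij. rewrite (ip_ext n _ (psi i) _ (psi j)) by (intros; now apply E). now apply Horth.
  - intro k. pose proof (lam_le n A B HA HB psi lam Heig Horth k).
    rewrite <- (Rinv_inv A). apply Rinv_le_contravar; auto.
  - intros f N Hf. rewrite Esum, <- (energy_residual n A B psi lam Heig Horth f N Hf).
    apply energy_ext. intros r Hr. rewrite Ecomb by auto. f_equal. apply ssum_ext.
    intros k _. now rewrite Ecoef.
  - intros f N Hf. rewrite Esum. now apply (bessel n A B psi lam Heig Horth).
  - intros f e Hf He. destruct (parseval n A B HA HB psi lam Heig Horth Hmax f e Hf He) as [N HN].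
    exists N. intros M HM. rewrite Esum. auto.
Qed.

(** * Integration by parts against the eigenfunctions, and the spectral gap *)

Section Basis.
Variables (n : nat) (A B : R) (psi dpsi : nat -> R -> R) (nu : nat -> R).
Variable (HA : 0 < A).
Variable (HB : 0 <= B).
Variable (Hb : eigenbasis n A B psi dpsi nu).
Local Notation rho := (rho A B).
Local Notation wt := (wt n).
Local Notation coef := (coef n psi).

Lemma eb_cpsi k : cont (psi k).
Proof. apply (cont_derive _ (dpsi k)). intro. apply (eb_derive _ _ _ _ _ _ Hb). Qed.
Lemma eb_cdpsi k : cont (dpsi k). Proof. apply (eb_cont _ _ _ _ _ _ Hb). Qed.
Lemma eb_crho : cont rho. Proof. apply cont_rho. Qed.
Lemma is_derive_rho r : is_derive rho r (2 * B * r).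
Proof. unfold rho. auto_derive; auto. rring. Qed.

Lemma wt_pow r : wt r = r ^ n * r ^ (n + 1).
Proof. unfold wt. rewrite <- pow_add. f_equal. lia. Qed.

(** The eigenvalue equation multiplied by f / r^n, which is singular at 0 only, while the primitive
    r^(n+1) rho psi' f is continuous. The boundary term is kept for functions that do not vanish at
    1, as they occur for n = 1. *)
Lemma ibp_general k (f f' : R -> R) : (forall r, is_derive f r (f' r)) -> cont f' ->
  RInt (fun r => rho r * r ^ n * dpsi k r * (r * f' r - INR n * f r)) 0 1
  = f 1 * rho 1 * dpsi k 1 + nu k * coef f k.
Proof.
  intros Hf Cf'. assert (Cf : cont f) by (apply (cont_derive _ f'); auto).
  pose proof (eb_cpsi k) as C1. pose proof (eb_cdpsi k) as C2. pose proof eb_crho as C3.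
  assert (H : RInt (fun r => rho r * r ^ n * dpsi k r * (r * f' r - INR n * f r)
                  - nu k * (r ^ (n + 1) * (f r * psi k r))) 0 1
    = 1 ^ (n + 1) * rho 1 * dpsi k 1 * f 1 - 0 ^ (n + 1) * rho 0 * dpsi k 0 * f 0).
  { apply (RInt_cderive_open _ (fun r => r ^ (n + 1) * rho r * dpsi k r * f r)); [lra|cont_tac|cont_tac|].
    intros r Hr.
    assert (Hrn : 0 < r ^ n) by (apply pow_lt; lra).
    apply (is_derive_ext_loc (fun r => wt r * (rho r * dpsi k r) * (f r * / r ^ n))).
    - assert (Hr' : 0 < r) by lra. exists (mkposreal r Hr'). intros y Hy.
      unfold ball in Hy; simpl in Hy; unfold AbsRing_ball, abs, minus, plus, opp in Hy; simpl in Hy.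
      apply Rabs_def2 in Hy.
      assert (Hyn : 0 < y ^ n) by (apply pow_lt; lra).
      rewrite wt_pow.
      change (y ^ n * y ^ (n + 1) * (rho y * dpsi k y) * (f y * / y ^ n) = y ^ (n + 1) * rho y * dpsi k y * f y).
      field. lra.
    - assert (D : is_derive (fun r => f r * / r ^ n) r (f' r * / r ^ n + f r * (- (INR n * r ^ pred n) / (r ^ n) ^ 2))).
      { eapply is_derive_eq; [apply is_derive_rmult; [apply Hf|apply (is_derive_inv (fun r => r ^ n) r (INR n * r ^ pred n)); [apply is_derive_rpow|lra]]|reflexivity]. }
      eapply is_derive_eq; [apply is_derive_rmult; [now apply (eb_eq _ _ _ _ _ _ Hb)|apply D]|].
      assert (En : INR n * r ^ pred n * r = INR n * r ^ n).
      { destruct n as [|m]; [simpl; ring|]. simpl pred. rewrite <- (tech_pow_Rmult r m). ring. }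
      cbv beta. rewrite !wt_pow, !pow_add, !pow_1.
      assert (Er : r ^ pred n * INR n = INR n * r ^ n / r) by (field_simplify_eq; [lra|lra]).
      match goal with |- ?a = ?b => change (@eq R a b) end.
      replace (- (INR n * r ^ pred n) / (r ^ n) ^ 2) with (- (INR n * r ^ n / r) / (r ^ n) ^ 2)
        by (rewrite <- Er; field; lra).
      field. split; lra. }
  rewrite RInt_cminus, RInt_cscal in H by cont_tac.
  rewrite pow1, (pow_ne_zero (n + 1)) in H by lia.
  fold (coef f k) in H. unfold coef in *.
  match goal with |- ?a = ?b => change (@eq R a b) end. lra.
Qed.

(** [D] is Y' + (n + 1) Y / r, which lowers the angular number from n + 1 to n. Its integrating
    factor r^(n+1) is exactly the weight in [coef], and psi(1) = 0 removes the boundary term. *)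
Lemma ibp_plus k (Y Y' D : R -> R) : (forall r, is_derive Y r (Y' r)) -> cont Y' -> cont D ->
  (forall r, 0 <= r <= 1 -> r * D r = r * Y' r + INR (n + 1) * Y r) ->
  coef D k = - RInt (fun r => Y r * (r ^ (n + 1) * dpsi k r)) 0 1.
Proof.
  intros HY CY' CD HD. assert (CY : cont Y) by (apply (cont_derive _ Y'); auto).
  pose proof (eb_cpsi k) as C1. pose proof (eb_cdpsi k) as C2.
  assert (H : RInt (fun r => r ^ (n + 1) * (D r * psi k r) + Y r * (r ^ (n + 1) * dpsi k r)) 0 1
    = 1 ^ (n + 1) * Y 1 * psi k 1 - 0 ^ (n + 1) * Y 0 * psi k 0).
  { apply (RInt_cderive_open _ (fun r => r ^ (n + 1) * Y r * psi k r)); [lra|cont_tac|cont_tac|].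
    intros r Hr. eapply is_derive_eq.
    { apply is_derive_rmult; [apply is_derive_rmult; [apply is_derive_rpow|apply HY]|apply (eb_derive _ _ _ _ _ _ Hb)]. }
    replace (pred (n + 1)) with n by lia.
    match goal with |- ?a = ?b => change (@eq R a b) end.
    specialize (HD r ltac:(lra)). rewrite pow_add, pow_1.
    replace (r ^ n * r * (D r * psi k r)) with (r ^ n * (r * D r) * psi k r) by ring. rewrite HD. ring. }
  rewrite RInt_cplus in H by cont_tac.
  rewrite (eb_end _ _ _ _ _ _ Hb), (pow_ne_zero (n + 1)) in H by lia.
  unfold coef.
  match goal with |- ?a = ?b => change (@eq R a b) end. lra.
Qed.

(** [D] is Y' - (n - 1) Y / r, which raises the angular number from n - 1 to n. Now r^(n+1) D =
    (r^(n+1) Y)' - 2 n r^n Y, whence the additional term in the test function. *)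
Lemma ibp_minus k (Y Y' D : R -> R) : (forall r, is_derive Y r (Y' r)) -> cont Y' -> cont D ->
  (forall r, 0 <= r <= 1 -> r * D r = r * Y' r - (INR n - 1) * Y r) ->
  coef D k = - RInt (fun r => Y r * (2 * INR n * r ^ n * psi k r + r ^ (n + 1) * dpsi k r)) 0 1.
Proof.
  intros HY CY' CD HD. assert (CY : cont Y) by (apply (cont_derive _ Y'); auto).
  pose proof (eb_cpsi k) as C1. pose proof (eb_cdpsi k) as C2.
  assert (H : RInt (fun r => r ^ (n + 1) * (D r * psi k r) + Y r * (2 * INR n * r ^ n * psi k r + r ^ (n + 1) * dpsi k r)) 0 1
    = 1 ^ (n + 1) * Y 1 * psi k 1 - 0 ^ (n + 1) * Y 0 * psi k 0).
  { apply (RInt_cderive_open _ (fun r => r ^ (n + 1) * Y r * psi k r)); [lra|cont_tac|cont_tac|].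
    intros r Hr. eapply is_derive_eq.
    { apply is_derive_rmult; [apply is_derive_rmult; [apply is_derive_rpow|apply HY]|apply (eb_derive _ _ _ _ _ _ Hb)]. }
    replace (pred (n + 1)) with n by lia.
    match goal with |- ?a = ?b => change (@eq R a b) end.
    specialize (HD r ltac:(lra)). rewrite pow_add, pow_1, plus_INR. simpl (INR 1).
    replace (r ^ n * r * (D r * psi k r)) with (r ^ n * (r * D r) * psi k r) by ring. rewrite HD. ring. }
  rewrite RInt_cplus in H by cont_tac.
  rewrite (eb_end _ _ _ _ _ _ Hb), (pow_ne_zero (n + 1)) in H by lia.
  unfold coef.
  match goal with |- ?a = ?b => change (@eq R a b) end. lra.
Qed.

Lemma energy_dpsi i j :
  RInt (fun r => wt r * rho r * (dpsi i r * dpsi j r)) 0 1 = nu i * ip n (psi i) (psi j).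
Proof.
  pose proof (eb_cpsi i) as C1. pose proof (eb_cdpsi i) as C2. pose proof (eb_cpsi j) as C3.
  pose proof (eb_cdpsi j) as C4. pose proof eb_crho as C5. pose proof (cont_wt n) as C6.
  assert (H : RInt (fun r => wt r * rho r * (dpsi i r * dpsi j r) - nu i * (wt r * (psi i r * psi j r))) 0 1
    = wt 1 * (rho 1 * dpsi i 1) * psi j 1 - wt 0 * (rho 0 * dpsi i 0) * psi j 0).
  { apply (RInt_cderive_open _ (fun r => wt r * (rho r * dpsi i r) * psi j r)); [lra|cont_tac|cont_tac|].
    intros r Hr. eapply is_derive_eq.
    { apply is_derive_rmult; [now apply (eb_eq _ _ _ _ _ _ Hb)|apply (eb_derive _ _ _ _ _ _ Hb)]. }
    cbv beta. rring. }
  rewrite RInt_cminus, RInt_cscal in H by cont_tac.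
  rewrite (eb_end _ _ _ _ _ _ Hb), wt_0 in H. unfold ip.
  match goal with |- ?a = ?b => change (@eq R a b) end. lra.
Qed.

(** The cross term of the square is 2 n r (psi^2)'. Integrated by parts it cancels the term 4 n^2
    psi^2 and leaves - 4 n b times the normalization integral, which comes from the derivative of b
    r^2. *)
Lemma completed_square k (c b : R) : (1 <= n)%nat ->
  RInt (fun r => (c + b * r ^ 2) * r ^ (2 * n - 1) * (r * dpsi k r + 2 * INR n * psi k r) ^ 2) 0 1
  = RInt (fun r => (c + b * r ^ 2) * (wt r * (dpsi k r * dpsi k r))) 0 1 - 4 * INR n * b.
Proof.
  intro Hn. pose proof (eb_cpsi k) as C1. pose proof (eb_cdpsi k) as C2. pose proof (cont_wt n) as C6.
  assert (H : RInt (fun r => (c + b * r ^ 2) * r ^ (2 * n - 1) * (r * dpsi k r + 2 * INR n * psi k r) ^ 2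
      - (c + b * r ^ 2) * (wt r * (dpsi k r * dpsi k r)) + 4 * INR n * b * (wt r * (psi k r * psi k r))) 0 1
    = 2 * INR n * ((c + b * 1 ^ 2) * 1 ^ (2 * n) * (psi k 1 * psi k 1)) - 2 * INR n * ((c + b * 0 ^ 2) * 0 ^ (2 * n) * (psi k 0 * psi k 0))).
  { apply (RInt_cderive_open _ (fun r => 2 * INR n * ((c + b * r ^ 2) * r ^ (2 * n) * (psi k r * psi k r)))); [lra|cont_tac|cont_tac|].
    intros r Hr. eapply is_derive_eq.
    { apply is_derive_rscal. apply is_derive_rmult.
      - apply (is_derive_rmult (fun r => c + b * r ^ 2)); [|apply is_derive_rpow].
        instantiate (1 := 2 * b * r). auto_derive; auto. rring.
      - apply is_derive_rmult; apply (eb_derive _ _ _ _ _ _ Hb). }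
    match goal with |- ?a = ?b => change (@eq R a b) end.
    unfold wt. replace (2 * n)%nat with (S (2 * n - 1)) by lia.
    replace (S (2 * n - 1) + 1)%nat with (S (S (2 * n - 1))) by lia. simpl pred.
    replace (S (2 * n - 1) - 1)%nat with (2 * n - 1)%nat by lia.
    assert (EI : INR (S (2 * n - 1)) = 2 * INR n).
    { replace (S (2 * n - 1)) with (2 * n)%nat by lia. rewrite mult_INR. simpl. ring. }
    rewrite EI. simpl pow. ring. }
  rewrite RInt_cplus, RInt_cminus, RInt_cscal in H by cont_tac.
  rewrite (eb_end _ _ _ _ _ _ Hb), (pow_ne_zero (2 * n)) in H by lia.
  pose proof (eb_norm _ _ _ _ _ _ Hb k) as N. unfold ip in N. rewrite N in H.
  match goal with |- ?a = ?b => change (@eq R a b) end. lra.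
Qed.

(** Let I be the integral of wt psi'^2. Bounding the completed square with rho from below by the one
    with A gives A I <= nu - 4 n B, and rho <= A + B gives nu <= (A + B) I. The constant depends
    neither on [n] nor on [k]. *)
Lemma nu_gap k : A / (A + B) * nu k <= nu k - 4 * INR n * B.
Proof.
  assert (Hq : A / (A + B) <= 1).
  { apply (Rmult_le_reg_r (A + B)); [lra|]. unfold Rdiv. rewrite Rmult_assoc, Rinv_l; lra. }
  pose proof (eb_nu _ _ _ _ _ _ Hb k) as Hnu.
  destruct (Nat.eq_dec n 0) as [E0|Hn].
  { rewrite E0. simpl. nra. }
  assert (Hn1 : (1 <= n)%nat) by lia.
  pose proof (eb_cpsi k) as C1. pose proof (eb_cdpsi k) as C2. pose proof (cont_wt n) as C6.
  pose proof (completed_square k A B Hn1) as E1. pose proof (completed_square k 1 0 Hn1) as E2.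
  pose proof (energy_dpsi k k) as E3. rewrite (eb_norm _ _ _ _ _ _ Hb k) in E3.
  rewrite (RInt_rext _ (fun r => (A + B * r ^ 2) * (wt r * (dpsi k r * dpsi k r)))) in E3.
  2:{ intro r. unfold rho. ring. }
  rewrite E3 in E1.
  rewrite (RInt_rext (fun r => (1 + 0 * r ^ 2) * (wt r * (dpsi k r * dpsi k r)))
    (fun r => wt r * (dpsi k r * dpsi k r))) in E2 by (intro; ring).
  rewrite (RInt_rext (fun r => (1 + 0 * r ^ 2) * r ^ (2 * n - 1) * (r * dpsi k r + 2 * INR n * psi k r) ^ 2)
    (fun r => r ^ (2 * n - 1) * (r * dpsi k r + 2 * INR n * psi k r) ^ 2)) in E2 by (intro; ring).
  set (I := RInt (fun r => wt r * (dpsi k r * dpsi k r)) 0 1) in *.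
  assert (H1 : A * I <= nu k - 4 * INR n * B).
  { replace I with (RInt (fun r => r ^ (2 * n - 1) * (r * dpsi k r + 2 * INR n * psi k r) ^ 2) 0 1)
      by (rewrite E2; rring).
    rewrite <- RInt_cscal by cont_tac.
    replace (nu k - 4 * INR n * B) with (nu k * 1 - 4 * INR n * B) by ring. rewrite <- E1.
    apply RInt_cle; [lra|cont_tac|cont_tac|]. intros r Hr.
    rewrite (Rmult_assoc (A + B * r ^ 2)). apply Rmult_le_compat_r.
    - apply Rmult_le_pos; [apply pow_le; lra|apply pow2_ge_0].
    - pose proof (pow2_ge_0 r). nra. }
  assert (H2 : nu k <= (A + B) * I).
  { replace (nu k) with (nu k * 1) by ring. rewrite <- E3. unfold I. rewrite <- RInt_cscal by cont_tac.
    apply RInt_cle; [lra|cont_tac|cont_tac|]. intros r Hr. apply Rmult_le_compat_r.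
    - apply Rmult_le_pos; [apply wt_ge0; lra|apply Rle_0_sqr].
    - assert (r ^ 2 <= 1) by (apply (pow_01 r 2 Hr)). nra. }
  apply Rle_trans with (A * I); auto.
  apply Rle_trans with (A / (A + B) * ((A + B) * I)); [|right; field; lra].
  apply Rmult_le_compat_l; auto. apply Rdiv_le_0_compat; lra.
Qed.

End Basis.

(** * Systems with constant coefficients *)
Lemma is_derive_zero_const (F : R -> R) : (forall t, is_derive F t 0) -> forall t, F t = F 0.
Proof.
  intros H t. assert (E : RInt (fun _ => 0) 0 t = F t - F 0).
  { apply (RInt_cderive (fun _ => 0) F); [apply cont_const|exact H]. }
  rewrite RInt_cconst in E. lra.
Qed.

(** An entry (l, a, b) is the real form of an amplitude times exp (i (l t - al)). Time and phase
    enter only through l t - al, so that substituting - n (theta - omega t) for [al] gives a single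
    travelling wave. *)
Definition trig_sum (L : list (R * R * R)) (al t : R) : R :=
  fold_right (fun e acc => snd (fst e) * cos (fst (fst e) * t - al)
                           + snd e * sin (fst (fst e) * t - al) + acc) 0 L.
Definition trig (c : R -> R -> R) : Prop := exists L, forall al t, c al t = trig_sum L al t.

Lemma trig_sum_app L L' al t : trig_sum (L ++ L') al t = trig_sum L al t + trig_sum L' al t.
Proof. induction L; simpl; [ring|rewrite IHL; ring]. Qed.
Lemma trig_add c d : trig c -> trig d -> trig (fun al t => c al t + d al t).
Proof.
  intros [L H] [L' H']. exists (L ++ L'). intros. now rewrite trig_sum_app, H, H'.
Qed.
Lemma trig_scal k c : trig c -> trig (fun al t => k * c al t).
Proof.
  intros [L H]. exists (map (fun e => (fst (fst e), k * snd (fst e), k * snd e)) L).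
  intros al t. rewrite H. clear H. induction L; simpl; [ring|]. rewrite <- IHL. ring.
Qed.
Lemma trig_ext c d : (forall al t, c al t = d al t) -> trig c -> trig d.
Proof. intros E [L H]. exists L. intros. now rewrite <- E. Qed.
Lemma trig_single l a b : trig (fun al t => a * cos (l * t - al) + b * sin (l * t - al)).
Proof. exists ((l, a, b) :: nil). intros. simpl. ring. Qed.
Lemma trig_zero : trig (fun _ _ => 0).
Proof. exists nil. reflexivity. Qed.

(** Real part of (x + i y) exp (- i al). *)
Definition phase (x y : R -> R) (al t : R) : R := cos al * x t + sin al * y t.

Lemma rotation_ode (l : R) (U V : R -> R) :
  (forall t, is_derive U t (- l * V t)) -> (forall t, is_derive V t (l * U t)) ->
  forall t, U t = U 0 * cos (l * t) - V 0 * sin (l * t) /\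
            V t = U 0 * sin (l * t) + V 0 * cos (l * t).
Proof.
  intros HU HV t.
  assert (Hc : forall t, is_derive (fun t => cos (l * t)) t (- l * sin (l * t))).
  { intro s. auto_derive; auto. rring. }
  assert (Hs : forall t, is_derive (fun t => sin (l * t)) t (l * cos (l * t))).
  { intro s. auto_derive; auto. rring. }
  pose proof (is_derive_zero_const (fun t => U t * cos (l * t) + V t * sin (l * t))) as E1.
  pose proof (is_derive_zero_const (fun t => V t * cos (l * t) - U t * sin (l * t))) as E2.
  cbv beta in E1, E2.
  assert (F1 : U t * cos (l * t) + V t * sin (l * t) = U 0).
  { rewrite E1, Rmult_0_r, cos_0, sin_0; [ring|]. intro s. eapply is_derive_eq.
    - apply is_derive_rplus; apply is_derive_rmult; auto.
    - rring. }
  assert (F2 : V t * cos (l * t) - U t * sin (l * t) = V 0).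
  { rewrite E2, Rmult_0_r, cos_0, sin_0; [ring|]. intro s. eapply is_derive_eq.
    - apply is_derive_rminus; apply is_derive_rmult; auto.
    - rring. }
  pose proof (sin2_cos2 (l * t)) as H. unfold Rsqr in H.
  rewrite <- F1, <- F2. split.
  - transitivity (U t * (sin (l * t) * sin (l * t) + cos (l * t) * cos (l * t))); [rewrite H|]; ring.
  - transitivity (V t * (sin (l * t) * sin (l * t) + cos (l * t) * cos (l * t))); [rewrite H|]; ring.
Qed.

Lemma rotation_trig (l : R) (U V : R -> R) :
  (forall t, is_derive U t (- l * V t)) -> (forall t, is_derive V t (l * U t)) ->
  trig (phase U V).
Proof.
  intros HU HV. apply (trig_ext (fun al t => U 0 * cos (l * t - al) + (- V 0) * sin (l * t - al))).
  - intros al t. unfold phase. destruct (rotation_ode l U V HU HV t) as [-> ->].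
    rewrite cos_minus, sin_minus. ring.
  - apply trig_single.
Qed.

(** With x = sqrt (p/3) the cubic changes sign between -2x, -x, x and 2x, since the assumption says
    |q| < 2 x^3. The zero sum follows by dividing differences of the equations by differences of the
    roots. *)
Lemma cubic_roots (p q : R) : 0 < p -> 27 * q ^ 2 < 4 * p ^ 3 ->
  exists l1 l2 l3, l1 < l2 < l3 /\ l1 + l2 + l3 = 0 /\
    q = p * l1 - l1 ^ 3 /\ q = p * l2 - l2 ^ 3 /\ q = p * l3 - l3 ^ 3.
Proof.
  intros Hp Hq. set (x := sqrt (p / 3)).
  assert (Hx : 0 < x) by (apply sqrt_lt_R0; lra).
  assert (Hx2 : p = 3 * x ^ 2).
  { unfold x. rewrite pow2_sqrt by lra. field. }
  assert (Hq2 : - (2 * x ^ 3) < q < 2 * x ^ 3).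
  { rewrite Hx2 in Hq. assert (q ^ 2 < (2 * x ^ 3) ^ 2) by nra.
    assert (Hx3 : 0 < x ^ 3) by now apply pow_lt.
    assert (0 < 2 * x ^ 3) by lra.
    assert (Hq' : Rabs q < Rabs (2 * x ^ 3)) by (apply Rsqr_lt_abs_0; unfold Rsqr; nra).
    rewrite (Rabs_pos_eq (2 * x ^ 3)) in Hq' by lra. apply Rabs_def2 in Hq'. lra. }
  set (f := fun l => l ^ 3 - p * l + q).
  assert (Cf : continuity f).
  { intro l. apply continuity_pt_filterlim. assert (C : cont f) by (unfold f; cont_tac). apply C. }
  assert (V1 : f (- (2 * x)) < 0) by (unfold f; rewrite Hx2; ring_simplify; lra).
  assert (V2 : 0 < f (- x)) by (unfold f; rewrite Hx2; ring_simplify; lra).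
  assert (V3 : f x < 0) by (unfold f; rewrite Hx2; ring_simplify; lra).
  assert (V4 : 0 < f (2 * x)) by (unfold f; rewrite Hx2; ring_simplify; lra).
  destruct (IVT f (- (2 * x)) (- x) Cf ltac:(lra) V1 V2) as [l1 [R1 F1]].
  destruct (IVT (fun l => - f l) (- x) x) as [l2 [R2 F2]]; try lra.
  { intro l. apply continuity_pt_opp. apply Cf. }
  destruct (IVT f x (2 * x) Cf ltac:(lra) V3 V4) as [l3 [R3 F3]].
  assert (F2' : f l2 = 0) by lra.
  assert (N1 : l1 <> - x) by (intro E; rewrite E in F1; lra).
  assert (N2 : l3 <> x) by (intro E; rewrite E in F3; lra).
  unfold f in F1, F2', F3.
  exists l1, l2, l3. split; [lra|]. split; [|repeat split; lra].
  assert (E1 : l1 ^ 2 + l1 * l2 + l2 ^ 2 = p).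
  { apply (Rmult_eq_reg_l (l1 - l2)); [|lra]. ring_simplify. ring_simplify in F1. ring_simplify in F2'. lra. }
  assert (E2 : l1 ^ 2 + l1 * l3 + l3 ^ 2 = p).
  { apply (Rmult_eq_reg_l (l1 - l3)); [|lra]. ring_simplify. ring_simplify in F1. ring_simplify in F3. lra. }
  apply (Rmult_eq_reg_l (l2 - l3)); [|lra].
  rewrite Rmult_0_r. ring_simplify. ring_simplify in E1. ring_simplify in E2. lra.
Qed.

(** For z = x + i y the equation is z''' = - p z' + i q z. If l is a root of l^3 - p l + q, then U_l
    = z'' + i l z' + (p - l^2) z satisfies U_l' = i l U_l, a pure rotation. The second divided
    difference of U_l over the three roots is - z. *)
Lemma third_order_trig (p q : R) (x y x1 y1 x2 y2 : R -> R) :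
  0 < p -> 27 * q ^ 2 < 4 * p ^ 3 ->
  (forall t, is_derive x t (x1 t)) -> (forall t, is_derive y t (y1 t)) ->
  (forall t, is_derive x1 t (x2 t)) -> (forall t, is_derive y1 t (y2 t)) ->
  (forall t, is_derive x2 t (- p * x1 t - q * y t)) ->
  (forall t, is_derive y2 t (- p * y1 t + q * x t)) ->
  trig (phase x y).
Proof.
  intros Hp Hq Dx Dy Dx1 Dy1 Dx2 Dy2.
  destruct (cubic_roots p q Hp Hq) as [l1 [l2 [l3 [Hl [Hs [Q1 [Q2 Q3]]]]]]].
  set (Ux := fun l t => x2 t - l * y1 t + (p - l ^ 2) * x t).
  set (Uy := fun l t => y2 t + l * x1 t + (p - l ^ 2) * y t).
  assert (HU : forall l, q = p * l - l ^ 3 -> trig (phase (Ux l) (Uy l))).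
  { intros l Hq'. apply (rotation_trig l); intro t.
    - eapply is_derive_eq; [apply is_derive_rplus; [apply is_derive_rminus; [apply Dx2|apply is_derive_rscal, Dy1]|apply is_derive_rscal, Dx]|].
      unfold Uy. rewrite Hq'. rring.
    - eapply is_derive_eq; [apply is_derive_rplus; [apply is_derive_rplus; [apply Dy2|apply is_derive_rscal, Dx1]|apply is_derive_rscal, Dy]|].
      unfold Ux. rewrite Hq'. rring. }
  apply (trig_ext (fun al t => (/ (l1 - l2) * / (l3 - l2)) * (phase (Ux l1) (Uy l1) al t + (-1) * phase (Ux l2) (Uy l2) al t)
     + (- / (l1 - l3) * / (l3 - l2)) * (phase (Ux l1) (Uy l1) al t + (-1) * phase (Ux l3) (Uy l3) al t))).
  - intros al t. unfold phase, Ux, Uy. replace l3 with (- l1 - l2) by lra. field. lra.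
  - apply trig_add; apply trig_scal; apply trig_add; try apply trig_scal; auto.
Qed.

(** * The 3 x 3 system for the coefficients of density and velocity *)

Section Triple.
Variables (w a b : R) (sx sy px py mx my : R -> R).
Variable (Ha : 0 < a).
Variable (Hb : 0 < b).
Variable (Dsx : forall t, is_derive sx t (- / 2 * (px t + mx t))).
Variable (Dsy : forall t, is_derive sy t (- / 2 * (py t + my t))).
Variable (Dpx : forall t, is_derive px t (2 * w * py t + a * sx t)).
Variable (Dpy : forall t, is_derive py t (- 2 * w * px t + a * sy t)).
Variable (Dmx : forall t, is_derive mx t (- 2 * w * my t + b * sx t)).
Variable (Dmy : forall t, is_derive my t (2 * w * mx t + b * sy t)).

(** In complex form the system is s' = - (P + M) / 2, P' = - 2 i w P + a s, M' = 2 i w M + b s. Its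
    characteristic polynomial makes each of the three unknowns satisfy z''' = - p z' + i q z. *)
Let p := 4 * w ^ 2 + (a + b) / 2.
Let q := w * (a - b).

Lemma triple_p_pos : 0 < p.
Proof. unfold p. pose proof (pow2_ge_0 w). lra. Qed.
(* With S = (a + b) / 2: (4 w^2 + S)^3 - 27 w^2 S^2 = (S - 8 w^2)^2 (S + w^2). *)
Lemma triple_discriminant : 27 * q ^ 2 < 4 * p ^ 3.
Proof.
  unfold p, q. set (S := (a + b) / 2). assert (HS : 0 < S) by (unfold S; lra).
  assert (Hw : 0 <= w ^ 2) by apply pow2_ge_0.
  assert (H : (4 * w ^ 2 + S) ^ 3 - 27 * w ^ 2 * S ^ 2 = (S - 8 * w ^ 2) ^ 2 * (S + w ^ 2)) by ring.
  assert (H1 : 0 <= (S - 8 * w ^ 2) ^ 2 * (S + w ^ 2)) by (apply Rmult_le_pos; [apply pow2_ge_0|lra]).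
  assert (H2 : (a - b) ^ 2 < 4 * S ^ 2) by (unfold S; nra).
  rewrite Rpow_mult_distr.
  destruct Hw as [Hw|Hw].
  - assert (w ^ 2 * (a - b) ^ 2 < w ^ 2 * (4 * S ^ 2)) by (apply Rmult_lt_compat_l; auto). lra.
  - rewrite <- Hw. assert (0 < S ^ 3) by now apply pow_lt. ring_simplify. lra.
Qed.

Ltac dtac := repeat (match goal with
  | |- is_derive (fun x => @?f x + @?g x) _ _ => apply (is_derive_rplus f g)
  | |- is_derive (fun x => @?f x - @?g x) _ _ => apply (is_derive_rminus f g)
  | |- is_derive (fun x => ?c * @?f x) _ _ => apply (is_derive_rscal f c)
  | |- is_derive (fun x => @?f x * @?g x) _ _ => apply (is_derive_rmult f g)
  | |- is_derive ?f _ _ => first [exact (Dsx _) | exact (Dsy _) | exact (Dpx _) | exact (Dpy _) | exact (Dmx _) | exact (Dmy _)]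
  end).

Lemma triple_trig_s : trig (phase sx sy).
Proof.
  apply (third_order_trig p q sx sy (fun t => - / 2 * (px t + mx t)) (fun t => - / 2 * (py t + my t))
    (fun t => (- w) * (py t - my t) + (- ((a + b) / 2)) * sx t)
    (fun t => w * (px t - mx t) + (- ((a + b) / 2)) * sy t));
  [apply triple_p_pos|apply triple_discriminant|..]; intro t; (eapply is_derive_eq; [dtac|]);
  unfold p, q; rfield.
Qed.
Lemma triple_trig_p : trig (phase px py).
Proof.
  apply (third_order_trig p q px py (fun t => 2 * w * py t + a * sx t) (fun t => - 2 * w * px t + a * sy t)
    (fun t => (- (4 * w ^ 2)) * px t + (2 * w * a) * sy t + (- (a / 2)) * (px t + mx t))
    (fun t => (- (4 * w ^ 2)) * py t + (- (2 * w * a)) * sx t + (- (a / 2)) * (py t + my t)));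
  [apply triple_p_pos|apply triple_discriminant|..]; intro t; (eapply is_derive_eq; [dtac|]);
  unfold p, q; rfield.
Qed.
Lemma triple_trig_m : trig (phase mx my).
Proof.
  apply (third_order_trig p q mx my (fun t => - 2 * w * my t + b * sx t) (fun t => 2 * w * mx t + b * sy t)
    (fun t => (- (4 * w ^ 2)) * mx t + (- (2 * w * b)) * sy t + (- (b / 2)) * (px t + mx t))
    (fun t => (- (4 * w ^ 2)) * my t + (2 * w * b) * sx t + (- (b / 2)) * (py t + my t)));
  [apply triple_p_pos|apply triple_discriminant|..]; intro t; (eapply is_derive_eq; [dtac|]);
  unfold p, q; rfield.
Qed.

(** The rotations by 2 w preserve the moduli of the last two unknowns, and the weights 2 a, 1 and a
    / b make the coupling terms cancel. *)
Lemma triple_energy t :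
  2 * a * (sx t ^ 2 + sy t ^ 2) + (px t ^ 2 + py t ^ 2) + a / b * (mx t ^ 2 + my t ^ 2)
  = 2 * a * (sx 0 ^ 2 + sy 0 ^ 2) + (px 0 ^ 2 + py 0 ^ 2) + a / b * (mx 0 ^ 2 + my 0 ^ 2).
Proof.
  apply (is_derive_zero_const (fun t => 2 * a * (sx t ^ 2 + sy t ^ 2) + (px t ^ 2 + py t ^ 2) + a / b * (mx t ^ 2 + my t ^ 2))).
  intro s.
  apply (is_derive_ext (fun t => (2 * a) * (sx t * sx t + sy t * sy t) + (px t * px t + py t * py t) + (a / b) * (mx t * mx t + my t * my t))).
  { intro u. rring. }
  eapply is_derive_eq.
  - dtac.
  - rfield. lra.
Qed.

End Triple.

(** * Truncation errors of radial profiles *)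
Lemma is_derive_ssum (f f' : nat -> R -> R) (N : nat) (x : R) :
  (forall k, is_derive (f k) x (f' k x)) ->
  is_derive (fun x => ssum (fun k => f k x) N) x (ssum (fun k => f' k x) N).
Proof.
  intro H. induction N; simpl.
  - apply (is_derive_const (K := R_AbsRing) (V := R_NormedModule) 0).
  - now apply is_derive_rplus.
Qed.

Lemma MVT_bound (F f : R -> R) (r e : R) : 0 < r <= 1 ->
  (forall x, r <= x <= 1 -> is_derive F x (f x)) -> F 1 = 0 ->
  (forall x, r <= x <= 1 -> Rabs (f x) <= e) -> Rabs (F r) <= e.
Proof.
  intros Hr HF H1 Hf.
  assert (He : 0 <= e) by (apply Rle_trans with (Rabs (f 1)); [apply Rabs_pos|apply Hf; lra]).
  destruct (MVT_gen F r 1 f) as [x [Hx E]].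
  - rewrite Rmin_left, Rmax_right by lra. intros; apply HF; lra.
  - rewrite Rmin_left, Rmax_right by lra. intros x Hx. apply continuity_pt_filterlim.
    apply (ex_derive_continuous (V := R_NormedModule) F x). exists (f x). now apply HF.
  - rewrite Rmin_left, Rmax_right in Hx by lra. rewrite H1 in E.
    replace (F r) with (- (f x * (1 - r))) by lra.
    rewrite Rabs_Ropp, Rabs_mult, (Rabs_pos_eq (1 - r)) by lra.
    specialize (Hf x Hx). pose proof (Rabs_pos (f x)). nra.
Qed.

Section Static.
Variables (n : nat) (A B : R) (psi dpsi : nat -> R -> R) (nu : nat -> R).
Variable (HA : 0 < A).
Variable (HB : 0 <= B).
Variable (Hb : eigenbasis n A B psi dpsi nu).
Local Notation rho := (rho A B).
Local Notation wt := (wt n).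
Local Notation coef := (coef n psi).
Local Notation comb := (comb n psi).
Let cpsi k : cont (psi k) := eb_cpsi n A B psi dpsi nu Hb k.
Let cdpsi k : cont (dpsi k) := eb_cdpsi n A B psi dpsi nu Hb k.

Lemma nu_pos k : 0 < nu k.
Proof. pose proof (eb_nu _ _ _ _ _ _ Hb k). lra. Qed.
Lemma cont_combine c N : cont (comb c N).
Proof.
  apply (cont_ssum (fun k r => c k * (r ^ n * psi k r))). intro k. pose proof (cpsi k). cont_tac.
Qed.

(** The solution, regular at 0, of Y' + (n + 1) Y / r = r^n psi_k, in the closed form given by the
    eigenvalue equation. *)
Definition eta (k : nat) (r : R) : R := - (r ^ n * (rho r * dpsi k r)) / nu k.
Lemma cont_eta k : cont (eta k).
Proof.
  unfold eta, Rdiv. pose proof (cdpsi k). pose proof (cont_rho A B). cont_tac.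
Qed.
Lemma eta_prim k r : 0 <= r <= 1 -> r ^ (n + 1) * eta k r = RInt (fun t => wt t * psi k t) 0 r.
Proof.
  intro Hr. pose proof (cdpsi k) as C1. pose proof (cpsi k) as C2. pose proof (cont_rho A B) as C3.
  pose proof (cont_wt n) as C4.
  assert (E : RInt (fun t => - nu k * (wt t * psi k t)) 0 r
     = wt r * (rho r * dpsi k r) - wt 0 * (rho 0 * dpsi k 0)).
  { apply (RInt_cderive_open _ (fun t => wt t * (rho t * dpsi k t))); [lra|cont_tac|cont_tac|].
    intros x Hx. eapply is_derive_eq; [apply (eb_eq _ _ _ _ _ _ Hb); lra|]. rring. }
  rewrite RInt_cscal, wt_0 in E by cont_tac. pose proof (nu_pos k) as Hnu.
  apply (Rmult_eq_reg_l (- nu k)); [|lra].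
  match goal with |- ?a = ?b => change (@eq R a b) end.
  rewrite E. unfold eta. rewrite wt_pow. field. lra.
Qed.

(** The error is r^-(n+1) times the integral of t^(n+1) times the error of [D] over [0, r].
    Cauchy-Schwarz for t dt applies, because the integral of t^(2n+1) over [0, r] is at most
    r^(2n+2). *)
Lemma residual_plus (Y Y' D : R -> R) (N : nat) (e : R) :
  (forall r, is_derive Y r (Y' r)) -> cont Y' -> cont D ->
  (forall r, 0 <= r <= 1 -> r * D r = r * Y' r + INR (n + 1) * Y r) ->
  0 <= e -> energy (fun r => D r - comb (coef D) N r) <= e ^ 2 ->
  forall r, 0 <= r <= 1 -> Rabs (Y r - ssum (fun k => coef D k * eta k r) N) <= e.
Proof.
  intros HY CY' CD HD He HE.
  assert (CY : cont Y) by (apply (cont_derive _ Y'); auto).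
  pose proof (cont_combine (coef D) N) as Cc.
  assert (CE : cont (fun r => ssum (fun k => coef D k * eta k r) N)).
  { apply (cont_ssum (fun k r => coef D k * eta k r)). intro k. pose proof (cont_eta k). cont_tac. }
  apply cont_le_at_0; [cont_tac|]. intros r Hr.
  assert (E : r ^ (n + 1) * (Y r - ssum (fun k => coef D k * eta k r) N)
      = RInt (fun t => t * (t ^ n * (D t - comb (coef D) N t))) 0 r).
  { assert (E1 : RInt (fun t => t ^ n * (t * D t)) 0 r = r ^ (n + 1) * Y r - 0 ^ (n + 1) * Y 0).
    { apply (RInt_cderive_open _ (fun t => t ^ (n + 1) * Y t)); [lra|cont_tac|cont_tac|].
      intros x Hx. eapply is_derive_eq; [apply is_derive_rmult; [apply is_derive_rpow|apply HY]|].
      replace (pred (n + 1)) with n by lia. rewrite HD by lra. rewrite pow_add, pow_1. rring. }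
    rewrite (pow_ne_zero (n + 1)) in E1 by lia.
    assert (E2 : RInt (fun t => t ^ (n + 1) * comb (coef D) N t) 0 r
       = r ^ (n + 1) * ssum (fun k => coef D k * eta k r) N).
    { rewrite (RInt_rext _ (fun t => ssum (fun k => coef D k * (wt t * psi k t)) N)).
      - rewrite (RInt_ssum (fun k t => coef D k * (wt t * psi k t))).
        + rewrite <- ssum_scal. apply ssum_ext. intros k _.
          rewrite RInt_cscal, <- eta_prim by (try lra; pose proof (cpsi k); pose proof (cont_wt n); cont_tac). ring.
        + intro k. pose proof (cpsi k). pose proof (cont_wt n). cont_tac.
      - intro t. unfold comb. rewrite <- ssum_scal. apply ssum_ext. intros k _. rewrite wt_pow. ring. }
    rewrite (RInt_rext _ (fun t => t ^ n * (t * D t) - t ^ (n + 1) * comb (coef D) N t)).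
    2:{ intro t. rewrite pow_add. ring. }
    rewrite RInt_cminus by cont_tac. rewrite E2.
    match goal with |- ?a = ?b => change (@eq R a b) end.
    transitivity ((r ^ (n + 1) * Y r - 0 * Y 0) - r ^ (n + 1) * ssum (fun k => coef D k * eta k r) N); [ring|].
    rewrite <- E1. reflexivity. }
  assert (Hrn : 0 < r ^ (n + 1)) by (apply pow_lt; lra).
  apply (Rmult_le_reg_l (r ^ (n + 1))); auto.
  rewrite <- (Rabs_pos_eq (r ^ (n + 1))) at 1 by lra. rewrite <- Rabs_mult, E.
  apply RInt_cs_abs; [lra|cont_tac|cont_tac|cont_tac| |lra|auto| |].
  - intros x Hx. lra.
  - rewrite (RInt_rext _ (fun x => x ^ (2 * n + 1))).
    2:{ intro x. rewrite pow_add, pow_1, (Nat.mul_comm 2 n), pow_mult. ring. }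
    rewrite RInt_pow, (pow_ne_zero (S (2 * n + 1))) by lia. rewrite <- pow_mult.
    replace ((n + 1) * 2)%nat with (S (2 * n + 1)) by lia.
    assert (0 < r ^ S (2 * n + 1)) by (apply pow_lt; lra).
    assert (1 <= INR (S (2 * n + 1))) by (change 1 with (INR 1); apply le_INR; lia).
    apply (Rmult_le_reg_r (INR (S (2 * n + 1)))); [lra|].
    unfold Rdiv. rewrite Rmult_assoc, Rinv_l by lra. nra.
  - eapply Rle_trans; [|exact HE]. unfold energy.
    assert (Cd : cont (fun t => t * (D t - comb (coef D) N t) ^ 2)) by cont_tac.
    rewrite <- (RInt_cChasles _ 0 r 1 Cd).
    assert (0 <= RInt (fun t => t * (D t - comb (coef D) N t) ^ 2) r 1).
    { apply RInt_cge0; [lra|auto|]. intros x Hx. apply Rmult_le_pos; [lra|apply pow2_ge_0]. }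
    lra.
Qed.

(** Two integrations. [rho Q] solves the plus equation with source [- T], and since
    [coef T = nu coef f] the profiles [eta] turn into r^n rho psi'. Then G / r^n, with G the error
    of [f], has derivative (error of Q) / r^n and vanishes at 1, and the mean value theorem
    applies. *)
Lemma residual_scalar (f f' Q Q' T : R -> R) (N : nat) (e : R) :
  (forall r, is_derive f r (f' r)) -> cont f' ->
  (forall r, 0 <= r <= 1 -> r * Q r = r * f' r - INR n * f r) ->
  (forall r, is_derive Q r (Q' r)) -> cont Q' -> cont T ->
  (forall r, 0 <= r <= 1 ->
     r * (- T r) = r * (2 * B * r * Q r + rho r * Q' r) + INR (n + 1) * (rho r * Q r)) ->
  f 1 = 0 -> (forall k, coef T k = nu k * coef f k) ->
  0 <= e -> energy (fun r => T r - comb (coef T) N r) <= e ^ 2 ->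
  forall r, 0 <= r <= 1 ->
    Rabs (f r - ssum (fun k => coef f k * (r ^ n * psi k r)) N) <= e / A.
Proof.
  intros Hf Cf' HQ HQ' CQ' CT HT f1 Hc He HE.
  assert (Cf : cont f) by (apply (cont_derive _ f'); auto).
  assert (CQ : cont Q) by (apply (cont_derive _ Q'); auto).
  pose proof (cont_rho A B) as Cr.
  assert (Ccomb : cont (fun r => ssum (fun k => coef f k * (r ^ n * psi k r)) N)).
  { apply (cont_ssum (fun k r => coef f k * (r ^ n * psi k r))). intro k. pose proof (cpsi k). cont_tac. }
  assert (Ecoef : forall k, coef (fun r => - T r) k = - coef T k).
  { intro k. unfold coef. rewrite <- RInt_copp.
    - apply RInt_rext. intro; ring.
    - pose proof (cpsi k). cont_tac. }
  assert (Hq : forall r, 0 <= r <= 1 -> Rabs (Q r - ssum (fun k => coef f k * (r ^ n * dpsi k r)) N) <= e / A).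
  { intros r Hr.
    assert (H := residual_plus (fun r => rho r * Q r) (fun r => 2 * B * r * Q r + rho r * Q' r) (fun r => - T r) N e).
    assert (H' : Rabs (rho r * Q r - ssum (fun k => coef (fun r => - T r) k * eta k r) N) <= e).
    { apply H; auto.
      - intro x. apply is_derive_rmult; auto. apply is_derive_rho.
      - cont_tac.
      - cont_tac.
      - rewrite (energy_ext _ (fun r => (-1) * (T r - comb (coef T) N r))).
        + rewrite energy_scal by (pose proof (cont_combine (coef T) N); cont_tac). lra.
        + intros x _. unfold comb.
          rewrite (ssum_ext _ (fun k => (-1) * (coef T k * (x ^ n * psi k x)))).
          * rewrite ssum_scal. ring.
          * intros k _. rewrite Ecoef. ring. }
    replace (rho r * Q r - ssum (fun k => coef (fun r => - T r) k * eta k r) N)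
      with (rho r * (Q r - ssum (fun k => coef f k * (r ^ n * dpsi k r)) N)) in H'.
    2:{ rewrite Rmult_minus_distr_l, <- ssum_scal. f_equal. apply ssum_ext. intros k _.
        rewrite Ecoef, Hc. unfold eta. field. pose proof (nu_pos k); lra. }
    rewrite Rabs_mult in H'. pose proof (rho_ge A B HB r) as Hrho. rewrite (Rabs_pos_eq (rho r)) in H' by lra.
    apply (Rmult_le_reg_l A); auto. replace (A * (e / A)) with e by (field; lra).
    set (v := Q r - ssum (fun k => coef f k * (r ^ n * dpsi k r)) N) in *.
    pose proof (Rabs_pos v). nra. }
  assert (HeA : 0 <= e / A) by (apply Rdiv_le_0_compat; lra).
  apply cont_le_at_0; [cont_tac|]. intros r Hr.
  set (G := fun r => f r - ssum (fun k => coef f k * (r ^ n * psi k r)) N).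
  set (q := fun r => Q r - ssum (fun k => coef f k * (r ^ n * dpsi k r)) N) in *.
  assert (G1 : G 1 = 0).
  { unfold G. rewrite f1, (ssum_ext _ (fun _ => 0)), ssum_zero; [ring|].
    intros k _. rewrite (eb_end _ _ _ _ _ _ Hb). ring. }
  assert (DG : forall x, 0 < x <= 1 -> is_derive (fun x => G x * / x ^ n) x (q x * / x ^ n)).
  { intros x Hx. assert (Hxn : 0 < x ^ n) by (apply pow_lt; lra).
    assert (D1 : is_derive G x (f' x - ssum (fun k => coef f k * (INR n * x ^ pred n * psi k x + x ^ n * dpsi k x)) N)).
    { apply is_derive_rminus; auto.
      apply (is_derive_ssum (fun k x => coef f k * (x ^ n * psi k x))
        (fun k x => coef f k * (INR n * x ^ pred n * psi k x + x ^ n * dpsi k x))).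
      intro k. apply is_derive_rscal. apply is_derive_rmult; [apply is_derive_rpow|apply (eb_derive _ _ _ _ _ _ Hb)]. }
    eapply is_derive_eq.
    { apply is_derive_rmult; [apply D1|apply (is_derive_inv (fun r => r ^ n) x (INR n * x ^ pred n)); [apply is_derive_rpow|lra]]. }
    cbv beta. match goal with |- ?a = ?b => change (@eq R a b) end.
    assert (En : INR n * x ^ pred n = INR n * x ^ n / x).
    { destruct n as [|m]; [simpl; field; lra|]. simpl pred. rewrite <- (tech_pow_Rmult x m). field; lra. }
    rewrite En.
    assert (Eq : q x = f' x - INR n * G x / x - ssum (fun k => coef f k * (x ^ n * dpsi k x)) N
       - INR n / x * ssum (fun k => coef f k * (x ^ n * psi k x)) N).
    { unfold q, G. replace (Q x) with ((x * Q x) / x) by (field; lra). rewrite HQ by lra. field. lra. }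
    rewrite (ssum_ext (fun k => coef f k * (INR n * x ^ n / x * psi k x + x ^ n * dpsi k x))
      (fun k => INR n / x * (coef f k * (x ^ n * psi k x)) + coef f k * (x ^ n * dpsi k x))).
    2:{ intros k _. field. lra. }
    rewrite ssum_plus, ssum_scal, Eq. field. lra. }
  assert (Hrn : 0 < r ^ n) by (apply pow_lt; lra).
  assert (HM : Rabs (G r * / r ^ n) <= e / A * / r ^ n).
  { apply (MVT_bound (fun x => G x * / x ^ n) (fun x => q x * / x ^ n)); auto.
    - intros x Hx. apply DG. lra.
    - rewrite G1. ring.
    - intros x Hx. assert (0 < x ^ n) by (apply pow_lt; lra).
      rewrite Rabs_mult, Rabs_inv, (Rabs_pos_eq (x ^ n)) by lra.
      apply Rmult_le_compat; [apply Rabs_pos|apply Rlt_le, Rinv_0_lt_compat; auto|apply Hq; lra|].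
      apply Rinv_le_contravar; auto. apply pow_incr. lra. }
  rewrite Rabs_mult, Rabs_inv, (Rabs_pos_eq (r ^ n)) in HM by lra.
  apply (Rmult_le_reg_r (/ r ^ n)); [now apply Rinv_0_lt_compat|exact HM].
Qed.

(** The solution of Y' - (n - 1) Y / r = r^n psi_k that vanishes at the boundary; integration starts
    from 1 because the factor t^-(n-1) is singular at 0. *)
Definition zeta (k : nat) (r : R) : R := - (r ^ (n - 1) * RInt (fun t => t * psi k t) r 1).
Lemma cont_zeta k : cont (zeta k).
Proof.
  unfold zeta. pose proof (cpsi k).
  assert (cont (fun r => RInt (fun t => t * psi k t) r 1)).
  { apply (cont_derive _ (fun r => - (r * psi k r))). intro r.
    apply (is_derive_RInt_low (fun t => t * psi k t)). cont_tac. }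
  cont_tac.
Qed.

Lemma minus_integral (Y Y' D : R -> R) (N : nat) : (1 <= n)%nat ->
  (forall r, is_derive Y r (Y' r)) -> cont Y' -> cont D ->
  (forall r, 0 <= r <= 1 -> r * D r = r * Y' r - (INR n - 1) * Y r) ->
  forall r, 0 < r <= 1 ->
  Y r - r ^ (n - 1) * Y 1 - ssum (fun k => coef D k * zeta k r) N
  = - (r ^ (n - 1) * RInt (fun t => / Rmax r t ^ (n - 1) * (D t - comb (coef D) N t)) r 1).
Proof.
  intros Hn HY CY' CD HD r Hr.
  assert (CY : cont Y) by (apply (cont_derive _ Y'); auto).
  pose proof (cont_combine (coef D) N) as Cc.
  (* Replacing t by [Rmax r t] changes nothing on [r, 1] and makes the integrand continuous on the
     whole line. *)
  assert (Cm : cont (fun t => / Rmax r t ^ (n - 1))).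
  { apply cont_inv.
    - apply cont_pow. apply (cont_ext (fun t => / 2 * (r + t + Rabs (r - t)))); [|cont_tac].
      intro t. unfold Rmax, Rabs. destruct (Rle_dec r t), (Rcase_abs (r - t)); lra.
    - intro t. apply pow_nonzero. pose proof (Rmax_l r t). lra. }
  assert (Hrn : 0 < r ^ (n - 1)) by (apply pow_lt; lra).
  assert (Hm : forall t, r <= t -> / Rmax r t ^ (n - 1) = / t ^ (n - 1)) by (intros; rewrite Rmax_right; auto).
  assert (E1 : RInt (fun t => / Rmax r t ^ (n - 1) * D t) r 1 = Y 1 - Y r * / r ^ (n - 1)).
  { rewrite (RInt_cderive_open _ (fun t => Y t * / Rmax r t ^ (n - 1))).
    - rewrite !Hm by lra. rewrite pow1, Rinv_1. rring.
    - lra.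
    - cont_tac.
    - cont_tac.
    - intros x Hx. assert (Hxn : 0 < x ^ (n - 1)) by (apply pow_lt; lra).
      apply (is_derive_ext_loc (fun t => Y t * / t ^ (n - 1))).
      + assert (Hd : 0 < x - r) by lra. exists (mkposreal _ Hd). intros y Hy.
        unfold ball in Hy; simpl in Hy; unfold AbsRing_ball, abs, minus, plus, opp in Hy; simpl in Hy.
        apply Rabs_def2 in Hy. rewrite Hm by lra. reflexivity.
      + eapply is_derive_eq.
        { apply is_derive_rmult; [apply HY|apply (is_derive_inv (fun r => r ^ (n - 1)) x (INR (n - 1) * x ^ pred (n - 1))); [apply is_derive_rpow|lra]]. }
        cbv beta. rewrite Hm by lra. match goal with |- ?a = ?b => change (@eq R a b) end.
        assert (En : INR (n - 1) * x ^ pred (n - 1) = INR (n - 1) * x ^ (n - 1) / x).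
        { destruct (n - 1)%nat as [|m]; [simpl; field; lra|]. simpl pred. rewrite <- (tech_pow_Rmult x m). field; lra. }
        rewrite En. rewrite minus_INR by lia. simpl (INR 1).
        replace (D x) with (x * D x / x) by (field; lra). rewrite HD by lra. field. lra. }
  assert (E2 : RInt (fun t => / Rmax r t ^ (n - 1) * comb (coef D) N t) r 1
     = ssum (fun k => coef D k * RInt (fun t => t * psi k t) r 1) N).
  { rewrite (RInt_cext _ (fun t => ssum (fun k => coef D k * (t * psi k t)) N)); [|lra|].
    - rewrite (RInt_ssum (fun k t => coef D k * (t * psi k t))).
      + apply ssum_ext. intros k _. rewrite RInt_cscal; [reflexivity|]. pose proof (cpsi k). cont_tac.
      + intro k. pose proof (cpsi k). cont_tac.
    - intros t Ht. rewrite Hm by lra. unfold comb. rewrite <- ssum_scal. apply ssum_ext. intros k _.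
      assert (0 < t ^ (n - 1)) by (apply pow_lt; lra).
      replace (t ^ n) with (t * t ^ (n - 1)).
      + field. lra.
      + rewrite tech_pow_Rmult. f_equal. lia. }
  rewrite (RInt_rext _ (fun t => / Rmax r t ^ (n - 1) * D t - / Rmax r t ^ (n - 1) * comb (coef D) N t))
    by (intro; ring).
  rewrite RInt_cminus by cont_tac. rewrite E1, E2.
  unfold zeta. rewrite (ssum_ext _ (fun k => (- r ^ (n - 1)) * (coef D k * RInt (fun t => t * psi k t) r 1))).
  2:{ intros k _. rring. }
  rewrite ssum_scal. match goal with |- ?a = ?b => change (@eq R a b) end. field. lra.
Qed.

(** Cauchy-Schwarz for t dt requires the integral of t^(1-2n) over [r, 1] to be at most r^(2-2n).
    This holds from n = 2 on; for n = 1 it is - ln r against a constant. *)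
Lemma residual_minus (Y Y' D : R -> R) (N : nat) (e : R) : (2 <= n)%nat ->
  (forall r, is_derive Y r (Y' r)) -> cont Y' -> cont D ->
  (forall r, 0 <= r <= 1 -> r * D r = r * Y' r - (INR n - 1) * Y r) ->
  0 <= e -> energy (fun r => D r - comb (coef D) N r) <= e ^ 2 ->
  forall r, 0 <= r <= 1 ->
  Rabs (Y r - r ^ (n - 1) * Y 1 - ssum (fun k => coef D k * zeta k r) N) <= e.
Proof.
  intros Hn HY CY' CD HD He HE.
  assert (CY : cont Y) by (apply (cont_derive _ Y'); auto).
  pose proof (cont_combine (coef D) N) as Cc.
  assert (Cz : cont (fun r => ssum (fun k => coef D k * zeta k r) N)).
  { apply (cont_ssum (fun k r => coef D k * zeta k r)). intro k. pose proof (cont_zeta k). cont_tac. }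
  apply cont_le_at_0; [cont_tac|]. intros r Hr.
  rewrite (minus_integral Y Y' D N) by (auto; lia).
  assert (Cmx : cont (fun t => Rmax r t)).
  { apply (cont_ext (fun t => / 2 * (r + t + Rabs (r - t)))); [|cont_tac].
    intro t. unfold Rmax, Rabs. destruct (Rle_dec r t), (Rcase_abs (r - t)); lra. }
  assert (Cm : forall m, cont (fun t => / Rmax r t ^ m)).
  { intro m. apply cont_inv; [cont_tac|]. intro t. apply pow_nonzero. pose proof (Rmax_l r t). lra. }
  assert (Hm : forall m t, r <= t -> / Rmax r t ^ m = / t ^ m) by (intros; rewrite Rmax_right; auto).
  set (E := fun t => D t - comb (coef D) N t) in *.
  assert (CE : cont E) by (unfold E; cont_tac).
  assert (Hrn : 0 < r ^ (n - 1)) by (apply pow_lt; lra).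
  rewrite Rabs_Ropp, Rabs_mult, (Rabs_pos_eq (r ^ (n - 1))) by lra.
  apply (Rmult_le_reg_l (/ r ^ (n - 1))); [now apply Rinv_0_lt_compat|].
  rewrite <- Rmult_assoc, Rinv_l, Rmult_1_l by lra.
  rewrite (RInt_cext _ (fun t => t * (/ Rmax r t ^ n * E t))); [|lra|].
  2:{ intros t Ht. rewrite !Hm by lra. assert (0 < t ^ (n - 1)) by (apply pow_lt; lra).
      replace (t ^ n) with (t * t ^ (n - 1)) by (rewrite tech_pow_Rmult; f_equal; lia). unfold E. field. lra. }
  apply RInt_cs_abs; [lra|cont_tac|apply Cm|auto| | |auto| |].
  - intros x Hx. lra.
  - apply Rlt_le, Rinv_0_lt_compat; auto.
  - assert (I3 : RInt (fun t => / Rmax r t ^ 3) r 1 = / 2 * (/ r ^ 2 - 1)).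
    { rewrite (RInt_cderive_open _ (fun t => - / 2 * / Rmax r t ^ 2)); [|lra|apply Cm|pose proof (Cm 2%nat); cont_tac|].
      - rewrite !Hm by lra. rewrite pow1, Rinv_1. rring.
      - intros x Hx. apply (is_derive_ext_loc (fun t => - / 2 * / t ^ 2)).
        + assert (Hd : 0 < x - r) by lra. exists (mkposreal _ Hd). intros y Hy.
          unfold ball in Hy; simpl in Hy; unfold AbsRing_ball, abs, minus, plus, opp in Hy; simpl in Hy.
          apply Rabs_def2 in Hy. rewrite Hm by lra. reflexivity.
        + rewrite Hm by lra. auto_derive; [|rfield; lra].
          change (x ^ 2 <> 0). apply pow_nonzero. lra. }
    (* t^(1-2n) is split as t^-(2n-4) t^-3: the first factor is largest at t = r, the second has an
       explicit integral. *)
    apply Rle_trans with (RInt (fun t => / r ^ (2 * n - 4) * / Rmax r t ^ 3) r 1).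
    + pose proof (Cm 3%nat). pose proof (Cm n). apply RInt_cle; [lra|cont_tac|cont_tac|].
      intros t Ht. rewrite !Hm by lra.
      assert (0 < t) by lra. assert (Ht2 : 0 < t ^ (2 * n - 4)) by (apply pow_lt; lra).
      replace (t * (/ t ^ n) ^ 2) with (/ t ^ (2 * n - 4) * / t ^ 3).
      * apply Rmult_le_compat_r; [apply Rlt_le, Rinv_0_lt_compat; apply pow_lt; lra|].
        apply Rinv_le_contravar; [apply pow_lt; lra|]. apply pow_incr. lra.
      * assert (Et : (t ^ n) ^ 2 = t ^ (2 * n - 4) * t ^ 4).
        { rewrite <- pow_mult, <- pow_add. f_equal. lia. }
        rewrite pow_inv, Et. field. lra.
    + rewrite RInt_cscal by apply Cm. rewrite I3.
      assert (Er : (/ r ^ (n - 1)) ^ 2 = / r ^ (2 * n - 4) * / r ^ 2).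
      { rewrite pow_inv, <- pow_mult, <- Rinv_mult, <- pow_add. do 2 f_equal. lia. }
      rewrite Er.
      assert (0 < / r ^ (2 * n - 4)) by (apply Rinv_0_lt_compat, pow_lt; lra).
      assert (0 < / r ^ 2) by (apply Rinv_0_lt_compat, pow_lt; lra).
      apply Rmult_le_compat_l; lra.
  - eapply Rle_trans; [|exact HE]. unfold energy. fold E.
    assert (Cd : cont (fun t => t * E t ^ 2)) by cont_tac.
    rewrite <- (RInt_cChasles _ 0 r 1 Cd).
    assert (0 <= RInt (fun t => t * E t ^ 2) 0 r).
    { apply RInt_cge0; [lra|auto|]. intros x Hx. apply Rmult_le_pos; [lra|apply pow2_ge_0]. }
    change (RInt (fun t => t * E t ^ 2) r 1 <= RInt (fun t => t * E t ^ 2) 0 r + RInt (fun t => t * E t ^ 2) r 1).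
    lra.
Qed.

End Static.

(** * The logarithmic case n = 1 *)
Lemma bounded_sum_tail (g : nat -> R) (M : R) : (forall k, 0 <= g k) -> (forall K, ssum g K <= M) ->
  forall e, 0 < e -> exists N, forall K, (N <= K)%nat -> ssum g K - ssum g N <= e.
Proof.
  intros Hg HM e He. apply NNPP. intro Hn.
  assert (H : forall N, exists K, (N <= K)%nat /\ e < ssum g K - ssum g N).
  { intro N. apply NNPP. intro H. apply Hn. exists N. intros K HK. apply Rnot_lt_le. intro. apply H. now exists K. }
  assert (H' : forall j, exists N, INR j * e <= ssum g N).
  { induction j as [|j [N HN]]; [exists 0%nat; simpl; lra|].
    destruct (H N) as [K [_ HK]]. exists K. rewrite S_INR. lra. }
  destruct (INR_unbounded (M / e)) as [j Hj]. destruct (H' j) as [N HN]. specialize (HM N).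
  apply (Rmult_lt_compat_r e) in Hj; auto. unfold Rdiv in Hj. rewrite Rmult_assoc, Rinv_l in Hj; lra.
Qed.

Lemma sq_le_of_sq_le_mul (V D : R) : 0 <= V -> V ^ 2 <= D * V -> V <= D \/ V = 0.
Proof. intros [H|H] E; [left|right; lra]. apply (Rmult_le_reg_r V); nra. Qed.

(* The modes n = 1 of the component with angular number n - 1 = 0, for which the pairing of
   a square-integrable function with tau |-> 1 / tau diverges logarithmically at the origin. *)
Section Log.
Variables (A B : R) (psi dpsi : nat -> R -> R) (nu : nat -> R).
Variable (HA : 0 < A).
Variable (HB : 0 <= B).
Variable (Hb : eigenbasis 1 A B psi dpsi nu).
Local Notation rho := (rho A B).
Local Notation coef := (coef 1 psi).
Let cpsi k : cont (psi k) := eb_cpsi 1 A B psi dpsi nu Hb k.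
Let cdpsi k : cont (dpsi k) := eb_cdpsi 1 A B psi dpsi nu Hb k.
Let crho : cont rho := cont_rho A B.
Let nu0 k : 0 < nu k := nu_pos 1 A B psi dpsi nu HA Hb k.

(** [- gl r 1 k] is the profile [zeta] for n = 1; the intermediate endpoint allows the integral to
    be split at a chosen radius. *)
Definition gl (r s : R) (k : nat) : R := RInt (fun t => t * psi k t) r s.

Lemma cont_lin (c : nat -> R) K : cont (fun t => ssum (fun k => c k * psi k t) K).
Proof. apply (cont_ssum (fun k t => c k * psi k t)). intro k. pose proof (cpsi k). cont_tac. Qed.
Lemma cont_dlin (c : nat -> R) K : cont (fun t => ssum (fun k => c k * dpsi k t) K).
Proof. apply (cont_ssum (fun k t => c k * dpsi k t)). intro k. pose proof (cdpsi k). cont_tac. Qed.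
Lemma RInt_lin_gl (c : nat -> R) K r s :
  RInt (fun t => t * ssum (fun k => c k * psi k t) K) r s = ssum (fun k => c k * gl r s k) K.
Proof.
  rewrite (RInt_rext _ (fun t => ssum (fun k => c k * (t * psi k t)) K)).
  2:{ intro t. rewrite <- ssum_scal. apply ssum_ext. intros; ring. }
  rewrite (RInt_ssum (fun k t => c k * (t * psi k t))) by (intro k; pose proof (cpsi k); cont_tac).
  apply ssum_ext. intros k _. rewrite RInt_cscal by (pose proof (cpsi k); cont_tac). reflexivity.
Qed.

(** Pythagoras for a weighted orthogonal family, applied to [psi] with weight r^3 and to [dpsi] with
    weight r^3 rho. *)
Lemma quad_lin (c d : nat -> R) (f : nat -> R -> R) (q : R -> R) (N : nat) : cont q -> (forall k, cont (f k)) ->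
  (forall i j, i <> j -> RInt (fun r => q r * (f i r * f j r)) 0 1 = 0) ->
  (forall i, RInt (fun r => q r * (f i r * f i r)) 0 1 = d i) ->
  RInt (fun r => q r * ssum (fun k => c k * f k r) N ^ 2) 0 1 = ssum (fun k => d k * c k ^ 2) N.
Proof.
  intros Hq Hf H1 H2. assert (Cs : forall M, cont (fun r => ssum (fun k => c k * f k r) M)).
  { intro M. apply (cont_ssum (fun k r => c k * f k r)). intro k. pose proof (Hf k). cont_tac. }
  assert (Hx : forall M j, (M <= j)%nat -> RInt (fun r => q r * (ssum (fun k => c k * f k r) M * f j r)) 0 1 = 0).
  { induction M; intros j Hj; simpl.
    - rewrite (RInt_rext _ (fun _ => 0)) by (intro; ring). rewrite RInt_cconst. rring.
    - rewrite (RInt_rext _ (fun r => q r * (ssum (fun k => c k * f k r) M * f j r) + c M * (q r * (f M r * f j r)))) by (intro; ring).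
      pose proof (Hf M). pose proof (Hf j). pose proof (Cs M).
      rewrite RInt_cplus, RInt_cscal, IHM, H1 by (cont_tac || lia). rring. }
  induction N; cbn [ssum].
  - rewrite (RInt_rext _ (fun _ => 0)) by (intro; ring). rewrite RInt_cconst. rring.
  - pose proof (Hf N). pose proof (Cs N).
    rewrite (RInt_rext _ (fun r => (q r * ssum (fun k => c k * f k r) N ^ 2 + (2 * c N) * (q r * (ssum (fun k => c k * f k r) N * f N r))) + c N ^ 2 * (q r * (f N r * f N r)))) by (intro; ring).
    rewrite !RInt_cplus, !RInt_cscal, IHN, Hx, H2 by (cont_tac || lia). rring.
Qed.

(** Duality: with c = [gl q 1] and h = sum c_k psi_k, the sum V of the squares is the integral of t
    h over [q, 1], while t h has square norm V. Pairing with 1/t, whose square norm on [q, 1] is -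
    ln q, gives V^2 <= - ln q V. *)
Lemma gl_outer q K : 0 < q <= 1 -> ssum (fun k => gl q 1 k ^ 2) K <= - ln q.
Proof.
  intro HR. set (c := gl q 1). set (h := fun t => ssum (fun k => c k * psi k t) K).
  assert (Ch : cont h) by apply cont_lin.
  set (V := ssum (fun k => c k ^ 2) K).
  assert (HV : 0 <= V) by (apply ssum_ge0; intros; apply pow2_ge_0).
  assert (E1 : RInt (fun t => t * h t) q 1 = V).
  { unfold h. rewrite RInt_lin_gl. apply ssum_ext. intros; unfold c; ring. }
  assert (Cmx : cont (fun t => / Rmax q t)).
  { apply cont_inv.
    - apply (cont_ext (fun t => / 2 * (q + t + Rabs (q - t)))); [|cont_tac].
      intro t. unfold Rmax, Rabs. destruct (Rle_dec q t), (Rcase_abs (q - t)); lra.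
    - intro t. pose proof (Rmax_l q t). lra. }
  assert (E2 : RInt (fun t => t * (t * h t) ^ 2) 0 1 = V).
  { rewrite (RInt_rext _ (fun t => t ^ 3 * ssum (fun k => c k * psi k t) K ^ 2)) by (intro; unfold h; ring).
    rewrite (quad_lin c (fun _ => 1) psi (fun t => t ^ 3)).
    - apply ssum_ext. intros; ring.
    - cont_tac.
    - auto.
    - intros i j Hij. apply (eb_orth _ _ _ _ _ _ Hb i j Hij).
    - apply (eb_norm _ _ _ _ _ _ Hb). }
  assert (E3 : RInt (fun t => t * (/ Rmax q t) ^ 2) q 1 = - ln q).
  { rewrite (RInt_cext _ (fun t => / Rmax q t)); [|lra|].
    - rewrite (RInt_cderive_open _ (fun t => ln (Rmax q t))).
      + rewrite !Rmax_right by lra. rewrite ln_1. rring.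
      + lra.
      + auto.
      + intro t. apply (continuous_comp (fun t => Rmax q t) ln).
        * apply (cont_ext (fun t => / 2 * (q + t + Rabs (q - t)))); [|cont_tac].
          intro u. unfold Rmax, Rabs. destruct (Rle_dec q u), (Rcase_abs (q - u)); lra.
        * apply continuity_pt_filterlim. apply derivable_continuous_pt.
          exists (/ Rmax q t). apply derivable_pt_lim_ln. pose proof (Rmax_l q t). lra.
      + intros x Hx. apply (is_derive_ext_loc ln).
        * assert (Hd : 0 < x - q) by lra. exists (mkposreal _ Hd). intros y Hy.
          unfold ball in Hy; simpl in Hy; unfold AbsRing_ball, abs, minus, plus, opp in Hy; simpl in Hy.
          apply Rabs_def2 in Hy. rewrite Rmax_right by lra. reflexivity.
        * rewrite Rmax_right by lra. apply is_derive_Reals. apply derivable_pt_lim_ln. lra.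
    - intros t Ht. rewrite Rmax_right by lra. field. lra. }
  assert (CS : V ^ 2 <= (- ln q) * V).
  { rewrite <- E1 at 1.
    rewrite (RInt_cext (fun t => t * h t) (fun t => t * (/ Rmax q t * (t * h t)))); [|lra|].
    2:{ intros t Ht. rewrite Rmax_right by lra. field. lra. }
    eapply Rle_trans; [apply RInt_cauchy_schwarz; [lra|cont_tac|auto|cont_tac|intros; lra]|].
    cbv beta. rewrite E3. apply Rmult_le_compat_l.
    - rewrite <- E3. apply RInt_cge0; [lra|cont_tac|]. intros; apply Rmult_le_pos; [lra|apply pow2_ge_0].
    - rewrite <- E2 at 1. rewrite <- (RInt_cChasles (fun t => t * (t * h t) ^ 2) 0 q 1) by cont_tac.
      assert (0 <= RInt (fun t => t * (t * h t) ^ 2) 0 q).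
      { apply RInt_cge0; [lra|cont_tac|]. intros; apply Rmult_le_pos; [lra|apply pow2_ge_0]. }
      change (RInt (fun t => t * (t * h t) ^ 2) q 1 <= RInt (fun t => t * (t * h t) ^ 2) 0 q + RInt (fun t => t * (t * h t) ^ 2) q 1). lra. }
  destruct (sq_le_of_sq_le_mul V (- ln q) HV CS) as [H|H]; [exact H|].
  fold V. rewrite H. assert (ln q <= ln 1) by (apply ln_le; lra). rewrite ln_1 in H0. lra.
Qed.

(** The same duality in the norm of the gradient. The combination h with coefficients
    [gl r q k / nu k] has gradient energy V; Hardy's inequality bounds the integral of t h^2 by that
    of t (t h')^2, since h(1) = 0, and this is at most V / A. *)
Lemma gl_inner r q K : 0 <= r <= q -> q <= 1 -> ssum (fun k => gl r q k ^ 2 / nu k) K <= q ^ 2 / A.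
Proof.
  intros Hr HR. set (c := fun k => gl r q k / nu k). set (h := fun t => ssum (fun k => c k * psi k t) K).
  set (h' := fun t => ssum (fun k => c k * dpsi k t) K).
  assert (Ch : cont h) by apply cont_lin. assert (Ch' : cont h') by apply cont_dlin.
  set (V := ssum (fun k => nu k * c k ^ 2) K).
  assert (EV : ssum (fun k => gl r q k ^ 2 / nu k) K = V).
  { apply ssum_ext. intros k _. unfold c. field. pose proof (nu0 k). lra. }
  assert (HV : 0 <= V).
  { apply ssum_ge0. intros k _. pose proof (nu0 k). apply Rmult_le_pos; [lra|apply pow2_ge_0]. }
  assert (E1 : RInt (fun t => t * h t) r q = V).
  { unfold h. rewrite RInt_lin_gl. apply ssum_ext. intros k _. unfold c. field. pose proof (nu0 k). lra. }
  assert (E2 : RInt (fun t => wt 1 t * rho t * h' t ^ 2) 0 1 = V).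
  { apply (quad_lin c nu dpsi (fun t => wt 1 t * rho t)).
    - pose proof (cont_wt 1). cont_tac.
    - auto.
    - intros i j Hij. rewrite (energy_dpsi 1 A B psi dpsi nu Hb), (eb_orth _ _ _ _ _ _ Hb i j Hij). rring.
    - intro i. rewrite (energy_dpsi 1 A B psi dpsi nu Hb), (eb_norm _ _ _ _ _ _ Hb). rring. }
  set (J := RInt (fun t => t * (t * h' t) ^ 2) 0 1).
  assert (HJ : A * J <= V).
  { rewrite <- E2. unfold J. rewrite <- RInt_cscal by cont_tac. pose proof (cont_wt 1).
    apply RInt_cle; [lra|cont_tac|cont_tac|]. intros t Ht. pose proof (rho_ge A B HB t).
    replace (wt 1 t * rho t * h' t ^ 2) with (rho t * (t * (t * h' t) ^ 2)) by (unfold wt; simpl; ring).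
    apply Rmult_le_compat_r; [|lra]. apply Rmult_le_pos; [lra|apply pow2_ge_0]. }
  set (I := RInt (fun t => t * h t ^ 2) 0 1).
  assert (HI0 : 0 <= I).
  { apply RInt_cge0; [lra|cont_tac|]. intros; apply Rmult_le_pos; [lra|apply pow2_ge_0]. }
  assert (Dh : forall t, is_derive h t (h' t)).
  { intro t. apply (is_derive_ssum (fun k t => c k * psi k t) (fun k t => c k * dpsi k t)).
    intro k. apply is_derive_rscal. apply (eb_derive _ _ _ _ _ _ Hb). }
  assert (h1 : h 1 = 0).
  { unfold h. rewrite (ssum_ext _ (fun _ => 0)), ssum_zero; auto. intros k _. rewrite (eb_end _ _ _ _ _ _ Hb). ring. }
  assert (Hardy : I = - RInt (fun t => t * (h t * (t * h' t))) 0 1).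
  { assert (E : RInt (fun t => 2 * (t * h t ^ 2) + 2 * (t * (h t * (t * h' t)))) 0 1 = 1 ^ 2 * (h 1 * h 1) - 0 ^ 2 * (h 0 * h 0)).
    { apply (RInt_cderive _ (fun t => t ^ 2 * (h t * h t))); [cont_tac|]. intro t.
      eapply is_derive_eq; [apply is_derive_rmult; [apply is_derive_rpow|apply is_derive_rmult; apply Dh]|].
      simpl. rring. }
    rewrite h1, RInt_cplus, !RInt_cscal in E by cont_tac. unfold I.
    match goal with |- ?a = ?b => change (@eq R a b) end. lra. }
  assert (HIJ : I <= J).
  { assert (CS : I ^ 2 <= J * I).
    { replace (I ^ 2) with (RInt (fun t => t * (h t * (t * h' t))) 0 1 ^ 2) by (rewrite Hardy; ring).
      eapply Rle_trans; [apply RInt_cauchy_schwarz; [lra|cont_tac|auto|cont_tac|intros; lra]|].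
      cbv beta. fold I J. rewrite (Rmult_comm I J). apply Rle_refl. }
    destruct (sq_le_of_sq_le_mul I J HI0 CS) as [H|H]; auto. rewrite H.
    apply RInt_cge0; [lra|cont_tac|]. intros; apply Rmult_le_pos; [lra|apply pow2_ge_0]. }
  assert (CS : V ^ 2 <= (q ^ 2 / A) * V).
  { rewrite <- E1 at 1. rewrite (RInt_rext (fun t => t * h t) (fun t => t * (1 * h t))) by (intro; ring).
    eapply Rle_trans; [apply RInt_cauchy_schwarz; [lra|cont_tac|apply cont_const|auto|intros; lra]|].
    assert (I1 : RInt (fun t => t * 1 ^ 2) r q <= q ^ 2).
    { rewrite (RInt_rext _ (fun t => t ^ 1)) by (intro; ring). rewrite RInt_pow. simpl. nra. }
    assert (I2 : RInt (fun t => t * h t ^ 2) r q <= I).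
    { unfold I. rewrite <- (RInt_cChasles (fun t => t * h t ^ 2) 0 r 1), <- (RInt_cChasles (fun t => t * h t ^ 2) r q 1) by cont_tac.
      assert (0 <= RInt (fun t => t * h t ^ 2) 0 r) by (apply RInt_cge0; [lra|cont_tac|intros; apply Rmult_le_pos; [lra|apply pow2_ge_0]]).
      assert (0 <= RInt (fun t => t * h t ^ 2) q 1) by (apply RInt_cge0; [lra|cont_tac|intros; apply Rmult_le_pos; [lra|apply pow2_ge_0]]).
      change (RInt (fun t => t * h t ^ 2) r q <= RInt (fun t => t * h t ^ 2) 0 r + (RInt (fun t => t * h t ^ 2) r q + RInt (fun t => t * h t ^ 2) q 1)). lra. }
    assert (I3 : I <= V / A).
    { apply (Rmult_le_reg_l A); auto. replace (A * (V / A)) with V by (field; lra).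
      apply Rle_trans with (A * J); auto. apply Rmult_le_compat_l; lra. }
    replace (q ^ 2 / A * V) with (q ^ 2 * (V / A)) by (field; lra).
    apply Rmult_le_compat; try lra.
    - apply RInt_cge0; [lra|cont_tac|intros; apply Rmult_le_pos; [lra|apply pow2_ge_0]].
    - apply RInt_cge0; [lra|cont_tac|intros; apply Rmult_le_pos; [lra|apply pow2_ge_0]]. }
  rewrite EV. destruct (sq_le_of_sq_le_mul V (q ^ 2 / A) HV CS) as [H|H]; auto. rewrite H.
  apply Rdiv_le_0_compat; [apply pow2_ge_0|auto].
Qed.

Definition gsum (u : nat -> R) (N m : nat) (r : R) : R :=
  ssum (fun k => Rabs (u (N + k)%nat) * Rabs (gl r 1 (N + k)%nat)) m.
(** Absolute convergence against the profiles, uniformly in the radius down to the origin. *)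
Definition summable (u : nat -> R) : Prop := forall e, 0 < e ->
  exists N0, forall N m r, (N0 <= N)%nat -> 0 < r <= 1 -> gsum u N m r <= e.

Lemma gsum_ge0 u N m r : 0 <= gsum u N m r.
Proof. apply ssum_ge0. intros. apply Rmult_le_pos; apply Rabs_pos. Qed.

Lemma summable_lin u v w a b : (forall k, Rabs (w k) <= a * Rabs (u k) + b * Rabs (v k)) -> 0 <= a -> 0 <= b ->
  summable u -> summable v -> summable w.
Proof.
  intros H Ha Hb' Hu Hv e He.
  destruct (Hu (e / (2 * (a + 1)))) as [N1 H1]; [apply Rdiv_lt_0_compat; lra|].
  destruct (Hv (e / (2 * (b + 1)))) as [N2 H2]; [apply Rdiv_lt_0_compat; lra|].
  exists (max N1 N2). intros N m r HN Hr.
  specialize (H1 N m r ltac:(lia) Hr). specialize (H2 N m r ltac:(lia) Hr).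
  apply Rle_trans with (a * gsum u N m r + b * gsum v N m r).
  - unfold gsum. rewrite <- !ssum_scal, <- ssum_plus. apply ssum_le. intros k _.
    pose proof (Rabs_pos (gl r 1 (N + k)%nat)). specialize (H (N + k)%nat). nra.
  - pose proof (gsum_ge0 u N m r). pose proof (gsum_ge0 v N m r).
    assert (a * gsum u N m r <= (a + 1) * (e / (2 * (a + 1)))) by (apply Rmult_le_compat; lra).
    assert (b * gsum v N m r <= (b + 1) * (e / (2 * (b + 1)))) by (apply Rmult_le_compat; lra).
    replace e with ((a + 1) * (e / (2 * (a + 1))) + (b + 1) * (e / (2 * (b + 1)))) by (field; lra). lra.
Qed.

Lemma ssum_shift_le (g : nat -> R) N m M : (forall k, 0 <= g k) -> (forall K, ssum g K <= M) ->
  ssum (fun k => g (N + k)%nat) m <= M.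
Proof.
  intros H0 H. specialize (H (N + m)%nat). rewrite ssum_add in H.
  assert (0 <= ssum g N) by (apply ssum_ge0; auto). lra.
Qed.

(** The profile is split at the radius [q]. The outer part costs the logarithm against the plain
    square sum, the inner part only the small factor [q] against the square sum weighted by [nu]. *)
Lemma gsum_split u N m r q a b : 0 < r <= 1 -> 0 < q <= 1 -> 0 <= a -> 0 <= b ->
  ssum (fun k => u (N + k)%nat ^ 2) m <= a ^ 2 ->
  ssum (fun k => nu (N + k)%nat * u (N + k)%nat ^ 2) m <= b ^ 2 ->
  gsum u N m r <= a * sqrt (- ln q) + b * (q * sqrt (/ A)).
Proof.
  intros Hr HR Ha Hb' H1 H2.
  assert (HlnR : 0 <= - ln q).
  { assert (ln q <= ln 1) by (apply ln_le; lra). rewrite ln_1 in H. lra. }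
  assert (Ho : forall q', q <= q' <= 1 -> ssum (fun k => Rabs (u (N + k)%nat) * Rabs (gl q' 1 (N + k)%nat)) m <= a * sqrt (- ln q)).
  { intros q' HR1. apply (ssum_cs_abs (fun k => u (N + k)%nat) (fun k => gl q' 1 (N + k)%nat)); auto; [apply sqrt_pos|].
    rewrite pow2_sqrt by auto. apply (ssum_shift_le (fun k => gl q' 1 k ^ 2)).
    - intro; apply pow2_ge_0.
    - intro K. eapply Rle_trans; [apply gl_outer; lra|]. assert (ln q <= ln q') by (apply ln_le; lra). lra. }
  assert (HRA : 0 <= q * sqrt (/ A)) by (apply Rmult_le_pos; [lra|apply sqrt_pos]).
  destruct (Rle_lt_dec q r) as [Hle|Hlt].
  - assert (0 <= b * (q * sqrt (/ A))) by (apply Rmult_le_pos; auto).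
    specialize (Ho r ltac:(lra)). unfold gsum. lra.
  - specialize (Ho q ltac:(lra)).
    assert (Hi : ssum (fun k => Rabs (u (N + k)%nat) * Rabs (gl r q (N + k)%nat)) m <= b * (q * sqrt (/ A))).
    { rewrite (ssum_ext _ (fun k => Rabs (sqrt (nu (N + k)%nat) * u (N + k)%nat) * Rabs (gl r q (N + k)%nat / sqrt (nu (N + k)%nat)))).
      - apply (ssum_cs_abs (fun k => sqrt (nu (N + k)%nat) * u (N + k)%nat) (fun k => gl r q (N + k)%nat / sqrt (nu (N + k)%nat))); auto.
        + rewrite (ssum_ext _ (fun k => nu (N + k)%nat * u (N + k)%nat ^ 2)); auto.
          intros k _. rewrite Rpow_mult_distr, pow2_sqrt; auto. pose proof (nu0 (N + k)). lra.
        + replace ((q * sqrt (/ A)) ^ 2) with (q ^ 2 / A).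
          * rewrite (ssum_ext _ (fun k => gl r q (N + k)%nat ^ 2 / nu (N + k)%nat)).
            -- apply (ssum_shift_le (fun k => gl r q k ^ 2 / nu k)).
               ++ intro k. apply Rdiv_le_0_compat; [apply pow2_ge_0|apply nu0].
               ++ intro K. apply gl_inner; lra.
            -- intros k _. unfold Rdiv. rewrite Rpow_mult_distr, pow_inv, pow2_sqrt; auto. pose proof (nu0 (N + k)). lra.
          * rewrite Rpow_mult_distr, pow2_sqrt; [reflexivity|]. apply Rlt_le, Rinv_0_lt_compat; auto.
      - intros k _. pose proof (sqrt_lt_R0 _ (nu0 (N + k))).
        unfold Rdiv. rewrite !Rabs_mult, Rabs_inv. rewrite (Rabs_pos_eq (sqrt _)) by lra. field. lra. }
    apply Rle_trans with (ssum (fun k => Rabs (u (N + k)%nat) * Rabs (gl r q (N + k)%nat)) m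
       + ssum (fun k => Rabs (u (N + k)%nat) * Rabs (gl q 1 (N + k)%nat)) m); [|lra].
    unfold gsum. rewrite <- ssum_plus. apply ssum_le. intros k _.
    assert (E : gl r 1 (N + k) = gl r q (N + k) + gl q 1 (N + k)).
    { unfold gl. rewrite RInt_cChasles; auto. pose proof (cpsi (N + k)). cont_tac. }
    rewrite E, <- Rmult_plus_distr_l. apply Rmult_le_compat_l; [apply Rabs_pos|apply Rabs_triang].
Qed.

(** Splitting at q = 1 makes the logarithm vanish, so that only the weighted square sum counts. *)
Lemma summable_weighted u M : (forall K, ssum (fun k => nu k * u k ^ 2) K <= M) -> summable u.
Proof.
  intros HM e He.
  assert (Hs : 0 < sqrt (/ A)) by (apply sqrt_lt_R0, Rinv_0_lt_compat; auto).
  set (b := e / sqrt (/ A)). assert (Hb' : 0 < b) by (apply Rdiv_lt_0_compat; auto).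
  assert (H0 : forall k, 0 <= nu k * u k ^ 2).
  { intro k. pose proof (nu0 k). apply Rmult_le_pos; [lra|apply pow2_ge_0]. }
  destruct (bounded_sum_tail (fun k => nu k * u k ^ 2) M H0 HM (b ^ 2)) as [N0 HN0]; [now apply pow_lt|].
  exists N0. intros N m r HN Hr.
  assert (Hu2 : ssum (fun k => u (N + k)%nat ^ 2) m <= sqrt (M / A) ^ 2).
  { assert (HM0 : 0 <= M) by (apply (HM 0%nat)).
    rewrite pow2_sqrt by (apply Rdiv_le_0_compat; lra).
    apply (ssum_shift_le (fun k => u k ^ 2)); [intro; apply pow2_ge_0|].
    intro K. apply (Rmult_le_reg_l A); auto. replace (A * (M / A)) with M by (field; lra).
    eapply Rle_trans; [|apply (HM K)]. rewrite <- ssum_scal. apply ssum_le. intros k _.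
    apply Rmult_le_compat_r; [apply pow2_ge_0|apply (eb_nu _ _ _ _ _ _ Hb)]. }
  eapply Rle_trans; [apply (gsum_split u N m r 1 (sqrt (M / A)) b); auto; try lra; [apply sqrt_pos|]|].
  - pose proof (HN0 N HN). pose proof (HN0 (N + m)%nat ltac:(lia)). rewrite ssum_add in H1.
    assert (ssum (fun k => nu k * u k ^ 2) N0 <= ssum (fun k => nu k * u k ^ 2) N) by (apply ssum_mono; auto). lra.
  - rewrite ln_1, Ropp_0, sqrt_0. right. unfold b. field. lra.
Qed.

(** The case e = 0 is the function r, the model of data that do not vanish at the boundary. The
    powers r^(1+e) have the same boundary value and ever smaller norm. *)
Definition xe (e : nat) (k : nat) : R := coef (fun r => r ^ (1 + e)) k.

Lemma energy_pow e : energy (fun r => r ^ (1 + e)) <= / INR (2 * e + 4).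
Proof.
  unfold energy. rewrite (RInt_rext _ (fun r => r ^ (2 * e + 3))).
  - rewrite RInt_pow, pow1, pow_ne_zero by lia. replace (S (2 * e + 3)) with (2 * e + 4)%nat by lia.
    right. unfold Rdiv. rewrite Rminus_0_r, Rmult_1_l. reflexivity.
  - intro r. rewrite <- pow_mult, tech_pow_Rmult. f_equal. lia.
Qed.

(** Image of r^(1+e) under the operator that acts on r psi_k as multiplication by [nu k]. *)
Definition Te (e : nat) (r : R) : R := - (INR e * (r ^ pred e * (2 * B * r ^ 2 + INR (e + 2) * rho r))).
Lemma cont_Te e : cont (Te e). Proof. unfold Te. cont_tac. Qed.

(** The boundary term does not depend on [e]: it cancels in differences, and [Te 0 = 0] evaluates it
    as [- nu k * xe 0 k]. *)
Lemma Te_coef e k : coef (Te e) k = rho 1 * dpsi k 1 + nu k * xe e k.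
Proof.
  pose proof (ibp_general 1 A B psi dpsi nu Hb k (fun r => r ^ (1 + e)) (fun r => INR (1 + e) * r ^ e)) as E.
  assert (Ep : forall r, r * (INR e * r ^ pred e) = INR e * r ^ e).
  { intro r. destruct e as [|e']; [simpl; ring|]. simpl pred. rewrite <- (tech_pow_Rmult r e'). ring. }
  pose proof (ibp_plus 1 A B psi dpsi nu Hb k (fun r => rho r * (INR e * r ^ e))
    (fun r => 2 * B * r * (INR e * r ^ e) + rho r * (INR e * (INR e * r ^ pred e))) (fun r => - Te e r)) as F.
  assert (En : coef (fun r => - Te e r) k = - coef (Te e) k).
  { unfold coef. rewrite <- RInt_copp; [apply RInt_rext; intro; ring|].
    pose proof (cpsi k). pose proof (cont_Te e). cont_tac. }
  rewrite En in F.
  transitivity (RInt (fun r => rho r * (INR e * r ^ e) * (r ^ (1 + 1) * dpsi k r)) 0 1).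
  - apply Ropp_eq_reg. rewrite F; clear E F; [rring| | | |].
    + intro r. eapply is_derive_eq; [apply is_derive_rmult; [apply is_derive_rho|apply is_derive_rscal, is_derive_rpow]|reflexivity].
    + cont_tac.
    + pose proof (cont_Te e). cont_tac.
    + intros r _. unfold Te. rewrite plus_INR. simpl (INR (1 + 1)). simpl (INR 2).
      transitivity (2 * B * r ^ 2 * (r * (INR e * r ^ pred e)) + (INR e + 2) * rho r * (r * (INR e * r ^ pred e))); [simpl; ring|].
      rewrite Ep.
      transitivity (2 * B * r ^ 2 * (INR e * r ^ e) + rho r * INR e * (r * (INR e * r ^ pred e)) + 2 * (rho r * (INR e * r ^ e))); [rewrite Ep; ring|simpl; ring].
  - rewrite (RInt_rext _ (fun r => rho r * r ^ 1 * dpsi k r * (r * (INR (1 + e) * r ^ e) - INR 1 * r ^ (1 + e)))).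
    + rewrite E; [unfold xe; rewrite pow1; rring| |cont_tac].
      intro r. apply (is_derive_rpow (1 + e)).
    + intro r. rewrite plus_INR, pow_add. simpl. ring.
Qed.

Lemma energy_Te e : (1 <= e)%nat -> energy (Te e) <= 25 * (A + B) ^ 2 * INR e ^ 3.
Proof.
  intro He. assert (He1 : 1 <= INR e) by (change 1 with (INR 1); now apply le_INR).
  apply Rle_trans with (RInt (fun r => 25 * (A + B) ^ 2 * INR e ^ 4 * r ^ (2 * e - 1)) 0 1).
  - apply RInt_cle; [lra|pose proof (cont_Te e); cont_tac|cont_tac|]. intros r Hr. unfold Te.
    assert (Er : r * (r ^ pred e) ^ 2 = r ^ (2 * e - 1)).
    { rewrite <- pow_mult, tech_pow_Rmult. f_equal. lia. }
    set (v := 2 * B * r ^ 2 + INR (e + 2) * rho r).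
    assert (Hv : 0 <= v <= 5 * (A + B) * INR e).
    { unfold v, rho. rewrite plus_INR. simpl (INR 2). pose proof (pow_01 r 2 Hr).
      assert (0 <= B * r ^ 2 <= B) by nra. split; [|].
      - assert (0 <= (INR e + 2) * (A + B * r ^ 2)) by (apply Rmult_le_pos; lra). lra.
      - assert ((INR e + 2) * (A + B * r ^ 2) <= (3 * INR e) * (A + B)) by (apply Rmult_le_compat; lra).
        assert (0 <= (INR e - 1) * (A + B)) by (apply Rmult_le_pos; lra). nra. }
    replace (r * (- (INR e * (r ^ pred e * v))) ^ 2) with (r ^ (2 * e - 1) * (INR e ^ 2 * v ^ 2)) by (rewrite <- Er; ring).
    replace (25 * (A + B) ^ 2 * INR e ^ 4 * r ^ (2 * e - 1)) with (r ^ (2 * e - 1) * (INR e ^ 2 * (5 * (A + B) * INR e) ^ 2)) by ring.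
    apply Rmult_le_compat_l; [apply pow_le; lra|]. apply Rmult_le_compat_l; [apply pow2_ge_0|]. apply pow_incr. auto.
  - rewrite RInt_cscal, RInt_pow, pow1, pow_ne_zero by (cont_tac || lia).
    replace (S (2 * e - 1)) with (2 * e)%nat by lia. rewrite mult_INR. simpl (INR 2).
    assert (HX : 0 <= 25 * (A + B) ^ 2 * INR e ^ 3).
    { apply Rmult_le_pos; [|apply pow_le; lra]. pose proof (pow2_ge_0 (A + B)). lra. }
    apply Rle_trans with (25 * (A + B) ^ 2 * INR e ^ 3 / 2).
    + right. rfield. lra.
    + revert HX. generalize (25 * (A + B) ^ 2 * INR e ^ 3). intros. lra.
Qed.

(* r = sum_j (r^(1 + e_j) - r^(1 + e_(j+1))) with e_j = 16^j - 1; the summands, concentrated at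
   distance 16^(-j) from the boundary, have coefficients that interpolate between l^2 bounds. *)
Definition expo (j : nat) : nat := (16 ^ j - 1)%nat.
Lemma expo_INR j : INR (expo j) = 16 ^ j - 1.
Proof.
  unfold expo. rewrite minus_INR, pow_INR; [simpl; f_equal; f_equal; ring|].
  clear. induction j; simpl; lia.
Qed.
Definition uj (j k : nat) : R := xe (expo j) k - xe (expo (S j)) k.

Lemma cont_powf e : cont (fun r => r ^ (1 + e)). Proof. cont_tac. Qed.

Lemma coef_minus f g k : cont f -> cont g -> coef (fun r => f r - g r) k = coef f k - coef g k.
Proof.
  intros Hf Hg. pose proof (cpsi k). unfold coef. rewrite <- RInt_cminus by cont_tac.
  apply RInt_rext. intro; ring.
Qed.

Lemma uj_sq j K : ssum (fun k => uj j k ^ 2) K <= (/ 4 ^ j) ^ 2.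
Proof.
  set (f := fun r => r ^ (1 + expo j) - r ^ (1 + expo (S j))).
  assert (Cf : cont f) by (unfold f; cont_tac).
  rewrite (ssum_ext _ (fun k => coef f k ^ 2)).
  2:{ intros k _. unfold uj, xe, f. rewrite coef_minus by cont_tac. reflexivity. }
  eapply Rle_trans; [apply (eb_bessel _ _ _ _ _ _ Hb); auto|].
  apply Rle_trans with (energy (fun r => r ^ (1 + expo j))).
  - apply RInt_cle; [lra|cont_tac|cont_tac|]. intros r Hr. apply Rmult_le_compat_l; [lra|].
    apply pow_incr. unfold f.
    assert (r ^ (1 + expo (S j)) <= r ^ (1 + expo j)).
    { replace (1 + expo (S j))%nat with ((1 + expo j) + (expo (S j) - expo j))%nat.
      - rewrite pow_add. pose proof (pow_01 r (1 + expo j) Hr). pose proof (pow_01 r (expo (S j) - expo j) Hr). nra.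
      - assert (expo j <= expo (S j))%nat; [|lia]. unfold expo. simpl. lia. }
    pose proof (pow_01 r (1 + expo (S j)) Hr). lra.
  - eapply Rle_trans; [apply energy_pow|].
    rewrite pow_inv. apply Rinv_le_contravar; [apply pow_lt, pow_lt; lra|].
    rewrite plus_INR, mult_INR, expo_INR. simpl (INR 2). simpl (INR 4).
    rewrite <- pow_mult, Nat.mul_comm, pow_mult. replace (4 ^ 2) with 16 by ring.
    assert (0 < 16 ^ j) by (apply pow_lt; lra). lra.
Qed.

(** Interpolation: [nu k * uj j k] is a coefficient of the difference [T] of two [Te], so the sum is
    at most the norm of [T], of order 64^j by the cubic growth in [energy_Te], times the bound 4^-j
    of [uj_sq]. *)
Lemma uj_nu j K : ssum (fun k => nu k * uj j k ^ 2) K <= 800 * (A + B) * 16 ^ j.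
Proof.
  set (T := fun r => Te (expo j) r - Te (expo (S j)) r).
  pose proof (cont_Te (expo j)) as C1. pose proof (cont_Te (expo (S j))) as C2.
  assert (CT : cont T) by (unfold T; cont_tac).
  assert (H16 : 1 <= 16 ^ j) by (apply pow_R1_Rle; lra).
  assert (ET : energy T <= (800 * (A + B) * 64 ^ j) ^ 2).
  { unfold T. rewrite (energy_ext _ (fun r => Te (expo j) r + (-1) * Te (expo (S j)) r)) by (intros; ring).
    eapply Rle_trans; [apply energy_add; cont_tac|]. rewrite energy_scal by auto.
    assert (E2 : energy (Te (expo (S j))) <= 25 * (A + B) ^ 2 * (16 * 16 ^ j) ^ 3).
    { eapply Rle_trans; [apply energy_Te|].
      - unfold expo. simpl. assert (1 <= 16 ^ j)%nat; [|lia]. clear. induction j; simpl; lia.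
      - apply Rmult_le_compat_l; [pose proof (pow2_ge_0 (A + B)); lra|]. apply pow_incr.
        rewrite expo_INR. simpl. split; lra. }
    assert (E1 : energy (Te (expo j)) <= 25 * (A + B) ^ 2 * (16 * 16 ^ j) ^ 3).
    { destruct j as [|j'].
      - unfold energy. rewrite (RInt_rext _ (fun _ => 0)).
        + rewrite RInt_cconst. apply Rle_trans with 0; [right; rring|]. apply Rmult_le_pos; [pose proof (pow2_ge_0 (A + B)); lra|apply pow_le; simpl; lra].
        + intro r. unfold Te, expo. simpl. ring.
      - eapply Rle_trans; [apply energy_Te|].
        + unfold expo. simpl. assert (1 <= 16 ^ j')%nat; [|lia]. clear. induction j'; simpl; lia.
        + apply Rmult_le_compat_l; [pose proof (pow2_ge_0 (A + B)); lra|]. apply pow_incr.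
          rewrite expo_INR. split; lra. }
    assert (E3 : (16 * 16 ^ j) ^ 3 = 4096 * (64 ^ j) ^ 2).
    { rewrite Rpow_mult_distr, <- !pow_mult, (Nat.mul_comm j 3), (Nat.mul_comm j 2), !pow_mult.
      replace (16 ^ 3) with 4096 by ring. replace (64 ^ 2) with 4096 by ring. ring. }
    rewrite E3 in E1, E2.
    assert (0 <= (A + B) ^ 2 * (64 ^ j) ^ 2) by (apply Rmult_le_pos; apply pow2_ge_0).
    replace ((800 * (A + B) * 64 ^ j) ^ 2) with (640000 * ((A + B) ^ 2 * (64 ^ j) ^ 2)) by ring. lra. }
  assert (HTk : forall k, nu k * uj j k = coef T k).
  { intro k. unfold T, uj. rewrite coef_minus, !Te_coef by auto. ring. }
  rewrite (ssum_ext _ (fun k => coef T k * uj j k)).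
  2:{ intros k _. rewrite <- HTk. ring. }
  assert (H64 : 0 <= 800 * (A + B) * 64 ^ j) by (apply Rmult_le_pos; [lra|apply pow_le; lra]).
  assert (H4 : 0 < 4 ^ j) by (apply pow_lt; lra).
  apply Rle_trans with (800 * (A + B) * 64 ^ j * / 4 ^ j).
  - eapply Rle_trans; [|apply (ssum_cs_abs (coef T) (uj j) K (800 * (A + B) * 64 ^ j) (/ 4 ^ j))].
    + apply ssum_le. intros k _. rewrite <- Rabs_mult. apply Rle_abs.
    + auto.
    + apply Rlt_le, Rinv_0_lt_compat; auto.
    + eapply Rle_trans; [apply (eb_bessel _ _ _ _ _ _ Hb); auto|auto].
    + apply uj_sq.
  - right. replace 64 with (16 * 4) by ring. rewrite Rpow_mult_distr. field. lra.
Qed.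

Lemma gsum_plus u v N m r : gsum (fun k => u k + v k) N m r <= gsum u N m r + gsum v N m r.
Proof.
  unfold gsum. rewrite <- ssum_plus. apply ssum_le. intros k _. rewrite <- Rmult_plus_distr_r.
  apply Rmult_le_compat_r; [apply Rabs_pos|apply Rabs_triang].
Qed.
Lemma gsum_ext u v N m r : (forall k, u k = v k) -> gsum u N m r = gsum v N m r.
Proof. intro H. apply ssum_ext. intros k _. now rewrite H. Qed.

Let D := 4 + sqrt (800 * (A + B)) * sqrt (/ A).
(** The split radius q = 16^-j balances the two parts: the outer one is 4^-j sqrt (j ln 16) <= 4 /
    2^j, the inner one 4^j / 16^j up to constants. The decay is geometric in [j] and uniform in
    [N]. *)
Lemma gsum_uj j N m r : 0 < r <= 1 -> gsum (uj j) N m r <= D * / 2 ^ j.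
Proof.
  intro Hr.
  assert (H16 : 0 < 16 ^ j) by (apply pow_lt; lra). assert (H4 : 0 < 4 ^ j) by (apply pow_lt; lra).
  assert (H2 : 1 <= 2 ^ j) by (apply pow_R1_Rle; lra).
  assert (E4 : 4 ^ j = 2 ^ j * 2 ^ j) by (rewrite <- Rpow_mult_distr; f_equal; ring).
  assert (E16 : 16 ^ j = 4 ^ j * 4 ^ j) by (rewrite <- Rpow_mult_distr; f_equal; ring).
  assert (HAB : 0 <= 800 * (A + B)) by lra.
  assert (H161 : 1 <= 16 ^ j) by (apply pow_R1_Rle; lra).
  eapply Rle_trans.
  - apply (gsum_split (uj j) N m r (/ 16 ^ j) (/ 4 ^ j) (sqrt (800 * (A + B)) * 4 ^ j)); auto.
    + split; [now apply Rinv_0_lt_compat|]. rewrite <- Rinv_1. apply Rinv_le_contravar; lra.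
    + apply Rlt_le, Rinv_0_lt_compat; auto.
    + apply Rmult_le_pos; [apply sqrt_pos|lra].
    + apply (ssum_shift_le (fun k => uj j k ^ 2)); [intro; apply pow2_ge_0|apply uj_sq].
    + rewrite Rpow_mult_distr, pow2_sqrt by auto. replace ((4 ^ j) ^ 2) with (16 ^ j) by (rewrite E16; ring).
      apply (ssum_shift_le (fun k => nu k * uj j k ^ 2)).
      * intro k. pose proof (nu0 k). apply Rmult_le_pos; [lra|apply pow2_ge_0].
      * intro K. apply uj_nu.
  - assert (Hln : sqrt (- ln (/ 16 ^ j)) <= 4 * 2 ^ j).
    { rewrite <- (sqrt_pow2 (4 * 2 ^ j)) by lra. apply sqrt_le_1_alt.
      rewrite ln_Rinv, Ropp_involutive, ln_pow by lra.
      assert (L1 : ln 16 <= 15).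
      { assert (L : 0 < ln 16) by (rewrite <- ln_1; apply ln_increasing; lra).
        pose proof (exp_ineq1 (ln 16) ltac:(lra)) as X. rewrite exp_ln in X; lra. }
      assert (L2 : INR j <= 4 ^ j).
      { clear. induction j; [simpl; lra|]. rewrite S_INR. simpl. assert (1 <= 4 ^ j) by (apply pow_R1_Rle; lra). lra. }
      pose proof (pos_INR j).
      assert (0 <= ln 16) by (rewrite <- ln_1; apply ln_le; lra).
      replace ((4 * 2 ^ j) ^ 2) with (4 ^ j * 16) by (rewrite E4; ring).
      apply Rmult_le_compat; lra. }
    assert (E1 : / 4 ^ j * (4 * 2 ^ j) = 4 * / 2 ^ j) by (rewrite E4; field; lra).
    assert (X1 : / 4 ^ j * sqrt (- ln (/ 16 ^ j)) <= 4 * / 2 ^ j).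
    { rewrite <- E1. apply Rmult_le_compat_l; auto. apply Rlt_le, Rinv_0_lt_compat; auto. }
    assert (X2 : sqrt (800 * (A + B)) * 4 ^ j * (/ 16 ^ j * sqrt (/ A)) <= sqrt (800 * (A + B)) * sqrt (/ A) * / 2 ^ j).
    { replace (sqrt (800 * (A + B)) * 4 ^ j * (/ 16 ^ j * sqrt (/ A))) with (sqrt (800 * (A + B)) * sqrt (/ A) * / 4 ^ j)
        by (rewrite E16; field; lra).
      apply Rmult_le_compat_l; [apply Rmult_le_pos; apply sqrt_pos|]. apply Rinv_le_contravar; [lra|]. rewrite E4. nra. }
    unfold D. lra.
Qed.

Lemma summable_uj j : summable (uj j).
Proof. apply (summable_weighted _ (800 * (A + B) * 16 ^ j)). intro. apply uj_nu. Qed.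
Lemma summable_zero : summable (fun _ => 0).
Proof.
  apply (summable_weighted _ 0). intro K. rewrite (ssum_ext _ (fun _ => 0)), ssum_zero; [lra|].
  intros; ring.
Qed.

(** The telescoping series is cut twice. Finitely many pieces are summable one by one; those from J0
    to J form a small geometric sum; the remainder r^(1 + expo J) is small in norm against sqrt (-
    ln r). *)
Lemma summable_xe0 : summable (xe 0).
Proof.
  assert (HD : 0 <= D) by (unfold D; pose proof (Rmult_le_pos _ _ (sqrt_pos (800 * (A + B))) (sqrt_pos (/ A))); lra).
  intros e He.
  assert (Hgeo : forall d, 0 < d -> exists J, / 2 ^ J <= d).
  { intros d Hd. destruct (pow_lt_1_zero (/ 2)) with (y := d) as [J HJ]; [rewrite Rabs_pos_eq; lra|auto|].
    exists J. specialize (HJ J (le_n J)). rewrite pow_inv in HJ. apply Rabs_def2 in HJ. lra. }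
  destruct (Hgeo (e / (8 * (D + 1)))) as [J0 HJ0]; [apply Rdiv_lt_0_compat; lra|].
  set (U := fun J k => ssum (fun j => uj j k) J).
  assert (HU : forall J, summable (U J)).
  { induction J; [exact summable_zero|].
    apply (summable_lin (U J) (uj J) (U (S J)) 1 1); try lra; auto using summable_uj.
    intro k. unfold U. simpl. eapply Rle_trans; [apply Rabs_triang|]. lra. }
  destruct (HU J0 (e / 4)) as [N0 HN0]; [lra|]. exists N0. intros N m r HN Hr.
  assert (Htail : forall i, gsum (U (J0 + i)%nat) N m r <= gsum (U J0) N m r + D * (2 * / 2 ^ J0 - 2 * / 2 ^ (J0 + i))).
  { induction i as [|i IH]; [rewrite Nat.add_0_r; lra|]. rewrite Nat.add_succ_r.
    eapply Rle_trans; [apply (gsum_plus (U (J0 + i)%nat) (uj (J0 + i)))|].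
    pose proof (gsum_uj (J0 + i) N m r Hr). simpl pow.
    assert (H2 : 0 < 2 ^ (J0 + i)) by (apply pow_lt; lra).
    replace (2 * / (2 * 2 ^ (J0 + i))) with (/ 2 ^ (J0 + i)) by (field; lra). lra. }
  assert (Hdec : forall J k, xe 0 k = U J k + xe (expo J) k).
  { intros J k. unfold U. induction J; [change (expo 0) with 0%nat; simpl; ring|]. cbn [ssum]. rewrite IHJ. unfold uj. ring. }
  set (L := sqrt (- ln r)). assert (HL : 0 <= L) by apply sqrt_pos.
  (* The second cut depends on [r], but [N0] was fixed before it, so uniformity in the radius is
     preserved. *)
  destruct (Hgeo (e / (4 * (L + 1)))) as [J1 HJ1]; [apply Rdiv_lt_0_compat; lra|].
  set (J := (J0 + J1)%nat).
  assert (H2J0 : 0 < / 2 ^ J0) by (apply Rinv_0_lt_compat, pow_lt; lra).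
  assert (H2J : 0 < / 2 ^ J) by (apply Rinv_0_lt_compat, pow_lt; lra).
  rewrite (gsum_ext _ (fun k => U J k + xe (expo J) k)) by (intro; apply Hdec).
  eapply Rle_trans; [apply gsum_plus|].
  specialize (Htail J1). fold J in Htail. specialize (HN0 N m r HN Hr).
  assert (B1 : D * (2 * / 2 ^ J0) <= e / 4).
  { apply Rle_trans with ((D + 1) * (2 * (e / (8 * (D + 1))))); [|right; field; lra].
    apply Rmult_le_compat; lra. }
  assert (B2 : 0 <= D * (2 * / 2 ^ J)) by (apply Rmult_le_pos; lra).
  assert (B3 : gsum (xe (expo J)) N m r <= e / 4).
  { apply Rle_trans with (/ 2 ^ J1 * L).
    - apply (ssum_cs_abs (fun k => xe (expo J) (N + k)%nat) (fun k => gl r 1 (N + k)%nat)); auto.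
      + apply Rlt_le, Rinv_0_lt_compat, pow_lt; lra.
      + apply (ssum_shift_le (fun k => xe (expo J) k ^ 2)); [intro; apply pow2_ge_0|]. intro K.
        eapply Rle_trans; [apply (eb_bessel _ _ _ _ _ _ Hb); apply cont_powf|].
        eapply Rle_trans; [apply energy_pow|]. rewrite pow_inv.
        assert (P1 : 0 < (2 ^ J1) ^ 2) by (apply pow_lt, pow_lt; lra).
        apply Rinv_le_contravar; auto.
        rewrite plus_INR, mult_INR, expo_INR. simpl (INR 2). simpl (INR 4).
        assert (E4 : (2 ^ J1) ^ 2 = 4 ^ J1) by (rewrite <- pow_mult, Nat.mul_comm, pow_mult; f_equal; ring).
        assert (P4 : 4 ^ J1 <= 16 ^ J1) by (apply pow_incr; lra).
        assert (P16 : 16 ^ J1 <= 16 ^ J) by (apply Rle_pow; [lra|unfold J; lia]).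
        rewrite E4. assert (0 < 16 ^ J) by (apply pow_lt; lra). lra.
      + unfold L. rewrite pow2_sqrt.
        * apply (ssum_shift_le (fun k => gl r 1 k ^ 2)); [intro; apply pow2_ge_0|]. intro K. apply gl_outer. auto.
        * assert (ln r <= ln 1) by (apply ln_le; lra). rewrite ln_1 in H. lra.
    - apply Rle_trans with (e / (4 * (L + 1)) * (L + 1)); [|right; field; lra].
      apply Rmult_le_compat; try lra. apply Rlt_le, Rinv_0_lt_compat, pow_lt; lra. }
  lra.
Qed.

(** Angular number 1 data to which the second order operator can be applied with continuous result
    [T], without a condition at the boundary. *)
Definition regular (f : R -> R) : Prop := cont f /\ exists f' q q' T,
  (forall r, is_derive f r (f' r)) /\ cont f' /\ (forall r, r * q r = r * f' r - f r) /\
  (forall r, is_derive q r (q' r)) /\ cont q' /\ cont T /\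
  (forall r, r * - T r = r * (2 * B * r * q r + rho r * q' r) + 2 * (rho r * q r)).

Lemma summable_over_sqrt T : cont T -> summable (fun k => coef T k / sqrt (nu k)).
Proof.
  intro CT. apply (summable_weighted _ (energy T)). intro K.
  rewrite (ssum_ext _ (fun k => coef T k ^ 2)); [now apply (eb_bessel _ _ _ _ _ _ Hb)|].
  intros k _. pose proof (nu0 k). pose proof (sqrt_lt_R0 _ (nu0 k)).
  unfold Rdiv. rewrite Rpow_mult_distr, pow_inv, pow2_sqrt by lra. field. lra.
Qed.

(** Integration by parts leaves the boundary value times rho(1) psi_k'(1), which [Te_coef] at e = 0
    expresses by the coefficients of r. Hence [coef f = coef T / nu + f 1 * xe 0], and both parts
    are summable. *)
Lemma summable_regular f : regular f -> summable (coef f).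
Proof.
  intros [Cf [f' [q [q' [T [H1 [H2 [H3 [H4 [H5 [H6 H7]]]]]]]]]]].
  assert (Cq : cont q) by (apply (cont_derive _ q'); auto).
  assert (Ek : forall k, coef f k = coef T k / nu k + f 1 * xe 0 k).
  { intro k.
    pose proof (ibp_general 1 A B psi dpsi nu Hb k f f' H1 H2) as E.
    pose proof (ibp_plus 1 A B psi dpsi nu Hb k (fun r => rho r * q r) (fun r => 2 * B * r * q r + rho r * q' r) (fun r => - T r)) as F.
    assert (En : coef (fun r => - T r) k = - coef T k).
    { unfold coef. rewrite <- RInt_copp; [apply RInt_rext; intro; ring|]. pose proof (cpsi k). cont_tac. }
    rewrite En in F.
    assert (X : coef T k = f 1 * rho 1 * dpsi k 1 + nu k * coef f k).
    { rewrite <- E. apply Ropp_eq_reg. rewrite F; clear E F.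
      - f_equal. apply RInt_rext. intro r.
        transitivity (rho r * r * dpsi k r * (r * q r)); [simpl; ring|]. rewrite H3. simpl. ring.
      - intro r. apply is_derive_rmult; [apply is_derive_rho|apply H4].
      - cont_tac.
      - cont_tac.
      - intros r _. rewrite H7. simpl. ring. }
    pose proof (Te_coef 0 k) as T0.
    assert (Z : coef (Te 0) k = 0).
    { unfold coef. rewrite (RInt_rext _ (fun _ => 0)); [rewrite RInt_cconst; rring|].
      intro r. unfold Te. simpl. ring. }
    rewrite Z in T0. pose proof (nu0 k).
    assert (Y : rho 1 * dpsi k 1 = - (nu k * xe 0 k)) by lra.
    rewrite Rmult_assoc, Y in X. rewrite X. field. lra. }
  assert (HT : summable (fun k => coef T k / nu k)).
  { apply (summable_weighted _ (energy T / A)). intro K.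
    apply (Rmult_le_reg_l A); auto. replace (A * (energy T / A)) with (energy T) by (field; lra).
    eapply Rle_trans; [|apply (eb_bessel _ _ _ _ _ _ Hb T K H6)]. rewrite <- ssum_scal. apply ssum_le. intros k _.
    pose proof (nu0 k). pose proof (eb_nu _ _ _ _ _ _ Hb k). pose proof (pow2_ge_0 (coef T k)).
    replace (A * (nu k * (coef T k / nu k) ^ 2)) with (A / nu k * coef T k ^ 2) by (field; lra).
    rewrite <- (Rmult_1_l (coef T k ^ 2)) at 2. apply Rmult_le_compat_r; auto.
    apply (Rmult_le_reg_r (nu k)); auto. unfold Rdiv. rewrite Rmult_assoc, Rinv_l by lra. lra. }
  apply (summable_lin (fun k => coef T k / nu k) (xe 0) (coef f) 1 (Rabs (f 1))); auto using summable_xe0; try lra.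
  - intro k. rewrite Ek. eapply Rle_trans; [apply Rabs_triang|]. rewrite (Rabs_mult (f 1)). lra.
  - apply Rabs_pos.
Qed.

End Log.

(** * Dynamics of the Fourier coefficients *)
Inductive modal : (R -> R -> R -> R) -> Prop :=
| modal_zero : modal (fun _ _ _ => 0)
| modal_term q c : cont q -> trig c -> modal (fun al t r => q r * c al t)
| modal_add f g : modal f -> modal g -> modal (fun al t r => f al t r + g al t r).

(** Uniformity in the phase matters as much as that in time, since the phase will be replaced by a
    function of angle and time. *)
Definition apx (f : R -> R -> R -> R) : Prop := forall e, 0 < e ->
  exists g, modal g /\ forall al t r, 0 <= r <= 1 -> Rabs (f al t r - g al t r) <= e.

Lemma modal_mulr q f : cont q -> modal f -> exists g, modal g /\ forall al t r, g al t r = q r * f al t r.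
Proof.
  intros Hq. induction 1 as [|p c Hp Hc|f g _ [f' [Hf Ef]] _ [g' [Hg Eg]]].
  - exists (fun _ _ _ => 0). split; [constructor|]. intros; ring.
  - exists (fun al t r => (q r * p r) * c al t). split; [constructor; cont_tac|]. intros; ring.
  - exists (fun al t r => f' al t r + g' al t r). split; [now constructor|]. intros. rewrite Ef, Eg. ring.
Qed.
Lemma apx_ext f g : (forall al t r, 0 <= r <= 1 -> f al t r = g al t r) -> apx f -> apx g.
Proof.
  intros E H e He. destruct (H e He) as [h [Hh Hb]]. exists h. split; auto. intros.
  rewrite <- E by auto. auto.
Qed.
Lemma apx_add f g : apx f -> apx g -> apx (fun al t r => f al t r + g al t r).
Proof.
  intros Hf Hg e He. destruct (Hf (e / 2)) as [f' [F1 F2]]; [lra|]. destruct (Hg (e / 2)) as [g' [G1 G2]]; [lra|].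
  exists (fun al t r => f' al t r + g' al t r). split; [now constructor|]. intros al t r Hr.
  replace (_ - _) with ((f al t r - f' al t r) + (g al t r - g' al t r)) by ring.
  eapply Rle_trans; [apply Rabs_triang|]. specialize (F2 al t r Hr). specialize (G2 al t r Hr). lra.
Qed.
Lemma apx_mulr q f : cont q -> apx f -> apx (fun al t r => q r * f al t r).
Proof.
  intros Hq Hf e He. destruct (cont_bounded_max (fun x => Rabs (q x))) as [c [Hc HM]]; [cont_tac|].
  cbv beta in HM. set (M := Rabs (q c)) in *. assert (0 <= M) by apply Rabs_pos.
  destruct (Hf (e / (M + 1))) as [g [G1 G2]]; [apply Rdiv_lt_0_compat; lra|].
  destruct (modal_mulr q g Hq G1) as [g' [G1' E]]. exists g'. split; auto. intros al t r Hr.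
  rewrite E. replace (_ - _) with (q r * (f al t r - g al t r)) by ring. rewrite Rabs_mult.
  specialize (HM r Hr). specialize (G2 al t r Hr).
  apply Rle_trans with ((M + 1) * (e / (M + 1))); [|right; field; lra].
  apply Rmult_le_compat; try apply Rabs_pos; lra.
Qed.
Lemma apx_term q c : cont q -> trig c -> apx (fun al t r => q r * c al t).
Proof.
  intros Hq Hc e He. exists (fun al t r => q r * c al t). split; [now constructor|].
  intros. rewrite Rminus_diag, Rabs_R0. lra.
Qed.
Lemma apx_zero : apx (fun _ _ _ => 0).
Proof. intros e He. exists (fun _ _ _ => 0). split; [constructor|]. intros. rewrite Rminus_diag, Rabs_R0. lra. Qed.
Lemma apx_ssum (f : nat -> R -> R -> R -> R) N : (forall k, apx (f k)) ->
  apx (fun al t r => ssum (fun k => f k al t r) N).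
Proof. intro H. induction N; simpl; [apply apx_zero|apply apx_add; auto]. Qed.
Lemma apx_lim f : (forall e, 0 < e -> exists g, apx g /\ forall al t r, 0 <= r <= 1 ->
    Rabs (f al t r - g al t r) <= e) -> apx f.
Proof.
  intros H e He. destruct (H (e / 2)) as [g [G1 G2]]; [lra|]. destruct (G1 (e / 2)) as [h [H1 H2]]; [lra|].
  exists h. split; auto. intros al t r Hr.
  replace (_ - _) with ((f al t r - g al t r) + (g al t r - h al t r)) by ring.
  eapply Rle_trans; [apply Rabs_triang|]. specialize (G2 al t r Hr). specialize (H2 al t r Hr). lra.
Qed.

Definition phase2 (fx fy : R -> R -> R) (al t r : R) : R := cos al * fx t r + sin al * fy t r.
Lemma phase2_bound fx fy al t r e : Rabs (fx t r) <= e -> Rabs (fy t r) <= e ->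
  Rabs (phase2 fx fy al t r) <= 2 * e.
Proof.
  intros H1 H2. unfold phase2. eapply Rle_trans; [apply Rabs_triang|]. rewrite !Rabs_mult.
  assert (Hc : Rabs (cos al) <= 1) by (apply Rabs_le; apply COS_bound).
  assert (Hs : Rabs (sin al) <= 1) by (apply Rabs_le; apply SIN_bound).
  pose proof (Rabs_pos (fx t r)). pose proof (Rabs_pos (fy t r)).
  pose proof (Rabs_pos (cos al)). pose proof (Rabs_pos (sin al)). nra.
Qed.

Lemma cont_slice2 (f : R -> R -> R) t : (forall t r, continuity_2d_pt f t r) -> cont (f t).
Proof.
  intros H r. specialize (H t r). apply continuity_2d_pt_filterlim in H.
  apply (continuous_comp_2 (fun _ : R => t) (fun r => r) f r); [apply continuous_const|apply continuous_id|].
  exact H.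
Qed.

Lemma is_derive_RInt_weighted (f ft : R -> R -> R) (q : R -> R) t :
  (forall t r, is_derive (fun t => f t r) t (ft t r)) ->
  (forall t r, continuity_2d_pt ft t r) -> (forall t, cont (f t)) -> cont q ->
  is_derive (fun t => RInt (fun r => f t r * q r) 0 1) t (RInt (fun r => ft t r * q r) 0 1).
Proof.
  intros Hd Hc Hf Hq. apply (is_derive_RInt_2d (fun t r => f t r * q r) (fun t r => ft t r * q r)).
  - intros x r. eapply is_derive_eq.
    + apply (is_derive_ext (fun x => q r * f x r)); [intro; apply Rmult_comm|]. apply is_derive_rscal, Hd.
    + rring.
  - intros x r. apply continuity_2d_pt_mult; auto. apply continuity_2d_pt_filterlim.
    change (continuous (fun z : R * R => q (snd z)) (x, r)).
    apply (continuous_comp snd q); [apply continuous_snd|apply Hq].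
  - intro x. pose proof (Hf x). cont_tac.
Qed.

(* Real Fourier data of one angular number n and one phase: S of the density, P and M of
   v_x + i v_y and v_x - i v_y (angular numbers n + 1 and n - 1), Q and Qm of the gradient of the
   density, Dp and Dm of divergence plus and minus vorticity of rho v, T of minus
   divergence minus vorticity of rho grad of the density.
   The suffixes t and r stand for derivatives; arguments are the time and the radius. *)
Record comp := { cS : R -> R -> R; cSt : R -> R -> R; cSr : R -> R -> R; cStr : R -> R -> R;
  cP : R -> R -> R; cPt : R -> R -> R; cPr : R -> R -> R;
  cM : R -> R -> R; cMt : R -> R -> R; cMr : R -> R -> R;
  cQ : R -> R -> R; cQr : R -> R -> R; cQm : R -> R -> R; cDp : R -> R -> R; cDm : R -> R -> R;
  cT : R -> R -> R; cQt : R -> R -> R; cQtr : R -> R -> R; cTt : R -> R -> R }.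

(** The differential relations are multiplied by r and so remain valid at the origin. *)
Record comp_ok (n : nat) (A B : R) (C : comp) : Prop := {
  ok_St : forall t r, is_derive (fun t => cS C t r) t (cSt C t r);
  ok_Pt : forall t r, is_derive (fun t => cP C t r) t (cPt C t r);
  ok_Mt : forall t r, is_derive (fun t => cM C t r) t (cMt C t r);
  ok_Stc : forall t r, continuity_2d_pt (cSt C) t r;
  ok_Ptc : forall t r, continuity_2d_pt (cPt C) t r;
  ok_Mtc : forall t r, continuity_2d_pt (cMt C) t r;
  ok_Sr : forall t r, is_derive (cS C t) r (cSr C t r);
  ok_Str : forall t r, is_derive (cSt C t) r (cStr C t r);
  ok_Pr : forall t r, is_derive (cP C t) r (cPr C t r);
  ok_Mr : forall t r, is_derive (cM C t) r (cMr C t r);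
  ok_Qr : forall t r, is_derive (cQ C t) r (cQr C t r);
  ok_Qtr : forall t r, is_derive (cQt C t) r (cQtr C t r);
  ok_Src : forall t, cont (cSr C t);
  ok_Strc : forall t, cont (cStr C t);
  ok_Prc : forall t, cont (cPr C t);
  ok_Mrc : forall t, cont (cMr C t);
  ok_Qrc : forall t, cont (cQr C t);
  ok_Qtrc : forall t, cont (cQtr C t);
  ok_Qmc : forall t, cont (cQm C t);
  ok_Dpc : forall t, cont (cDp C t);
  ok_Dmc : forall t, cont (cDm C t);
  ok_Tc : forall t, cont (cT C t);
  ok_Ttc : forall t, cont (cTt C t);
  ok_Q : forall t r, r * cQ C t r = r * cSr C t r - INR n * cS C t r;
  ok_Qm : forall t r, r * cQm C t r = r * cSr C t r + INR n * cS C t r;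
  ok_Qt : forall t r, r * cQt C t r = r * cStr C t r - INR n * cSt C t r;
  ok_Dp : forall t r, r * cDp C t r =
    r * (2 * B * r * cP C t r + rho A B r * cPr C t r) + INR (n + 1) * (rho A B r * cP C t r);
  ok_Dm : forall t r, r * cDm C t r =
    r * (2 * B * r * cM C t r + rho A B r * cMr C t r) - (INR n - 1) * (rho A B r * cM C t r);
  ok_T : forall t r, r * - cT C t r =
    r * (2 * B * r * cQ C t r + rho A B r * cQr C t r) + INR (n + 1) * (rho A B r * cQ C t r);
  ok_Tt : forall t r, r * - cTt C t r =
    r * (2 * B * r * cQt C t r + rho A B r * cQtr C t r) + INR (n + 1) * (rho A B r * cQt C t r);
  ok_bd : forall t, cS C t 1 = 0 }.

(** [X] and [Y] are the phases 0 and pi/2, real and imaginary part of one amplitude. In the rotating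
    frame the velocity amplitudes turn with frequencies - 2 w and 2 w under the Coriolis force,
    driven by the gradient of the density. *)
Record evolves (w c : R) (X Y : comp) : Prop := {
  ev_SX : forall t r, 0 <= r <= 1 -> cSt X t r = - / 2 * (cDp X t r + cDm X t r);
  ev_SY : forall t r, 0 <= r <= 1 -> cSt Y t r = - / 2 * (cDp Y t r + cDm Y t r);
  ev_PX : forall t r, 0 <= r <= 1 -> cPt X t r = 2 * w * cP Y t r - c ^ 2 * cQ X t r;
  ev_PY : forall t r, 0 <= r <= 1 -> cPt Y t r = - 2 * w * cP X t r - c ^ 2 * cQ Y t r;
  ev_MX : forall t r, 0 <= r <= 1 -> cMt X t r = - 2 * w * cM Y t r - c ^ 2 * cQm X t r;
  ev_MY : forall t r, 0 <= r <= 1 -> cMt Y t r = 2 * w * cM X t r - c ^ 2 * cQm Y t r }.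

(** * Coefficient equations and truncation estimates uniform in time *)

Section Dynamics.
Variables (n : nat) (A B : R) (psi dpsi : nat -> R -> R) (nu : nat -> R).
Variable (HA : 0 < A).
Variable (HB : 0 <= B).
Variable (Hb : eigenbasis n A B psi dpsi nu).
Local Notation rho := (rho A B).
Local Notation coef := (coef n psi).
Local Notation comb := (comb n psi).
Let cpsi k : cont (psi k) := eb_cpsi n A B psi dpsi nu Hb k.
Let cdpsi k : cont (dpsi k) := eb_cdpsi n A B psi dpsi nu Hb k.
Let crho : cont rho := cont_rho A B.

Lemma coef_lin2 f g a b k : cont f -> cont g ->
  coef (fun r => a * f r + b * g r) k = a * coef f k + b * coef g k.
Proof.
  intros Hf Hg. pose proof (cpsi k). unfold coef.
  rewrite (RInt_rext _ (fun s => a * (s ^ (n + 1) * (f s * psi k s)) + b * (s ^ (n + 1) * (g s * psi k s)))).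
  2:{ intro; ring. }
  rewrite RInt_cplus, !RInt_cscal by cont_tac. reflexivity.
Qed.

Section OneComp.
Variable (C : comp).
Variable (HC : comp_ok n A B C).
Lemma cont_cS t : cont (cS C t). Proof. apply (cont_derive _ (cSr C t)), (ok_Sr _ _ _ _ HC). Qed.
Lemma cont_cSt t : cont (cSt C t). Proof. apply (cont_derive _ (cStr C t)), (ok_Str _ _ _ _ HC). Qed.
Lemma cont_cP t : cont (cP C t). Proof. apply (cont_derive _ (cPr C t)), (ok_Pr _ _ _ _ HC). Qed.
Lemma cont_cM t : cont (cM C t). Proof. apply (cont_derive _ (cMr C t)), (ok_Mr _ _ _ _ HC). Qed.
Lemma cont_cQ t : cont (cQ C t). Proof. apply (cont_derive _ (cQr C t)), (ok_Qr _ _ _ _ HC). Qed.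

Lemma is_derive_rho_mult (f f' : R -> R) r : is_derive f r (f' r) ->
  is_derive (fun r => rho r * f r) r (2 * B * r * f r + rho r * f' r).
Proof. intro H. apply is_derive_rmult; auto. apply is_derive_rho. Qed.

Lemma is_derive_coef_S k t : is_derive (fun t => coef (cS C t) k) t (coef (cSt C t) k).
Proof.
  pose proof (cpsi k).
  apply (is_derive_ext (fun t => RInt (fun r => cS C t r * (r ^ (n + 1) * psi k r)) 0 1)).
  { intro u. apply RInt_rext. intro; ring. }
  eapply is_derive_eq.
  - apply (is_derive_RInt_weighted (cS C) (cSt C) (fun r => r ^ (n + 1) * psi k r)); [apply (ok_St _ _ _ _ HC)|apply (ok_Stc _ _ _ _ HC)|apply cont_cS|cont_tac].
  - apply RInt_rext. intro; ring.
Qed.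

(** The integration by parts comes before the differentiation in time, so that only the time
    derivative of [cP] is involved and none of its radial derivative. *)
Lemma is_derive_coef_Dp k t : is_derive (fun t => coef (cDp C t) k) t
  (- RInt (fun r => rho r * cPt C t r * (r ^ (n + 1) * dpsi k r)) 0 1).
Proof.
  pose proof (cdpsi k).
  apply (is_derive_ext (fun t => (-1) * RInt (fun r => cP C t r * (rho r * r ^ (n + 1) * dpsi k r)) 0 1)).
  { intro u. rewrite (ibp_plus n A B psi dpsi nu Hb k (fun r => rho r * cP C u r)
      (fun r => 2 * B * r * cP C u r + rho r * cPr C u r) (cDp C u)).
    - rewrite (RInt_rext (fun r => cP C u r * (rho r * r ^ (n + 1) * dpsi k r)) (fun r => rho r * cP C u r * (r ^ (n + 1) * dpsi k r))) by (intro; ring). rring.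
    - intro r. apply is_derive_rho_mult. apply (ok_Pr _ _ _ _ HC).
    - pose proof (cont_cP u). pose proof (ok_Prc _ _ _ _ HC u). cont_tac.
    - apply (ok_Dpc _ _ _ _ HC).
    - intros r _. apply (ok_Dp _ _ _ _ HC). }
  eapply is_derive_eq.
  - apply is_derive_rscal. apply (is_derive_RInt_weighted (cP C) (cPt C) (fun r => rho r * r ^ (n + 1) * dpsi k r)); [apply (ok_Pt _ _ _ _ HC)|apply (ok_Ptc _ _ _ _ HC)|apply cont_cP|cont_tac].
  - rewrite (RInt_rext (fun r => rho r * cPt C t r * (r ^ (n + 1) * dpsi k r)) (fun r => cPt C t r * (rho r * r ^ (n + 1) * dpsi k r))) by (intro; ring). rring.
Qed.

Lemma is_derive_coef_Dm k t : is_derive (fun t => coef (cDm C t) k) t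
  (- RInt (fun r => rho r * cMt C t r * (2 * INR n * r ^ n * psi k r + r ^ (n + 1) * dpsi k r)) 0 1).
Proof.
  pose proof (cdpsi k). pose proof (cpsi k).
  apply (is_derive_ext (fun t => (-1) * RInt (fun r => cM C t r * (rho r * (2 * INR n * r ^ n * psi k r + r ^ (n + 1) * dpsi k r))) 0 1)).
  { intro u. rewrite (ibp_minus n A B psi dpsi nu Hb k (fun r => rho r * cM C u r)
      (fun r => 2 * B * r * cM C u r + rho r * cMr C u r) (cDm C u)).
    - rewrite (RInt_rext (fun r => cM C u r * (rho r * (2 * INR n * r ^ n * psi k r + r ^ (n + 1) * dpsi k r))) (fun r => rho r * cM C u r * (2 * INR n * r ^ n * psi k r + r ^ (n + 1) * dpsi k r))) by (intro; ring). rring.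
    - intro r. apply is_derive_rho_mult. apply (ok_Mr _ _ _ _ HC).
    - pose proof (cont_cM u). pose proof (ok_Mrc _ _ _ _ HC u). cont_tac.
    - apply (ok_Dmc _ _ _ _ HC).
    - intros r _. apply (ok_Dm _ _ _ _ HC). }
  eapply is_derive_eq.
  - apply is_derive_rscal. apply (is_derive_RInt_weighted (cM C) (cMt C) (fun r => rho r * (2 * INR n * r ^ n * psi k r + r ^ (n + 1) * dpsi k r))); [apply (ok_Mt _ _ _ _ HC)|apply (ok_Mtc _ _ _ _ HC)|apply cont_cM|cont_tac].
  - rewrite (RInt_rext (fun r => rho r * cMt C t r * (2 * INR n * r ^ n * psi k r + r ^ (n + 1) * dpsi k r)) (fun r => cMt C t r * (rho r * (2 * INR n * r ^ n * psi k r + r ^ (n + 1) * dpsi k r)))) by (intro; ring). rring.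
Qed.

Lemma Dp_repr k t : coef (cDp C t) k = - RInt (fun r => rho r * cP C t r * (r ^ (n + 1) * dpsi k r)) 0 1.
Proof.
  apply (ibp_plus n A B psi dpsi nu Hb k (fun r => rho r * cP C t r)
      (fun r => 2 * B * r * cP C t r + rho r * cPr C t r) (cDp C t)).
  - intro r. apply is_derive_rho_mult. apply (ok_Pr _ _ _ _ HC).
  - pose proof (cont_cP t). pose proof (ok_Prc _ _ _ _ HC t). cont_tac.
  - apply (ok_Dpc _ _ _ _ HC).
  - intros r _. apply (ok_Dp _ _ _ _ HC).
Qed.
Lemma Dm_repr k t : coef (cDm C t) k = - RInt (fun r => rho r * cM C t r * (2 * INR n * r ^ n * psi k r + r ^ (n + 1) * dpsi k r)) 0 1.
Proof.
  apply (ibp_minus n A B psi dpsi nu Hb k (fun r => rho r * cM C t r)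
      (fun r => 2 * B * r * cM C t r + rho r * cMr C t r) (cDm C t)).
  - intro r. apply is_derive_rho_mult. apply (ok_Mr _ _ _ _ HC).
  - pose proof (cont_cM t). pose proof (ok_Mrc _ _ _ _ HC t). cont_tac.
  - apply (ok_Dmc _ _ _ _ HC).
  - intros r _. apply (ok_Dm _ _ _ _ HC).
Qed.

Lemma Q_pairing k t : RInt (fun r => rho r * cQ C t r * (r ^ (n + 1) * dpsi k r)) 0 1 = nu k * coef (cS C t) k.
Proof.
  pose proof (ibp_general n A B psi dpsi nu Hb k (cS C t) (cSr C t) (ok_Sr _ _ _ _ HC t) (ok_Src _ _ _ _ HC t)) as E.
  rewrite (ok_bd _ _ _ _ HC) in E.
  rewrite (RInt_rext (fun r => rho r * cQ C t r * (r ^ (n + 1) * dpsi k r)) (fun r => rho r * r ^ n * dpsi k r * (r * cSr C t r - INR n * cS C t r))).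
  - rewrite E. rring.
  - intro r. rewrite <- (ok_Q _ _ _ _ HC), pow_add, pow_1. ring.
Qed.

Lemma T_coef k t : coef (cT C t) k = nu k * coef (cS C t) k.
Proof.
  pose proof (ibp_plus n A B psi dpsi nu Hb k (fun r => rho r * cQ C t r)
      (fun r => 2 * B * r * cQ C t r + rho r * cQr C t r) (fun r => - cT C t r)) as E.
  assert (En : coef (fun r => - cT C t r) k = - coef (cT C t) k).
  { unfold coef. rewrite <- RInt_copp; [apply RInt_rext; intro; ring|].
    pose proof (cpsi k). pose proof (ok_Tc _ _ _ _ HC t). cont_tac. }
  rewrite En, Q_pairing in E. apply Ropp_eq_reg. apply E.
  - intro r. apply is_derive_rho_mult. apply (ok_Qr _ _ _ _ HC).
  - pose proof (cont_cQ t). pose proof (ok_Qrc _ _ _ _ HC t). cont_tac.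
  - pose proof (ok_Tc _ _ _ _ HC t). cont_tac.
  - intros r _. apply (ok_T _ _ _ _ HC).
Qed.

Lemma St_bd t : cSt C t 1 = 0.
Proof.
  pose proof (is_derive_unique _ _ _ (ok_St _ _ _ _ HC t 1)) as E. rewrite <- E.
  rewrite (Derive_ext _ (fun _ => 0)); [apply Derive_const|]. intro; apply (ok_bd _ _ _ _ HC).
Qed.

Lemma Tt_coef k t : coef (cTt C t) k = nu k * coef (cSt C t) k.
Proof.
  pose proof (ibp_general n A B psi dpsi nu Hb k (cSt C t) (cStr C t) (ok_Str _ _ _ _ HC t) (ok_Strc _ _ _ _ HC t)) as E0.
  rewrite St_bd in E0.
  pose proof (ibp_plus n A B psi dpsi nu Hb k (fun r => rho r * cQt C t r)
      (fun r => 2 * B * r * cQt C t r + rho r * cQtr C t r) (fun r => - cTt C t r)) as E.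
  assert (En : coef (fun r => - cTt C t r) k = - coef (cTt C t) k).
  { unfold coef. rewrite <- RInt_copp; [apply RInt_rext; intro; ring|].
    pose proof (cpsi k). pose proof (ok_Ttc _ _ _ _ HC t). cont_tac. }
  rewrite En in E.
  rewrite (RInt_rext (fun r => rho r * cQt C t r * (r ^ (n + 1) * dpsi k r)) (fun r => rho r * r ^ n * dpsi k r * (r * cStr C t r - INR n * cSt C t r))) in E.
  2:{ intro r. rewrite <- (ok_Qt _ _ _ _ HC), pow_add, pow_1. ring. }
  rewrite E0 in E. apply Ropp_eq_reg. rewrite E.
  - rring.
  - intro r. apply is_derive_rho_mult. apply (ok_Qtr _ _ _ _ HC).
  - assert (cont (cQt C t)) by (apply (cont_derive _ (cQtr C t)), (ok_Qtr _ _ _ _ HC)).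
    pose proof (ok_Qtrc _ _ _ _ HC t). cont_tac.
  - pose proof (ok_Ttc _ _ _ _ HC t). cont_tac.
  - intros r _. apply (ok_Tt _ _ _ _ HC).
Qed.

(** [cQm] and [cQ] differ by 2 n S / r, so this pairing and that of [Q_pairing] differ by an exact
    derivative, except where the derivative falls on rho: rho' = 2 B r produces - 4 n B. This is the
    shift that separates the two coupling constants. *)
Lemma Qm_pairing k t :
  RInt (fun r => rho r * cQm C t r * (2 * INR n * r ^ n * psi k r + r ^ (n + 1) * dpsi k r)) 0 1
  = (nu k - 4 * INR n * B) * coef (cS C t) k.
Proof.
  pose proof (cpsi k). pose proof (cdpsi k). pose proof (cont_cS t). pose proof (ok_Src _ _ _ _ HC t).
  pose proof (ok_Qmc _ _ _ _ HC t).
  pose proof (ibp_general n A B psi dpsi nu Hb k (cS C t) (cSr C t) (ok_Sr _ _ _ _ HC t) (ok_Src _ _ _ _ HC t)) as E.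
  rewrite (ok_bd _ _ _ _ HC) in E.
  destruct (Nat.eq_dec n 0) as [E0|Hn].
  - rewrite (RInt_rext _ (fun r => rho r * r ^ n * dpsi k r * (r * cSr C t r - INR n * cS C t r))).
    + rewrite E. rewrite E0. simpl. rring.
    + intro r. pose proof (ok_Qm _ _ _ _ HC t r) as HQ. rewrite E0 in *. simpl in *.
      replace (r * cSr C t r - 0 * cS C t r) with (r * cQm C t r) by lra. ring.
  - set (F := fun r => 2 * INR n * (rho r * r ^ n * (psi k r * cS C t r))).
    assert (E2 : RInt (fun r => rho r * cQm C t r * (2 * INR n * r ^ n * psi k r + r ^ (n + 1) * dpsi k r)
       - rho r * r ^ n * dpsi k r * (r * cSr C t r - INR n * cS C t r) + 4 * INR n * B * (r ^ (n + 1) * (cS C t r * psi k r))) 0 1 = F 1 - F 0).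
    { apply (RInt_cderive_open _ F); [lra|cont_tac|unfold F; cont_tac|].
      intros r Hr. eapply is_derive_eq.
      { apply is_derive_rscal. apply is_derive_rmult.
        - apply is_derive_rmult; [apply is_derive_rho|apply is_derive_rpow].
        - apply is_derive_rmult; [apply (eb_derive _ _ _ _ _ _ Hb)|apply (ok_Sr _ _ _ _ HC)]. }
      cbv beta. match goal with |- ?a = ?b => change (@eq R a b) end.
      assert (En : r ^ n = r * r ^ pred n).
      { rewrite tech_pow_Rmult. f_equal. lia. }
      replace (cQm C t r) with ((r * cQm C t r) / r) by (field; lra). rewrite (ok_Qm _ _ _ _ HC).
      rewrite pow_add, pow_1, En. field. lra. }
    unfold F in E2. rewrite (ok_bd _ _ _ _ HC), (pow_ne_zero n) in E2 by auto.
    rewrite RInt_cplus, RInt_cminus, RInt_cscal, E in E2 by cont_tac.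
    unfold coef. unfold coef in E2. match goal with |- ?a = ?b => change (@eq R a b) end. lra.
Qed.

End OneComp.

Variables (w c : R) (X Y : comp).
Variable (Hc : 0 < c).
Variable (HX : comp_ok n A B X).
Variable (HY : comp_ok n A B Y).
Variable (Hev : evolves w c X Y).

Let ak k := c ^ 2 * nu k.
Let bk k := c ^ 2 * (nu k - 4 * INR n * B).
Lemma nu_pos' k : 0 < nu k.
Proof. pose proof (eb_nu _ _ _ _ _ _ Hb k). lra. Qed.
Lemma ak_pos k : 0 < ak k.
Proof. unfold ak. pose proof (nu_pos' k). assert (0 < c ^ 2) by now apply pow_lt. nra. Qed.
Lemma bk_ge k : A / (A + B) * ak k <= bk k.
Proof.
  unfold ak, bk. pose proof (nu_gap n A B psi dpsi nu HA HB Hb k) as G.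
  assert (0 < c ^ 2) by now apply pow_lt.
  replace (A / (A + B) * (c ^ 2 * nu k)) with (c ^ 2 * (A / (A + B) * nu k)) by ring.
  apply Rmult_le_compat_l; lra.
Qed.
Lemma bk_pos k : 0 < bk k.
Proof.
  pose proof (bk_ge k). pose proof (ak_pos k). assert (0 < A / (A + B)) by (apply Rdiv_lt_0_compat; lra). nra.
Qed.

Definition sX k t := coef (cS X t) k.
Definition sY k t := coef (cS Y t) k.
Definition pX k t := coef (cDp X t) k.
Definition pY k t := coef (cDp Y t) k.
Definition mX k t := coef (cDm X t) k.
Definition mY k t := coef (cDm Y t) k.

Lemma St_coef C : comp_ok n A B C ->
  (forall t r, 0 <= r <= 1 -> cSt C t r = - / 2 * (cDp C t r + cDm C t r)) ->
  forall k t, coef (cSt C t) k = - / 2 * (coef (cDp C t) k + coef (cDm C t) k).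
Proof.
  intros H E k t. transitivity (coef (fun r => - / 2 * cDp C t r + - / 2 * cDm C t r) k).
  - apply RInt_cext; [lra|]. intros r Hr. rewrite E by auto. ring.
  - rewrite coef_lin2; [ring|apply (ok_Dpc _ _ _ _ H)|apply (ok_Dmc _ _ _ _ H)].
Qed.

Lemma ode_sX k t : is_derive (sX k) t (- / 2 * (pX k t + mX k t)).
Proof. eapply is_derive_eq; [apply (is_derive_coef_S X HX)|]. apply St_coef; auto. apply (ev_SX _ _ _ _ Hev). Qed.
Lemma ode_sY k t : is_derive (sY k) t (- / 2 * (pY k t + mY k t)).
Proof. eapply is_derive_eq; [apply (is_derive_coef_S Y HY)|]. apply St_coef; auto. apply (ev_SY _ _ _ _ Hev). Qed.

Lemma pairing_split (f g h q : R -> R) (a b : R) : cont g -> cont h -> cont q ->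
  (forall r, 0 <= r <= 1 -> f r = a * g r - b * h r) ->
  RInt (fun r => rho r * f r * q r) 0 1
  = a * RInt (fun r => rho r * g r * q r) 0 1 - b * RInt (fun r => rho r * h r * q r) 0 1.
Proof.
  intros Hg Hh Hq E.
  rewrite (RInt_cext _ (fun r => a * (rho r * g r * q r) - b * (rho r * h r * q r))); [|lra|].
  - rewrite RInt_cminus, !RInt_cscal by cont_tac. reflexivity.
  - intros r Hr. rewrite E by auto. ring.
Qed.

Lemma cont_dp k : cont (fun r => r ^ (n + 1) * dpsi k r).
Proof. pose proof (cdpsi k). cont_tac. Qed.
Lemma cont_dm k : cont (fun r => 2 * INR n * r ^ n * psi k r + r ^ (n + 1) * dpsi k r).
Proof. pose proof (cdpsi k). pose proof (cpsi k). cont_tac. Qed.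

Lemma ode_pX k t : is_derive (pX k) t (2 * w * pY k t + ak k * sX k t).
Proof.
  eapply is_derive_eq; [apply (is_derive_coef_Dp X HX)|].
  rewrite (pairing_split _ (cP Y t) (cQ X t) _ (2 * w) (c ^ 2)); auto using cont_cP, cont_cQ, cont_dp.
  - rewrite (Q_pairing X HX). unfold pY. rewrite (Dp_repr Y HY). unfold ak, sX. rring.
  - apply (ev_PX _ _ _ _ Hev).
Qed.
Lemma ode_pY k t : is_derive (pY k) t (- 2 * w * pX k t + ak k * sY k t).
Proof.
  eapply is_derive_eq; [apply (is_derive_coef_Dp Y HY)|].
  rewrite (pairing_split _ (cP X t) (cQ Y t) _ (- 2 * w) (c ^ 2)); auto using cont_cP, cont_cQ, cont_dp.
  - rewrite (Q_pairing Y HY). unfold pX. rewrite (Dp_repr X HX). unfold ak, sY. rring.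
  - apply (ev_PY _ _ _ _ Hev).
Qed.
Lemma ode_mX k t : is_derive (mX k) t (- 2 * w * mY k t + bk k * sX k t).
Proof.
  eapply is_derive_eq; [apply (is_derive_coef_Dm X HX)|].
  rewrite (pairing_split _ (cM Y t) (cQm X t) _ (- 2 * w) (c ^ 2)); auto using cont_cM, cont_dm.
  - rewrite (Qm_pairing X HX). unfold mY. rewrite (Dm_repr Y HY). unfold bk, sX. rring.
  - apply (ok_Qmc _ _ _ _ HX).
  - apply (ev_MX _ _ _ _ Hev).
Qed.
Lemma ode_mY k t : is_derive (mY k) t (2 * w * mX k t + bk k * sY k t).
Proof.
  eapply is_derive_eq; [apply (is_derive_coef_Dm Y HY)|].
  rewrite (pairing_split _ (cM X t) (cQm Y t) _ (2 * w) (c ^ 2)); auto using cont_cM, cont_dm.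
  - rewrite (Qm_pairing Y HY). unfold mX. rewrite (Dm_repr X HX). unfold bk, sY. rring.
  - apply (ok_Qmc _ _ _ _ HY).
  - apply (ev_MY _ _ _ _ Hev).
Qed.

(** The initial data of the triple and of its time derivative, each scalar accompanied by its image
    under the operator; this suffices to bound both conserved forms. *)
Definition init (k : nat) : R :=
  (coef (cS X 0) k ^ 2 + coef (cT X 0) k ^ 2 + coef (cDp X 0) k ^ 2 + coef (cDm X 0) k ^ 2
   + coef (cSt X 0) k ^ 2 + coef (cTt X 0) k ^ 2) +
  (coef (cS Y 0) k ^ 2 + coef (cT Y 0) k ^ 2 + coef (cDp Y 0) k ^ 2 + coef (cDm Y 0) k ^ 2
   + coef (cSt Y 0) k ^ 2 + coef (cTt Y 0) k ^ 2).
Definition init_energy : R :=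
  (energy (cS X 0) + energy (cT X 0) + energy (cDp X 0) + energy (cDm X 0)
   + energy (cSt X 0) + energy (cTt X 0)) +
  (energy (cS Y 0) + energy (cT Y 0) + energy (cDp Y 0) + energy (cDm Y 0)
   + energy (cSt Y 0) + energy (cTt Y 0)).

Lemma init_ge0 k : 0 <= init k.
Proof. unfold init. repeat apply Rplus_le_le_0_compat; apply pow2_ge_0. Qed.
Lemma init_sum K : ssum init K <= init_energy.
Proof.
  unfold init, init_energy. rewrite !ssum_plus.
  repeat apply Rplus_le_compat; apply (eb_bessel _ _ _ _ _ _ Hb).
  - exact (cont_cS X HX 0).
  - exact (ok_Tc _ _ _ _ HX 0).
  - exact (ok_Dpc _ _ _ _ HX 0).
  - exact (ok_Dmc _ _ _ _ HX 0).
  - exact (cont_cSt X HX 0).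
  - exact (ok_Ttc _ _ _ _ HX 0).
  - exact (cont_cS Y HY 0).
  - exact (ok_Tc _ _ _ _ HY 0).
  - exact (ok_Dpc _ _ _ _ HY 0).
  - exact (ok_Dmc _ _ _ _ HY 0).
  - exact (cont_cSt Y HY 0).
  - exact (ok_Ttc _ _ _ _ HY 0).
Qed.

Let th := (A + B) / A.
Let K1 := c ^ 2 + th.
Let K2 := c ^ 2 + th * (8 * w ^ 2 + 4 * c ^ 4).
Definition amp : R := K1 + (2 * K2 + 8 * w ^ 2 * K1) / c ^ 4.

(** [nu_gap] in the form needed: the conserved form and the plain sum of squares of the velocity
    coefficients are comparable, uniformly in [n] and [k]. *)
Lemma ratio_bounds k : 1 <= ak k / bk k <= th.
Proof.
  pose proof (ak_pos k) as H1. pose proof (bk_pos k) as H2. pose proof (bk_ge k) as H3.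
  assert (H4 : bk k <= ak k).
  { unfold ak, bk. assert (0 < c ^ 2) by now apply pow_lt. pose proof (pos_INR n).
    apply Rmult_le_compat_l; [lra|]. assert (0 <= INR n * B) by now apply Rmult_le_pos. lra. }
  split.
  - apply (Rmult_le_reg_r (bk k)); auto. unfold Rdiv. rewrite Rmult_assoc, Rinv_l; lra.
  - apply (Rmult_le_reg_r (bk k)); auto. unfold Rdiv at 1. rewrite Rmult_assoc, Rinv_l, Rmult_1_r by lra.
    apply Rle_trans with (th * (A / (A + B) * ak k)); [right; unfold th; field; lra|].
    apply Rmult_le_compat_l; auto. unfold th. apply Rdiv_le_0_compat; lra.
Qed.
Lemma th_ge1 : 1 <= th.
Proof. pose proof (ratio_bounds 0). lra. Qed.
Lemma c2_pos : 0 < c ^ 2. Proof. now apply pow_lt. Qed.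

Lemma scal_coef_bound k s T : T = nu k * s -> 2 * ak k * s ^ 2 <= c ^ 2 * (s ^ 2 + T ^ 2).
Proof.
  intros ->. unfold ak. pose proof c2_pos.
  replace (2 * (c ^ 2 * nu k) * s ^ 2) with (c ^ 2 * (2 * s * (nu k * s))) by ring.
  apply Rmult_le_compat_l; [lra|]. pose proof (pow2_ge_0 (s - nu k * s)). nra.
Qed.

(** Conservation of the form; its density part at time 0 is 2 c^2 s (nu s) <= c^2 (s^2 + T^2), with
    T = nu s a coefficient of the initial data. *)
Lemma coef_bound_pm k t : pX k t ^ 2 + pY k t ^ 2 + (mX k t ^ 2 + mY k t ^ 2) <= K1 * init k.
Proof.
  pose proof (triple_energy w (ak k) (bk k) _ _ _ _ _ _ (bk_pos k) (ode_sX k) (ode_sY k) (ode_pX k) (ode_pY k) (ode_mX k) (ode_mY k) t) as E.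
  pose proof (ratio_bounds k) as [R1 R2]. pose proof (ak_pos k). pose proof c2_pos. pose proof th_ge1.
  pose proof (scal_coef_bound k (sX k 0) _ (T_coef X HX k 0)) as S1.
  pose proof (scal_coef_bound k (sY k 0) _ (T_coef Y HY k 0)) as S2.
  fold (sX k 0) in S1. fold (sY k 0) in S2.
  set (tx := coef (cT X 0) k) in *. set (ty := coef (cT Y 0) k) in *.
  assert (Hi : sX k 0 ^ 2 + tx ^ 2 + (sY k 0 ^ 2 + ty ^ 2) + (pX k 0 ^ 2 + pY k 0 ^ 2) + (mX k 0 ^ 2 + mY k 0 ^ 2) <= init k).
  { unfold init, sX, sY, pX, pY, mX, mY, tx, ty.
    pose proof (pow2_ge_0 (coef (cSt X 0) k)). pose proof (pow2_ge_0 (coef (cSt Y 0) k)).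
    pose proof (pow2_ge_0 (coef (cTt X 0) k)). pose proof (pow2_ge_0 (coef (cTt Y 0) k)). lra. }
  pose proof (pow2_ge_0 (sX k t)). pose proof (pow2_ge_0 (sY k t)).
  pose proof (pow2_ge_0 (mX k t)). pose proof (pow2_ge_0 (mY k t)).
  pose proof (pow2_ge_0 (sX k 0)). pose proof (pow2_ge_0 (sY k 0)).
  pose proof (pow2_ge_0 (mX k 0)). pose proof (pow2_ge_0 (mY k 0)).
  pose proof (pow2_ge_0 (pX k 0)). pose proof (pow2_ge_0 (pY k 0)).
  pose proof (pow2_ge_0 tx). pose proof (pow2_ge_0 ty).
  assert (L1 : mX k t ^ 2 + mY k t ^ 2 <= ak k / bk k * (mX k t ^ 2 + mY k t ^ 2)) by nra.
  assert (L2 : ak k / bk k * (mX k 0 ^ 2 + mY k 0 ^ 2) <= th * (mX k 0 ^ 2 + mY k 0 ^ 2)) by nra.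
  assert (L3 : 0 <= 2 * ak k * (sX k t ^ 2 + sY k t ^ 2)) by nra.
  assert (L4 : pX k 0 ^ 2 + pY k 0 ^ 2 <= th * (pX k 0 ^ 2 + pY k 0 ^ 2)) by nra.
  apply Rle_trans with (K1 * (sX k 0 ^ 2 + tx ^ 2 + (sY k 0 ^ 2 + ty ^ 2) + (pX k 0 ^ 2 + pY k 0 ^ 2) + (mX k 0 ^ 2 + mY k 0 ^ 2))).
  - unfold K1.
    assert (L5 : 0 <= th * (sX k 0 ^ 2 + tx ^ 2 + (sY k 0 ^ 2 + ty ^ 2))) by (apply Rmult_le_pos; lra).
    assert (L6 : 0 <= c ^ 2 * ((pX k 0 ^ 2 + pY k 0 ^ 2) + (mX k 0 ^ 2 + mY k 0 ^ 2))) by (apply Rmult_le_pos; lra).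
    lra.
  - apply Rmult_le_compat_l; [unfold K1; lra|auto].
Qed.

Lemma sq_sum_le u v : (u + v) ^ 2 <= 2 * u ^ 2 + 2 * v ^ 2.
Proof. pose proof (pow2_ge_0 (u - v)). nra. Qed.

(** Conservation of the form for the time derivative of the triple, which solves the same linear
    system. *)
Lemma coef_bound_dp k t :
  (2 * w * pY k t + ak k * sX k t) ^ 2 + (- 2 * w * pX k t + ak k * sY k t) ^ 2 <= K2 * init k.
Proof.
  set (a := ak k). set (b := bk k).
  set (sx1 := fun t => - / 2 * (pX k t + mX k t)). set (sy1 := fun t => - / 2 * (pY k t + mY k t)).
  set (px1 := fun t => 2 * w * pY k t + a * sX k t). set (py1 := fun t => - 2 * w * pX k t + a * sY k t).
  set (mx1 := fun t => - 2 * w * mY k t + b * sX k t). set (my1 := fun t => 2 * w * mX k t + b * sY k t).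
  assert (D1 : forall t, is_derive sx1 t (- / 2 * (px1 t + mx1 t))).
  { intro u. apply is_derive_rscal, is_derive_rplus; [apply ode_pX|apply ode_mX]. }
  assert (D2 : forall t, is_derive sy1 t (- / 2 * (py1 t + my1 t))).
  { intro u. apply is_derive_rscal, is_derive_rplus; [apply ode_pY|apply ode_mY]. }
  assert (D3 : forall t, is_derive px1 t (2 * w * py1 t + a * sx1 t)).
  { intro u. apply is_derive_rplus; apply is_derive_rscal; [apply ode_pY|apply ode_sX]. }
  assert (D4 : forall t, is_derive py1 t (- 2 * w * px1 t + a * sy1 t)).
  { intro u. apply is_derive_rplus; apply is_derive_rscal; [apply ode_pX|apply ode_sY]. }
  assert (D5 : forall t, is_derive mx1 t (- 2 * w * my1 t + b * sx1 t)).
  { intro u. apply is_derive_rplus; apply is_derive_rscal; [apply ode_mY|apply ode_sX]. }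
  assert (D6 : forall t, is_derive my1 t (2 * w * mx1 t + b * sy1 t)).
  { intro u. apply is_derive_rplus; apply is_derive_rscal; [apply ode_mX|apply ode_sY]. }
  pose proof (triple_energy w a b _ _ _ _ _ _ (bk_pos k) D1 D2 D3 D4 D5 D6 t) as E.
  pose proof (ratio_bounds k) as [R1 R2]. fold a b in R1, R2.
  pose proof (ak_pos k) as Ha. fold a in Ha. pose proof c2_pos as Hc2. pose proof th_ge1 as Hth.
  assert (S1 : 2 * a * sx1 0 ^ 2 <= c ^ 2 * (coef (cSt X 0) k ^ 2 + coef (cTt X 0) k ^ 2)).
  { replace (sx1 0) with (coef (cSt X 0) k).
    - apply scal_coef_bound. apply (Tt_coef X HX).
    - apply St_coef; auto. apply (ev_SX _ _ _ _ Hev). }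
  assert (S2 : 2 * a * sy1 0 ^ 2 <= c ^ 2 * (coef (cSt Y 0) k ^ 2 + coef (cTt Y 0) k ^ 2)).
  { replace (sy1 0) with (coef (cSt Y 0) k).
    - apply scal_coef_bound. apply (Tt_coef Y HY).
    - apply St_coef; auto. apply (ev_SY _ _ _ _ Hev). }
  assert (Tx : a * sX k 0 = c ^ 2 * coef (cT X 0) k) by (rewrite (T_coef X HX); unfold a, ak, sX; ring).
  assert (Ty : a * sY k 0 = c ^ 2 * coef (cT Y 0) k) by (rewrite (T_coef Y HY); unfold a, ak, sY; ring).
  assert (Hba : 0 < b <= a).
  { unfold b, a. split; [apply bk_pos|]. unfold ak, bk. pose proof (pos_INR n).
    apply Rmult_le_compat_l; [lra|]. assert (0 <= INR n * B) by now apply Rmult_le_pos. lra. }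
  assert (Bx : (b * sX k 0) ^ 2 <= (a * sX k 0) ^ 2).
  { rewrite !Rpow_mult_distr. apply Rmult_le_compat_r; [apply pow2_ge_0|]. apply pow_incr. lra. }
  assert (By : (b * sY k 0) ^ 2 <= (a * sY k 0) ^ 2).
  { rewrite !Rpow_mult_distr. apply Rmult_le_compat_r; [apply pow2_ge_0|]. apply pow_incr. lra. }
  rewrite Tx in Bx. rewrite Ty in By.
  pose proof (sq_sum_le (2 * w * pY k 0) (a * sX k 0)) as P1. pose proof (sq_sum_le (- 2 * w * pX k 0) (a * sY k 0)) as P2.
  pose proof (sq_sum_le (- 2 * w * mY k 0) (b * sX k 0)) as P3. pose proof (sq_sum_le (2 * w * mX k 0) (b * sY k 0)) as P4.
  rewrite Tx in P1. rewrite Ty in P2. fold (px1 0) in P1. fold (py1 0) in P2. fold (mx1 0) in P3. fold (my1 0) in P4.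
  rewrite <- Tx in P1. fold (px1 0) in P1. rewrite Tx in P1.
  rewrite <- Ty in P2. fold (py1 0) in P2. rewrite Ty in P2.
  change ((2 * w * pY k t + a * sX k t) ^ 2 + (- 2 * w * pX k t + a * sY k t) ^ 2) with (px1 t ^ 2 + py1 t ^ 2).
  assert (Hi : (coef (cT X 0) k ^ 2 + coef (cT Y 0) k ^ 2) + (pX k 0 ^ 2 + pY k 0 ^ 2) + (mX k 0 ^ 2 + mY k 0 ^ 2)
     + (coef (cSt X 0) k ^ 2 + coef (cTt X 0) k ^ 2 + (coef (cSt Y 0) k ^ 2 + coef (cTt Y 0) k ^ 2)) <= init k).
  { unfold init, pX, pY, mX, mY.
    pose proof (pow2_ge_0 (coef (cS X 0) k)). pose proof (pow2_ge_0 (coef (cS Y 0) k)). lra. }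
  set (tx := coef (cT X 0) k) in *. set (ty := coef (cT Y 0) k) in *.
  set (st := coef (cSt X 0) k ^ 2 + coef (cTt X 0) k ^ 2 + (coef (cSt Y 0) k ^ 2 + coef (cTt Y 0) k ^ 2)) in *.
  assert (Hst : 0 <= st) by (unfold st; repeat apply Rplus_le_le_0_compat; apply pow2_ge_0).
  pose proof (pow2_ge_0 tx). pose proof (pow2_ge_0 ty).
  pose proof (pow2_ge_0 (sx1 t)). pose proof (pow2_ge_0 (sy1 t)).
  pose proof (pow2_ge_0 (mx1 t)). pose proof (pow2_ge_0 (my1 t)).
  pose proof (pow2_ge_0 (mx1 0)). pose proof (pow2_ge_0 (my1 0)).
  pose proof (pow2_ge_0 (px1 0)). pose proof (pow2_ge_0 (py1 0)).
  pose proof (pow2_ge_0 (mX k 0)). pose proof (pow2_ge_0 (mY k 0)).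
  pose proof (pow2_ge_0 (pX k 0)). pose proof (pow2_ge_0 (pY k 0)). pose proof (pow2_ge_0 w).
  assert (L1 : 0 <= a / b * (mx1 t ^ 2 + my1 t ^ 2)) by (apply Rmult_le_pos; lra).
  assert (L2 : a / b * (mx1 0 ^ 2 + my1 0 ^ 2) <= th * (mx1 0 ^ 2 + my1 0 ^ 2)) by (apply Rmult_le_compat_r; lra).
  assert (L3 : 0 <= 2 * a * (sx1 t ^ 2 + sy1 t ^ 2)) by (apply Rmult_le_pos; lra).
  assert (L4 : px1 0 ^ 2 + py1 0 ^ 2 <= th * (px1 0 ^ 2 + py1 0 ^ 2)).
  { rewrite <- (Rmult_1_l (px1 0 ^ 2 + py1 0 ^ 2)) at 1. apply Rmult_le_compat_r; lra. }
  set (U := (tx ^ 2 + ty ^ 2) + (pX k 0 ^ 2 + pY k 0 ^ 2) + (mX k 0 ^ 2 + mY k 0 ^ 2)) in *.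
  assert (L5 : (px1 0 ^ 2 + py1 0 ^ 2) + (mx1 0 ^ 2 + my1 0 ^ 2) <= (8 * w ^ 2 + 4 * c ^ 4) * U).
  { assert (N1 : 0 <= 4 * c ^ 4 * ((pX k 0 ^ 2 + pY k 0 ^ 2) + (mX k 0 ^ 2 + mY k 0 ^ 2))).
    { apply Rmult_le_pos; [|lra]. pose proof (pow_lt c 4 Hc). lra. }
    assert (N2 : 0 <= 8 * w ^ 2 * (tx ^ 2 + ty ^ 2)) by (apply Rmult_le_pos; lra).
    unfold U. rewrite !Rpow_mult_distr in P1, P2, P3, P4, Bx, By.
    replace ((c ^ 2) ^ 2) with (c ^ 4) in * by ring. lra. }
  assert (L6 : th * ((px1 0 ^ 2 + py1 0 ^ 2) + (mx1 0 ^ 2 + my1 0 ^ 2)) <= th * ((8 * w ^ 2 + 4 * c ^ 4) * U))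
    by (apply Rmult_le_compat_l; lra).
  assert (HU : 0 <= U) by (unfold U; lra).
  assert (HK : 0 <= th * (8 * w ^ 2 + 4 * c ^ 4)).
  { apply Rmult_le_pos; [lra|]. pose proof (pow_lt c 4 Hc). lra. }
  apply Rle_trans with (K2 * (U + st)).
  - unfold K2. assert (0 <= c ^ 2 * U) by (apply Rmult_le_pos; lra).
    assert (0 <= th * (8 * w ^ 2 + 4 * c ^ 4) * st) by (apply Rmult_le_pos; lra).
    assert (2 * a * (sx1 0 ^ 2 + sy1 0 ^ 2) <= c ^ 2 * st) by (unfold st; lra). lra.
  - apply Rmult_le_compat_l; [unfold K2; lra|unfold st in *; lra].
Qed.

(** The equation for the plus amplitude is solved for its forcing [ak k * s], which is c^2 times the
    coefficient of [cT]: it is the time derivative of that amplitude up to the Coriolis term. *)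
Lemma coef_bound_T k t : coef (cT X t) k ^ 2 + coef (cT Y t) k ^ 2 <= (2 * K2 + 8 * w ^ 2 * K1) / c ^ 4 * init k.
Proof.
  pose proof (coef_bound_dp k t) as H1. pose proof (coef_bound_pm k t) as H2.
  assert (Tx : c ^ 2 * coef (cT X t) k = (2 * w * pY k t + ak k * sX k t) + (- (2 * w * pY k t)))
    by (rewrite (T_coef X HX); unfold ak, sX; ring).
  assert (Ty : c ^ 2 * coef (cT Y t) k = (- 2 * w * pX k t + ak k * sY k t) + (2 * w * pX k t))
    by (rewrite (T_coef Y HY); unfold ak, sY; ring).
  pose proof (sq_sum_le (2 * w * pY k t + ak k * sX k t) (- (2 * w * pY k t))) as S1. rewrite <- Tx in S1.
  pose proof (sq_sum_le (- 2 * w * pX k t + ak k * sY k t) (2 * w * pX k t)) as S2. rewrite <- Ty in S2.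
  pose proof (pow_lt c 4 Hc) as H4.
  apply (Rmult_le_reg_l (c ^ 4)); auto.
  replace (c ^ 4 * ((2 * K2 + 8 * w ^ 2 * K1) / c ^ 4 * init k)) with (2 * (K2 * init k) + 8 * w ^ 2 * (K1 * init k)) by (field; lra).
  pose proof (pow2_ge_0 (mX k t)). pose proof (pow2_ge_0 (mY k t)). pose proof (pow2_ge_0 w).
  assert (8 * w ^ 2 * (pX k t ^ 2 + pY k t ^ 2) <= 8 * w ^ 2 * (K1 * init k)) by (apply Rmult_le_compat_l; lra).
  replace (c ^ 4 * (coef (cT X t) k ^ 2 + coef (cT Y t) k ^ 2)) with ((c ^ 2 * coef (cT X t) k) ^ 2 + (c ^ 2 * coef (cT Y t) k) ^ 2) by ring.
  assert (E1 : (- (2 * w * pY k t)) ^ 2 = 4 * w ^ 2 * pY k t ^ 2) by ring.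
  assert (E2 : (2 * w * pX k t) ^ 2 = 4 * w ^ 2 * pX k t ^ 2) by ring.
  rewrite E1 in S1. rewrite E2 in S2. lra.
Qed.

Lemma K1_pos : 0 < K1. Proof. unfold K1. pose proof c2_pos. pose proof th_ge1. lra. Qed.
Lemma K2_pos : 0 < K2.
Proof.
  unfold K2. pose proof c2_pos. pose proof th_ge1. pose proof (pow_lt c 4 Hc). pose proof (pow2_ge_0 w).
  assert (0 <= th * (8 * w ^ 2 + 4 * c ^ 4)) by (apply Rmult_le_pos; lra). lra.
Qed.
Lemma amp_ge : K1 <= amp /\ (2 * K2 + 8 * w ^ 2 * K1) / c ^ 4 <= amp.
Proof.
  pose proof K1_pos. pose proof K2_pos. pose proof (pow_lt c 4 Hc). pose proof (pow2_ge_0 w).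
  assert (0 <= (2 * K2 + 8 * w ^ 2 * K1) / c ^ 4).
  { apply Rdiv_le_0_compat; auto. assert (0 <= 8 * w ^ 2 * K1) by (apply Rmult_le_pos; lra). lra. }
  unfold amp. lra.
Qed.
Lemma coef_bounds k t : pX k t ^ 2 <= amp * init k /\ pY k t ^ 2 <= amp * init k /\
  mX k t ^ 2 <= amp * init k /\ mY k t ^ 2 <= amp * init k /\
  coef (cT X t) k ^ 2 <= amp * init k /\ coef (cT Y t) k ^ 2 <= amp * init k.
Proof.
  pose proof (coef_bound_pm k t). pose proof (coef_bound_T k t). destruct amp_ge as [A1 A2].
  pose proof (init_ge0 k).
  assert (K1 * init k <= amp * init k) by (apply Rmult_le_compat_r; auto).
  assert ((2 * K2 + 8 * w ^ 2 * K1) / c ^ 4 * init k <= amp * init k) by (apply Rmult_le_compat_r; auto).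
  pose proof (pow2_ge_0 (mX k t)). pose proof (pow2_ge_0 (mY k t)). pose proof (pow2_ge_0 (pX k t)).
  pose proof (pow2_ge_0 (pY k t)). pose proof (pow2_ge_0 (coef (cT X t) k)). pose proof (pow2_ge_0 (coef (cT Y t) k)).
  repeat split; lra.
Qed.
Lemma amp_pos : 0 < amp. Proof. pose proof amp_ge. pose proof K1_pos. lra. Qed.

Definition tailb (N : nat) (e : R) : Prop :=
  0 <= e /\ forall K, (N <= K)%nat -> amp * (ssum init K - ssum init N) <= e ^ 2.

Lemma tailb_exists e : 0 < e -> exists N, tailb N e.
Proof.
  intro He. pose proof amp_pos.
  destruct (bounded_sum_tail init init_energy init_ge0 init_sum (e ^ 2 / amp)) as [N HN].
  { apply Rdiv_lt_0_compat; auto. now apply pow_lt. }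
  exists N. split; [lra|]. intros K HK. specialize (HN K HK).
  apply (Rmult_le_compat_l amp) in HN; [|lra].
  replace (amp * (e ^ 2 / amp)) with (e ^ 2) in HN by (field; lra). auto.
Qed.
Lemma tailb_0 : tailb 0 (sqrt (amp * init_energy)).
Proof.
  split; [apply sqrt_pos|]. intros K _. pose proof amp_pos. pose proof (init_sum K).
  assert (0 <= ssum init K) by (apply ssum_ge0; intros; apply init_ge0).
  rewrite pow2_sqrt by (apply Rmult_le_pos; lra). simpl. apply Rmult_le_compat_l; lra.
Qed.

(** By Parseval the error is the tail of the squared coefficients, and that tail is dominated by the
    tail of [init], which does not involve the time. *)
Lemma energy_tail D N e : cont D -> (forall k, coef D k ^ 2 <= amp * init k) -> tailb N e ->
  energy (fun r => D r - comb (coef D) N r) <= e ^ 2.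
Proof.
  intros CD HD [He HT]. rewrite (eb_residual _ _ _ _ _ _ Hb) by auto.
  apply Rnot_lt_le. intro Hlt.
  set (d := (energy D - ssum (fun k => coef D k ^ 2) N - e ^ 2) / 2).
  destruct (eb_parseval _ _ _ _ _ _ Hb D d CD) as [M HM]; [unfold d; lra|].
  set (L := max N M). specialize (HM L ltac:(unfold L; lia)). specialize (HT L ltac:(unfold L; lia)).
  assert (ssum (fun k => coef D k ^ 2) L - ssum (fun k => coef D k ^ 2) N <= amp * (ssum init L - ssum init N)).
  { replace L with (N + (L - N))%nat by (unfold L; lia). rewrite !ssum_add.
    replace (amp * _) with (ssum (fun k => amp * init (N + k)%nat) (L - N)) by (rewrite ssum_scal; ring).
    assert (ssum (fun k => coef D (N + k)%nat ^ 2) (L - N) <= ssum (fun k => amp * init (N + k)%nat) (L - N))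
      by (apply ssum_le; intros; apply HD). lra. }
  unfold d in *. lra.
Qed.

Lemma residual_P C N e t : comp_ok n A B C -> (forall k, coef (cDp C t) k ^ 2 <= amp * init k) -> tailb N e ->
  forall r, 0 <= r <= 1 -> Rabs (rho r * cP C t r - ssum (fun k => coef (cDp C t) k * eta n A B dpsi nu k r) N) <= e.
Proof.
  intros HC HD Ht. apply (residual_plus n A B psi dpsi nu HA Hb (fun r => rho r * cP C t r)
      (fun r => 2 * B * r * cP C t r + rho r * cPr C t r) (cDp C t)).
  - intro r. apply is_derive_rho_mult. apply (ok_Pr _ _ _ _ HC).
  - pose proof (cont_cP C HC t). pose proof (ok_Prc _ _ _ _ HC t). cont_tac.
  - apply (ok_Dpc _ _ _ _ HC).
  - intros r _. apply (ok_Dp _ _ _ _ HC).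
  - apply Ht.
  - apply energy_tail; auto. apply (ok_Dpc _ _ _ _ HC).
Qed.
Lemma residual_S C N e t : comp_ok n A B C -> (forall k, coef (cT C t) k ^ 2 <= amp * init k) -> tailb N e ->
  forall r, 0 <= r <= 1 -> Rabs (cS C t r - ssum (fun k => coef (cS C t) k * (r ^ n * psi k r)) N) <= e / A.
Proof.
  intros HC HD Ht. apply (residual_scalar n A B psi dpsi nu HA HB Hb (cS C t) (cSr C t) (cQ C t) (cQr C t) (cT C t)).
  - apply (ok_Sr _ _ _ _ HC).
  - apply (ok_Src _ _ _ _ HC).
  - intros r _. apply (ok_Q _ _ _ _ HC).
  - apply (ok_Qr _ _ _ _ HC).
  - apply (ok_Qrc _ _ _ _ HC).
  - apply (ok_Tc _ _ _ _ HC).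
  - intros r _. apply (ok_T _ _ _ _ HC).
  - apply (ok_bd _ _ _ _ HC).
  - intro k. apply (T_coef C HC).
  - apply Ht.
  - apply energy_tail; auto. apply (ok_Tc _ _ _ _ HC).
Qed.
Lemma residual_M0 C N e t : n = 0%nat -> comp_ok n A B C -> (forall k, coef (cDm C t) k ^ 2 <= amp * init k) -> tailb N e ->
  forall r, 0 <= r <= 1 -> Rabs (rho r * cM C t r - ssum (fun k => coef (cDm C t) k * eta n A B dpsi nu k r) N) <= e.
Proof.
  intros Hn HC HD Ht. apply (residual_plus n A B psi dpsi nu HA Hb (fun r => rho r * cM C t r)
      (fun r => 2 * B * r * cM C t r + rho r * cMr C t r) (cDm C t)).
  - intro r. apply is_derive_rho_mult. apply (ok_Mr _ _ _ _ HC).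
  - pose proof (cont_cM C HC t). pose proof (ok_Mrc _ _ _ _ HC t). cont_tac.
  - apply (ok_Dmc _ _ _ _ HC).
  - intros r _. rewrite (ok_Dm _ _ _ _ HC), Hn. simpl. ring.
  - apply Ht.
  - apply energy_tail; auto. apply (ok_Dmc _ _ _ _ HC).
Qed.

(* The homogeneous solution r^(n-1) of the minus equation is invisible to the eigenfunctions; its
   amplitude is recovered from the boundary value here, and from the moment [hh] below. *)
Definition Wres (C : comp) (N : nat) (t r : R) : R :=
  rho r * cM C t r - r ^ (n - 1) * (rho 1 * cM C t 1) - ssum (fun k => coef (cDm C t) k * zeta n psi k r) N.

Lemma residual_M2 C N e t : (2 <= n)%nat -> comp_ok n A B C -> (forall k, coef (cDm C t) k ^ 2 <= amp * init k) -> tailb N e ->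
  forall r, 0 <= r <= 1 -> Rabs (Wres C N t r) <= e.
Proof.
  intros Hn HC HD Ht. unfold Wres.
  apply (residual_minus n A B psi dpsi nu Hb (fun r => rho r * cM C t r)
      (fun r => 2 * B * r * cM C t r + rho r * cMr C t r) (cDm C t)); auto.
  - intro r. apply is_derive_rho_mult. apply (ok_Mr _ _ _ _ HC).
  - pose proof (cont_cM C HC t). pose proof (ok_Mrc _ _ _ _ HC t). cont_tac.
  - apply (ok_Dmc _ _ _ _ HC).
  - intros r _. apply (ok_Dm _ _ _ _ HC).
  - apply Ht.
  - apply energy_tail; auto. apply (ok_Dmc _ _ _ _ HC).
Qed.

Lemma trig_coef_p k : trig (phase (pX k) (pY k)).
Proof.
  apply (triple_trig_p w (ak k) (bk k) (sX k) (sY k) (pX k) (pY k) (mX k) (mY k) (ak_pos k) (bk_pos k)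
    (ode_sX k) (ode_sY k) (ode_pX k) (ode_pY k) (ode_mX k) (ode_mY k)).
Qed.
Lemma trig_coef_s k : trig (phase (sX k) (sY k)).
Proof.
  apply (triple_trig_s w (ak k) (bk k) (sX k) (sY k) (pX k) (pY k) (mX k) (mY k) (ak_pos k) (bk_pos k)
    (ode_sX k) (ode_sY k) (ode_pX k) (ode_pY k) (ode_mX k) (ode_mY k)).
Qed.
Lemma trig_coef_m k : trig (phase (mX k) (mY k)).
Proof.
  apply (triple_trig_m w (ak k) (bk k) (sX k) (sY k) (pX k) (pY k) (mX k) (mY k) (ak_pos k) (bk_pos k)
    (ode_sX k) (ode_sY k) (ode_pX k) (ode_pY k) (ode_mX k) (ode_mY k)).
Qed.

Lemma apx_of_residual (fx fy : R -> R -> R) (cx cy : nat -> R -> R) (q : nat -> R -> R) :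
  (forall k, cont (q k)) -> (forall k, trig (phase (cx k) (cy k))) ->
  (forall e, 0 < e -> exists N, forall t r, 0 <= r <= 1 ->
     Rabs (fx t r - ssum (fun k => cx k t * q k r) N) <= e /\
     Rabs (fy t r - ssum (fun k => cy k t * q k r) N) <= e) ->
  apx (phase2 fx fy).
Proof.
  intros Hq Htr H. apply apx_lim. intros e He. destruct (H (e / 2)) as [N HN]; [lra|].
  exists (fun al t r => ssum (fun k => q k r * phase (cx k) (cy k) al t) N). split.
  - apply (apx_ssum (fun k al t r => q k r * phase (cx k) (cy k) al t)). intro k. now apply apx_term.
  - intros al t r Hr. destruct (HN t r Hr) as [H1 H2].
    replace (_ - _) with (phase2 (fun t r => fx t r - ssum (fun k => cx k t * q k r) N)
      (fun t r => fy t r - ssum (fun k => cy k t * q k r) N) al t r).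
    + eapply Rle_trans; [apply phase2_bound; [exact H1|exact H2]|lra].
    + unfold phase2.
      rewrite (ssum_ext (fun k => q k r * phase (cx k) (cy k) al t)
        (fun k => cos al * (cx k t * q k r) + sin al * (cy k t * q k r))) by (intros; unfold phase; ring).
      rewrite ssum_plus, !ssum_scal. ring.
Qed.

Lemma apx_div_rho fx fy : apx (phase2 (fun t r => rho r * fx t r) (fun t r => rho r * fy t r)) -> apx (phase2 fx fy).
Proof.
  intro H. apply (apx_ext (fun al t r => / rho r * phase2 (fun t r => rho r * fx t r) (fun t r => rho r * fy t r) al t r)).
  - intros al t r _. unfold phase2. pose proof (rho_neq A B HA HB r). field. auto.
  - apply (apx_mulr (fun r => / rho r)); auto. apply cont_inv; auto. apply rho_neq; auto.
Qed.

Lemma apx_P : apx (phase2 (cP X) (cP Y)).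
Proof.
  apply apx_div_rho. apply (apx_of_residual _ _ pX pY (eta n A B dpsi nu)).
  - intro k. apply (cont_eta n A B psi dpsi nu Hb).
  - apply trig_coef_p.
  - intros e He. destruct (tailb_exists e He) as [N HN]. exists N. intros t r Hr.
    split; apply residual_P; auto; intro k; apply (coef_bounds k t).
Qed.
Lemma apx_S : apx (phase2 (cS X) (cS Y)).
Proof.
  apply (apx_of_residual _ _ sX sY (fun k r => r ^ n * psi k r)).
  - intro k. pose proof (cpsi k). cont_tac.
  - apply trig_coef_s.
  - intros e He. destruct (tailb_exists (e * A)) as [N HN]; [apply Rmult_lt_0_compat; auto|]. exists N. intros t r Hr.
    assert (E : e * A / A = e) by (field; lra).
    split; rewrite <- E; apply residual_S; auto; intro k; apply (coef_bounds k t).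
Qed.
Lemma apx_M0 : n = 0%nat -> apx (phase2 (cM X) (cM Y)).
Proof.
  intro Hn. apply apx_div_rho. apply (apx_of_residual _ _ mX mY (eta n A B dpsi nu)).
  - intro k. apply (cont_eta n A B psi dpsi nu Hb).
  - apply trig_coef_m.
  - intros e He. destruct (tailb_exists e He) as [N HN]. exists N. intros t r Hr.
    split; apply residual_M0; auto; intro k; apply (coef_bounds k t).
Qed.

Let E0 := sqrt (amp * init_energy).
Lemma div_rho_bound x r : Rabs (rho r * x) <= E0 -> Rabs x <= E0 / A.
Proof.
  intro H. pose proof (rho_ge A B HB r). rewrite Rabs_mult, Rabs_pos_eq in H by lra.
  apply (Rmult_le_reg_l A); auto. replace (A * (E0 / A)) with E0 by (field; lra).
  pose proof (Rabs_pos x). nra.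
Qed.
Lemma bound_P t r : 0 <= r <= 1 -> Rabs (cP X t r) <= E0 / A /\ Rabs (cP Y t r) <= E0 / A.
Proof.
  intro Hr. split; apply (div_rho_bound _ r).
  - pose proof (residual_P X 0 E0 t HX (fun k => proj1 (coef_bounds k t)) tailb_0 r Hr) as H. simpl in H. now rewrite Rminus_0_r in H.
  - pose proof (residual_P Y 0 E0 t HY (fun k => proj1 (proj2 (coef_bounds k t))) tailb_0 r Hr) as H. simpl in H. now rewrite Rminus_0_r in H.
Qed.
Lemma bound_S t r : 0 <= r <= 1 -> Rabs (cS X t r) <= E0 / A /\ Rabs (cS Y t r) <= E0 / A.
Proof.
  intro Hr. split.
  - pose proof (residual_S X 0 E0 t HX (fun k => proj1 (proj2 (proj2 (proj2 (proj2 (coef_bounds k t)))))) tailb_0 r Hr) as H. simpl in H. now rewrite Rminus_0_r in H.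
  - pose proof (residual_S Y 0 E0 t HY (fun k => proj2 (proj2 (proj2 (proj2 (proj2 (coef_bounds k t)))))) tailb_0 r Hr) as H. simpl in H. now rewrite Rminus_0_r in H.
Qed.

Definition hh (C : comp) (t : R) : R := RInt (fun r => cM C t r * r ^ n) 0 1.

(** r^n Q_m is the derivative of r^n S, which vanishes at both ends. Hence the pressure does not act
    on the moment [hh], and only the rotation by 2 w remains. *)
Lemma Qm_moment C t : comp_ok n A B C -> (1 <= n)%nat -> RInt (fun r => cQm C t r * r ^ n) 0 1 = 0.
Proof.
  intros HC Hn.
  rewrite (RInt_cderive _ (fun r => r ^ n * cS C t r)).
  - rewrite (ok_bd _ _ _ _ HC), (pow_ne_zero n) by lia. rring.
  - pose proof (ok_Qmc _ _ _ _ HC t). cont_tac.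
  - intro r. eapply is_derive_eq; [apply is_derive_rmult; [apply is_derive_rpow|apply (ok_Sr _ _ _ _ HC)]|].
    assert (En : r ^ n = r * r ^ pred n) by (rewrite tech_pow_Rmult; f_equal; lia).
    match goal with |- ?a = ?b => change (@eq R a b) end.
    transitivity (r ^ pred n * (r * cSr C t r + INR n * cS C t r)).
    + rewrite En at 1. ring.
    + rewrite <- (ok_Qm _ _ _ _ HC). rewrite En at 1. ring.
Qed.

Lemma is_derive_hh C D d t : comp_ok n A B C -> comp_ok n A B D -> (1 <= n)%nat ->
  (forall r, 0 <= r <= 1 -> cMt C t r = d * cM D t r - c ^ 2 * cQm C t r) ->
  is_derive (hh C) t (d * hh D t).
Proof.
  intros HC HD Hn E. eapply is_derive_eq.
  - apply (is_derive_RInt_weighted (cM C) (cMt C) (fun r => r ^ n)); [apply (ok_Mt _ _ _ _ HC)|apply (ok_Mtc _ _ _ _ HC)|apply cont_cM; auto|cont_tac].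
  - rewrite (RInt_cext _ (fun r => d * (cM D t r * r ^ n) - c ^ 2 * (cQm C t r * r ^ n))); [|lra|].
    + pose proof (cont_cM D HD t). pose proof (ok_Qmc _ _ _ _ HC t).
      rewrite RInt_cminus, !RInt_cscal, Qm_moment by (auto; cont_tac). unfold hh. rring.
    + intros r Hr. rewrite E by auto. ring.
Qed.
Lemma ode_hX t : (1 <= n)%nat -> is_derive (hh X) t (- (2 * w) * hh Y t).
Proof.
  intro Hn. apply is_derive_hh; auto. intros r Hr. rewrite (ev_MX _ _ _ _ Hev) by auto. ring.
Qed.
Lemma ode_hY t : (1 <= n)%nat -> is_derive (hh Y) t (2 * w * hh X t).
Proof. intro Hn. apply is_derive_hh; auto. intros r Hr. apply (ev_MY _ _ _ _ Hev). auto. Qed.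

Let cirho : cont (fun r => / rho r).
Proof. apply cont_inv; auto. apply rho_neq; auto. Qed.

Definition cn : R := RInt (fun r => r ^ n * (r ^ (n - 1) * / rho r)) 0 1.
Definition zk (k : nat) : R := RInt (fun r => r ^ n * (zeta n psi k r * / rho r)) 0 1.

(** The explicit dependence on [n] is recorded because dividing by [cn] costs a factor n in the
    bounds, to be repaid by decay of the initial data. *)
Lemma cn_ge : (1 <= n)%nat -> / (2 * INR n * (A + B)) <= cn.
Proof.
  intro Hn. assert (HnR : 1 <= INR n) by (change 1 with (INR 1); now apply le_INR).
  apply Rle_trans with (RInt (fun r => / (A + B) * r ^ (2 * n - 1)) 0 1).
  - rewrite RInt_cscal, RInt_pow, pow1, pow_ne_zero by (cont_tac || lia).
    replace (S (2 * n - 1)) with (2 * n)%nat by lia. rewrite mult_INR. simpl (INR 2). right. field. lra.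
  - apply RInt_cle; [lra|cont_tac|cont_tac|]. intros r Hr.
    replace (r ^ n * (r ^ (n - 1) * / rho r)) with (/ rho r * r ^ (2 * n - 1)).
    + apply Rmult_le_compat_r; [apply pow_le; lra|]. pose proof (rho_ge A B HB r).
      apply Rinv_le_contravar; [lra|]. unfold rho. pose proof (pow_01 r 2 Hr). nra.
    + replace (2 * n - 1)%nat with (n + (n - 1))%nat by lia. rewrite pow_add. ring.
Qed.
Lemma cn_pos : (1 <= n)%nat -> 0 < cn.
Proof.
  intro Hn. eapply Rlt_le_trans; [|apply cn_ge; auto]. apply Rinv_0_lt_compat.
  assert (1 <= INR n) by (change 1 with (INR 1); now apply le_INR). nra.
Qed.

Lemma cont_Wres C N t : comp_ok n A B C -> cont (Wres C N t).
Proof.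
  intro HC. unfold Wres. pose proof (cont_cM C HC t).
  assert (cont (fun r => ssum (fun k => coef (cDm C t) k * zeta n psi k r) N)).
  { apply (cont_ssum (fun k r => coef (cDm C t) k * zeta n psi k r)). intro k.
    pose proof (cont_zeta n A B psi dpsi nu Hb k). cont_tac. }
  cont_tac.
Qed.

(** The decomposition of rho M, divided by rho and paired with r^n, is linear in the boundary value
    with coefficient [cn]. As [cn] is positive, the boundary value can be eliminated in favour of
    the rotating moment [hh]. *)
Lemma M_moment C N t : comp_ok n A B C ->
  hh C t = cn * (rho 1 * cM C t 1) + ssum (fun k => coef (cDm C t) k * zk k) N
    + RInt (fun r => r ^ n * (Wres C N t r * / rho r)) 0 1.
Proof.
  intro HC. pose proof (cont_Wres C N t HC) as CW.
  assert (Cz : forall k, cont (fun r => r ^ n * (zeta n psi k r * / rho r))).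
  { intro k. pose proof (cont_zeta n A B psi dpsi nu Hb k). cont_tac. }
  unfold hh.
  rewrite (RInt_rext _ (fun r => ((rho 1 * cM C t 1) * (r ^ n * (r ^ (n - 1) * / rho r))
     + ssum (fun k => coef (cDm C t) k * (r ^ n * (zeta n psi k r * / rho r))) N)
     + r ^ n * (Wres C N t r * / rho r))).
  - rewrite RInt_cplus, RInt_cplus, RInt_cscal.
    + rewrite (RInt_ssum (fun k r => coef (cDm C t) k * (r ^ n * (zeta n psi k r * / rho r)))).
      * rewrite (ssum_ext (fun k => RInt _ 0 1) (fun k => coef (cDm C t) k * zk k)).
        -- unfold cn. rring.
        -- intros k _. rewrite RInt_cscal by apply Cz. reflexivity.
      * intro k. pose proof (Cz k). cont_tac.
    + cont_tac.
    + cont_tac.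
    + apply (cont_ssum (fun k r => coef (cDm C t) k * (r ^ n * (zeta n psi k r * / rho r)))). intro k. pose proof (Cz k). cont_tac.
    + apply cont_plus; [cont_tac|].
      apply (cont_ssum (fun k r => coef (cDm C t) k * (r ^ n * (zeta n psi k r * / rho r)))). intro k. pose proof (Cz k). cont_tac.
    + cont_tac.
  - intro r. rewrite (ssum_ext _ (fun k => (r ^ n * / rho r) * (coef (cDm C t) k * zeta n psi k r))) by (intros; ring).
    rewrite ssum_scal. unfold Wres. pose proof (rho_neq A B HA HB r). field. auto.
Qed.

Lemma M_residual C N t e : (1 <= n)%nat -> comp_ok n A B C ->
  (forall r, 0 <= r <= 1 -> Rabs (Wres C N t r) <= e) -> forall r, 0 <= r <= 1 ->
  Rabs (rho r * cM C t r - (hh C t * (r ^ (n - 1) * / cn)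
    + ssum (fun k => coef (cDm C t) k * (zeta n psi k r - zk k * (r ^ (n - 1) * / cn))) N)) <= e * (1 + / (A * cn)).
Proof.
  intros Hn HC HW r Hr. pose proof (cn_pos Hn) as Hcn. pose proof (M_moment C N t HC) as E.
  set (I := RInt (fun r => r ^ n * (Wres C N t r * / rho r)) 0 1) in *.
  assert (He : 0 <= e) by (apply Rle_trans with (Rabs (Wres C N t 0)); [apply Rabs_pos|apply HW; lra]).
  assert (HI : Rabs I <= e / A).
  { unfold I. replace (e / A) with (e / A * (1 - 0)) by ring. apply RInt_cabs_const; [lra| |].
    - pose proof (cont_Wres C N t HC). cont_tac.
    - intros x Hx. rewrite Rabs_mult. pose proof (pow_01 x n Hx). rewrite (Rabs_pos_eq (x ^ n)) by lra.
      pose proof (div_rho_le A B HA HB _ e x (HW x Hx)) as X0. unfold Rdiv at 1 in X0.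
      pose proof (Rabs_pos (Wres C N t x * / rho x)). nra. }
  rewrite (ssum_ext _ (fun k => coef (cDm C t) k * zeta n psi k r - (r ^ (n - 1) * / cn) * (coef (cDm C t) k * zk k))) by (intros; ring).
  rewrite ssum_minus, ssum_scal.
  replace (_ - _) with (Wres C N t r - r ^ (n - 1) * (I * / cn)).
  2:{ unfold Wres. rewrite E. field. lra. }
  unfold Rminus. eapply Rle_trans; [apply Rabs_triang|]. rewrite Rabs_Ropp, !Rabs_mult, Rabs_inv.
  rewrite (Rabs_pos_eq cn) by lra. pose proof (pow_01 r (n - 1) Hr). rewrite (Rabs_pos_eq (r ^ (n - 1))) by lra.
  specialize (HW r Hr). assert (Hic : 0 < / cn) by now apply Rinv_0_lt_compat.
  pose proof (Rabs_pos I).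
  assert (Rabs I * / cn <= e / A * / cn) by (apply Rmult_le_compat_r; lra).
  assert (0 <= Rabs I * / cn) by (apply Rmult_le_pos; lra).
  assert (r ^ (n - 1) * (Rabs I * / cn) <= Rabs I * / cn) by nra.
  replace (e * (1 + / (A * cn))) with (e + e / A * / cn) by (field; lra). lra.
Qed.

Definition W_small : Prop := forall e, 0 < e -> exists N, forall t r, 0 <= r <= 1 ->
  Rabs (Wres X N t r) <= e /\ Rabs (Wres Y N t r) <= e.

Lemma apx_M : (1 <= n)%nat -> W_small -> apx (phase2 (cM X) (cM Y)).
Proof.
  intros Hn HW. apply apx_div_rho. pose proof (cn_pos Hn) as Hcn.
  (* Index 0 is the moment, a rotation by 2 w; the triples are shifted to the indices from 1 on. *)
  apply (apx_of_residual _ _ (fun k => match k with O => hh X | S j => mX j end) (fun k => match k with O => hh Y | S j => mY j end)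
    (fun k r => match k with O => r ^ (n - 1) * / cn | S j => zeta n psi j r - zk j * (r ^ (n - 1) * / cn) end)).
  - intros [|k]; [cont_tac|]. pose proof (cont_zeta n A B psi dpsi nu Hb k). cont_tac.
  - intros [|k]; [|apply trig_coef_m].
    apply (rotation_trig (2 * w)); intro t; [apply ode_hX|apply ode_hY]; auto.
  - intros e He. assert (HK : 0 < 1 + / (A * cn)).
    { assert (0 < / (A * cn)) by (apply Rinv_0_lt_compat, Rmult_lt_0_compat; auto). lra. }
    destruct (HW (e / (1 + / (A * cn)))) as [N HN]; [now apply Rdiv_lt_0_compat|].
    exists (S N). intros t r Hr.
    assert (E : e / (1 + / (A * cn)) * (1 + / (A * cn)) = e) by (clear -HK; set (K := 1 + / (A * cn)) in *; field; lra).
    split; rewrite <- E; replace (S N) with (1 + N)%nat by lia; rewrite ssum_add.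
    + assert (H := M_residual X N t _ Hn HX (fun x Hx => proj1 (HN t x Hx)) r Hr).
      simpl ssum at 1. rewrite Rplus_0_l. exact H.
    + assert (H := M_residual Y N t _ Hn HY (fun x Hx => proj2 (HN t x Hx)) r Hr).
      simpl ssum at 1. rewrite Rplus_0_l. exact H.
Qed.

(** The zero term truncation, made explicit in [n]: the moment keeps its modulus, so its initial
    size enters at all times, multiplied by / cn <= 2 n (A + B). *)
Lemma bound_M e h0 : (1 <= n)%nat ->
  (forall t r, 0 <= r <= 1 -> Rabs (Wres X 0 t r) <= e /\ Rabs (Wres Y 0 t r) <= e) ->
  (forall r, 0 <= r <= 1 -> Rabs (cM X 0 r) <= h0 /\ Rabs (cM Y 0 r) <= h0) ->
  forall t r, 0 <= r <= 1 ->
  Rabs (cM X t r) <= (e * (1 + 2 * INR n * (A + B) / A) + 4 * INR n * (A + B) * h0) / A /\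
  Rabs (cM Y t r) <= (e * (1 + 2 * INR n * (A + B) / A) + 4 * INR n * (A + B) * h0) / A.
Proof.
  intros Hn HW H0 t r Hr. pose proof (cn_pos Hn) as Hcn.
  assert (He : 0 <= e) by (apply Rle_trans with (Rabs (Wres X 0 0 0)); [apply Rabs_pos|apply HW; lra]).
  assert (Hh0 : 0 <= h0) by (apply Rle_trans with (Rabs (cM X 0 0)); [apply Rabs_pos|apply H0; lra]).
  assert (Hic : / cn <= 2 * INR n * (A + B)).
  { rewrite <- (Rinv_inv (2 * INR n * (A + B))). apply Rinv_le_contravar; [|now apply cn_ge].
    apply Rinv_0_lt_compat. assert (1 <= INR n) by (change 1 with (INR 1); now apply le_INR). nra. }
  assert (Hh : forall C, comp_ok n A B C -> (forall r, 0 <= r <= 1 -> Rabs (cM C 0 r) <= h0) -> Rabs (hh C 0) <= h0).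
  { intros C HC H. replace h0 with (h0 * (1 - 0)) by ring. apply RInt_cabs_const; [lra|pose proof (cont_cM C HC 0); cont_tac|].
    intros x Hx. rewrite Rabs_mult. pose proof (pow_01 x n Hx). rewrite (Rabs_pos_eq (x ^ n)) by lra.
    specialize (H x Hx). pose proof (Rabs_pos (cM C 0 x)). nra. }
  pose proof (Hh X HX (fun x Hx => proj1 (H0 x Hx))) as HhX. pose proof (Hh Y HY (fun x Hx => proj2 (H0 x Hx))) as HhY.
  destruct (rotation_ode (2 * w) (hh X) (hh Y) (fun t => ode_hX t Hn) (fun t => ode_hY t Hn) t) as [RX RY].
  assert (Hc1 : Rabs (cos (2 * w * t)) <= 1) by (apply Rabs_le; apply COS_bound).
  assert (Hs1 : Rabs (sin (2 * w * t)) <= 1) by (apply Rabs_le; apply SIN_bound).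
  assert (BX : Rabs (hh X t) <= 2 * h0).
  { rewrite RX. unfold Rminus. eapply Rle_trans; [apply Rabs_triang|]. rewrite Rabs_Ropp, !Rabs_mult.
    pose proof (Rabs_pos (hh X 0)). pose proof (Rabs_pos (hh Y 0)).
    pose proof (Rabs_pos (cos (2 * w * t))). pose proof (Rabs_pos (sin (2 * w * t))). nra. }
  assert (BY : Rabs (hh Y t) <= 2 * h0).
  { rewrite RY. eapply Rle_trans; [apply Rabs_triang|]. rewrite !Rabs_mult.
    pose proof (Rabs_pos (hh X 0)). pose proof (Rabs_pos (hh Y 0)).
    pose proof (Rabs_pos (cos (2 * w * t))). pose proof (Rabs_pos (sin (2 * w * t))). nra. }
  assert (G : forall C, comp_ok n A B C -> (forall r, 0 <= r <= 1 -> Rabs (Wres C 0 t r) <= e) -> Rabs (hh C t) <= 2 * h0 ->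
    Rabs (cM C t r) <= (e * (1 + 2 * INR n * (A + B) / A) + 4 * INR n * (A + B) * h0) / A).
  { intros C HC HWC Hhc. pose proof (M_residual C 0 t e Hn HC HWC r Hr) as R0. simpl ssum in R0. rewrite Rplus_0_r in R0.
    assert (R1 : Rabs (hh C t * (r ^ (n - 1) * / cn)) <= 4 * INR n * (A + B) * h0).
    { rewrite !Rabs_mult, Rabs_inv, (Rabs_pos_eq cn) by lra. pose proof (pow_01 r (n - 1) Hr).
      rewrite (Rabs_pos_eq (r ^ (n - 1))) by lra. assert (0 < / cn) by now apply Rinv_0_lt_compat.
      pose proof (Rabs_pos (hh C t)).
      replace (4 * INR n * (A + B) * h0) with (2 * h0 * (2 * INR n * (A + B))) by ring.
      apply Rmult_le_compat; auto; [apply Rmult_le_pos; lra|]. nra. }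
    assert (R2 : e * (1 + / (A * cn)) <= e * (1 + 2 * INR n * (A + B) / A)).
    { apply Rmult_le_compat_l; auto. apply Rplus_le_compat_l. rewrite Rinv_mult.
      unfold Rdiv. rewrite (Rmult_comm (/ A)). apply Rmult_le_compat_r; auto. apply Rlt_le, Rinv_0_lt_compat; auto. }
    pose proof (rho_ge A B HB r). apply (Rmult_le_reg_l A); auto.
    replace (A * ((e * (1 + 2 * INR n * (A + B) / A) + 4 * INR n * (A + B) * h0) / A))
      with (e * (1 + 2 * INR n * (A + B) / A) + 4 * INR n * (A + B) * h0) by (field; lra).
    apply Rle_trans with (Rabs (rho r * cM C t r)).
    - rewrite Rabs_mult, (Rabs_pos_eq (rho r)) by lra. apply Rmult_le_compat_r; [apply Rabs_pos|auto].
    - replace (rho r * cM C t r) with ((rho r * cM C t r - hh C t * (r ^ (n - 1) * / cn)) + hh C t * (r ^ (n - 1) * / cn)) by ring.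
      eapply Rle_trans; [apply Rabs_triang|]. lra. }
  split; apply G; auto; intros x Hx; apply (HW t x Hx).
Qed.

(** Square root of the conserved form, with [a s^2 = c^2 (T / sqrt nu)^2]. The bound is linear in
    coefficients of the initial data because for n = 1 absolute sums have to be controlled uniformly
    in time. *)
Lemma coef_m_envelope k t :
  Rabs (mX k t) <= 2 * c * (Rabs (coef (cT X 0) k / sqrt (nu k)) + Rabs (coef (cT Y 0) k / sqrt (nu k)))
    + (Rabs (pX k 0) + Rabs (pY k 0)) + th * (Rabs (mX k 0) + Rabs (mY k 0)) /\
  Rabs (mY k t) <= 2 * c * (Rabs (coef (cT X 0) k / sqrt (nu k)) + Rabs (coef (cT Y 0) k / sqrt (nu k)))
    + (Rabs (pX k 0) + Rabs (pY k 0)) + th * (Rabs (mX k 0) + Rabs (mY k 0)).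
Proof.
  pose proof (triple_energy w (ak k) (bk k) _ _ _ _ _ _ (bk_pos k) (ode_sX k) (ode_sY k) (ode_pX k) (ode_pY k) (ode_mX k) (ode_mY k) t) as E.
  pose proof (ratio_bounds k) as [R1 R2]. pose proof (ak_pos k). pose proof th_ge1 as Hth. pose proof (nu_pos' k) as Hnu.
  pose proof (sqrt_lt_R0 _ Hnu) as Hsq.
  set (tx := coef (cT X 0) k / sqrt (nu k)). set (ty := coef (cT Y 0) k / sqrt (nu k)).
  assert (Es : sqrt (nu k) * sqrt (nu k) = nu k) by (apply sqrt_sqrt; lra).
  assert (Tx : ak k * sX k 0 ^ 2 = c ^ 2 * tx ^ 2).
  { unfold tx. rewrite (T_coef X HX). fold (sX k 0). unfold ak. rewrite <- Es at 1 2. field. lra. }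
  assert (Ty : ak k * sY k 0 ^ 2 = c ^ 2 * ty ^ 2).
  { unfold ty. rewrite (T_coef Y HY). fold (sY k 0). unfold ak. rewrite <- Es at 1 2. field. lra. }
  assert (Hm : mX k t ^ 2 + mY k t ^ 2 <= 2 * c ^ 2 * (tx ^ 2 + ty ^ 2) + (pX k 0 ^ 2 + pY k 0 ^ 2) + th * (mX k 0 ^ 2 + mY k 0 ^ 2)).
  { pose proof (pow2_ge_0 (sX k t)). pose proof (pow2_ge_0 (sY k t)).
    pose proof (pow2_ge_0 (mX k t)). pose proof (pow2_ge_0 (mY k t)). pose proof (pow2_ge_0 (pX k t)). pose proof (pow2_ge_0 (pY k t)).
    pose proof (pow2_ge_0 (mX k 0)). pose proof (pow2_ge_0 (mY k 0)).
    assert (0 <= 2 * ak k * (sX k t ^ 2 + sY k t ^ 2)) by (apply Rmult_le_pos; lra).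
    assert (mX k t ^ 2 + mY k t ^ 2 <= ak k / bk k * (mX k t ^ 2 + mY k t ^ 2)) by nra.
    assert (ak k / bk k * (mX k 0 ^ 2 + mY k 0 ^ 2) <= th * (mX k 0 ^ 2 + mY k 0 ^ 2)) by nra. lra. }
  set (a1 := Rabs tx) in *. set (a2 := Rabs ty) in *. set (a3 := Rabs (pX k 0)). set (a4 := Rabs (pY k 0)).
  set (a5 := Rabs (mX k 0)). set (a6 := Rabs (mY k 0)).
  assert (0 <= a1) by apply Rabs_pos. assert (0 <= a2) by apply Rabs_pos. assert (0 <= a3) by apply Rabs_pos.
  assert (0 <= a4) by apply Rabs_pos. assert (0 <= a5) by apply Rabs_pos. assert (0 <= a6) by apply Rabs_pos.
  rewrite <- (pow2_abs tx), <- (pow2_abs ty), <- (pow2_abs (pX k 0)), <- (pow2_abs (pY k 0)), <- (pow2_abs (mX k 0)), <- (pow2_abs (mY k 0)) in Hm.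
  fold a1 a2 a3 a4 a5 a6 in Hm.
  set (V := 2 * c * (a1 + a2) + (a3 + a4) + th * (a5 + a6)).
  assert (HV : 0 <= V).
  { unfold V. assert (0 <= 2 * c * (a1 + a2)) by (apply Rmult_le_pos; lra). assert (0 <= th * (a5 + a6)) by (apply Rmult_le_pos; lra). lra. }
  assert (HV2 : 2 * c ^ 2 * (a1 ^ 2 + a2 ^ 2) + (a3 ^ 2 + a4 ^ 2) + th * (a5 ^ 2 + a6 ^ 2) <= V ^ 2).
  { set (P := 2 * c * (a1 + a2)). set (Q := th * (a5 + a6)).
    assert (HP : 0 <= P) by (apply Rmult_le_pos; lra). assert (HQ : 0 <= Q) by (apply Rmult_le_pos; lra).
    assert (X1 : 2 * c ^ 2 * (a1 ^ 2 + a2 ^ 2) <= P ^ 2).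
    { unfold P. replace ((2 * c * (a1 + a2)) ^ 2) with (c ^ 2 * (4 * (a1 + a2) ^ 2)) by ring.
      replace (2 * c ^ 2 * (a1 ^ 2 + a2 ^ 2)) with (c ^ 2 * (2 * (a1 ^ 2 + a2 ^ 2))) by ring.
      apply Rmult_le_compat_l; [apply pow2_ge_0|]. nra. }
    assert (X2 : a3 ^ 2 + a4 ^ 2 <= (a3 + a4) ^ 2) by nra.
    assert (X3 : th * (a5 ^ 2 + a6 ^ 2) <= Q ^ 2).
    { unfold Q. rewrite Rpow_mult_distr. apply Rmult_le_compat; try nra. }
    unfold V. fold P Q. assert (0 <= P * (a3 + a4)) by (apply Rmult_le_pos; lra).
    assert (0 <= P * Q) by (apply Rmult_le_pos; lra). assert (0 <= (a3 + a4) * Q) by (apply Rmult_le_pos; lra).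
    replace ((P + (a3 + a4) + Q) ^ 2) with (P ^ 2 + (a3 + a4) ^ 2 + Q ^ 2 + 2 * (P * (a3 + a4) + P * Q + (a3 + a4) * Q)) by ring. lra. }
  pose proof (pow2_ge_0 (mX k t)). pose proof (pow2_ge_0 (mY k t)).
  split; rewrite <- (Rabs_pos_eq V) by auto; apply Rsqr_le_abs_0; unfold Rsqr; nra.
Qed.

Lemma W_small_ge2 : (2 <= n)%nat -> W_small.
Proof.
  intros Hn e He. destruct (tailb_exists e He) as [N HN]. exists N. intros t r Hr. split.
  - apply (residual_M2 X N e t Hn HX (fun k => proj1 (proj2 (proj2 (coef_bounds k t)))) HN r Hr).
  - apply (residual_M2 Y N e t Hn HY (fun k => proj1 (proj2 (proj2 (proj2 (coef_bounds k t))))) HN r Hr).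
Qed.
Lemma bound_W t r : (2 <= n)%nat -> 0 <= r <= 1 -> Rabs (Wres X 0 t r) <= E0 /\ Rabs (Wres Y 0 t r) <= E0.
Proof.
  intros Hn Hr. split.
  - apply (residual_M2 X 0 E0 t Hn HX (fun k => proj1 (proj2 (proj2 (coef_bounds k t)))) tailb_0 r Hr).
  - apply (residual_M2 Y 0 E0 t Hn HY (fun k => proj1 (proj2 (proj2 (proj2 (coef_bounds k t))))) tailb_0 r Hr).
Qed.

End Dynamics.

(** * The angular number 1: truncation errors by absolute summability *)

Section FirstMode.
Variables (A B : R) (psi dpsi : nat -> R -> R) (nu : nat -> R).
Variable (HA : 0 < A).
Variable (HB : 0 <= B).
Variable (Hb : eigenbasis 1 A B psi dpsi nu).
Local Notation rho := (rho A B).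
Local Notation coef := (coef 1 psi).
Local Notation comb := (comb 1 psi).
Local Notation summable := (summable psi).
Let cpsi k : cont (psi k) := eb_cpsi 1 A B psi dpsi nu Hb k.

Lemma cont_comb1 u N : cont (comb u N).
Proof. apply (cont_ssum (fun k r => u k * (r ^ 1 * psi k r))). intro k. pose proof (cpsi k). cont_tac. Qed.

Lemma RInt_residual_tail (D : R -> R) (N m : nat) (r : R) : cont D ->
  RInt (fun t => D t - comb (coef D) N t) r 1 =
  RInt (fun t => D t - comb (coef D) (N + m) t) r 1 + ssum (fun k => coef D (N + k)%nat * gl psi r 1 (N + k)%nat) m.
Proof.
  intro CD. pose proof (cont_comb1 (coef D)) as Cc.
  rewrite <- (ssum_ext (fun k => RInt (fun t => coef D (N + k)%nat * (t * psi (N + k)%nat t)) r 1)).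
  2:{ intros k _. pose proof (cpsi (N + k)). rewrite RInt_cscal by cont_tac. reflexivity. }
  rewrite <- (RInt_ssum (fun k t => coef D (N + k)%nat * (t * psi (N + k)%nat t))).
  2:{ intro k. pose proof (cpsi (N + k)). cont_tac. }
  rewrite <- RInt_cplus.
  - apply RInt_rext. intro t. unfold comb. rewrite ssum_add.
    rewrite (ssum_ext (fun k => coef D (N + k)%nat * (t ^ 1 * psi (N + k)%nat t)) (fun k => coef D (N + k)%nat * (t * psi (N + k)%nat t))).
    + ring.
    + intros; ring.
  - pose proof (Cc (N + m)%nat). cont_tac.
  - apply (cont_ssum (fun k t => coef D (N + k)%nat * (t * psi (N + k)%nat t))). intro k. pose proof (cpsi (N + k)). cont_tac.
Qed.

(** For a fixed radius the weight t is at least r on [r, 1], so convergence in mean square suffices.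
    The index found here depends on [r]. *)
Lemma RInt_residual_small (D : R -> R) (r e : R) : cont D -> 0 < r <= 1 -> 0 < e ->
  exists M, forall K, (M <= K)%nat -> Rabs (RInt (fun t => D t - comb (coef D) K t) r 1) <= e.
Proof.
  intros CD Hr He. destruct (eb_parseval _ _ _ _ _ _ Hb D (r * e ^ 2) CD) as [M HM].
  { apply Rmult_lt_0_compat; [lra|now apply pow_lt]. }
  exists M. intros K HK. specialize (HM K HK). rewrite <- (eb_residual _ _ _ _ _ _ Hb) in HM by auto.
  pose proof (cont_comb1 (coef D) K) as Cc.
  set (h := fun t => D t - comb (coef D) K t). assert (Ch : cont h) by (unfold h; cont_tac).
  assert (E : RInt (fun t => 1 * h t ^ 2) r 1 <= e ^ 2).
  { apply (Rmult_le_reg_l r); [lra|]. eapply Rle_trans; [|apply HM]. rewrite <- RInt_cscal by cont_tac.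
    change (energy (fun r => D r - comb (coef D) K r)) with (RInt (fun t => t * h t ^ 2) 0 1). rewrite <- (RInt_cChasles (fun t => t * h t ^ 2) 0 r 1) by cont_tac.
    assert (0 <= RInt (fun t => t * h t ^ 2) 0 r).
    { apply RInt_cge0; [lra|cont_tac|]. intros x Hx. apply Rmult_le_pos; [lra|apply pow2_ge_0]. }
    assert (RInt (fun t => r * (1 * h t ^ 2)) r 1 <= RInt (fun t => t * h t ^ 2) r 1).
    { apply RInt_cle; [lra|cont_tac|cont_tac|]. intros x Hx. pose proof (pow2_ge_0 (h x)). nra. }
    lra. }
  assert (F : RInt (fun t => 1 * (fun _ => 1) t ^ 2) r 1 <= 1 ^ 2).
  { rewrite (RInt_rext _ (fun _ => 1)) by (intro; ring). rewrite RInt_cconst. lra. }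
  pose proof (RInt_cs_abs (fun _ => 1) h (fun _ => 1) r 1 e 1 ltac:(lra) ltac:(cont_tac) Ch ltac:(cont_tac) ltac:(intros; lra) ltac:(lra) ltac:(lra) E F) as H.
  rewrite (RInt_rext _ h) in H by (intro; ring). lra.
Qed.

(** The error after N terms is a block of further terms, at most [e] by [gsum] whatever its length,
    plus a remainder that tends to 0 at fixed radius. Only the length of the block depends on time
    and radius. *)
Lemma summable_W_small (u : nat -> R) (Cs : comp) (t : R) (e : R) (N : nat) :
  comp_ok 1 A B Cs -> (forall k, Rabs (coef (cDm Cs t) k) <= u k) ->
  (forall m r, 0 < r <= 1 -> gsum psi u N m r <= e) ->
  forall r, 0 <= r <= 1 -> Rabs (Wres 1 A B psi Cs N t r) <= e.
Proof.
  intros HC Hu HN. apply cont_le_at_0.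
  { eapply cont_Wres; eauto. }
  intros r Hr. unfold Wres.
  rewrite (minus_integral 1 A B psi dpsi nu Hb (fun r => rho r * cM Cs t r)
      (fun r => 2 * B * r * cM Cs t r + rho r * cMr Cs t r) (cDm Cs t) N).
  - rewrite (RInt_rext _ (fun s => cDm Cs t s - comb (coef (cDm Cs t)) N s)).
    2:{ intro s. simpl. field. }
    simpl (r ^ (1 - 1)). rewrite Rmult_1_l, Rabs_Ropp.
    apply le_epsilon. intros d Hd.
    pose proof (ok_Dmc _ _ _ _ HC t) as CD.
    destruct (RInt_residual_small (cDm Cs t) r d CD Hr Hd) as [M HM].
    rewrite (RInt_residual_tail _ N M r CD). eapply Rle_trans; [apply Rabs_triang|].
    specialize (HM (N + M)%nat ltac:(lia)).
    assert (Rabs (ssum (fun k => coef (cDm Cs t) (N + k)%nat * gl psi r 1 (N + k)%nat) M) <= e); [|lra].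
    eapply Rle_trans; [apply ssum_abs|]. eapply Rle_trans; [|apply (HN M r Hr)]. unfold gsum.
    apply ssum_le. intros k _. rewrite Rabs_mult. apply Rmult_le_compat_r; [apply Rabs_pos|].
    eapply Rle_trans; [apply Hu|apply Rle_abs].
  - auto.
  - intro s. apply is_derive_rho_mult. apply (ok_Mr _ _ _ _ HC).
  - pose proof (cont_cM 1 A B Cs HC t). pose proof (ok_Mrc _ _ _ _ HC t). pose proof (cont_rho A B). cont_tac.
  - apply (ok_Dmc _ _ _ _ HC).
  - intros s _. apply (ok_Dm _ _ _ _ HC).
  - auto.
Qed.

Variables (w c : R) (X Y : comp).
Variable (Hc : 0 < c).
Variable (HX : comp_ok 1 A B X).
Variable (HY : comp_ok 1 A B Y).
Variable (Hev : evolves w c X Y).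
Variable (RpX : regular A B (cDp X 0)).
Variable (RpY : regular A B (cDp Y 0)).
Variable (RmX : regular A B (cDm X 0)).
Variable (RmY : regular A B (cDm Y 0)).

(** The envelope consists of initial coefficients alone: those of [cT] over [sqrt nu] are summable
    by Bessel, those of [cDp] and [cDm] by regularity of the initial data. *)
Lemma W_small_1 : W_small 1 A B psi X Y.
Proof.
  assert (add : forall u v a b, summable u -> summable v -> 0 <= a -> 0 <= b ->
     summable (fun k => a * Rabs (u k) + b * Rabs (v k))).
  { intros u v a b Hu Hv Ha Hb'. apply (summable_lin psi u v _ a b); auto.
    intro k. rewrite Rabs_pos_eq; [lra|]. apply Rplus_le_le_0_compat; apply Rmult_le_pos; auto using Rabs_pos. }
  pose proof (summable_over_sqrt A B psi dpsi nu HA HB Hb (cT X 0) (ok_Tc _ _ _ _ HX 0)) as S1.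
  pose proof (summable_over_sqrt A B psi dpsi nu HA HB Hb (cT Y 0) (ok_Tc _ _ _ _ HY 0)) as S2.
  pose proof (summable_regular A B psi dpsi nu HA HB Hb _ RpX) as S3.
  pose proof (summable_regular A B psi dpsi nu HA HB Hb _ RpY) as S4.
  pose proof (summable_regular A B psi dpsi nu HA HB Hb _ RmX) as S5.
  pose proof (summable_regular A B psi dpsi nu HA HB Hb _ RmY) as S6.
  set (th := (A + B) / A). assert (Hth : 0 <= th) by (apply Rdiv_le_0_compat; lra).
  pose proof (add _ _ (2 * c) (2 * c) S1 S2 ltac:(lra) ltac:(lra)) as U1.
  pose proof (add _ _ 1 1 S3 S4 ltac:(lra) ltac:(lra)) as U2.
  pose proof (add _ _ th th S5 S6 Hth Hth) as U3.
  pose proof (add _ _ 1 1 U1 U2 ltac:(lra) ltac:(lra)) as U4.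
  pose proof (add _ _ 1 1 U4 U3 ltac:(lra) ltac:(lra)) as U5. clear add U1 U2 U3 U4.
  assert (G : forall a1 a2 a3 a4 a5 a6, 2 * c * (a1 + a2) + (a3 + a4) + th * (a5 + a6) <=
    1 * Rabs (1 * Rabs (2 * c * a1 + 2 * c * a2) + 1 * Rabs (1 * a3 + 1 * a4)) + 1 * Rabs (th * a5 + th * a6)).
  { intros. pose proof (Rle_abs (2 * c * a1 + 2 * c * a2)). pose proof (Rle_abs (1 * a3 + 1 * a4)).
    pose proof (Rle_abs (th * a5 + th * a6)).
    pose proof (Rle_abs (1 * Rabs (2 * c * a1 + 2 * c * a2) + 1 * Rabs (1 * a3 + 1 * a4))). lra. }
  intros e He. destruct (U5 e He) as [N HN]. exists N. intros t r Hr.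
  assert (HN' : forall m r, 0 < r <= 1 -> gsum psi _ N m r <= e) by (intros; apply HN; auto).
  cbv beta in HN'.
  split; (eapply summable_W_small; [eassumption| |exact HN'|exact Hr]); intro k; cbv beta;
    destruct (coef_m_envelope 1 A B psi dpsi nu HA HB Hb w c X Y Hc HX HY Hev k t) as [E1 E2]; fold th in E1, E2.
  - eapply Rle_trans; [exact E1|]. apply G.
  - eapply Rle_trans; [exact E2|]. apply G.
Qed.

End FirstMode.

(** * Smooth functions on space-time *)
Lemma smooth_partial f i : smooth f -> smooth (partial i f).
Proof.
  intros Hf l. assert (E : iter_partial l (partial i f) = iter_partial (l ++ i :: nil) f).
  { unfold iter_partial. now rewrite fold_right_app. }
  rewrite E. apply Hf.
Qed.
Lemma smooth_is_derive f i t x y : smooth f -> is_derive (slice i f t x y) (coord_val i t x y) (partial i f t x y).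
Proof. intro Hf. apply Derive_correct, (proj1 (Hf nil t x y)). Qed.
Lemma smooth_dt f t x y : smooth f -> is_derive (fun s => f s x y) t (partial coord_t f t x y).
Proof. apply (smooth_is_derive f coord_t). Qed.
Lemma smooth_dx f t x y : smooth f -> is_derive (fun s => f t s y) x (partial coord_x f t x y).
Proof. apply (smooth_is_derive f coord_x). Qed.
Lemma smooth_dy f t x y : smooth f -> is_derive (fun s => f t x s) y (partial coord_y f t x y).
Proof. apply (smooth_is_derive f coord_y). Qed.
Lemma smooth_continuous f t x y : smooth f ->
  continuous (fun p : R * (R * R) => f (fst p) (fst (snd p)) (snd (snd p))) (t, (x, y)).
Proof. intro Hf. apply (proj2 (Hf nil t x y)). Qed.

(** A class of algebraic expressions closed under partial derivatives; membership yields existence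
    and continuity of derivatives of all orders by one induction. *)
Inductive smooth_span : (R -> scalar_field) -> Prop :=
| span_smooth f : smooth f -> smooth_span f
| span_const c : smooth_span (fun _ _ _ => c)
| span_x : smooth_span (fun _ x _ => x)
| span_y : smooth_span (fun _ _ y => y)
| span_plus f g : smooth_span f -> smooth_span g -> smooth_span (fun t x y => f t x y + g t x y)
| span_mult f g : smooth_span f -> smooth_span g -> smooth_span (fun t x y => f t x y * g t x y).

Lemma smooth_span_ex_derive f : smooth_span f -> forall i t x y, ex_derive (slice i f t x y) (coord_val i t x y).
Proof.
  induction 1 as [f Hf|c| | |f g _ IHf _ IHg|f g _ IHf _ IHg]; intros i t x y.
  - apply (proj1 (Hf nil t x y)).
  - destruct i; apply ex_derive_const.
  - destruct i; [apply ex_derive_const|apply ex_derive_id|apply ex_derive_const].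
  - destruct i; [apply ex_derive_const|apply ex_derive_const|apply ex_derive_id].
  - specialize (IHf i t x y). specialize (IHg i t x y).
    destruct i; apply (ex_derive_plus (V := R_NormedModule)); auto.
  - specialize (IHf i t x y). specialize (IHg i t x y). destruct i; apply ex_derive_mult; auto.
Qed.
Lemma smooth_span_partial f i : smooth_span f -> smooth_span (partial i f).
Proof.
  intro H. induction H as [f Hf|c| | |f g Hf IHf Hg IHg|f g Hf IHf Hg IHg].
  - apply span_smooth, smooth_partial, Hf.
  - replace (partial i _) with (fun _ _ _ : R => 0); [apply span_const|].
    apply functional_extensionality. intro t. do 2 (apply functional_extensionality; intro).
    symmetry. destruct i; unfold partial, slice, coord_val; apply Derive_const.
  - replace (partial i _) with (fun _ _ _ : R => match i with coord_x => 1 | _ => 0 end); [apply span_const|].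
    apply functional_extensionality. intro t. do 2 (apply functional_extensionality; intro).
    symmetry. destruct i; unfold partial, slice, coord_val; [apply Derive_const|apply Derive_id|apply Derive_const].
  - replace (partial i _) with (fun _ _ _ : R => match i with coord_y => 1 | _ => 0 end); [apply span_const|].
    apply functional_extensionality. intro t. do 2 (apply functional_extensionality; intro).
    symmetry. destruct i; unfold partial, slice, coord_val; [apply Derive_const|apply Derive_const|apply Derive_id].
  - replace (partial i _) with (fun t x y => partial i f t x y + partial i g t x y); [now apply span_plus|].
    apply functional_extensionality. intro t. do 2 (apply functional_extensionality; intro).
    pose proof (smooth_span_ex_derive f Hf i t x x0). pose proof (smooth_span_ex_derive g Hg i t x x0).
    symmetry. destruct i; apply Derive_plus; auto.
  - replace (partial i _) with (fun t x y => partial i f t x y * g t x y + f t x y * partial i g t x y).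
    + apply span_plus; apply span_mult; auto.
    + apply functional_extensionality. intro t. do 2 (apply functional_extensionality; intro).
      pose proof (smooth_span_ex_derive f Hf i t x x0). pose proof (smooth_span_ex_derive g Hg i t x x0).
      symmetry. destruct i; apply Derive_mult; auto.
Qed.
Lemma smooth_span_continuous f : smooth_span f -> forall t x y,
  continuous (fun p : R * (R * R) => f (fst p) (fst (snd p)) (snd (snd p))) (t, (x, y)).
Proof.
  induction 1 as [f Hf|c| | |f g _ IHf _ IHg|f g _ IHf _ IHg]; intros t x y.
  - now apply smooth_continuous.
  - apply continuous_const.
  - apply (continuous_comp snd fst); [apply continuous_snd|apply continuous_fst].
  - apply (continuous_comp snd snd); apply continuous_snd.
  - apply (continuous_plus (fun p : R * (R * R) => f (fst p) (fst (snd p)) (snd (snd p)))); auto.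
  - apply (continuous_mult (fun p : R * (R * R) => f (fst p) (fst (snd p)) (snd (snd p)))); auto.
Qed.
Lemma smooth_of_span f : smooth_span f -> smooth f.
Proof.
  intros H l. assert (Hl : smooth_span (iter_partial l f)).
  { induction l; simpl; auto. now apply smooth_span_partial. }
  intros t x y. split; [intro i; now apply smooth_span_ex_derive|now apply smooth_span_continuous].
Qed.
Lemma span_minus f g : smooth_span f -> smooth_span g -> smooth_span (fun t x y => f t x y - g t x y).
Proof.
  intros Hf Hg. replace (fun t x y => f t x y - g t x y) with (fun t x y => f t x y + (-1) * g t x y).
  - apply span_plus; auto. apply (span_mult (fun _ _ _ => -1)); auto. apply span_const.
  - do 3 (apply functional_extensionality; intro). ring.
Qed.
Ltac smooth_tac := apply smooth_of_span; repeat lazymatch goal with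
  | |- smooth_span (fun _ _ _ => ?c) => apply (span_const c)
  | |- smooth_span (fun t x y => @?f t x y + @?g t x y) => apply (span_plus f g)
  | |- smooth_span (fun t x y => @?f t x y - @?g t x y) => apply (span_minus f g)
  | |- smooth_span (fun t x y => @?f t x y * @?g t x y) => apply (span_mult f g)
  | |- smooth_span (fun t x y => x) => apply span_x
  | |- smooth_span (fun t x y => y) => apply span_y
  | |- _ => apply span_smooth; solve [auto using smooth_partial]
  end.

Section Composition.
Variable (U : UniformSpace).
Lemma continuous_pair_map (V W : UniformSpace) (f : U -> V) (g : U -> W) q :
  continuous f q -> continuous g q -> continuous (fun q => (f q, g q)) q.
Proof.
  intros Hf Hg. apply filterlim_locally. intro eps.
  apply filterlim_locally with (eps := eps) in Hf. apply filterlim_locally with (eps := eps) in Hg.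
  generalize (filter_and _ _ Hf Hg). apply filter_imp. intros p [H1 H2]. split; auto.
Qed.
Lemma smooth_continuous_comp f (a b c : U -> R) q : smooth f ->
  continuous a q -> continuous b q -> continuous c q -> continuous (fun q => f (a q) (b q) (c q)) q.
Proof.
  intros Hf Ha Hb Hc.
  apply (continuous_comp (fun q => (a q, (b q, c q))) (fun p : R * (R * R) => f (fst p) (fst (snd p)) (snd (snd p)))).
  - apply continuous_pair_map; auto. now apply continuous_pair_map.
  - now apply smooth_continuous.
Qed.
End Composition.

Lemma smooth_chain f t (b c : R -> R) (b' c' s : R) : smooth f -> is_derive b s b' -> is_derive c s c' ->
  is_derive (fun s => f t (b s) (c s)) s (partial coord_x f t (b s) (c s) * b' + partial coord_y f t (b s) (c s) * c').
Proof.
  intros Hf Hb Hc.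
  pose proof (is_derive_filterdiff (fun x y => f t x y) (b s) (c s)
    (fun x y => partial coord_x f t x y) (partial coord_y f t (b s) (c s))) as H.
  eapply is_derive_eq.
  - apply (filterdiff_ext_lin _ (fun h => h * b' * partial coord_x f t (b s) (c s) + h * c' * partial coord_y f t (b s) (c s))).
    + apply (filterdiff_comp'_2 b c (fun x y => f t x y) s (fun h => h * b') (fun h => h * c')
         (fun u v => u * partial coord_x f t (b s) (c s) + v * partial coord_y f t (b s) (c s))); [exact Hb|exact Hc|].
      apply H.
      * apply filter_forall. intros [x y]. apply (smooth_dx f t x y Hf).
      * apply (smooth_dy f t _ _ Hf).
      * apply (smooth_continuous_comp (prod_UniformSpace R_UniformSpace R_UniformSpace) (partial coord_x f) (fun _ => t) fst snd).
        -- now apply smooth_partial.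
        -- apply continuous_const.
        -- apply continuous_fst.
        -- apply continuous_snd.
    + intro h. instantiate (1 := b' * partial coord_x f t (b s) (c s) + c' * partial coord_y f t (b s) (c s)).
      unfold scal; simpl. unfold mult; simpl. ring.
  - rring.
Qed.

(** * Angular Fourier coefficients *)
Section ContinuousReal.
Variable (U : UniformSpace).
Implicit Types (f g : U -> R) (q : U).
Lemma continuous_rplus f g q : continuous f q -> continuous g q -> continuous (fun q => f q + g q) q.
Proof. intros. now apply (continuous_plus f g). Qed.
Lemma continuous_rminus f g q : continuous f q -> continuous g q -> continuous (fun q => f q - g q) q.
Proof. intros. now apply (continuous_minus f g). Qed.
Lemma continuous_rmult f g q : continuous f q -> continuous g q -> continuous (fun q => f q * g q) q.
Proof. intros. now apply (continuous_mult f g). Qed.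
Lemma continuous_rcos f q : continuous f q -> continuous (fun q => cos (f q)) q.
Proof. intros. apply (continuous_comp f cos); auto. apply continuous_cos. Qed.
Lemma continuous_rsin f q : continuous f q -> continuous (fun q => sin (f q)) q.
Proof. intros. apply (continuous_comp f sin); auto. apply continuous_sin. Qed.
End ContinuousReal.
Lemma continuous_fst_comp (U V : UniformSpace) (f : U -> R) (q : U * V) :
  continuous f (fst q) -> continuous (fun q : U * V => f (fst q)) q.
Proof. intro H. apply (continuous_comp fst f); auto. destruct q. apply continuous_fst. Qed.
Lemma continuous_snd_comp (U V : UniformSpace) (f : V -> R) (q : U * V) :
  continuous f (snd q) -> continuous (fun q : U * V => f (snd q)) q.
Proof. intro H. apply (continuous_comp snd f); auto. destruct q. apply continuous_snd. Qed.
Ltac ctn := repeat lazymatch goal with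
  | |- continuous (fun _ => ?c) _ => apply (continuous_const c)
  | |- continuous (fun x => x) _ => apply continuous_id
  | |- continuous (fun x => @?f x + @?g x) _ => apply (continuous_rplus _ f g)
  | |- continuous (fun x => @?f x - @?g x) _ => apply (continuous_rminus _ f g)
  | |- continuous (fun x => @?f x * @?g x) _ => apply (continuous_rmult _ f g)
  | |- continuous (fun x => cos (@?f x)) _ => apply (continuous_rcos _ f)
  | |- continuous (fun x => sin (@?f x)) _ => apply (continuous_rsin _ f)
  | |- continuous (fun x => fst (fst x)) _ => apply (continuous_fst_comp _ _ fst)
  | |- continuous (fun x => snd (fst x)) _ => apply (continuous_fst_comp _ _ snd)
  | |- continuous (fun x => fst x) _ => apply (continuous_fst_comp _ _ (fun x => x))
  | |- continuous (fun x => snd x) _ => apply (continuous_snd_comp _ _ (fun x => x))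
  | |- continuous fst _ => apply (continuous_fst_comp _ _ (fun x => x))
  | |- continuous snd _ => apply (continuous_snd_comp _ _ (fun x => x))
  | |- continuous (fun x => ?f (@?a x) (@?b x) (@?c x)) _ =>
      apply (smooth_continuous_comp _ f a b c); [solve [auto using smooth_partial]| | | ]
  end.

Lemma continuity_2d_of_continuous (f : R -> R -> R) (x y : R) :
  continuous (fun q : prod_UniformSpace R_UniformSpace R_UniformSpace => f (fst q) (snd q)) (x, y) ->
  continuity_2d_pt f x y.
Proof. intro H. apply continuity_2d_pt_filterlim. exact H. Qed.

(** The phase [- nu * t] with nu = n omega passes to the rotating frame, and a shift of [al] by pi/2
    exchanges real and imaginary part. *)
Definition ker (f : R -> scalar_field) (m : Z) (al nu t r th : R) : R :=
  f t (r * cos th) (r * sin th) * cos (IZR m * th + al - nu * t).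
Definition Fc (f : R -> scalar_field) (m : Z) (al nu t r : R) : R := RInt (ker f m al nu t r) 0 (2 * PI).

Lemma cont_ker f m al nu t r : smooth f -> cont (ker f m al nu t r).
Proof. intros Hf th. unfold ker. ctn. Qed.
Lemma two_pi_pos : 0 <= 2 * PI. Proof. pose proof PI_RGT_0. lra. Qed.

Lemma Fc_continuity_2d f m al nu t r : smooth f -> continuity_2d_pt (Fc f m al nu) t r.
Proof.
  intro Hf. apply continuity_2d_of_continuous.
  apply (continuous_RInt_param (prod_UniformSpace R_UniformSpace R_UniformSpace) (fun p th => ker f m al nu (fst p) (snd p) th) (t, r)).
  - apply two_pi_pos.
  - intro p. now apply cont_ker.
  - intros th _. unfold ker. ctn.
Qed.
Lemma cont_Fc f m al nu t : smooth f -> cont (Fc f m al nu t).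
Proof. intro Hf. apply cont_slice2. intros. now apply Fc_continuity_2d. Qed.

Lemma Fc_ext f g m al nu t r : (forall th, f t (r * cos th) (r * sin th) = g t (r * cos th) (r * sin th)) ->
  Fc f m al nu t r = Fc g m al nu t r.
Proof. intro H. apply RInt_rext. intro th. unfold ker. now rewrite H. Qed.
Lemma Fc_plus f g m al nu t r : smooth f -> smooth g ->
  Fc (fun t x y => f t x y + g t x y) m al nu t r = Fc f m al nu t r + Fc g m al nu t r.
Proof.
  intros Hf Hg. pose proof (cont_ker f m al nu t r Hf). pose proof (cont_ker g m al nu t r Hg).
  unfold Fc. rewrite <- RInt_cplus by auto. apply RInt_rext. intro. unfold ker. ring.
Qed.
Lemma Fc_minus f g m al nu t r : smooth f -> smooth g ->
  Fc (fun t x y => f t x y - g t x y) m al nu t r = Fc f m al nu t r - Fc g m al nu t r.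
Proof.
  intros Hf Hg. pose proof (cont_ker f m al nu t r Hf). pose proof (cont_ker g m al nu t r Hg).
  unfold Fc. rewrite <- RInt_cminus by auto. apply RInt_rext. intro. unfold ker. ring.
Qed.
Lemma Fc_scal_at f g m al nu t r k : smooth f ->
  (forall th, g t (r * cos th) (r * sin th) = k * f t (r * cos th) (r * sin th)) ->
  Fc g m al nu t r = k * Fc f m al nu t r.
Proof.
  intros Hf H. pose proof (cont_ker f m al nu t r Hf).
  unfold Fc. rewrite <- RInt_cscal by auto. apply RInt_rext. intro. unfold ker. rewrite H. ring.
Qed.

Lemma cos_next m th al s : cos (IZR (m + 1) * th + al - s) =
  cos (IZR m * th + al - s) * cos th - sin (IZR m * th + al - s) * sin th.
Proof. rewrite <- cos_plus. f_equal. rewrite plus_IZR. ring. Qed.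
Lemma cos_prev m th al s : cos (IZR (m - 1) * th + al - s) =
  cos (IZR m * th + al - s) * cos th + sin (IZR m * th + al - s) * sin th.
Proof. rewrite <- cos_minus. f_equal. rewrite minus_IZR. ring. Qed.
Lemma cos_quarter m th al s : cos (IZR m * th + (al - PI / 2) - s) = sin (IZR m * th + al - s).
Proof. rewrite <- cos_shift, <- (cos_neg (PI / 2 - _)). f_equal. ring. Qed.

Lemma Fc_half_turn f m al nu t r : smooth f -> Fc f m (al - PI / 2 - PI / 2) nu t r = - Fc f m al nu t r.
Proof.
  intro Hf. pose proof (cont_ker f m al nu t r Hf). unfold Fc. rewrite <- RInt_copp by auto.
  apply RInt_rext. intro th. unfold ker. rewrite !cos_quarter.
  replace (IZR m * th + (al - PI / 2) - nu * t) with (- (PI / 2 - (IZR m * th + al - nu * t))) by ring.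
  rewrite sin_neg, sin_shift. ring.
Qed.

(** [PP] is the real form of the coefficient of f + i g at angular number m + 1, [MM] that of f - i
    g at m - 1. *)
Definition PP (f g : R -> scalar_field) m al nu t r :=
  Fc f (m + 1)%Z al nu t r + Fc g (m + 1)%Z (al - PI / 2) nu t r.
Definition MM (f g : R -> scalar_field) m al nu t r :=
  Fc f (m - 1)%Z al nu t r - Fc g (m - 1)%Z (al - PI / 2) nu t r.
(** Coefficient of the radial derivative cos theta f_x + sin theta f_y, expressed through the two
    complex components of the gradient. *)
Definition Fr f m al nu t r :=
  / 2 * (PP (partial coord_x f) (partial coord_y f) m al nu t r + MM (partial coord_x f) (partial coord_y f) m al nu t r).

Lemma is_derive_Fc_t f m al nu t r : smooth f ->
  is_derive (fun t => Fc f m al nu t r) t (Fc (partial coord_t f) m al nu t r + nu * Fc f m (al - PI / 2) nu t r).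
Proof.
  intro Hf. pose proof (smooth_partial f coord_t Hf) as Hft.
  pose proof (cont_ker f m (al - PI / 2) nu t r Hf). pose proof (cont_ker _ m al nu t r Hft).
  unfold Fc at 2 3. rewrite <- RInt_cscal, <- RInt_cplus by (auto; cont_tac).
  apply (is_derive_RInt_2d (fun t th => ker f m al nu t r th)
    (fun t th => ker (partial coord_t f) m al nu t r th + nu * ker f m (al - PI / 2) nu t r th)).
  - intros s th. unfold ker. rewrite cos_quarter.
    eapply is_derive_eq.
    + apply is_derive_rmult; [apply (smooth_dt f); auto|].
      apply (is_derive_comp cos (fun t => IZR m * th + al - nu * t)); [apply is_derive_cos|].
      apply (is_derive_rminus (fun _ => IZR m * th + al)); [apply is_derive_const|apply is_derive_rscal, is_derive_id].
    + unfold zero, one, scal, mult; simpl. unfold mult; simpl. rring.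
  - intros s th. apply continuity_2d_of_continuous. unfold ker. ctn.
  - intro. now apply cont_ker.
Qed.

Lemma is_derive_Fc_r f m al nu t r : smooth f -> is_derive (Fc f m al nu t) r (Fr f m al nu t r).
Proof.
  intro Hf. pose proof (smooth_partial f coord_x Hf) as Hx. pose proof (smooth_partial f coord_y Hf) as Hy.
  pose proof (fun m al => cont_ker _ m al nu t r Hx) as Cx. pose proof (fun m al => cont_ker _ m al nu t r Hy) as Cy.
  assert (E : Fr f m al nu t r = RInt (fun th => partial coord_x f t (r * cos th) (r * sin th) * (cos th * cos (IZR m * th + al - nu * t))
    + partial coord_y f t (r * cos th) (r * sin th) * (sin th * cos (IZR m * th + al - nu * t))) 0 (2 * PI)).
  { unfold Fr, PP, MM, Fc.
    pose proof (Cx (m + 1)%Z al). pose proof (Cx (m - 1)%Z al). pose proof (Cy (m + 1)%Z (al - PI / 2)). pose proof (Cy (m - 1)%Z (al - PI / 2)).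
    rewrite <- RInt_cplus, <- RInt_cminus, <- RInt_cplus, <- RInt_cscal by cont_tac.
    apply RInt_rext. intro th. unfold ker. rewrite cos_next, cos_prev, cos_next, cos_prev, !cos_quarter.
    replace (sin (IZR m * th + (al - PI / 2) - nu * t)) with (- cos (IZR m * th + al - nu * t)).
    - field.
    - rewrite <- sin_shift, <- sin_neg. f_equal. ring. }
  rewrite E.
  apply (is_derive_RInt_2d (fun r th => ker f m al nu t r th)
    (fun r th => partial coord_x f t (r * cos th) (r * sin th) * (cos th * cos (IZR m * th + al - nu * t))
    + partial coord_y f t (r * cos th) (r * sin th) * (sin th * cos (IZR m * th + al - nu * t)))).
  - intros s th. unfold ker. eapply is_derive_eq.
    + apply (is_derive_rmult (fun s => f t (s * cos th) (s * sin th)) (fun _ => cos (IZR m * th + al - nu * t))); [|apply is_derive_const].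
      apply (smooth_chain f t (fun s => s * cos th) (fun s => s * sin th) (cos th) (sin th)); auto.
      * auto_derive; auto. ring.
      * auto_derive; auto. ring.
    + unfold zero; simpl. rring.
  - intros s th. apply continuity_2d_of_continuous. ctn.
  - intro. now apply cont_ker.
Qed.

Definition rot (f : R -> scalar_field) : R -> scalar_field :=
  fun t x y => x * partial coord_y f t x y - y * partial coord_x f t x y.
Lemma smooth_rot f : smooth f -> smooth (rot f).
Proof. intro Hf. unfold rot. smooth_tac. Qed.

Lemma Fc_rot f m al nu t r : smooth f -> Fc (rot f) m al nu t r = IZR m * Fc f m (al - PI / 2) nu t r.
Proof.
  intro Hf. pose proof (smooth_rot f Hf) as Hr.
  pose proof (cont_ker _ m al nu t r Hr). pose proof (cont_ker f m (al - PI / 2) nu t r Hf).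
  apply Rminus_diag_uniq. unfold Fc. rewrite <- RInt_cscal, <- RInt_cminus by cont_tac.
  rewrite (RInt_cderive _ (ker f m al nu t r)).
  - unfold ker. rewrite sin_2PI, cos_2PI, sin_0, cos_0.
    replace (cos (IZR m * (2 * PI) + al - nu * t)) with (cos (IZR m * 0 + al - nu * t)); [rring|].
    replace (IZR m * (2 * PI) + al - nu * t) with ((IZR m * 0 + al - nu * t) + IZR m * (2 * PI)) by ring.
    generalize (IZR m * 0 + al - nu * t). intro x. rewrite cos_plus.
    assert (P : forall k : nat, cos (INR k * (2 * PI)) = 1 /\ sin (INR k * (2 * PI)) = 0).
    { intro k. pose proof (cos_period 0 k) as X1. pose proof (sin_period 0 k) as X2.
      replace (0 + 2 * INR k * PI) with (INR k * (2 * PI)) in X1, X2 by ring.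
      now rewrite X1, X2, cos_0, sin_0. }
    destruct (Z_le_gt_dec 0 m) as [Hm|Hm].
    + destruct (P (Z.to_nat m)) as [P1 P2]. rewrite INR_IZR_INZ, Z2Nat.id in P1, P2 by auto. rewrite P1, P2. ring.
    + destruct (P (Z.to_nat (- m))) as [P1 P2]. rewrite INR_IZR_INZ, Z2Nat.id, opp_IZR in P1, P2 by lia.
      replace (IZR m * (2 * PI)) with (- (- IZR m * (2 * PI))) by ring. rewrite cos_neg, sin_neg, P1, P2. ring.
  - cont_tac.
  - intro th. unfold ker. rewrite cos_quarter. eapply is_derive_eq.
    + apply is_derive_rmult.
      * apply (smooth_chain f t (fun s => r * cos s) (fun s => r * sin s) (- (r * sin th)) (r * cos th)); auto.
        -- auto_derive; auto. ring.
        -- auto_derive; auto. ring.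
      * apply (is_derive_comp cos (fun th => IZR m * th + al - nu * t)); [apply is_derive_cos|].
        apply (is_derive_rminus (fun th => IZR m * th + al) (fun _ => nu * t)); [|apply is_derive_const].
        apply (is_derive_rplus (fun th => IZR m * th) (fun _ => al)); [apply is_derive_rscal, is_derive_id|apply is_derive_const].
    + unfold rot, zero, one, scal, mult; simpl. unfold mult; simpl. rring.
Qed.

Notation Dt := (partial coord_t).
Notation Dx := (partial coord_x).
Notation Dy := (partial coord_y).

(** The difference of the two gradient components is the angular derivative, integrated by parts
    over the circle. Together with the half sum [Fr] it puts f' - m f / r at angular number m + 1
    and f' + m f / r at m - 1, for the coefficient f of number m. *)
Lemma Fc_ibp f m al nu t r : smooth f ->
  r * (MM (Dx f) (Dy f) m al nu t r - PP (Dx f) (Dy f) m al nu t r) = 2 * IZR m * Fc f m al nu t r.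
Proof.
  intro Hf. pose proof (smooth_partial f coord_x Hf) as Hx. pose proof (smooth_partial f coord_y Hf) as Hy.
  assert (E : Fc f m al nu t r = Fc f m (al + PI / 2 - PI / 2) nu t r) by (f_equal; ring).
  rewrite E, Rmult_assoc, <- Fc_rot by auto.
  pose proof (fun m al => cont_ker _ m al nu t r Hx) as Cx. pose proof (fun m al => cont_ker _ m al nu t r Hy) as Cy.
  unfold PP, MM, Fc.
  pose proof (Cx (m + 1)%Z al). pose proof (Cx (m - 1)%Z al). pose proof (Cy (m + 1)%Z (al - PI / 2)). pose proof (Cy (m - 1)%Z (al - PI / 2)).
  pose proof (cont_ker _ m (al + PI / 2) nu t r (smooth_rot f Hf)).
  rewrite <- RInt_cplus, <- RInt_cminus, <- RInt_cminus, <- !RInt_cscal by cont_tac.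
  apply RInt_rext. intro th. unfold ker, rot. rewrite cos_next, cos_prev, cos_next, cos_prev, !cos_quarter.
  replace (sin (IZR m * th + (al - PI / 2) - nu * t)) with (- cos (IZR m * th + al - nu * t)).
  - replace (cos (IZR m * th + (al + PI / 2) - nu * t)) with (- sin (IZR m * th + al - nu * t)); [ring|].
    replace (IZR m * th + (al + PI / 2) - nu * t) with (IZR m * th + al - nu * t + PI / 2) by ring.
    rewrite cos_plus, cos_PI2, sin_PI2. ring.
  - rewrite <- sin_shift, <- sin_neg. f_equal. ring.
Qed.
Lemma PP_rel f m al nu t r : smooth f ->
  r * PP (Dx f) (Dy f) m al nu t r = r * Fr f m al nu t r - IZR m * Fc f m al nu t r.
Proof. intro Hf. pose proof (Fc_ibp f m al nu t r Hf). unfold Fr. lra. Qed.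
Lemma MM_rel f m al nu t r : smooth f ->
  r * MM (Dx f) (Dy f) m al nu t r = r * Fr f m al nu t r + IZR m * Fc f m al nu t r.
Proof. intro Hf. pose proof (Fc_ibp f m al nu t r Hf). unfold Fr. lra. Qed.

Definition diverg (g h : R -> scalar_field) : R -> scalar_field := fun t x y => Dx g t x y + Dy h t x y.
Definition vort (g h : R -> scalar_field) : R -> scalar_field := fun t x y => Dx h t x y - Dy g t x y.
Lemma smooth_diverg g h : smooth g -> smooth h -> smooth (diverg g h).
Proof. intros. unfold diverg. smooth_tac. Qed.
Lemma smooth_vort g h : smooth g -> smooth h -> smooth (vort g h).
Proof. intros. unfold vort. smooth_tac. Qed.

(** Real form of the coefficient of (d_x - i d_y) (g + i h) = div + i vort; [DM] belongs to the
    conjugate (d_x + i d_y) (g - i h). *)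
Definition DP g h m al nu t r := Fc (diverg g h) m al nu t r + Fc (vort g h) m (al - PI / 2) nu t r.
Definition DM g h m al nu t r := Fc (diverg g h) m al nu t r - Fc (vort g h) m (al - PI / 2) nu t r.
Definition PPr g h m al nu t r := Fr g (m + 1)%Z al nu t r + Fr h (m + 1)%Z (al - PI / 2) nu t r.
Definition MMr g h m al nu t r := Fr g (m - 1)%Z al nu t r - Fr h (m - 1)%Z (al - PI / 2) nu t r.

Lemma DP_rel g h m al nu t r : smooth g -> smooth h ->
  r * DP g h m al nu t r = r * PPr g h m al nu t r + IZR (m + 1) * PP g h m al nu t r.
Proof.
  intros Hg Hh. pose proof (MM_rel g (m + 1) al nu t r Hg) as E1. pose proof (MM_rel h (m + 1) (al - PI / 2) nu t r Hh) as E2.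
  unfold MM in E1, E2. replace (m + 1 - 1)%Z with m in E1, E2 by lia. rewrite Fc_half_turn in E2 by auto using smooth_partial.
  unfold DP, PPr, PP, diverg, vort. rewrite Fc_plus, Fc_minus by auto using smooth_partial. lra.
Qed.
Lemma DM_rel g h m al nu t r : smooth g -> smooth h ->
  r * DM g h m al nu t r = r * MMr g h m al nu t r - IZR (m - 1) * MM g h m al nu t r.
Proof.
  intros Hg Hh. pose proof (PP_rel g (m - 1) al nu t r Hg) as E1. pose proof (PP_rel h (m - 1) (al - PI / 2) nu t r Hh) as E2.
  unfold PP in E1, E2. replace (m - 1 + 1)%Z with m in E1, E2 by lia. rewrite Fc_half_turn in E2 by auto using smooth_partial.
  unfold DM, MMr, MM, diverg, vort. rewrite Fc_plus, Fc_minus by auto using smooth_partial. lra.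
Qed.

Lemma is_derive_PP g h m al nu t r : smooth g -> smooth h -> is_derive (PP g h m al nu t) r (PPr g h m al nu t r).
Proof. intros. apply is_derive_rplus; now apply is_derive_Fc_r. Qed.
Lemma is_derive_MM g h m al nu t r : smooth g -> smooth h -> is_derive (MM g h m al nu t) r (MMr g h m al nu t r).
Proof. intros. apply is_derive_rminus; now apply is_derive_Fc_r. Qed.
Lemma cont_PP g h m al nu t : smooth g -> smooth h -> cont (PP g h m al nu t).
Proof. intros. apply (cont_derive _ (PPr g h m al nu t)). intro. now apply is_derive_PP. Qed.
Lemma cont_MM g h m al nu t : smooth g -> smooth h -> cont (MM g h m al nu t).
Proof. intros. apply (cont_derive _ (MMr g h m al nu t)). intro. now apply is_derive_MM. Qed.
Lemma cont_Fr f m al nu t : smooth f -> cont (Fr f m al nu t).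
Proof.
  intro. unfold Fr. pose proof (cont_PP (Dx f) (Dy f) m al nu t). pose proof (cont_MM (Dx f) (Dy f) m al nu t).
  apply cont_mult; [cont_tac|]. apply cont_plus; auto using smooth_partial.
Qed.
Lemma cont_PPr g h m al nu t : smooth g -> smooth h -> cont (PPr g h m al nu t).
Proof. intros. unfold PPr. apply cont_plus; now apply cont_Fr. Qed.
Lemma cont_MMr g h m al nu t : smooth g -> smooth h -> cont (MMr g h m al nu t).
Proof. intros. unfold MMr. apply cont_minus; now apply cont_Fr. Qed.
Lemma cont_DP g h m al nu t : smooth g -> smooth h -> cont (DP g h m al nu t).
Proof. intros. unfold DP. apply cont_plus; apply cont_Fc; auto using smooth_diverg, smooth_vort. Qed.
Lemma cont_DM g h m al nu t : smooth g -> smooth h -> cont (DM g h m al nu t).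
Proof. intros. unfold DM. apply cont_minus; apply cont_Fc; auto using smooth_diverg, smooth_vort. Qed.

(** * Multiplication by the steady density and the linearized equations for Fourier coefficients *)

Section Density.
Variables (A B : R).
Definition rdens : R -> scalar_field := fun _ x y => A + B * (x * x + y * y).
Definition rmul (f : R -> scalar_field) : R -> scalar_field := fun t x y => rdens t x y * f t x y.
Lemma smooth_rmul f : smooth f -> smooth (rmul f).
Proof. intro. unfold rmul, rdens. smooth_tac. Qed.
Lemma rdens_polar t r th : rdens t (r * cos th) (r * sin th) = rho A B r.
Proof.
  unfold rdens, rho. replace (r * cos th * (r * cos th) + r * sin th * (r * sin th)) with (r ^ 2 * (Rsqr (sin th) + Rsqr (cos th))).
  - rewrite sin2_cos2. ring.
  - unfold Rsqr. ring.
Qed.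
Lemma Fc_rmul f m al nu t r : smooth f -> Fc (rmul f) m al nu t r = rho A B r * Fc f m al nu t r.
Proof. intro Hf. apply Fc_scal_at; auto. intro th. unfold rmul. now rewrite rdens_polar. Qed.
Lemma PP_rmul g h m al nu t r : smooth g -> smooth h ->
  PP (rmul g) (rmul h) m al nu t r = rho A B r * PP g h m al nu t r.
Proof. intros. unfold PP. rewrite !Fc_rmul by auto. ring. Qed.
Lemma MM_rmul g h m al nu t r : smooth g -> smooth h ->
  MM (rmul g) (rmul h) m al nu t r = rho A B r * MM g h m al nu t r.
Proof. intros. unfold MM. rewrite !Fc_rmul by auto. ring. Qed.
Lemma PPr_rmul g h m al nu t r : smooth g -> smooth h ->
  PPr (rmul g) (rmul h) m al nu t r = 2 * B * r * PP g h m al nu t r + rho A B r * PPr g h m al nu t r.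
Proof.
  intros Hg Hh.
  pose proof (is_derive_PP _ _ m al nu t r (smooth_rmul g Hg) (smooth_rmul h Hh)) as H1.
  assert (H2 : is_derive (PP (rmul g) (rmul h) m al nu t) r (2 * B * r * PP g h m al nu t r + rho A B r * PPr g h m al nu t r)).
  { apply (is_derive_ext (fun r => rho A B r * PP g h m al nu t r)); [intro; symmetry; now apply PP_rmul|].
    apply is_derive_rmult; [apply is_derive_rho|now apply is_derive_PP]. }
  apply is_derive_unique in H1, H2. congruence.
Qed.
Lemma MMr_rmul g h m al nu t r : smooth g -> smooth h ->
  MMr (rmul g) (rmul h) m al nu t r = 2 * B * r * MM g h m al nu t r + rho A B r * MMr g h m al nu t r.
Proof.
  intros Hg Hh.
  pose proof (is_derive_MM _ _ m al nu t r (smooth_rmul g Hg) (smooth_rmul h Hh)) as H1.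
  assert (H2 : is_derive (MM (rmul g) (rmul h) m al nu t) r (2 * B * r * MM g h m al nu t r + rho A B r * MMr g h m al nu t r)).
  { apply (is_derive_ext (fun r => rho A B r * MM g h m al nu t r)); [intro; symmetry; now apply MM_rmul|].
    apply is_derive_rmult; [apply is_derive_rho|now apply is_derive_MM]. }
  apply is_derive_unique in H1, H2. congruence.
Qed.
Lemma DP_rmul g h m al nu t r : smooth g -> smooth h -> r * DP (rmul g) (rmul h) m al nu t r =
  r * (2 * B * r * PP g h m al nu t r + rho A B r * PPr g h m al nu t r) + IZR (m + 1) * (rho A B r * PP g h m al nu t r).
Proof. intros. rewrite DP_rel, PPr_rmul, PP_rmul by auto using smooth_rmul. reflexivity. Qed.
Lemma DM_rmul g h m al nu t r : smooth g -> smooth h -> r * DM (rmul g) (rmul h) m al nu t r =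
  r * (2 * B * r * MM g h m al nu t r + rho A B r * MMr g h m al nu t r) - IZR (m - 1) * (rho A B r * MM g h m al nu t r).
Proof. intros. rewrite DM_rel, MMr_rmul, MM_rmul by auto using smooth_rmul. reflexivity. Qed.

Variables (w : R) (sg vx vy : R -> scalar_field).
Variable (Hs : smooth sg).
Variable (Hvx : smooth vx).
Variable (Hvy : smooth vy).
(* The derivative of the density along the rotating frame, in which the Fourier phases are taken. *)
Definition mat : R -> scalar_field := fun t x y => Dt sg t x y + w * rot sg t x y.
Lemma smooth_mat : smooth mat.
Proof. pose proof (smooth_rot sg Hs). unfold mat. smooth_tac. Qed.

Definition fourier_comp (n : nat) (al : R) : comp :=
  let m := Z.of_nat n in let nu := INR n * w in
  {| cS := Fc sg m al nu; cSt := Fc mat m al nu; cSr := Fr sg m al nu; cStr := Fr mat m al nu;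
     cP := PP vx vy m al nu; cPt := fun t r => PP (Dt vx) (Dt vy) m al nu t r + nu * PP vx vy m (al - PI / 2) nu t r;
     cPr := PPr vx vy m al nu;
     cM := MM vx vy m al nu; cMt := fun t r => MM (Dt vx) (Dt vy) m al nu t r + nu * MM vx vy m (al - PI / 2) nu t r;
     cMr := MMr vx vy m al nu;
     cQ := PP (Dx sg) (Dy sg) m al nu; cQr := PPr (Dx sg) (Dy sg) m al nu; cQm := MM (Dx sg) (Dy sg) m al nu;
     cDp := DP (rmul vx) (rmul vy) m al nu; cDm := DM (rmul vx) (rmul vy) m al nu;
     cT := fun t r => - DP (rmul (Dx sg)) (rmul (Dy sg)) m al nu t r;
     cQt := PP (Dx mat) (Dy mat) m al nu; cQtr := PPr (Dx mat) (Dy mat) m al nu;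
     cTt := fun t r => - DP (rmul (Dx mat)) (rmul (Dy mat)) m al nu t r |}.

Lemma continuity_2d_opt (f g : R -> R -> R) k x y :
  continuity_2d_pt f x y -> continuity_2d_pt g x y -> continuity_2d_pt (fun x y => f x y + k * g x y) x y.
Proof.
  intros Hf Hg. apply continuity_2d_pt_plus; auto. apply continuity_2d_pt_mult; auto. apply continuity_2d_pt_const.
Qed.

Lemma is_derive_Fc_mat n al t r :
  is_derive (fun t => Fc sg (Z.of_nat n) al (INR n * w) t r) t (Fc mat (Z.of_nat n) al (INR n * w) t r).
Proof.
  eapply is_derive_eq; [apply is_derive_Fc_t; auto|]. unfold mat. pose proof (smooth_rot sg Hs) as Hr.
  assert (Hwr : smooth (fun t x y => w * rot sg t x y)) by smooth_tac.
  rewrite (Fc_plus (Dt sg) (fun t x y => w * rot sg t x y)) by auto using smooth_partial.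
  rewrite (Fc_scal_at (rot sg) (fun t x y => w * rot sg t x y) _ _ _ _ _ w) by auto.
  rewrite Fc_rot by auto. rewrite <- INR_IZR_INZ. rring.
Qed.

Lemma fourier_comp_ok n al : (forall t x y, on_circle x y -> sg t x y = 0) -> comp_ok n A B (fourier_comp n al).
Proof.
  intro Hbd. pose proof smooth_mat as Hm. pose proof (smooth_rmul vx Hvx) as Hrx. pose proof (smooth_rmul vy Hvy) as Hry.
  pose proof (smooth_partial sg coord_x Hs) as Hsx. pose proof (smooth_partial sg coord_y Hs) as Hsy.
  pose proof (smooth_partial mat coord_x Hm) as Hmx. pose proof (smooth_partial mat coord_y Hm) as Hmy.
  pose proof (smooth_partial vx coord_t Hvx) as Hvxt. pose proof (smooth_partial vy coord_t Hvy) as Hvyt.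
  assert (E1 : IZR (Z.of_nat n + 1) = INR (n + 1)) by (rewrite INR_IZR_INZ, Nat2Z.inj_add; reflexivity).
  assert (E2 : IZR (Z.of_nat n - 1) = INR n - 1) by (rewrite minus_IZR, <- INR_IZR_INZ; reflexivity).
  constructor; simpl; intros.
  - apply is_derive_Fc_mat.
  - eapply is_derive_eq; [apply is_derive_rplus; apply is_derive_Fc_t; auto|]. unfold PP. rring.
  - eapply is_derive_eq; [apply is_derive_rminus; apply is_derive_Fc_t; auto|]. unfold MM. rring.
  - now apply Fc_continuity_2d.
  - apply (continuity_2d_opt (PP (Dt vx) (Dt vy) _ _ _) (PP vx vy _ _ _)); apply continuity_2d_pt_plus; now apply Fc_continuity_2d.
  - apply (continuity_2d_opt (MM (Dt vx) (Dt vy) _ _ _) (MM vx vy _ _ _)); apply continuity_2d_pt_minus; now apply Fc_continuity_2d.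
  - now apply is_derive_Fc_r.
  - now apply is_derive_Fc_r.
  - now apply is_derive_PP.
  - now apply is_derive_MM.
  - now apply is_derive_PP.
  - now apply is_derive_PP.
  - now apply cont_Fr.
  - now apply cont_Fr.
  - now apply cont_PPr.
  - now apply cont_MMr.
  - now apply cont_PPr.
  - now apply cont_PPr.
  - now apply cont_MM.
  - now apply cont_DP.
  - now apply cont_DM.
  - apply cont_opp, cont_DP; now apply smooth_rmul.
  - apply cont_opp, cont_DP; now apply smooth_rmul.
  - rewrite PP_rel by auto. now rewrite <- INR_IZR_INZ.
  - rewrite MM_rel by auto. now rewrite <- INR_IZR_INZ.
  - rewrite PP_rel by auto. now rewrite <- INR_IZR_INZ.
  - rewrite DP_rmul by auto. now rewrite E1.
  - rewrite DM_rmul by auto. now rewrite E2.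
  - rewrite Ropp_involutive, DP_rmul by auto. now rewrite E1.
  - rewrite Ropp_involutive, DP_rmul by auto. now rewrite E1.
  - unfold Fc. rewrite (RInt_rext _ (fun _ => 0)); [rewrite RInt_cconst; rring|].
    intro th. unfold ker. rewrite Hbd; [ring|]. unfold on_circle. rewrite !Rmult_1_l.
    pose proof (sin2_cos2 th) as X. unfold Rsqr in X. lra.
Qed.

Variable (c : R).
Variable (Hcont : forall t x y, in_disc x y -> mat t x y = - diverg (rmul vx) (rmul vy) t x y).
Variable (Hmomx : forall t x y, in_disc x y -> Dt vx t x y = - w * rot vx t x y + w * vy t x y - c ^ 2 * Dx sg t x y).
Variable (Hmomy : forall t x y, in_disc x y -> Dt vy t x y = - w * rot vy t x y - w * vx t x y - c ^ 2 * Dy sg t x y).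

Lemma polar_in_disc r th : 0 <= r <= 1 -> in_disc (r * cos th) (r * sin th).
Proof.
  intro Hr. unfold in_disc. replace ((r * cos th) ^ 2 + (r * sin th) ^ 2) with (r ^ 2 * (Rsqr (sin th) + Rsqr (cos th))) by (unfold Rsqr; ring).
  rewrite sin2_cos2. nra.
Qed.
Lemma Fc_mat_div m al nu t r : 0 <= r <= 1 ->
  Fc mat m al nu t r = - / 2 * (DP (rmul vx) (rmul vy) m al nu t r + DM (rmul vx) (rmul vy) m al nu t r).
Proof.
  intro Hr. pose proof (smooth_rmul vx Hvx) as Hrx. pose proof (smooth_rmul vy Hvy) as Hry.
  rewrite (Fc_scal_at (diverg (rmul vx) (rmul vy)) mat _ _ _ _ _ (-1)).
  - unfold DP, DM. field.
  - now apply smooth_diverg.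
  - intro th. rewrite Hcont by now apply polar_in_disc. ring.
Qed.
Lemma Fc_momx m al nu t r : 0 <= r <= 1 ->
  Fc (Dt vx) m al nu t r = - w * IZR m * Fc vx m (al - PI / 2) nu t r + w * Fc vy m al nu t r - c ^ 2 * Fc (Dx sg) m al nu t r.
Proof.
  intro Hr. pose proof (smooth_rot vx Hvx) as Hrv. pose proof (smooth_partial sg coord_x Hs) as Hsx.
  rewrite (Fc_ext _ (fun t x y => (- w * rot vx t x y + w * vy t x y) - c ^ 2 * Dx sg t x y)).
  2:{ intro th. apply Hmomx. now apply polar_in_disc. }
  assert (S1 : smooth (fun t x y => - w * rot vx t x y)) by smooth_tac.
  assert (S2 : smooth (fun t x y => w * vy t x y)) by smooth_tac.
  assert (S3 : smooth (fun t x y => c ^ 2 * Dx sg t x y)) by smooth_tac.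
  assert (S4 : smooth (fun t x y => - w * rot vx t x y + w * vy t x y)) by smooth_tac.
  rewrite (Fc_minus (fun t x y => - w * rot vx t x y + w * vy t x y) (fun t x y => c ^ 2 * Dx sg t x y)) by auto.
  rewrite (Fc_plus (fun t x y => - w * rot vx t x y) (fun t x y => w * vy t x y)) by auto.
  rewrite (Fc_scal_at (rot vx) (fun t x y => - w * rot vx t x y) _ _ _ _ _ (- w)), (Fc_scal_at vy (fun t x y => w * vy t x y) _ _ _ _ _ w),
    (Fc_scal_at (Dx sg) (fun t x y => c ^ 2 * Dx sg t x y) _ _ _ _ _ (c ^ 2)), Fc_rot by auto.
  ring.
Qed.
Lemma Fc_momy m al nu t r : 0 <= r <= 1 ->
  Fc (Dt vy) m al nu t r = - w * IZR m * Fc vy m (al - PI / 2) nu t r - w * Fc vx m al nu t r - c ^ 2 * Fc (Dy sg) m al nu t r.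
Proof.
  intro Hr. pose proof (smooth_rot vy Hvy) as Hrv. pose proof (smooth_partial sg coord_y Hs) as Hsy.
  rewrite (Fc_ext _ (fun t x y => (- w * rot vy t x y - w * vx t x y) - c ^ 2 * Dy sg t x y)).
  2:{ intro th. apply Hmomy. now apply polar_in_disc. }
  assert (S1 : smooth (fun t x y => - w * rot vy t x y)) by smooth_tac.
  assert (S2 : smooth (fun t x y => w * vx t x y)) by smooth_tac.
  assert (S3 : smooth (fun t x y => c ^ 2 * Dy sg t x y)) by smooth_tac.
  assert (S4 : smooth (fun t x y => - w * rot vy t x y - w * vx t x y)) by smooth_tac.
  rewrite (Fc_minus (fun t x y => - w * rot vy t x y - w * vx t x y) (fun t x y => c ^ 2 * Dy sg t x y)) by auto.
  rewrite (Fc_minus (fun t x y => - w * rot vy t x y) (fun t x y => w * vx t x y)) by auto.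
  rewrite (Fc_scal_at (rot vy) (fun t x y => - w * rot vy t x y) _ _ _ _ _ (- w)), (Fc_scal_at vx (fun t x y => w * vx t x y) _ _ _ _ _ w),
    (Fc_scal_at (Dy sg) (fun t x y => c ^ 2 * Dy sg t x y) _ _ _ _ _ (c ^ 2)), Fc_rot by auto.
  ring.
Qed.

(** Advection contributes - w (n + 1) and the rotating frame n w, which leaves - w; the term
    [nabla_v u] contributes another - w. For [MM] both signs are reversed. *)
Lemma PP_mom n al t r : 0 <= r <= 1 -> let m := Z.of_nat n in let nu := INR n * w in
  PP (Dt vx) (Dt vy) m al nu t r + nu * PP vx vy m (al - PI / 2) nu t r
  = - (2 * w) * PP vx vy m (al - PI / 2) nu t r - c ^ 2 * PP (Dx sg) (Dy sg) m al nu t r.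
Proof.
  intros Hr m nu. unfold PP. rewrite Fc_momx, Fc_momy, !Fc_half_turn by auto.
  unfold m, nu. rewrite plus_IZR, <- INR_IZR_INZ. ring.
Qed.
Lemma MM_mom n al t r : 0 <= r <= 1 -> let m := Z.of_nat n in let nu := INR n * w in
  MM (Dt vx) (Dt vy) m al nu t r + nu * MM vx vy m (al - PI / 2) nu t r
  = 2 * w * MM vx vy m (al - PI / 2) nu t r - c ^ 2 * MM (Dx sg) (Dy sg) m al nu t r.
Proof.
  intros Hr m nu. unfold MM. rewrite Fc_momx, Fc_momy, !Fc_half_turn by auto.
  unfold m, nu. rewrite minus_IZR, <- INR_IZR_INZ. ring.
Qed.

Lemma PP_quarter g h m al nu t r : smooth g -> smooth h -> PP g h m (al - PI / 2 - PI / 2) nu t r = - PP g h m al nu t r.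
Proof. intros. unfold PP. rewrite !Fc_half_turn by auto. ring. Qed.
Lemma MM_quarter g h m al nu t r : smooth g -> smooth h -> MM g h m (al - PI / 2 - PI / 2) nu t r = - MM g h m al nu t r.
Proof. intros. unfold MM. rewrite !Fc_half_turn by auto. ring. Qed.

Lemma fourier_comp_evolves n : evolves w c (fourier_comp n 0) (fourier_comp n (PI / 2)).
Proof.
  assert (E0 : PI / 2 - PI / 2 = 0) by ring.
  constructor; simpl; intros t r Hr.
  - now apply Fc_mat_div.
  - now apply Fc_mat_div.
  - rewrite PP_mom by auto. rewrite <- E0 at 1. rewrite PP_quarter by auto. ring.
  - rewrite PP_mom by auto. rewrite E0. ring.
  - rewrite MM_mom by auto. rewrite <- E0 at 1. rewrite MM_quarter by auto. ring.
  - rewrite MM_mom by auto. rewrite E0. ring.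
Qed.

(** [q] and [T] of the definition are read off the gradient of the smooth function and its weighted
    second derivatives. *)
Lemma regular_Fc f al nu t : smooth f -> regular A B (Fc f 1 al nu t).
Proof.
  intro Hf. pose proof (smooth_partial f coord_x Hf) as Hx. pose proof (smooth_partial f coord_y Hf) as Hy.
  split; [now apply cont_Fc|].
  exists (Fr f 1 al nu t), (PP (Dx f) (Dy f) 1 al nu t), (PPr (Dx f) (Dy f) 1 al nu t),
    (fun r => - DP (rmul (Dx f)) (rmul (Dy f)) 1 al nu t r).
  refine (conj _ (conj _ (conj _ (conj _ (conj _ (conj _ _)))))).
  - intro. now apply is_derive_Fc_r.
  - now apply cont_Fr.
  - intro. rewrite PP_rel by auto. ring.
  - intro. now apply is_derive_PP.
  - now apply cont_PPr.
  - apply cont_opp, cont_DP; now apply smooth_rmul.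
  - intro r. rewrite Ropp_involutive, DP_rmul by auto. reflexivity.
Qed.
Lemma regular_lin f g k : regular A B f -> regular A B g -> regular A B (fun r => f r + k * g r).
Proof.
  intros [Cf [f1 [q1 [q1' [T1 [H1 [H2 [H3 [H4 [H5 [H6 H7]]]]]]]]]]] [Cg [f2 [q2 [q2' [T2 [G1 [G2 [G3 [G4 [G5 [G6 G7]]]]]]]]]]].
  split; [cont_tac|].
  exists (fun r => f1 r + k * f2 r), (fun r => q1 r + k * q2 r), (fun r => q1' r + k * q2' r), (fun r => T1 r + k * T2 r).
  refine (conj _ (conj _ (conj _ (conj _ (conj _ (conj _ _)))))); try cont_tac.
  - intro. apply is_derive_rplus; auto. apply is_derive_rscal; auto.
  - intro r. specialize (H3 r). specialize (G3 r). nra.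
  - intro. apply is_derive_rplus; auto. apply is_derive_rscal; auto.
  - intro r. specialize (H7 r). pose proof (f_equal (Rmult k) (G7 r)). lra.
Qed.
Lemma regular_DP al nu t : regular A B (DP (rmul vx) (rmul vy) 1 al nu t).
Proof.
  pose proof (smooth_rmul vx Hvx) as Hrx. pose proof (smooth_rmul vy Hvy) as Hry.
  pose proof (regular_lin _ _ 1 (regular_Fc _ al nu t (smooth_diverg _ _ Hrx Hry)) (regular_Fc _ (al - PI / 2) nu t (smooth_vort _ _ Hrx Hry))) as H.
  replace (DP (rmul vx) (rmul vy) 1 al nu t) with (fun r => Fc (diverg (rmul vx) (rmul vy)) 1 al nu t r + 1 * Fc (vort (rmul vx) (rmul vy)) 1 (al - PI / 2) nu t r); auto.
  apply functional_extensionality. intro. unfold DP. ring.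
Qed.
Lemma regular_DM al nu t : regular A B (DM (rmul vx) (rmul vy) 1 al nu t).
Proof.
  pose proof (smooth_rmul vx Hvx) as Hrx. pose proof (smooth_rmul vy Hvy) as Hry.
  pose proof (regular_lin _ _ (-1) (regular_Fc _ al nu t (smooth_diverg _ _ Hrx Hry)) (regular_Fc _ (al - PI / 2) nu t (smooth_vort _ _ Hrx Hry))) as H.
  replace (DM (rmul vx) (rmul vy) 1 al nu t) with (fun r => Fc (diverg (rmul vx) (rmul vy)) 1 al nu t r + (-1) * Fc (vort (rmul vx) (rmul vy)) 1 (al - PI / 2) nu t r); auto.
  apply functional_extensionality. intro. unfold DM. ring.
Qed.

End Density.

(** * Fourier inversion *)
Definition dirichlet (N : nat) (s : R) : R := 1 + 2 * ssum (fun k => cos (INR (S k) * s)) N.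
Definition fejer (K : nat) (s : R) : R := ssum (fun N => dirichlet N s) K.

Lemma dirichlet_telescope N s : (1 - cos s) * dirichlet N s = cos (INR N * s) - cos (INR (S N) * s).
Proof.
  induction N.
  - unfold dirichlet. simpl. rewrite Rmult_0_l, Rmult_1_l, cos_0. ring.
  - unfold dirichlet in *. cbn [ssum].
    transitivity ((1 - cos s) * (1 + 2 * ssum (fun k => cos (INR (S k) * s)) N) + 2 * (1 - cos s) * cos (INR (S N) * s)); [ring|].
    rewrite IHN. rewrite (S_INR (S N)).
    replace (INR N * s) with (INR (S N) * s - s) by (rewrite S_INR; ring).
    replace ((INR (S N) + 1) * s) with (INR (S N) * s + s) by ring.
    rewrite cos_plus, cos_minus. ring.
Qed.
Lemma fejer_closed K s : (1 - cos s) * fejer K s = 1 - cos (INR K * s).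
Proof.
  unfold fejer. rewrite <- ssum_scal. induction K.
  - simpl. rewrite Rmult_0_l, cos_0. ring.
  - cbn [ssum]. rewrite IHK, dirichlet_telescope. ring.
Qed.
Lemma fejer_ge0 K s : 0 <= fejer K s.
Proof.
  pose proof (COS_bound s) as [_ H1]. destruct (Req_dec (cos s) 1) as [E|Hne].
  - assert (S0 : sin s = 0).
    { pose proof (sin2_cos2 s) as X. rewrite E in X. unfold Rsqr in X. nra. }
    assert (P : forall k, cos (INR k * s) = 1 /\ sin (INR k * s) = 0).
    { induction k as [|k [I1 I2]]; [simpl; rewrite Rmult_0_l, cos_0, sin_0; auto|].
      rewrite S_INR. replace ((INR k + 1) * s) with (INR k * s + s) by ring.
      rewrite cos_plus, sin_plus, I1, I2, E, S0. split; ring. }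
    apply ssum_ge0. intros N _. unfold dirichlet.
    assert (0 <= ssum (fun k => cos (INR (S k) * s)) N); [|lra].
    apply ssum_ge0. intros k _. rewrite (proj1 (P (S k))). lra.
  - pose proof (fejer_closed K s) as H. pose proof (COS_bound (INR K * s)) as [_ H2].
    apply (Rmult_le_reg_l (1 - cos s)); [lra|]. rewrite H. lra.
Qed.
Lemma cont_dirichlet N : cont (dirichlet N).
Proof.
  unfold dirichlet. assert (cont (fun s => ssum (fun k => cos (INR (S k) * s)) N)) by (apply (cont_ssum (fun k s => cos (INR (S k) * s))); intro; cont_tac). cont_tac.
Qed.
Lemma cont_fejer K : cont (fejer K).
Proof. apply (cont_ssum (fun N s => dirichlet N s)). apply cont_dirichlet. Qed.

Lemma RInt_cos_mult n : (1 <= n)%nat -> RInt (fun s => cos (INR n * s)) 0 (2 * PI) = 0.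
Proof.
  intro Hn. assert (0 < INR n) by (apply lt_0_INR; lia).
  rewrite (RInt_cderive _ (fun s => / INR n * sin (INR n * s))).
  - rewrite Rmult_0_r, sin_0. replace (INR n * (2 * PI)) with (0 + 2 * INR n * PI) by ring.
    rewrite sin_period, sin_0. rring.
  - cont_tac.
  - intro s. auto_derive; auto. field. lra.
Qed.
Lemma RInt_fejer K : RInt (fejer K) 0 (2 * PI) = 2 * PI * INR K.
Proof.
  unfold fejer. rewrite (RInt_ssum (fun N s => dirichlet N s)) by apply cont_dirichlet.
  rewrite (ssum_ext _ (fun _ => 2 * PI)).
  - induction K; [simpl; rring|]. cbn [ssum]. rewrite IHK, S_INR. rring.
  - intros N _. unfold dirichlet.
    assert (Ck : forall k, cont (fun s => cos (INR (S k) * s))) by (intro; cont_tac).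
    rewrite RInt_cplus, RInt_cscal, RInt_cconst, (RInt_ssum (fun k s => cos (INR (S k) * s))).
    + rewrite (ssum_ext _ (fun _ => 0)) by (intros; apply RInt_cos_mult; lia). rewrite ssum_zero. ring.
    + auto.
    + now apply (cont_ssum (fun k s => cos (INR (S k) * s))).
    + cont_tac.
    + apply cont_mult; [cont_tac|]. now apply (cont_ssum (fun k s => cos (INR (S k) * s))).
Qed.

Lemma RInt_shift_period (h : R -> R) (a : R) : cont h -> (forall x, h (x + 2 * PI) = h x) ->
  RInt (fun s => h (a + s)) 0 (2 * PI) = RInt h 0 (2 * PI).
Proof.
  intros Ch Hp.
  assert (D : forall x, is_derive (fun x => RInt h 0 x) x (h x)) by (intro; now apply is_derive_RInt_up).
  rewrite (RInt_cderive _ (fun s => RInt h 0 (a + s))).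
  - assert (E : forall a, RInt h 0 (a + 2 * PI) - RInt h 0 a = RInt h 0 (2 * PI)).
    { intro b. pose proof (is_derive_zero_const (fun a => RInt h 0 (a + 2 * PI) - RInt h 0 a)) as Z.
      rewrite Z.
      - rewrite Rplus_0_l, RInt_cpoint. ring.
      - intro t. eapply is_derive_eq.
        + apply is_derive_rminus; [|apply D].
          apply (is_derive_comp (fun x => RInt h 0 x) (fun a => a + 2 * PI)); [apply D|].
          apply (is_derive_rplus (fun a => a) (fun _ => 2 * PI)); [apply is_derive_id|apply is_derive_const].
        + unfold scal, one, zero; simpl. unfold mult; simpl. rewrite Hp. ring. }
    rewrite Rplus_0_r. apply E.
  - apply (cont_comp h (fun s => a + s)); auto. cont_tac.
  - intro s. eapply is_derive_eq.
    + apply (is_derive_comp (fun x => RInt h 0 x) (fun s => a + s)); [apply D|].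
      apply (is_derive_rplus (fun _ => a) (fun s => s)); [apply is_derive_const|apply is_derive_id].
    + unfold scal, one, zero; simpl. unfold mult; simpl. ring.
Qed.

(** A function vanishing at the period ends is small up to a multiple of 1 - cos s, which is bounded
    below away from the ends. This splits the Fejer integral without cutting the interval. *)
Lemma near_endpoints (h : R -> R) (e : R) : cont h -> h 0 = 0 -> h (2 * PI) = 0 -> 0 < e ->
  exists K, 0 <= K /\ forall s, 0 <= s <= 2 * PI -> Rabs (h s) <= e + K * (1 - cos s).
Proof.
  intros Ch H0 H1 He. pose proof PI_RGT_0 as Hpi.
  destruct (cont_eps h 0 e Ch He) as [d0 [Hd0 D0]]. destruct (cont_eps h (2 * PI) e Ch He) as [d1 [Hd1 D1]].
  rewrite H0 in D0. rewrite H1 in D1.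
  set (d := Rmin (Rmin d0 d1) PI / 2).
  assert (Hd : 0 < d /\ d < d0 /\ d < d1 /\ d < PI).
  { assert (0 < Rmin (Rmin d0 d1) PI) by (repeat apply Rmin_pos; auto).
    pose proof (Rmin_l (Rmin d0 d1) PI). pose proof (Rmin_r (Rmin d0 d1) PI). pose proof (Rmin_l d0 d1). pose proof (Rmin_r d0 d1).
    unfold d. lra. }
  destruct (cont_bounded_max (fun s => Rabs (h (2 * PI * s)))) as [z [_ HM]].
  { apply cont_abs. apply (cont_comp h (fun s => 2 * PI * s)); auto. cont_tac. }
  set (M := h (2 * PI * z)) in HM.
  assert (Hc : cos d < 1).
  { rewrite <- cos_0. apply cos_decreasing_1; lra. }
  exists (Rabs M / (1 - cos d)). split; [apply Rdiv_le_0_compat; [apply Rabs_pos|lra]|].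
  intros s Hs. pose proof (COS_bound s) as [_ Hcs].
  assert (HMd : 0 <= Rabs M / (1 - cos d)) by (apply Rdiv_le_0_compat; [apply Rabs_pos|lra]).
  assert (Hp : 0 <= Rabs M / (1 - cos d) * (1 - cos s)) by (apply Rmult_le_pos; lra).
  destruct (Rlt_dec s d) as [L|L].
  { specialize (D0 s ltac:(rewrite Rminus_0_r, Rabs_pos_eq; lra)). rewrite Rminus_0_r in D0. lra. }
  destruct (Rlt_dec (2 * PI - d) s) as [L'|L'].
  { specialize (D1 s ltac:(rewrite Rabs_left1; lra)). rewrite Rminus_0_r in D1. lra. }
  assert (Hcos : cos s <= cos d).
  { destruct (Rle_dec s PI).
    - apply cos_decr_1; lra.
    - replace (cos d) with (cos (2 * PI - d)).
      + apply cos_incr_1; lra.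
      + rewrite <- (cos_neg d). replace (2 * PI - d) with (- d + 2 * INR 1 * PI) by (simpl; ring). apply cos_period. }
  assert (Hh : Rabs (h s) <= Rabs M).
  { specialize (HM (s / (2 * PI))). cbv beta in HM. replace (2 * PI * (s / (2 * PI))) with s in HM by (field; lra).
    apply HM. split.
    - apply Rdiv_le_0_compat; lra.
    - apply (Rmult_le_reg_r (2 * PI)); [lra|]. unfold Rdiv. rewrite Rmult_assoc, Rinv_l by lra. lra. }
  assert (Rabs M <= Rabs M / (1 - cos d) * (1 - cos s)); [|lra].
  replace (Rabs M) with (Rabs M / (1 - cos d) * (1 - cos d)) at 1 by (field; lra).
  apply Rmult_le_compat_l; lra.
Qed.

Section Inversion.
Variable (g : R -> R).
Variable (Cg : cont g).
Variable (Pg : forall x, g (x + 2 * PI) = g x).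

Definition fcoef (n : nat) (phi : R) : R := RInt (fun s => g s * cos (INR n * (s - phi))) 0 (2 * PI).
Definition fsum (phi : R) (N : nat) : R := fcoef 0 phi + 2 * ssum (fun k => fcoef (S k) phi) N.

Lemma fcoef_shift n phi : fcoef n phi = RInt (fun s => g (phi + s) * cos (INR n * s)) 0 (2 * PI).
Proof.
  unfold fcoef. rewrite <- (RInt_shift_period (fun s => g s * cos (INR n * (s - phi))) phi).
  - apply RInt_rext. intro s. do 3 f_equal. ring.
  - cont_tac.
  - intro x. rewrite Pg. f_equal. replace (INR n * (x + 2 * PI - phi)) with (INR n * (x - phi) + 2 * INR n * PI) by ring.
    apply cos_period.
Qed.
Lemma fsum_dirichlet phi N : fsum phi N = RInt (fun s => g (phi + s) * dirichlet N s) 0 (2 * PI).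
Proof.
  assert (Cs : cont (fun s => g (phi + s))) by (apply (cont_comp g (fun s => phi + s)); auto; cont_tac).
  unfold fsum, dirichlet. rewrite fcoef_shift.
  rewrite (ssum_ext _ (fun k => RInt (fun s => g (phi + s) * cos (INR (S k) * s)) 0 (2 * PI))) by (intros; apply fcoef_shift).
  rewrite <- (RInt_ssum (fun k s => g (phi + s) * cos (INR (S k) * s))) by (intro; cont_tac).
  assert (Cc : cont (fun s => ssum (fun k => g (phi + s) * cos (INR (S k) * s)) N)).
  { apply (cont_ssum (fun k s => g (phi + s) * cos (INR (S k) * s))). intro; cont_tac. }
  rewrite <- RInt_cscal, <- RInt_cplus by cont_tac.
  apply RInt_rext. intro s. rewrite ssum_scal. simpl INR. rewrite Rmult_0_l, cos_0. ring.
Qed.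

Lemma fejer_converges phi e : 0 < e -> exists K0, forall K, (K0 <= K)%nat ->
  Rabs (ssum (fsum phi) K - INR K * (2 * PI * g phi)) <= INR K * e.
Proof.
  intro He. pose proof PI_RGT_0 as Hpi.
  assert (Cs : cont (fun s => g (phi + s))) by (apply (cont_comp g (fun s => phi + s)); auto; cont_tac).
  destruct (near_endpoints (fun s => g (phi + s) - g phi) (e / (4 * PI))) as [M [HM0 HM]].
  - cont_tac.
  - rewrite Rplus_0_r. ring.
  - rewrite Pg. ring.
  - apply Rdiv_lt_0_compat; lra.
  - destruct (INR_unbounded (8 * PI * M / e)) as [K0 HK0]. exists K0. intros K HK.
    assert (HKe : 8 * PI * M <= INR K * e).
    { apply le_INR in HK. apply (Rmult_lt_compat_r e) in HK0; auto. unfold Rdiv in HK0.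
      rewrite Rmult_assoc, Rinv_l in HK0 by lra. nra. }
    pose proof (cont_fejer K) as CF.
    assert (E : ssum (fsum phi) K - INR K * (2 * PI * g phi) = RInt (fun s => (g (phi + s) - g phi) * fejer K s) 0 (2 * PI)).
    { rewrite (RInt_rext (fun s => (g (phi + s) - g phi) * fejer K s) (fun s => g (phi + s) * fejer K s - g phi * fejer K s)) by (intro; ring).
      rewrite RInt_cminus, RInt_cscal, RInt_fejer by cont_tac.
      rewrite (RInt_rext (fun s => g (phi + s) * fejer K s) (fun s => ssum (fun N => g (phi + s) * dirichlet N s) K)).
      2:{ intro s. now rewrite ssum_scal. }
      rewrite (RInt_ssum (fun N s => g (phi + s) * dirichlet N s)) by (intro N; pose proof (cont_dirichlet N); cont_tac).
      rewrite (ssum_ext (fun N => RInt _ _ _) (fsum phi)) by (intros; now rewrite fsum_dirichlet). ring. }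
    rewrite E.
    apply Rle_trans with (RInt (fun s => e / (4 * PI) * fejer K s + M * (1 - cos (INR K * s))) 0 (2 * PI)).
    + apply RInt_cabs_le; [lra|cont_tac|cont_tac|]. intros s Hs. pose proof (fejer_ge0 K s) as F0.
      rewrite Rabs_mult, (Rabs_pos_eq (fejer K s)) by auto. rewrite <- fejer_closed.
      specialize (HM s Hs). cbv beta in HM. nra.
    + rewrite RInt_cplus, !RInt_cscal, RInt_fejer by cont_tac.
      assert (X : RInt (fun s => 1 - cos (INR K * s)) 0 (2 * PI) <= 4 * PI).
      { replace (4 * PI) with (2 * (2 * PI - 0)) by ring. rewrite <- RInt_cconst.
        apply RInt_cle; [lra|cont_tac|cont_tac|]. intros s _. pose proof (COS_bound (INR K * s)). lra. }
      replace (e / (4 * PI) * (2 * PI * INR K)) with (INR K * e / 2) by (field; lra). nra.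
Qed.

Lemma inverse_square_tail C N M : 0 <= C -> (1 <= N)%nat ->
  ssum (fun k => C / INR (S (N + k)) ^ 2) M <= C / INR N - C / INR (N + M).
Proof.
  intros HC HN. induction M.
  - rewrite Nat.add_0_r. simpl. lra.
  - cbn [ssum]. rewrite Nat.add_succ_r.
    set (x := INR (N + M)) in *. assert (Hx : 1 <= x) by (change 1 with (INR 1); apply le_INR; lia).
    rewrite S_INR. fold x.
    assert (C / (x + 1) ^ 2 <= C / x - C / (x + 1)); [|lra].
    replace (C / x - C / (x + 1)) with (C / (x * (x + 1))) by (field; lra).
    apply Rmult_le_compat_l; auto. apply Rinv_le_contravar; nra.
Qed.

(** Fejer's theorem identifies the limit, and the inverse square bound gives the explicit tail 2 C /
    N. The index needed for a given precision therefore depends on [C] only, and not on time, radius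
    or angle. *)
Lemma fourier_inversion (C phi : R) (N : nat) : 0 <= C -> (1 <= N)%nat ->
  (forall n, (2 <= n)%nat -> Rabs (fcoef n phi) <= C / INR n ^ 2) ->
  Rabs (2 * PI * g phi - fsum phi N) <= 2 * C / INR N.
Proof.
  intros HC HN HB. assert (HN0 : 0 < INR N) by (apply lt_0_INR; lia).
  assert (Hd : forall k, Rabs (fsum phi (N + k) - fsum phi N) <= 2 * C / INR N).
  { intro k. unfold fsum. rewrite ssum_add.
    replace (_ - _) with (2 * ssum (fun j => fcoef (S (N + j)) phi) k) by ring.
    rewrite Rabs_mult, (Rabs_pos_eq 2) by lra.
    pose proof (ssum_abs (fun j => fcoef (S (N + j)) phi) k).
    assert (ssum (fun j => Rabs (fcoef (S (N + j)) phi)) k <= ssum (fun j => C / INR (S (N + j)) ^ 2) k)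
      by (apply ssum_le; intros; apply HB; lia).
    pose proof (inverse_square_tail C N k HC HN).
    assert (0 <= C / INR (N + k)) by (apply Rdiv_le_0_compat; auto; apply lt_0_INR; lia).
    unfold Rdiv in *. lra. }
  apply le_epsilon. intros e He.
  destruct (fejer_converges phi (e / 2)) as [K0 HK0]; [lra|].
  (* The tail bound says nothing about the first N partial sums; K is taken so large that their
     share of the mean is at most e/2. *)
  set (D := ssum (fun k => Rabs (fsum phi k - fsum phi N)) N).
  destruct (INR_unbounded (2 * D / e)) as [K1 HK1].
  set (M := (K0 + K1 + 1)%nat). set (K := (N + M)%nat).
  specialize (HK0 K ltac:(unfold K, M; lia)).
  assert (HKpos : 0 < INR K) by (apply lt_0_INR; unfold K, M; lia).
  assert (HD : D <= INR K * (e / 2)).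
  { assert (INR K1 <= INR K) by (apply le_INR; unfold K, M; lia).
    apply (Rmult_lt_compat_r e) in HK1; auto. unfold Rdiv in HK1. rewrite Rmult_assoc, Rinv_l in HK1 by lra. nra. }
  assert (HA : Rabs (ssum (fsum phi) K - INR K * fsum phi N) <= D + INR K * (2 * C / INR N)).
  { replace (INR K * fsum phi N) with (ssum (fun _ => fsum phi N) K).
    2:{ clear. induction K; [simpl; ring|]. cbn [ssum]. rewrite IHK, S_INR. ring. }
    rewrite <- ssum_minus. eapply Rle_trans; [apply ssum_abs|]. unfold K. rewrite ssum_add.
    apply Rplus_le_compat; [apply Rle_refl|].
    eapply Rle_trans; [apply (ssum_le _ (fun _ => 2 * C / INR N)); intros; apply Hd|].
    assert (Q : forall m, ssum (fun _ => 2 * C / INR N) m = INR m * (2 * C / INR N)).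
    { induction m; [simpl; ring|]. cbn [ssum]. rewrite IHm, S_INR. ring. }
    rewrite Q. apply Rmult_le_compat_r; [apply Rdiv_le_0_compat; lra|]. apply le_INR. lia. }
  apply (Rmult_le_reg_l (INR K)); auto.
  replace (INR K * Rabs (2 * PI * g phi - fsum phi N)) with (Rabs (INR K * (2 * PI * g phi - fsum phi N)))
    by (rewrite Rabs_mult, (Rabs_pos_eq (INR K)); lra).
  replace (INR K * (2 * PI * g phi - fsum phi N)) with
    (- (ssum (fsum phi) K - INR K * (2 * PI * g phi)) + (ssum (fsum phi) K - INR K * fsum phi N)) by ring.
  eapply Rle_trans; [apply Rabs_triang|]. rewrite Rabs_Ropp. lra.
Qed.

End Inversion.

(** * Decay in the angular number *)
Lemma Fc_phase f m al b nu t r : smooth f ->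
  Fc f m (al + b) nu t r = cos al * Fc f m b nu t r + sin al * Fc f m (PI / 2 + b) nu t r.
Proof.
  intro Hf. pose proof (cont_ker f m b nu t r Hf). pose proof (cont_ker f m (PI / 2 + b) nu t r Hf).
  unfold Fc. rewrite <- !RInt_cscal, <- RInt_cplus by (auto; cont_tac). apply RInt_rext. intro th. unfold ker.
  replace (IZR m * th + (al + b) - nu * t) with ((IZR m * th + b - nu * t) + al) by ring.
  replace (IZR m * th + (PI / 2 + b) - nu * t) with ((IZR m * th + b - nu * t) + PI / 2) by ring.
  rewrite !cos_plus, cos_PI2, sin_PI2. ring.
Qed.
Lemma Fc_phase2 f m nu al t r : smooth f -> Fc f m al nu t r = phase2 (Fc f m 0 nu) (Fc f m (PI / 2) nu) al t r.
Proof. intro Hf. pose proof (Fc_phase f m al 0 nu t r Hf) as E. rewrite !Rplus_0_r in E. exact E. Qed.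
Lemma PP_phase2 f g m nu al t r : smooth f -> smooth g ->
  PP f g m al nu t r = phase2 (PP f g m 0 nu) (PP f g m (PI / 2) nu) al t r.
Proof.
  intros Hf Hg. unfold PP, phase2. rewrite (Fc_phase2 f) by auto. unfold Rminus at 1 2 3. rewrite (Fc_phase g _ al), Rplus_0_l by auto.
  unfold phase2. ring.
Qed.
Lemma MM_phase2 f g m nu al t r : smooth f -> smooth g ->
  MM f g m al nu t r = phase2 (MM f g m 0 nu) (MM f g m (PI / 2) nu) al t r.
Proof.
  intros Hf Hg. unfold MM, phase2. rewrite (Fc_phase2 f) by auto.
  replace (0 - PI / 2) with (- (PI / 2)) by ring.
  pose proof (Fc_phase g (m - 1) al (- (PI / 2)) nu t r Hg) as E.
  replace (al + - (PI / 2)) with (al - PI / 2) in E by ring. replace (PI / 2 + - (PI / 2)) with (PI / 2 - PI / 2) in E by ring.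
  rewrite E. unfold phase2. ring.
Qed.

Lemma Fc_initial_bound f : smooth f -> exists K, 0 <= K /\
  forall m al nu r, 0 <= r <= 1 -> Rabs (Fc f m al nu 0 r) <= K.
Proof.
  intro Hf. set (N := fun r => RInt (fun th => Rabs (f 0 (r * cos th) (r * sin th))) 0 (2 * PI)).
  assert (Cf : forall r, cont (fun th => f 0 (r * cos th) (r * sin th))) by (intros r th; ctn).
  assert (CN : cont N).
  { intro r. apply (continuous_RInt_param R_UniformSpace (fun r th => Rabs (f 0 (r * cos th) (r * sin th))) r).
    - apply two_pi_pos.
    - intro p. pose proof (Cf p). now apply cont_abs.
    - intros th _. apply (continuous_comp (fun q : R_UniformSpace * R => f 0 (fst q * cos (snd q)) (fst q * sin (snd q))) Rabs).
      + ctn.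
      + apply continuous_Rabs. }
  destruct (cont_bounded_max N CN) as [z [_ Hz]].
  assert (G : forall m al nu r, Rabs (Fc f m al nu 0 r) <= N r).
  { intros m al nu r. apply RInt_cabs_le; [apply two_pi_pos|now apply cont_ker|now apply cont_abs|].
    intros th _. unfold ker. rewrite Rabs_mult. pose proof (Rabs_pos (f 0 (r * cos th) (r * sin th))).
    assert (Rabs (cos (IZR m * th + al - nu * 0)) <= 1) by (apply Rabs_le; apply COS_bound). nra. }
  exists (N z). split.
  - eapply Rle_trans; [apply Rabs_pos|apply (G 0%Z 0 0 z)].
  - intros m al nu r Hr. eapply Rle_trans; [apply G|now apply Hz].
Qed.

(** The cubic rate comes from three angular derivatives. One power is later lost through [cn], and
    an inverse square is what Fourier inversion requires. *)
Definition decays (q : nat -> R -> R -> R -> R) : Prop := exists K, 0 <= K /\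
  forall n al nu r, (1 <= n)%nat -> 0 <= r <= 1 -> Rabs (q n al nu r) <= K / INR n ^ 3.

Lemma Fc_rot_inv f m al nu t r : smooth f -> IZR m <> 0 -> Fc f m al nu t r = Fc (rot f) m (al + PI / 2) nu t r / IZR m.
Proof.
  intros Hf Hm. rewrite Fc_rot by auto. replace (al + PI / 2 - PI / 2) with al by ring. field. auto.
Qed.
Lemma decays_Fc f : smooth f -> decays (fun n al nu r => Fc f (Z.of_nat n) al nu 0 r).
Proof.
  intro Hf. pose proof (smooth_rot _ Hf) as H1. pose proof (smooth_rot _ H1) as H2. pose proof (smooth_rot _ H2) as H3.
  destruct (Fc_initial_bound _ H3) as [K [HK0 HK]]. exists K. split; auto. intros n al nu r Hn Hr.
  assert (HnR : 0 < INR n) by (apply lt_0_INR; lia).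
  assert (Hz : IZR (Z.of_nat n) <> 0) by (rewrite <- INR_IZR_INZ; lra).
  rewrite (Fc_rot_inv f), (Fc_rot_inv (rot f)), (Fc_rot_inv (rot (rot f))) by auto. rewrite <- INR_IZR_INZ.
  unfold Rdiv. rewrite !Rabs_mult, Rabs_inv, (Rabs_pos_eq (INR n)) by lra.
  specialize (HK (Z.of_nat n) (al + PI / 2 + PI / 2 + PI / 2) nu r Hr).
  set (y := Rabs _) in *. replace (y * / INR n * / INR n * / INR n) with (y * / INR n ^ 3) by (field; lra).
  apply Rmult_le_compat_r; auto. apply Rlt_le, Rinv_0_lt_compat. now apply pow_lt.
Qed.
Lemma decays_shift q b : decays q -> decays (fun n al nu r => q n (al - b) nu r).
Proof. intros [K [H0 HK]]. exists K. split; auto. Qed.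
Lemma decays_opp q : decays q -> decays (fun n al nu r => - q n al nu r).
Proof. intros [K [H0 HK]]. exists K. split; auto. intros. rewrite Rabs_Ropp. auto. Qed.
Lemma decays_plus q p : decays q -> decays p -> decays (fun n al nu r => q n al nu r + p n al nu r).
Proof.
  intros [K [H0 HK]] [L [H1 HL]]. exists (K + L). split; [lra|]. intros n al nu r Hn Hr.
  eapply Rle_trans; [apply Rabs_triang|]. specialize (HK n al nu r Hn Hr). specialize (HL n al nu r Hn Hr). unfold Rdiv in *. lra.
Qed.
Lemma decays_DP g h : smooth g -> smooth h -> decays (fun n al nu r => DP g h (Z.of_nat n) al nu 0 r).
Proof.
  intros Hg Hh. apply decays_plus.
  - apply decays_Fc. now apply smooth_diverg.
  - apply (decays_shift (fun n al nu r => Fc (vort g h) (Z.of_nat n) al nu 0 r)), decays_Fc. now apply smooth_vort.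
Qed.
Lemma decays_DM g h : smooth g -> smooth h -> decays (fun n al nu r => DM g h (Z.of_nat n) al nu 0 r).
Proof.
  intros Hg Hh. apply (decays_plus _ (fun n al nu r => - _)).
  - apply decays_Fc. now apply smooth_diverg.
  - apply decays_opp, (decays_shift (fun n al nu r => Fc (vort g h) (Z.of_nat n) al nu 0 r)), decays_Fc. now apply smooth_vort.
Qed.
(** The angular number here is n - 1 >= n / 2, whence n >= 2 and the factor 8. *)
Lemma decays_MM g h : smooth g -> smooth h -> exists K, 0 <= K /\ forall n al nu r, (2 <= n)%nat -> 0 <= r <= 1 ->
  Rabs (MM g h (Z.of_nat n) al nu 0 r) <= K / INR n ^ 3.
Proof.
  intros Hg Hh.
  destruct (decays_plus _ (fun n al nu r => - _) (decays_Fc g Hg) (decays_opp _ (decays_shift _ (PI / 2) (decays_Fc h Hh)))) as [K [HK0 HK]].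
  exists (8 * K). split; [lra|]. intros n al nu r Hn Hr. specialize (HK (n - 1)%nat al nu r ltac:(lia) Hr).
  rewrite Nat2Z.inj_sub in HK by lia. change (Z.of_nat 1) with 1%Z in HK. unfold MM, Rminus at 1. cbv beta in HK.
  eapply Rle_trans; [exact HK|].
  assert (HnR : 2 <= INR n) by (change 2 with (INR 2); now apply le_INR).
  rewrite minus_INR by lia. change (INR 1) with 1.
  replace (8 * K / INR n ^ 3) with (K * / (INR n / 2) ^ 3) by (field; lra).
  apply Rmult_le_compat_l; auto. apply Rinv_le_contravar; [apply pow_lt; lra|]. apply pow_incr. lra.
Qed.

Lemma energy_le_sq (q : R -> R) (M : R) : cont q -> 0 <= M -> (forall r, 0 <= r <= 1 -> Rabs (q r) <= M) -> energy q <= M ^ 2.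
Proof.
  intros Cq HM H. unfold energy. replace (M ^ 2) with (M ^ 2 * (1 - 0)) by ring. rewrite <- RInt_cconst.
  apply RInt_cle; [lra|cont_tac|cont_tac|]. intros r Hr. specialize (H r Hr).
  rewrite <- (pow2_abs (q r)). pose proof (Rabs_pos (q r)). assert (Rabs (q r) ^ 2 <= M ^ 2) by (apply pow_incr; lra).
  pose proof (pow2_ge_0 (Rabs (q r))). nra.
Qed.

(** * The angular coefficients of a solution, with bounds uniform in time *)

Section Solution.
Variables (A B w c : R) (sg vx vy : R -> scalar_field).
Variable (HA : 0 < A).
Variable (HB : 0 <= B).
Variable (Hc : 0 < c).
Variable (Hs : smooth sg).
Variable (Hvx : smooth vx).
Variable (Hvy : smooth vy).
Variable (Hbd : forall t x y, on_circle x y -> sg t x y = 0).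
Variable (Hcont : forall t x y, in_disc x y -> mat w sg t x y = - diverg (rmul A B vx) (rmul A B vy) t x y).
Variable (Hmomx : forall t x y, in_disc x y -> Dt vx t x y = - w * rot vx t x y + w * vy t x y - c ^ 2 * Dx sg t x y).
Variable (Hmomy : forall t x y, in_disc x y -> Dt vy t x y = - w * rot vy t x y - w * vx t x y - c ^ 2 * Dy sg t x y).

Let X n := fourier_comp A B w sg vx vy n 0.
Let Y n := fourier_comp A B w sg vx vy n (PI / 2).
Let HX n : comp_ok n A B (X n) := fourier_comp_ok A B w sg vx vy Hs Hvx Hvy n 0 Hbd.
Let HY n : comp_ok n A B (Y n) := fourier_comp_ok A B w sg vx vy Hs Hvx Hvy n (PI / 2) Hbd.
Let Hev n : evolves w c (X n) (Y n) := fourier_comp_evolves A B w sg vx vy Hs Hvx Hvy c Hcont Hmomx Hmomy n.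

Definition Sn (n : nat) (al t r : R) : R := Fc sg (Z.of_nat n) al (INR n * w) t r.
Definition Pn (n : nat) (al t r : R) : R := PP vx vy (Z.of_nat n) al (INR n * w) t r.
Definition Mn (n : nat) (al t r : R) : R := MM vx vy (Z.of_nat n) al (INR n * w) t r.

Lemma Sn_phase n al t r : Sn n al t r = phase2 (cS (X n)) (cS (Y n)) al t r.
Proof. unfold Sn, X, Y, fourier_comp. cbn [cS]. exact (Fc_phase2 sg (Z.of_nat n) (INR n * w) al t r Hs). Qed.
Lemma Pn_phase n al t r : Pn n al t r = phase2 (cP (X n)) (cP (Y n)) al t r.
Proof. unfold Pn, X, Y, fourier_comp. cbn [cP]. exact (PP_phase2 vx vy (Z.of_nat n) (INR n * w) al t r Hvx Hvy). Qed.
Lemma Mn_phase n al t r : Mn n al t r = phase2 (cM (X n)) (cM (Y n)) al t r.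
Proof. unfold Mn, X, Y, fourier_comp. cbn [cM]. exact (MM_phase2 vx vy (Z.of_nat n) (INR n * w) al t r Hvx Hvy). Qed.

Lemma apx_SPM n : apx (Sn n) /\ apx (Pn n) /\ apx (Mn n).
Proof.
  destruct (eigenbasis_exists n A B HA HB) as [psi [dpsi [nu Hb]]].
  split; [|split].
  - apply (apx_ext (phase2 (cS (X n)) (cS (Y n)))); [intros; symmetry; apply Sn_phase|].
    apply (apx_S n A B psi dpsi nu HA HB Hb w c (X n) (Y n) Hc (HX n) (HY n) (Hev n)).
  - apply (apx_ext (phase2 (cP (X n)) (cP (Y n)))); [intros; symmetry; apply Pn_phase|].
    apply (apx_P n A B psi dpsi nu HA HB Hb w c (X n) (Y n) Hc (HX n) (HY n) (Hev n)).
  - apply (apx_ext (phase2 (cM (X n)) (cM (Y n)))); [intros; symmetry; apply Mn_phase|].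
    destruct n as [|[|n]].
    + apply (apx_M0 0 A B psi dpsi nu HA HB Hb w c (X 0) (Y 0) Hc (HX 0) (HY 0) (Hev 0) eq_refl).
    + apply (apx_M 1 A B psi dpsi nu HA HB Hb w c (X 1) (Y 1) Hc (HX 1) (HY 1) (Hev 1) (le_n 1)).
      apply (W_small_1 A B psi dpsi nu HA HB Hb w c (X 1) (Y 1) Hc (HX 1) (HY 1) (Hev 1)).
      * now apply regular_DP.
      * now apply regular_DP.
      * now apply regular_DM.
      * now apply regular_DM.
    + apply (apx_M _ A B psi dpsi nu HA HB Hb w c (X _) (Y _) Hc (HX _) (HY _) (Hev _)); [lia|].
      apply (W_small_ge2 _ A B psi dpsi nu HA HB Hb w c (X _) (Y _) Hc (HX _) (HY _) (Hev _)). lia.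
Qed.

Lemma init_energy_decay : exists E, 0 <= E /\ forall n, (1 <= n)%nat -> init_energy (X n) (Y n) <= E / INR n ^ 6.
Proof.
  pose proof (smooth_mat w sg Hs) as Hm.
  assert (P : forall q : nat -> R -> R -> R -> R, decays q -> (forall n al nu, cont (q n al nu)) ->
    exists E, 0 <= E /\ forall n al nu, (1 <= n)%nat -> energy (q n al nu) <= E / INR n ^ 6).
  { intros q [K [HK0 HK]] Cq. exists (K ^ 2). split; [apply pow2_ge_0|]. intros n al nu Hn.
    assert (HnR : 0 < INR n) by (apply lt_0_INR; lia).
    replace (K ^ 2 / INR n ^ 6) with ((K / INR n ^ 3) ^ 2) by (field; lra).
    apply energy_le_sq; auto. apply Rdiv_le_0_compat; auto. now apply pow_lt. }
  assert (T0 : forall g, smooth g -> smooth (rmul A B (Dx g)) /\ smooth (rmul A B (Dy g))).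
  { intros g Hg. split; apply smooth_rmul; now apply smooth_partial. }
  destruct (P _ (decays_Fc sg Hs) (fun n al nu => cont_Fc sg (Z.of_nat n) al nu 0 Hs)) as [E1 [P1 B1]].
  destruct (P _ (decays_opp _ (decays_DP _ _ (proj1 (T0 sg Hs)) (proj2 (T0 sg Hs))))) as [E2 [P2 B2]].
  { intros. apply cont_opp, cont_DP; apply (T0 sg Hs). }
  destruct (P _ (decays_DP _ _ (smooth_rmul A B vx Hvx) (smooth_rmul A B vy Hvy))) as [E3 [P3 B3]].
  { intros. apply cont_DP; now apply smooth_rmul. }
  destruct (P _ (decays_DM _ _ (smooth_rmul A B vx Hvx) (smooth_rmul A B vy Hvy))) as [E4 [P4 B4]].
  { intros. apply cont_DM; now apply smooth_rmul. }
  destruct (P _ (decays_Fc _ Hm) (fun n al nu => cont_Fc _ (Z.of_nat n) al nu 0 Hm)) as [E5 [P5 B5]].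
  destruct (P _ (decays_opp _ (decays_DP _ _ (proj1 (T0 _ Hm)) (proj2 (T0 _ Hm))))) as [E6 [P6 B6]].
  { intros. apply cont_opp, cont_DP; apply (T0 _ Hm). }
  exists (2 * (E1 + E2 + E3 + E4 + E5 + E6)). split; [lra|]. intros n Hn.
  unfold init_energy, X, Y. cbn [fourier_comp cS cT cDp cDm cSt cTt].
  specialize (B1 n). specialize (B2 n). specialize (B3 n). specialize (B4 n). specialize (B5 n). specialize (B6 n).
  pose proof (B1 0 (INR n * w) Hn). pose proof (B2 0 (INR n * w) Hn). pose proof (B3 0 (INR n * w) Hn).
  pose proof (B4 0 (INR n * w) Hn). pose proof (B5 0 (INR n * w) Hn). pose proof (B6 0 (INR n * w) Hn).
  pose proof (B1 (PI / 2) (INR n * w) Hn). pose proof (B2 (PI / 2) (INR n * w) Hn). pose proof (B3 (PI / 2) (INR n * w) Hn).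
  pose proof (B4 (PI / 2) (INR n * w) Hn). pose proof (B5 (PI / 2) (INR n * w) Hn). pose proof (B6 (PI / 2) (INR n * w) Hn).
  clear - H H0 H1 H2 H3 H4 H5 H6 H7 H8 H9 H10. cbv beta in *.
  replace (2 * (E1 + E2 + E3 + E4 + E5 + E6) / INR n ^ 6) with
    (E1 / INR n ^ 6 + E2 / INR n ^ 6 + E3 / INR n ^ 6 + E4 / INR n ^ 6 + E5 / INR n ^ 6 + E6 / INR n ^ 6 +
     (E1 / INR n ^ 6 + E2 / INR n ^ 6 + E3 / INR n ^ 6 + E4 / INR n ^ 6 + E5 / INR n ^ 6 + E6 / INR n ^ 6)) by (unfold Rdiv; ring).
  repeat apply Rplus_le_compat; assumption.
Qed.

(** [amp] depends on A, B, w and c alone, so the bounds at all times inherit the n^-3 of the initial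
    data, the square root of the n^-6 of the energies; the minus component gives up one power. *)
Lemma SPM_decay : exists C, 0 <= C /\ forall n al t r, (2 <= n)%nat -> 0 <= r <= 1 ->
  Rabs (Sn n al t r) <= C / INR n ^ 2 /\ Rabs (Pn n al t r) <= C / INR n ^ 2 /\ Rabs (Mn n al t r) <= C / INR n ^ 2.
Proof.
  destruct init_energy_decay as [E [HE0 HE]]. destruct (decays_MM vx vy Hvx Hvy) as [H [HH0 HH]].
  set (a := amp A B w c). assert (Ha : 0 < a).
  { destruct (eigenbasis_exists 0 A B HA HB) as [psi [dpsi [nu Hb]]]. exact (amp_pos 0 A B psi dpsi nu HA HB Hb w c Hc). }
  set (G := sqrt (a * E)). assert (HG : 0 <= G) by apply sqrt_pos.
  set (K := 1 + 2 * (A + B) / A). assert (HK : 1 <= K).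
  { unfold K. assert (0 <= 2 * (A + B) / A) by (apply Rdiv_le_0_compat; lra). lra. }
  exists (2 * ((G * K + 4 * (A + B) * H) / A)).
  assert (HD : 0 <= (G * K + 4 * (A + B) * H) / A).
  { apply Rdiv_le_0_compat; auto. apply Rplus_le_le_0_compat; apply Rmult_le_pos; lra. }
  split; [lra|]. intros n al t r Hn Hr.
  assert (HnR : 2 <= INR n) by (change 2 with (INR 2); now apply le_INR).
  assert (Hn2 : 0 < / INR n ^ 2) by (apply Rinv_0_lt_compat, pow_lt; lra).
  destruct (eigenbasis_exists n A B HA HB) as [psi [dpsi [nu Hb]]].
  set (e := sqrt (a * init_energy (X n) (Y n))).
  assert (He : e <= G / INR n ^ 3).
  { unfold e, G. rewrite <- (sqrt_pow2 (INR n ^ 3)) by (apply pow_le; lra).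
    rewrite <- sqrt_div_alt by (do 2 apply pow_lt; lra). apply sqrt_le_1_alt.
    replace (a * E / (INR n ^ 3) ^ 2) with (a * (E / INR n ^ 6)) by (field; lra).
    apply Rmult_le_compat_l; [lra|]. apply HE. lia. }
  assert (He0 : 0 <= e) by apply sqrt_pos.
  assert (Hn3 : / INR n ^ 3 = / INR n ^ 2 * / INR n) by (field; lra).
  assert (Hin : 0 < / INR n <= 1).
  { split; [apply Rinv_0_lt_compat; lra|]. rewrite <- Rinv_1. apply Rinv_le_contravar; lra. }
  assert (Hen : e * INR n <= G * / INR n ^ 2).
  { apply (Rmult_le_compat_r (INR n)) in He; [|lra]. replace (G / INR n ^ 3 * INR n) with (G * / INR n ^ 2) in He by (field; lra). auto. }
  assert (Hee : e <= e * INR n) by nra.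
  assert (B1 : e / A <= (G * K + 4 * (A + B) * H) / A / INR n ^ 2).
  { unfold Rdiv. rewrite (Rmult_comm _ (/ A)), (Rmult_comm _ (/ A)), Rmult_assoc.
    apply Rmult_le_compat_l; [apply Rlt_le, Rinv_0_lt_compat; auto|].
    rewrite Rmult_plus_distr_r. assert (0 <= 4 * (A + B) * H * / INR n ^ 2) by (apply Rmult_le_pos; [apply Rmult_le_pos|]; lra).
    assert (G * / INR n ^ 2 <= G * K * / INR n ^ 2) by (apply Rmult_le_compat_r; nra). lra. }
  assert (B2 : (e * (1 + 2 * INR n * (A + B) / A) + 4 * INR n * (A + B) * (H / INR n ^ 3)) / A <= (G * K + 4 * (A + B) * H) / A / INR n ^ 2).
  { unfold Rdiv. rewrite (Rmult_comm _ (/ A)), (Rmult_comm (G * _ + _) (/ A)), (Rmult_assoc (/ A)).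
    apply Rmult_le_compat_l; [apply Rlt_le, Rinv_0_lt_compat; auto|].
    replace (4 * INR n * (A + B) * (H * / INR n ^ 3)) with (4 * (A + B) * H * / INR n ^ 2) by (field; lra).
    assert (e * (1 + 2 * INR n * (A + B) * / A) <= G * K * / INR n ^ 2); [|lra].
    assert (0 <= 2 * (A + B) / A) by (apply Rdiv_le_0_compat; lra).
    apply Rle_trans with (e * INR n * K).
    - unfold K. replace (2 * INR n * (A + B) * / A) with (INR n * (2 * (A + B) / A)) by (unfold Rdiv; ring).
      set (z := 2 * (A + B) / A) in *. nra.
    - replace (G * K * / INR n ^ 2) with (G * / INR n ^ 2 * K) by ring. apply Rmult_le_compat_r; lra. }
  assert (F : forall fx fy b, Rabs (fx t r) <= b /\ Rabs (fy t r) <= b -> b <= (G * K + 4 * (A + B) * H) / A / INR n ^ 2 ->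
    Rabs (phase2 fx fy al t r) <= 2 * ((G * K + 4 * (A + B) * H) / A) / INR n ^ 2).
  { intros fx fy b [F1 F2] F3. pose proof (phase2_bound fx fy al t r b F1 F2). unfold Rdiv in *. lra. }
  rewrite Sn_phase, Pn_phase, Mn_phase. split; [|split].
  - apply (F _ _ (e / A)); auto.
    apply (bound_S n A B psi dpsi nu HA HB Hb w c (X n) (Y n) Hc (HX n) (HY n) (Hev n) t r Hr).
  - apply (F _ _ (e / A)); auto.
    apply (bound_P n A B psi dpsi nu HA HB Hb w c (X n) (Y n) Hc (HX n) (HY n) (Hev n) t r Hr).
  - eapply F; [|exact B2].
    apply (bound_M n A B psi dpsi nu HA HB Hb w c (X n) (Y n) (HX n) (HY n) (Hev n)); auto; [lia| |].
    + intros s q Hq. apply (bound_W n A B psi dpsi nu HA HB Hb w c (X n) (Y n) Hc (HX n) (HY n) (Hev n) s q Hn Hq).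
    + intros q Hq. split; apply HH; auto.
Qed.

End Solution.

(** * From approximations to series *)
Section Blocks.
Variables (X P : Type) (D : P -> Prop) (val : X -> P -> C) (sc : R -> X -> X) (x0 : X) (f : P -> C).
Variable (val_sc : forall a x p, val (sc a x) p = (RtoC a * val x p)%C).
Variable (val_x0 : forall p, val x0 p = RtoC 0).
Variable (val_bounded : forall x, exists M, forall p, D p -> Cmod (val x p) <= M).

Definition lval (l : list X) (p : P) : C := fold_right (fun x acc => (val x p + acc)%C) (RtoC 0) l.

Lemma lval_app l l' p : lval (l ++ l') p = (lval l p + lval l' p)%C.
Proof. induction l; simpl; [ring|]. rewrite IHl. ring. Qed.
Lemma lval_map a l p : lval (map (sc a) l) p = (RtoC a * lval l p)%C.
Proof. induction l; simpl; [ring|]. rewrite IHl, val_sc. ring. Qed.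
Lemma prefix_bounded l : exists M, 0 <= M /\ forall l1 l2 p, l = l1 ++ l2 -> D p -> Cmod (lval l1 p) <= M.
Proof.
  induction l as [|x l [M [HM0 HM]]].
  - exists 0. split; [lra|]. intros l1 l2 p E _. symmetry in E. apply app_eq_nil in E. destruct E as [-> _].
    simpl. rewrite Cmod_0. lra.
  - destruct (val_bounded x) as [K HK]. exists (Rabs K + M). split; [pose proof (Rabs_pos K); lra|].
    intros [|y l1] l2 p E Hp; simpl.
    + rewrite Cmod_0. pose proof (Rabs_pos K). lra.
    + simpl in E. injection E as <- E. eapply Rle_trans; [apply Cmod_triangle|].
      apply Rplus_le_compat; [eapply Rle_trans; [now apply HK|apply Rle_abs]|now apply (HM l1 l2)].
Qed.
(** A prefix of the repeated list consists of whole copies, at most k of them, and a prefix of one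
    copy. *)
Lemma repeat_prefix l M k : (forall l1 l2 p, l = l1 ++ l2 -> D p -> Cmod (lval l1 p) <= M) -> 0 <= M ->
  forall l1 l2 p, concat (repeat l k) = l1 ++ l2 -> D p -> Cmod (lval l1 p) <= INR k * Cmod (lval l p) + M.
Proof.
  intros HM HM0. induction k; intros l1 l2 p E Hp.
  - simpl in E. symmetry in E. apply app_eq_nil in E. destruct E as [-> _]. simpl. rewrite Cmod_0. lra.
  - simpl repeat in E. cbn [concat] in E. apply app_eq_app in E. rewrite S_INR.
    assert (0 <= INR k * Cmod (lval l p)) by (apply Rmult_le_pos; [apply pos_INR|apply Cmod_ge_0]).
    pose proof (Cmod_ge_0 (lval l p)).
    destruct E as [l' [[E _]|[E E']]].
    + specialize (HM _ _ _ E Hp). lra.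
    + rewrite E, lval_app. eapply Rle_trans; [apply Cmod_triangle|]. specialize (IHk _ _ _ E' Hp). lra.
Qed.
Lemma lval_repeat l k p : lval (concat (repeat l k)) p = (RtoC (INR k) * lval l p)%C.
Proof.
  induction k; [simpl; ring|]. simpl repeat. cbn [concat]. rewrite lval_app, IHk, S_INR, RtoC_plus. ring.
Qed.

(* Running through the scaled list [l / K] exactly [K] times keeps all partial sums near the segment from 0 to the sum of [l]. *)
Lemma fine_block l M e : 0 < e -> (forall p, D p -> Cmod (lval l p) <= M) ->
  exists l', (forall p, lval l' p = lval l p) /\
    forall l1 l2 p, l' = l1 ++ l2 -> D p -> Cmod (lval l1 p) <= M + e.
Proof.
  intros He HM. destruct (prefix_bounded l) as [S0 [HS0 HS]].
  destruct (INR_unbounded (S0 / e)) as [K HK].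
  assert (HKp : 0 < INR K) by (eapply Rle_lt_trans; [|exact HK]; apply Rdiv_le_0_compat; lra).
  assert (HKe : / INR K * S0 <= e).
  { apply (Rmult_lt_compat_r e) in HK; auto. unfold Rdiv in HK. rewrite Rmult_assoc, Rinv_l in HK by lra.
    apply (Rmult_le_reg_l (INR K)); auto. rewrite <- Rmult_assoc, Rinv_r by lra. lra. }
  assert (HKi : 0 < / INR K) by now apply Rinv_0_lt_compat.
  exists (concat (repeat (map (sc (/ INR K)) l) K)). split.
  - intro p. rewrite lval_repeat, lval_map, Cmult_assoc, <- RtoC_mult, Rinv_r by lra. ring.
  - intros l1 l2 p E Hp.
    eapply Rle_trans; [eapply (repeat_prefix (map (sc (/ INR K)) l) (/ INR K * S0) K)|]; eauto.
    + intros m1 m2 q Em Hq. apply map_eq_app in Em. destruct Em as [n1 [n2 [En [<- <-]]]].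
      rewrite lval_map, Cmod_mult, Cmod_R, Rabs_pos_eq by lra.
      apply Rmult_le_compat_l; [lra|]. now apply (HS n1 n2).
    + apply Rmult_le_pos; lra.
    + rewrite lval_map, Cmod_mult, Cmod_R, Rabs_pos_eq by lra.
      rewrite <- Rmult_assoc, Rinv_r by lra. specialize (HM p Hp). lra.
Qed.

Lemma sum_n_firstn (l : list X) (p : P) m : (S m <= length l)%nat ->
  sum_n (fun j => val (nth j l x0) p) m = lval (firstn (S m) l) p.
Proof.
  intro H. induction m.
  - rewrite sum_O. destruct l; [simpl in H; lia|]. simpl. ring.
  - rewrite sum_Sn, IHm by lia.
    assert (E : forall n (k : list X), (n < length k)%nat -> firstn (S n) k = firstn n k ++ nth n k x0 :: nil).
    { induction n; intros [|y k] Hk; simpl in *; try lia; auto. f_equal. apply (IHn k). lia. }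
    rewrite (E (S m)) by lia. rewrite lval_app. simpl (lval (_ :: nil) p). unfold plus; simpl. ring.
Qed.

Variable (approx : forall e, 0 < e -> exists l, forall p, D p -> Cmod (lval l p - f p)%C <= e).

(** The approximants are not partial sums of one series, so consecutive differences are appended as
    blocks. A difference has size at most [2 * d j], and [fine_block] keeps its internal partial
    sums below [3 * d j], so that stopping inside a block does no harm. *)
Theorem approx_series : exists x : nat -> X, forall e, 0 < e -> exists N, forall m, (N <= m)%nat ->
  forall p, D p -> Cmod (sum_n (fun j => val (x j) p) m - f p)%C < e.
Proof.
  set (d := fun j : nat => / INR (S j)).
  assert (Hd : forall j, 0 < d j) by (intro j; apply Rinv_0_lt_compat, lt_0_INR; lia).
  assert (Hdm : forall i j, (i <= j)%nat -> d j <= d i).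
  { intros i j Hij. apply Rinv_le_contravar; [apply lt_0_INR; lia|apply le_INR; lia]. }
  assert (HL : exists L : nat -> list X, forall j p, D p -> Cmod (lval (L j) p - f p)%C <= d j).
  { exists (fun j => proj1_sig (constructive_indefinite_description _ (approx (d j) (Hd j)))).
    intro j. exact (proj2_sig (constructive_indefinite_description _ (approx (d j) (Hd j)))). }
  destruct HL as [L HL].
  assert (HB : exists B : nat -> list X, forall j,
    (forall p, lval (B j) p = (lval (L (S j)) p - lval (L j) p)%C) /\
    (forall l1 l2 p, B j = l1 ++ l2 -> D p -> Cmod (lval l1 p) <= 3 * d j)).
  { assert (H : forall j, exists l, (forall p, lval l p = (lval (L (S j)) p - lval (L j) p)%C) /\
      (forall l1 l2 p, l = l1 ++ l2 -> D p -> Cmod (lval l1 p) <= 3 * d j)).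
    { intro j.
      assert (E : forall p, lval (L (S j) ++ map (sc (-1)) (L j)) p = (lval (L (S j)) p - lval (L j) p)%C).
      { intro p. rewrite lval_app, lval_map.
        replace (RtoC (-1)) with (- RtoC 1)%C by (rewrite <- RtoC_opp; f_equal; lra). ring. }
      destruct (fine_block (L (S j) ++ map (sc (-1)) (L j)) (2 * d j) (d j)) as [l [H1 H2]]; auto.
      - intros p Hp. rewrite E. replace (lval (L (S j)) p - lval (L j) p)%C
          with ((lval (L (S j)) p - f p) + - (lval (L j) p - f p))%C by ring.
        eapply Rle_trans; [apply Cmod_triangle|]. rewrite Cmod_opp.
        pose proof (HL (S j) p Hp). pose proof (HL j p Hp). pose proof (Hdm j (S j) ltac:(lia)). lra.
      - exists l. split; [intro p; now rewrite H1|]. intros l1 l2 p El Hp. specialize (H2 l1 l2 p El Hp). lra. }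
    exists (fun j => proj1_sig (constructive_indefinite_description _ (H j))).
    intro j. exact (proj2_sig (constructive_indefinite_description _ (H j))). }
  destruct HB as [B HB].
  (* The padding by [x0], of value 0, makes stage j at least j + 1 entries long even if all blocks
     are empty. Entry i can therefore be read off at stage i and never changes later. *)
  set (Q := fix Q (j : nat) : list X := match j with O => x0 :: L O | S i => Q i ++ x0 :: B i end).
  assert (HQlen : forall j, (S j <= length (Q j))%nat).
  { induction j; simpl; [lia|]. rewrite length_app. simpl. lia. }
  assert (HQval : forall j p, lval (Q j) p = lval (L j) p).
  { induction j; intro p; simpl Q.
    - simpl. rewrite val_x0. ring.
    - rewrite lval_app, IHj. simpl. rewrite val_x0, (proj1 (HB j)). ring. }
  assert (HQpre : forall i k, exists l, Q (i + k)%nat = Q i ++ l).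
  { intros i k. induction k as [|k [l IH]].
    - exists nil. now rewrite Nat.add_0_r, app_nil_r.
    - exists (l ++ x0 :: B (i + k)%nat). rewrite Nat.add_succ_r. simpl Q. rewrite IH, app_assoc. reflexivity. }
  assert (Hnear : forall j k l1 l2 p, Q (j + k)%nat = l1 ++ l2 -> (length (Q j) <= length l1)%nat -> D p ->
    Cmod (lval l1 p - f p)%C <= 4 * d j).
  { intros j k. induction k; intros l1 l2 p E Hlen Hp.
    - rewrite Nat.add_0_r in E. assert (l2 = nil).
      { apply (f_equal (@length X)) in E. rewrite length_app in E. destruct l2; auto. simpl in E. lia. }
      subst l2. rewrite app_nil_r in E. rewrite <- E, HQval. pose proof (HL j p Hp). pose proof (Hd j). lra.
    - rewrite Nat.add_succ_r in E. simpl Q in E. apply app_eq_app in E. destruct E as [l [[E _]|[E E']]].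
      + now apply (IHk l1 l).
      + pose proof (HL (j + k)%nat p Hp) as H1. pose proof (Hdm j (j + k)%nat ltac:(lia)) as H2.
        rewrite E, lval_app, HQval.
        replace (lval (L (j + k)%nat) p + lval l p - f p)%C with ((lval (L (j + k)%nat) p - f p) + lval l p)%C by ring.
        eapply Rle_trans; [apply Cmod_triangle|].
        assert (Cmod (lval l p) <= 3 * d (j + k)%nat); [|lra].
        destruct l as [|y l]; simpl in E'.
        * simpl. rewrite Cmod_0. pose proof (Hd (j + k)%nat). lra.
        * injection E' as <- E'. simpl. rewrite val_x0, Cplus_0_l. apply (proj2 (HB (j + k)%nat) l l2 p E' Hp). }
  exists (fun i => nth i (Q i) x0). intros e He.
  destruct (INR_unbounded (4 / e)) as [j Hj].
  assert (Hje : 4 * d j < e).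
  { unfold d. apply (Rmult_lt_reg_r (INR (S j))); [apply lt_0_INR; lia|].
    rewrite Rmult_assoc, Rinv_l by (apply not_0_INR; lia). rewrite S_INR.
    apply (Rmult_lt_compat_r e) in Hj; auto. unfold Rdiv in Hj. rewrite Rmult_assoc, Rinv_l in Hj by lra. nra. }
  exists (length (Q j) + j)%nat. intros m Hm p Hp.
  eapply Rle_lt_trans; [|exact Hje].
  rewrite (sum_n_ext_loc _ (fun i => val (nth i (Q m) x0) p)).
  - rewrite sum_n_firstn by apply HQlen.
    apply (Hnear j (m - j)%nat _ (skipn (S m) (Q m)) p); auto.
    + replace (j + (m - j))%nat with m by lia. symmetry. apply firstn_skipn.
    + rewrite length_firstn. pose proof (HQlen m). lia.
  - intros i Hi. f_equal. destruct (HQpre i (m - i)%nat) as [l El]. replace (i + (m - i))%nat with m in El by lia.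
    rewrite El, app_nth1; auto.
Qed.
End Blocks.

(** * Approximation by modes *)
Lemma polynomial_derivatives p : polynomial p -> exists d : nat -> R -> R,
  (forall r, d O r = p r) /\ forall k r, is_derive (d k) r (d (S k) r).
Proof.
  induction 1 as [c|p q _ [d [D0 D1]] _ [e [E0 E1]]|c p _ [d [D0 D1]]|p _ [d [D0 D1]]].
  - exists (fun k _ => match k with O => c | _ => 0 end). split; auto. intros [|k] r; [exact (is_derive_const c r)|exact (is_derive_const 0 r)].
  - exists (fun k r => d k r + e k r). split; [intro; now rewrite D0, E0|]. intros k r. apply is_derive_rplus; auto.
  - exists (fun k r => c * d k r). split; [intro; now rewrite D0|]. intros k r. apply is_derive_rscal; auto.
  - exists (fun k r => r * d k r + INR k * d (pred k) r). split.
    + intro r. simpl. rewrite D0. ring.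
    + intros k r. eapply is_derive_eq.
      * apply is_derive_rplus; [apply is_derive_rmult; [apply is_derive_id|apply D1]|apply is_derive_rscal, D1].
      * destruct k; [simpl; unfold one; simpl; rring|]. rewrite (S_INR (S k)). simpl pred. unfold one; simpl. rring.
Qed.
Lemma polynomial_smooth_on_unit p : polynomial p -> smooth_on_unit p.
Proof.
  intro Hp. destruct (polynomial_derivatives p Hp) as [d [D0 D1]]. exists d. split; [auto|split; [|auto]].
  intros k r. apply (cont_derive (d k) (d (S k))). apply D1.
Qed.

Lemma cis_add a b : (cis a * cis b)%C = cis (a + b).
Proof. unfold cis, Cmult. simpl. rewrite cos_plus, sin_plus. f_equal; ring. Qed.

Inductive component := density_comp | radial | angular.
(** One frequency and one angular number with a profile for each component, so that density and both
    velocity components share their sequences as in [sum_of_modes]. *)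
Record term := Term { tm_freq : R; tm_wave : Z; tm_profile : component -> R -> C;
  tm_smooth : forall k, smooth_profile (tm_profile k) }.
Definition point : Type := component * R * R * R.
Definition in_unit (p : point) : Prop := 0 <= snd (fst p) <= 1.
(** Embeds an expansion of one component into the simultaneous expansion, with zero profiles in the
    other two. *)
Definition ind (s k : component) : R :=
  match s, k with
  | density_comp, density_comp => 1 | radial, radial => 1 | angular, angular => 1
  | _, _ => 0
  end.

Section Modes.
Variable (w : R).
Definition term_val (x : term) (p : point) : C :=
  let '(k, t, r, th) := p in mode w (tm_freq x) (tm_wave x) (tm_profile x k) t r th.

Lemma smooth_profile_scal a q : smooth_profile q -> smooth_profile (fun r => (RtoC a * q r)%C).
Proof.
  assert (H : forall f, smooth_on_unit f -> smooth_on_unit (fun r => a * f r)).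
  { intros f [d [D0 [D1 D2]]]. exists (fun k r => a * d k r). split; [|split].
    - intros r Hr. now rewrite D0.
    - intros k r. apply (continuous_rmult _ (fun _ => a) (d k)); [apply continuous_const|apply D1].
    - intros k r Hr. apply is_derive_rscal; auto. }
  assert (E : forall f g : R -> R, (forall r, f r = g r) -> smooth_on_unit f -> smooth_on_unit g).
  { intros f g Efg [d [D0 D]]. exists d. split; auto. intros r Hr. now rewrite <- Efg, D0. }
  intros [H1 H2]. split.
  - apply (E (fun r => a * Re (q r))); [intro r; destruct (q r); unfold Re, Im, Cmult, RtoC; simpl; ring|auto].
  - apply (E (fun r => a * Im (q r))); [intro r; destruct (q r); unfold Re, Im, Cmult, RtoC; simpl; ring|auto].
Qed.
Definition term_scal (a : R) (x : term) : term :=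
  Term (tm_freq x) (tm_wave x) (fun k r => (RtoC a * tm_profile x k r)%C)
    (fun k => smooth_profile_scal a _ (tm_smooth x k)).
Lemma term_val_scal a x p : term_val (term_scal a x) p = (RtoC a * term_val x p)%C.
Proof. destruct p as [[[k t] r] th]. unfold term_val, mode. simpl. ring. Qed.

Lemma smooth_profile_poly (p : R -> R) (a b : R) : polynomial p -> smooth_profile (fun r => (a * p r, b * p r)).
Proof. intro Hp. split; simpl; apply polynomial_smooth_on_unit; now apply polynomial_scal. Qed.
Definition term_zero : term := Term 0 0 (fun _ r => (0 * 0, 0 * 0)) (fun _ => smooth_profile_poly (fun _ => 0) 0 0 (polynomial_const 0)).
Lemma term_val_zero p : term_val term_zero p = RtoC 0.
Proof.
  destruct p as [[[k t] r] th]. unfold term_val, mode. simpl tm_profile.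
  replace (0 * 0, 0 * 0) with (RtoC 0) by (unfold RtoC; f_equal; ring). ring.
Qed.

Lemma Cmod_cis a : Cmod (cis a) = 1.
Proof.
  unfold Cmod, cis. simpl. replace (cos a * (cos a * 1) + sin a * (sin a * 1)) with (Rsqr (sin a) + Rsqr (cos a)) by (unfold Rsqr; ring).
  rewrite sin2_cos2. apply sqrt_1.
Qed.
Lemma smooth_on_unit_bounded f : smooth_on_unit f -> exists M, forall r, 0 <= r <= 1 -> Rabs (f r) <= M.
Proof.
  intros [d [D0 [D1 _]]]. destruct (cont_bounded_max (fun r => Rabs (d O r))) as [z [_ Hz]].
  - apply cont_abs. exact (D1 O).
  - exists (Rabs (d O z)). intros r Hr. rewrite <- D0 by auto. now apply Hz.
Qed.
Lemma term_bounded x : exists M, forall p, in_unit p -> Cmod (term_val x p) <= M.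
Proof.
  assert (H : forall k, exists M, forall r, 0 <= r <= 1 -> Cmod (tm_profile x k r) <= M).
  { intro k. destruct (tm_smooth x k) as [H1 H2].
    destruct (smooth_on_unit_bounded _ H1) as [M1 B1]. destruct (smooth_on_unit_bounded _ H2) as [M2 B2].
    exists (M1 + M2). intros r Hr. specialize (B1 r Hr). specialize (B2 r Hr).
    destruct (tm_profile x k r) as [a b]. simpl in B1, B2.
    replace (a, b) with ((a, 0) + Ci * (b, 0))%C by (unfold Ci, Cplus, Cmult; simpl; f_equal; ring).
    eapply Rle_trans; [apply Cmod_triangle|]. rewrite Cmod_mult.
    change (a, 0) with (RtoC a). change (b, 0) with (RtoC b). rewrite !Cmod_R.
    replace (Cmod Ci) with 1; [lra|]. unfold Cmod, Ci. simpl. replace (0 * (0 * 1) + 1 * (1 * 1)) with 1 by ring. now rewrite sqrt_1. }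
  destruct (H density_comp) as [M1 B1]. destruct (H radial) as [M2 B2]. destruct (H angular) as [M3 B3].
  exists (Rabs M1 + Rabs M2 + Rabs M3). intros [[[k t] r] th] Hr. unfold in_unit in Hr. simpl in Hr.
  unfold term_val, mode. rewrite !Cmod_mult, !Cmod_cis.
  specialize (B1 r Hr). specialize (B2 r Hr). specialize (B3 r Hr).
  pose proof (Rle_abs M1). pose proof (Rle_abs M2). pose proof (Rle_abs M3).
  pose proof (Rabs_pos M1). pose proof (Rabs_pos M2). pose proof (Rabs_pos M3).
  destruct k; lra.
Qed.

Notation tval := (lval term point term_val).

Definition real_val (h : component -> R -> R -> R -> R) (p : point) : C :=
  let '(k, t, r, th) := p in RtoC (h k t r th).
Definition approximable (h : component -> R -> R -> R -> R) : Prop := forall e, 0 < e ->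
  exists l, forall p, in_unit p -> Cmod (tval l p - real_val h p)%C <= e.

Lemma approximable_lim h : (forall e, 0 < e -> exists g, approximable g /\
    forall k t r th, 0 <= r <= 1 -> Rabs (h k t r th - g k t r th) <= e) -> approximable h.
Proof.
  intros H e He. destruct (H (e / 2)) as [g [G1 G2]]; [lra|]. destruct (G1 (e / 2)) as [l Hl]; [lra|].
  exists l. intros p Hp. specialize (Hl p Hp).
  replace (tval l p - real_val h p)%C with ((tval l p - real_val g p) + (real_val g p - real_val h p))%C by ring.
  eapply Rle_trans; [apply Cmod_triangle|].
  assert (Cmod (real_val g p - real_val h p)%C <= e / 2); [|lra].
  destruct p as [[[k t] r] th]. simpl. rewrite <- RtoC_minus, Cmod_R, Rabs_minus_sym. apply G2. exact Hp.
Qed.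
Lemma approximable_ext h g : (forall k t r th, 0 <= r <= 1 -> h k t r th = g k t r th) -> approximable g -> approximable h.
Proof.
  intros E Hg. apply approximable_lim. intros e He. exists g. split; auto. intros. rewrite E, Rminus_diag, Rabs_R0; auto. lra.
Qed.
Lemma approximable_zero : approximable (fun _ _ _ _ => 0).
Proof.
  intros e He. exists nil. intros [[[k t] r] th] _. simpl. replace (RtoC 0 - RtoC 0)%C with (RtoC 0) by ring. rewrite Cmod_0. lra.
Qed.
Lemma approximable_add h g : approximable h -> approximable g -> approximable (fun k t r th => h k t r th + g k t r th).
Proof.
  intros Hh Hg e He. destruct (Hh (e / 2)) as [l Hl]; [lra|]. destruct (Hg (e / 2)) as [m Hm]; [lra|].
  exists (l ++ m). intros p Hp. specialize (Hl p Hp). specialize (Hm p Hp). rewrite lval_app.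
  replace (real_val (fun k t r th => h k t r th + g k t r th) p) with (real_val h p + real_val g p)%C
    by (destruct p as [[[k t] r] th]; simpl; now rewrite RtoC_plus).
  replace (_ - _)%C with ((tval l p - real_val h p) + (tval m p - real_val g p))%C by ring.
  eapply Rle_trans; [apply Cmod_triangle|]. lra.
Qed.

(** A real wave is a pair of conjugate modes with opposite frequency and angular number. The
    continuous profile is replaced by a polynomial, as the profiles of modes have to be smooth. *)
Lemma approximable_mode s q l n a b : cont q ->
  approximable (fun k t r th => ind s k * (q r * (a * cos (l * t + IZR n * (th - w * t)) + b * sin (l * t + IZR n * (th - w * t))))).
Proof.
  intros Cq. set (M := Rabs a + Rabs b). assert (HM : 0 <= M) by (unfold M; pose proof (Rabs_pos a); pose proof (Rabs_pos b); lra).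
  intros e He. destruct (weierstrass q (e / (M + 1)) Cq) as [p [Pp Hp]]; [apply Rdiv_lt_0_compat; lra|].
  set (f1 := fun k r => ((ind s k * (a / 2)) * p r, (- (ind s k * (b / 2))) * p r) : C).
  set (f2 := fun k r => ((ind s k * (a / 2)) * p r, (ind s k * (b / 2)) * p r) : C).
  exists (Term l n f1 (fun k => smooth_profile_poly p _ _ Pp) :: Term (- l) (- n) f2 (fun k => smooth_profile_poly p _ _ Pp) :: nil).
  intros [[[k t] r] th] Hr. unfold in_unit in Hr. simpl in Hr. simpl. unfold mode.
  set (x := l * t + IZR n * (th - w * t)).
  replace (cis (l * t) * f1 k r * cis (IZR n * (th - w * t)))%C with (f1 k r * (cis (l * t) * cis (IZR n * (th - w * t))))%C by ring.
  replace (cis (- l * t) * f2 k r * cis (IZR (- n) * (th - w * t)))%C with (f2 k r * (cis (- l * t) * cis (IZR (- n) * (th - w * t))))%C by ring.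
  rewrite !cis_add. fold x. replace (- l * t + IZR (- n) * (th - w * t)) with (- x) by (unfold x; rewrite opp_IZR; ring).
  assert (E : (f1 k r * cis x + (f2 k r * cis (- x) + RtoC 0))%C = RtoC (ind s k * (p r * (a * cos x + b * sin x)))).
  { unfold f1, f2, cis, Cmult, Cplus, RtoC. simpl. rewrite cos_neg, sin_neg. f_equal; field. }
  rewrite E, <- RtoC_minus, Cmod_R.
  replace (_ - _) with (ind s k * ((p r - q r) * (a * cos x + b * sin x))) by ring.
  rewrite !Rabs_mult. specialize (Hp r Hr).
  assert (Hi : 0 <= Rabs (ind s k) <= 1) by (destruct s, k; simpl; rewrite ?Rabs_R0, ?Rabs_R1; lra).
  assert (Ht : Rabs (a * cos x + b * sin x) <= M).
  { eapply Rle_trans; [apply Rabs_triang|]. rewrite !Rabs_mult. unfold M.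
    assert (Rabs (cos x) <= 1) by (apply Rabs_le; apply COS_bound). assert (Rabs (sin x) <= 1) by (apply Rabs_le; apply SIN_bound).
    pose proof (Rabs_pos a). pose proof (Rabs_pos b). nra. }
  apply Rle_trans with (1 * (e / (M + 1) * (M + 1))); [|right; field; lra].
  apply Rmult_le_compat; try lra.
  - apply Rmult_le_pos; apply Rabs_pos.
  - apply Rmult_le_compat; auto using Rabs_pos. lra.
Qed.
Lemma approximable_modal s n g : modal g -> approximable (fun k t r th => ind s k * g (- (IZR n * (th - w * t))) t r).
Proof.
  induction 1 as [|q c Cq [L HL]|f g _ IHf _ IHg].
  - apply (approximable_ext _ (fun _ _ _ _ => 0)); [intros; ring|apply approximable_zero].
  - apply (approximable_ext _ (fun k t r th => ind s k * (q r * trig_sum L (- (IZR n * (th - w * t))) t))); [intros; now rewrite HL|].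
    clear HL. induction L as [|[[l a] b] L IH].
    + apply (approximable_ext _ (fun _ _ _ _ => 0)); [intros; simpl; ring|apply approximable_zero].
    + eapply approximable_ext; [|apply approximable_add; [exact (approximable_mode s q l n a b Cq)|exact IH]].
      intros k t r th _. simpl.
      replace (l * t - - (IZR n * (th - w * t))) with (l * t + IZR n * (th - w * t)) by ring. ring.
  - eapply approximable_ext; [|exact (approximable_add _ _ IHf IHg)]. intros. cbv beta. ring.
Qed.
(** Here the phase becomes - n (theta - w t), which is legitimate because the approximation is
    uniform in the phase. *)
Lemma approximable_apx s n g : apx g -> approximable (fun k t r th => ind s k * g (- (IZR n * (th - w * t))) t r).
Proof.
  intro Hg. apply approximable_lim. intros e He. destruct (Hg e He) as [m [M1 M2]].
  exists (fun k t r th => ind s k * m (- (IZR n * (th - w * t))) t r). split; [now apply approximable_modal|].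
  intros k t r th Hr. specialize (M2 (- (IZR n * (th - w * t))) t r Hr).
  replace (_ - _) with (ind s k * (g (- (IZR n * (th - w * t))) t r - m (- (IZR n * (th - w * t))) t r)) by ring.
  rewrite Rabs_mult. assert (Hi : 0 <= Rabs (ind s k) <= 1) by (destruct s, k; simpl; rewrite ?Rabs_R0, ?Rabs_R1; lra).
  pose proof (Rabs_pos (g (- (IZR n * (th - w * t))) t r - m (- (IZR n * (th - w * t))) t r)). nra.
Qed.

Lemma trig_shift c b : trig c -> trig (fun al t => c (al - b) t).
Proof.
  intros [L HL]. apply (trig_ext (fun al t => trig_sum L (al - b) t)); [intros; now rewrite HL|]. clear HL.
  induction L as [|[[l x] y] L IH]; [apply trig_zero|].
  eapply trig_ext; [|exact (trig_add _ _ (trig_single l (x * cos b + y * sin b) (- (x * sin b) + y * cos b)) IH)].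
  intros al t. simpl. replace (l * t - (al - b)) with ((l * t - al) + b) by ring. rewrite cos_plus, sin_plus. ring.
Qed.
Lemma apx_shift f b : apx f -> apx (fun al t r => f (al - b) t r).
Proof.
  intros Hf e He. destruct (Hf e He) as [g [G1 G2]]. exists (fun al t r => g (al - b) t r). split; auto.
  clear - G1. induction G1; [apply modal_zero| |now apply modal_add].
  apply (modal_term q (fun al t => c (al - b) t)); auto. now apply trig_shift.
Qed.

(** Truncation of the Fourier series at an N with 2 K / N <= e reduces the claim to finitely many
    angular numbers. *)
Lemma approximable_series s (h : R -> R -> R -> R) (c : nat -> R -> R -> R -> R) (K : R) :
  (forall t r, cont (h t r)) -> (forall t r th, h t r (th + 2 * PI) = h t r th) ->
  (forall n, apx (c n)) -> 0 <= K ->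
  (forall n t r th, 0 <= r <= 1 -> fcoef (h t r) n th = c n (- (INR n * (th - w * t))) t r) ->
  (forall n al t r, (2 <= n)%nat -> 0 <= r <= 1 -> Rabs (c n al t r) <= K / INR n ^ 2) ->
  approximable (fun k t r th => ind s k * h t r th).
Proof.
  intros Ch Ph Hc HK Hf HB. pose proof PI_RGT_0 as Hpi. apply approximable_lim. intros e He.
  destruct (INR_unbounded (2 * K / e)) as [N0 HN0]. set (N := S N0).
  assert (HNp : 0 < INR N) by (apply lt_0_INR; unfold N; lia).
  assert (HN : 2 * K / INR N <= e).
  { assert (INR N0 <= INR N) by (apply le_INR; unfold N; lia).
    apply (Rmult_lt_compat_r e) in HN0; auto. unfold Rdiv in HN0. rewrite Rmult_assoc, Rinv_l in HN0 by lra.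
    apply (Rmult_le_reg_r (INR N)); auto. unfold Rdiv. rewrite Rmult_assoc, Rinv_l by lra. nra. }
  exists (fun k t r th => ind s k * (/ (2 * PI) * fsum (h t r) th N)). split.
  - assert (A1 : forall n z, approximable (fun k t r th => ind s k * (z * fcoef (h t r) n th))).
    { intros n z. apply (approximable_ext _ (fun k t r th => ind s k * ((fun al t r => z * c n al t r) (- (IZR (Z.of_nat n) * (th - w * t))) t r))).
      - intros k t r th Hr. cbv beta. now rewrite Hf, INR_IZR_INZ.
      - apply (approximable_apx s (Z.of_nat n) (fun al t r => z * c n al t r)).
        apply (apx_mulr (fun _ => z)); [cont_tac|apply Hc]. }
    assert (A2 : forall m, approximable (fun k t r th => ind s k * (/ (2 * PI) * (2 * ssum (fun j => fcoef (h t r) (S j) th) m)))).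
    { induction m.
      - apply (approximable_ext _ (fun _ _ _ _ => 0)); [intros; simpl; ring|apply approximable_zero].
      - eapply approximable_ext; [|exact (approximable_add _ _ IHm (A1 (S m) (/ (2 * PI) * 2)))].
        intros. cbn [ssum]. ring. }
    eapply approximable_ext; [|exact (approximable_add _ _ (A1 0%nat (/ (2 * PI))) (A2 N))].
    intros. unfold fsum. ring.
  - intros k t r th Hr.
    pose proof (fourier_inversion (h t r) (Ch t r) (Ph t r) K th N HK ltac:(unfold N; lia)) as F.
    specialize (F ltac:(intros n Hn; rewrite Hf by auto; apply HB; auto)).
    replace (_ - _) with (ind s k * (/ (2 * PI) * (2 * PI * h t r th - fsum (h t r) th N))) by (field; lra).
    rewrite !Rabs_mult. assert (Hi : 0 <= Rabs (ind s k) <= 1) by (destruct s, k; simpl; rewrite ?Rabs_R0, ?Rabs_R1; lra).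
    assert (Hj : 0 < / (2 * PI) <= 1).
    { split; [apply Rinv_0_lt_compat; lra|]. rewrite <- Rinv_1. apply Rinv_le_contravar; [lra|]. pose proof PI2_1. lra. }
    rewrite (Rabs_pos_eq (/ (2 * PI))) by lra. pose proof (Rabs_pos (2 * PI * h t r th - fsum (h t r) th N)).
    apply Rle_trans with (1 * (1 * e)); [|lra]. apply Rmult_le_compat; try lra.
    + apply Rmult_le_pos; lra.
    + apply Rmult_le_compat; lra.
Qed.
End Modes.

Lemma polar_coordinates x y : in_disc x y -> exists r th, 0 <= r <= 1 /\ x = r * cos th /\ y = r * sin th.
Proof.
  intro H. unfold in_disc in H. set (r := sqrt (x ^ 2 + y ^ 2)).
  assert (Hxy : 0 <= x ^ 2 + y ^ 2) by (pose proof (pow2_ge_0 x); pose proof (pow2_ge_0 y); lra).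
  assert (Hr2 : r * r = x ^ 2 + y ^ 2) by (apply sqrt_sqrt; auto).
  assert (Hr0 : 0 <= r) by apply sqrt_pos.
  assert (Hr1 : r <= 1) by nra.
  destruct (Req_dec r 0) as [E|Hne].
  - exists 0, 0. rewrite E in Hr2. assert (x = 0) by nra. assert (y = 0) by nra. subst. split; [lra|split; ring].
  - assert (Hr : 0 < r) by lra. set (u := x / r). assert (Eu : x = r * u) by (unfold u; field; lra).
    assert (Hyu : y ^ 2 = r ^ 2 * (1 - u ^ 2)) by (rewrite Eu in Hr2; nra).
    assert (Hu : -1 <= u <= 1).
    { assert (Hu2 : u ^ 2 <= 1).
      { apply (Rmult_le_reg_l (r ^ 2)); [nra|]. pose proof (pow2_ge_0 y). lra. }
      split; nra. }
    assert (Es : sqrt (1 - Rsqr u) = Rabs y / r).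
    { rewrite <- (sqrt_Rsqr (Rabs y / r)).
      - f_equal. replace (Rsqr (Rabs y / r)) with (Rabs y ^ 2 / r ^ 2) by (unfold Rsqr; field; lra).
        rewrite pow2_abs, Hyu. unfold Rsqr. field. lra.
      - apply Rdiv_le_0_compat; [apply Rabs_pos|auto]. }
    destruct (Rle_dec 0 y) as [Hy|Hy].
    + exists r, (acos u). rewrite cos_acos, sin_acos, Es, Rabs_pos_eq by auto. split; [lra|split; [auto|field; auto]].
    + exists r, (- acos u). rewrite cos_neg, sin_neg, cos_acos, sin_acos, Es, Rabs_left by lra. split; [lra|split; [auto|field; auto]].
Qed.

(** * Expansion of the polar components of a solution *)

Section Expansion.
Variables (A B w c : R) (sg : R -> scalar_field) (v : R -> vector_field).
Let ux : R -> scalar_field := fun t => vx (v t).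
Let uy : R -> scalar_field := fun t => vy (v t).
Variable (HA : 0 < A).
Variable (HB : 0 <= B).
Variable (Hc : 0 < c).
Variable (Hs : smooth sg).
Variable (Hvx : smooth ux).
Variable (Hvy : smooth uy).
Variable (Hbd : forall t x y, on_circle x y -> sg t x y = 0).
Variable (Hcont : forall t x y, in_disc x y -> mat w sg t x y = - diverg (rmul A B ux) (rmul A B uy) t x y).
Variable (Hmomx : forall t x y, in_disc x y -> Dt ux t x y = - w * rot ux t x y + w * uy t x y - c ^ 2 * Dx sg t x y).
Variable (Hmomy : forall t x y, in_disc x y -> Dt uy t x y = - w * rot uy t x y - w * ux t x y - c ^ 2 * Dy sg t x y).

Lemma periodic_cos x : cos (x + 2 * PI) = cos x.
Proof. rewrite <- (cos_period x 1). simpl. f_equal. ring. Qed.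
Lemma periodic_sin x : sin (x + 2 * PI) = sin x.
Proof. rewrite <- (sin_period x 1). simpl. f_equal. ring. Qed.

Lemma phase_angle n al th t s : al = - (INR n * (th - w * t)) ->
  INR n * (s - th) = IZR (Z.of_nat n) * s + al - INR n * w * t.
Proof. intros ->. rewrite <- INR_IZR_INZ. ring. Qed.

Lemma fcoef_density n t r th :
  fcoef (polar (sg t) r) n th = Sn w sg n (- (INR n * (th - w * t))) t r.
Proof.
  unfold fcoef, Sn, Fc. apply RInt_rext. intro s. unfold ker, polar. now rewrite <- (phase_angle n _ th).
Qed.
(** Radial and angular component are real and imaginary part of exp (- i theta) (v_x + i v_y). The
    factor lowers the angular number n + 1 to n, and its conjugate raises n - 1 to n. *)
Lemma fcoef_radial n t r th : fcoef (radial_comp (v t) r) n th =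
  / 2 * (Pn w ux uy n (- (INR n * (th - w * t))) t r + Mn w ux uy n (- (INR n * (th - w * t))) t r).
Proof.
  set (al := - (INR n * (th - w * t))). set (m := Z.of_nat n). set (nu := INR n * w).
  pose proof (cont_ker ux (m + 1) al nu t r Hvx). pose proof (cont_ker ux (m - 1) al nu t r Hvx).
  pose proof (cont_ker uy (m + 1) (al - PI / 2) nu t r Hvy). pose proof (cont_ker uy (m - 1) (al - PI / 2) nu t r Hvy).
  unfold fcoef, Pn, Mn, PP, MM, Fc. fold m nu.
  rewrite <- RInt_cplus, <- RInt_cminus, <- RInt_cplus, <- RInt_cscal by cont_tac.
  apply RInt_rext. intro s. unfold ker, radial_comp, polar, ux, uy.
  rewrite (phase_angle n al th t s eq_refl). fold m nu.
  rewrite cos_next, cos_prev, cos_next, cos_prev, !cos_quarter.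
  replace (sin (IZR m * s + (al - PI / 2) - nu * t)) with (- cos (IZR m * s + al - nu * t)); [field|].
  rewrite <- sin_shift, <- sin_neg. f_equal. ring.
Qed.
Lemma fcoef_angular n t r th : fcoef (angular_comp (v t) r) n th =
  / 2 * (Mn w ux uy n (- (INR n * (th - w * t)) - PI / 2) t r - Pn w ux uy n (- (INR n * (th - w * t)) - PI / 2) t r).
Proof.
  set (al := - (INR n * (th - w * t))). set (m := Z.of_nat n). set (nu := INR n * w).
  unfold fcoef, Pn, Mn. fold m nu. unfold PP, MM. rewrite !Fc_half_turn by auto. unfold Fc.
  pose proof (cont_ker ux (m + 1) (al - PI / 2) nu t r Hvx). pose proof (cont_ker ux (m - 1) (al - PI / 2) nu t r Hvx).
  pose proof (cont_ker uy (m + 1) al nu t r Hvy). pose proof (cont_ker uy (m - 1) al nu t r Hvy).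
  rewrite <- !RInt_copp, <- RInt_cminus, <- RInt_cplus, <- RInt_cminus, <- RInt_cscal by cont_tac.
  apply RInt_rext. intro s. unfold ker, angular_comp, polar, ux, uy.
  rewrite (phase_angle n al th t s eq_refl). fold m nu.
  rewrite cos_prev, cos_prev, cos_next, cos_next, !cos_quarter.
  replace (sin (IZR m * s + (al - PI / 2) - nu * t)) with (- cos (IZR m * s + al - nu * t)); [field|].
  rewrite <- sin_shift, <- sin_neg. f_equal. ring.
Qed.

Definition components (k : component) (t r th : R) : R :=
  match k with
  | density_comp => polar (sg t) r th
  | radial => radial_comp (v t) r th
  | angular => angular_comp (v t) r th
  end.

Lemma components_approximable : approximable w components.
Proof.
  destruct (SPM_decay A B w c sg ux uy HA HB Hc Hs Hvx Hvy Hbd Hcont Hmomx Hmomy) as [K [HK0 HK]].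
  pose proof (apx_SPM A B w c sg ux uy HA HB Hc Hs Hvx Hvy Hbd Hcont Hmomx Hmomy) as HSPM.
  pose proof (fun n => proj1 (HSPM n)) as HS. pose proof (fun n => proj1 (proj2 (HSPM n))) as HP.
  pose proof (fun n => proj2 (proj2 (HSPM n))) as HM. clear HSPM.
  assert (Cp : forall f : R -> scalar_field, smooth f -> forall t r, cont (polar (f t) r)).
  { intros f Hf t r s. unfold polar. ctn. }
  assert (Pp : forall (f : scalar_field) r th, polar f r (th + 2 * PI) = polar f r th).
  { intros. unfold polar. now rewrite periodic_cos, periodic_sin. }
  assert (Ap : forall n, apx (fun al t r => / 2 * (Pn w ux uy n al t r + Mn w ux uy n al t r))).
  { intro n. apply (apx_mulr (fun _ => / 2)); [cont_tac|]. exact (apx_add _ _ (HP n) (HM n)). }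
  assert (Am : forall n, apx (fun al t r => / 2 * (Mn w ux uy n (al - PI / 2) t r - Pn w ux uy n (al - PI / 2) t r))).
  { intro n. apply (apx_shift (fun al t r => / 2 * (Mn w ux uy n al t r - Pn w ux uy n al t r))).
    apply (apx_mulr (fun _ => / 2)); [cont_tac|].
    apply (apx_ext (fun al t r => Mn w ux uy n al t r + -1 * Pn w ux uy n al t r)); [intros; ring|].
    exact (apx_add _ _ (HM n) (apx_mulr (fun _ => -1) _ (cont_const (-1)) (HP n))). }
  assert (B2 : forall a b y, Rabs a <= y -> Rabs b <= y -> Rabs (/ 2 * (a + b)) <= y /\ Rabs (/ 2 * (a - b)) <= y).
  { intros a b y H1 H2. split; rewrite Rabs_mult, (Rabs_pos_eq (/ 2)) by lra;
      [pose proof (Rabs_triang a b)|pose proof (Rabs_triang a (- b)); rewrite Rabs_Ropp in *; unfold Rminus]; lra. }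
  assert (H1 : approximable w (fun k t r th => ind density_comp k * polar (sg t) r th)).
  { apply (approximable_series w density_comp (fun t r => polar (sg t) r) (Sn w sg) K (Cp sg Hs) ltac:(intros; apply Pp)); auto.
    - intros. apply fcoef_density.
    - intros n al t r Hn Hr. exact (proj1 (HK n al t r Hn Hr)). }
  assert (H2 : approximable w (fun k t r th => ind radial k * radial_comp (v t) r th)).
  { apply (approximable_series w radial (fun t r => radial_comp (v t) r) (fun n al t r => / 2 * (Pn w ux uy n al t r + Mn w ux uy n al t r)) K); auto.
    - intros t r. unfold radial_comp. pose proof (Cp ux Hvx t r). pose proof (Cp uy Hvy t r). cont_tac.
    - intros. unfold radial_comp. now rewrite !Pp, periodic_cos, periodic_sin.
    - intros. apply fcoef_radial.
    - intros n al t r Hn Hr. destruct (HK n al t r Hn Hr) as [_ [K1 K2]]. exact (proj1 (B2 _ _ _ K1 K2)). }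
  assert (H3 : approximable w (fun k t r th => ind angular k * angular_comp (v t) r th)).
  { apply (approximable_series w angular (fun t r => angular_comp (v t) r)
      (fun n al t r => / 2 * (Mn w ux uy n (al - PI / 2) t r - Pn w ux uy n (al - PI / 2) t r)) K); auto.
    - intros t r. unfold angular_comp. pose proof (Cp ux Hvx t r). pose proof (Cp uy Hvy t r). cont_tac.
    - intros. unfold angular_comp. now rewrite !Pp, periodic_cos, periodic_sin.
    - intros. apply fcoef_angular.
    - intros n al t r Hn Hr. destruct (HK n (al - PI / 2) t r Hn Hr) as [_ [K1 K2]]. exact (proj2 (B2 _ _ _ K2 K1)). }
  eapply approximable_ext; [|exact (approximable_add _ _ _ (approximable_add _ _ _ H1 H2) H3)].
  intros k t r th _. cbv beta. destruct k; simpl; ring.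
Qed.

(** A finite sum of modes at uniform distance 1 suffices: each mode is bounded, since its time
    factors have modulus 1. *)
Lemma components_bounded : bounded_in_time sg v.
Proof.
  destruct (components_approximable 1 ltac:(lra)) as [l Hl].
  destruct (prefix_bounded term point in_unit (term_val w) (term_bounded w) l) as [M [HM0 HM]].
  assert (G : forall k t r th, 0 <= r <= 1 -> Rabs (components k t r th) <= M + 1).
  { intros k t r th Hr. specialize (Hl (k, t, r, th) Hr). specialize (HM l nil (k, t, r, th) (eq_sym (app_nil_r l)) Hr).
    simpl in Hl. rewrite <- Cmod_R.
    set (z := lval _ _ _ _ _) in *.
    replace (RtoC (components k t r th)) with (z + - (z - RtoC (components k t r th)))%C by ring.
    eapply Rle_trans; [apply Cmod_triangle|]. rewrite Cmod_opp. lra. }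
  exists (2 * (M + 1)). intros t x y Hxy. destruct (polar_coordinates x y Hxy) as [r [th [Hr [-> ->]]]].
  pose proof (G density_comp t r th Hr) as G1. pose proof (G radial t r th Hr) as G2. pose proof (G angular t r th Hr) as G3.
  simpl in G1, G2, G3. split; [unfold polar in G1; lra|].
  unfold radial_comp, angular_comp, polar in G2, G3.
  set (a := vx (v t) (r * cos th) (r * sin th)) in *. set (b := vy (v t) (r * cos th) (r * sin th)) in *.
  replace (a ^ 2 + b ^ 2) with ((cos th * a + sin th * b) ^ 2 + (- sin th * a + cos th * b) ^ 2).
  - rewrite <- (sqrt_pow2 (2 * (M + 1))) by lra. apply sqrt_le_1_alt.
    rewrite <- (pow2_abs (cos th * a + sin th * b)), <- (pow2_abs (- sin th * a + cos th * b)).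
    pose proof (Rabs_pos (cos th * a + sin th * b)). pose proof (Rabs_pos (- sin th * a + cos th * b)). nra.
  - replace (a ^ 2 + b ^ 2) with ((Rsqr (sin th) + Rsqr (cos th)) * (a ^ 2 + b ^ 2)) by (rewrite sin2_cos2; ring).
    unfold Rsqr. ring.
Qed.

Lemma components_sum_of_modes : sum_of_modes w sg v.
Proof.
  destruct (approx_series term point in_unit (term_val w) term_scal term_zero (real_val components)
    (term_val_scal w) (term_val_zero w) (term_bounded w) components_approximable) as [x Hx].
  exists (fun j => tm_freq (x j)), (fun j => tm_wave (x j)), (fun j => tm_profile (x j) density_comp),
    (fun j => tm_profile (x j) radial), (fun j => tm_profile (x j) angular).
  assert (U : forall k, uniform_sum (fun j => mode w (tm_freq (x j)) (tm_wave (x j)) (tm_profile (x j) k)) (components k)).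
  { intros k e He. destruct (Hx e He) as [N HN]. exists N. intros m Hm t r th Hr. exact (HN m Hm (k, t, r, th) Hr). }
  split; [|split; [apply (U density_comp)|split; [apply (U radial)|apply (U angular)]]].
  intro j. split; [|split]; apply tm_smooth.
Qed.

End Expansion.

Theorem theorem4p5 (omega c rho0 : R)
    (sigma : R -> scalar_field) (v : R -> vector_field) :
  0 < c ->
  omega ^ 2 / (2 * c ^ 2) < rho0 ->
  linearized_solution omega c rho0 sigma v ->
  bounded_in_time sigma v /\ sum_of_modes omega sigma v.
Proof.
  intros Hc Hrho [Hs [Hvx [Hvy [Hcont [Hmx [Hmy Hbd]]]]]].
  (* The hypothesis on [rho0] says that the density at the centre is positive. *)
  set (A := rho0 - omega ^ 2 / (2 * c ^ 2)). set (B := omega ^ 2 / (2 * c ^ 2)).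
  set (ux := fun t => vx (v t)). set (uy := fun t => vy (v t)).
  assert (HA : 0 < A) by (unfold A; lra).
  assert (HB : 0 <= B) by (apply Rdiv_le_0_compat; [apply pow2_ge_0|nra]).
  assert (Erho : forall t, density omega c rho0 = rdens A B t).
  { intro t. apply functional_extensionality. intro x. apply functional_extensionality. intro y.
    unfold density, rdens, A, B. field. lra. }
  assert (HC : forall t x y, in_disc x y -> mat omega sigma t x y = - diverg (rmul A B ux) (rmul A B uy) t x y).
  { intros t x y H. specialize (Hcont t x y H). rewrite (Erho t) in Hcont.
    change (div (smul (rdens A B t) (v t)) x y) with (diverg (rmul A B ux) (rmul A B uy) t x y) in Hcont.
    change (Derive (fun s => sigma s x y) t) with (Dt sigma t x y) in Hcont.
    (* The rotation field is divergence free, so only the derivative of [sigma] along it remains. *)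
    assert (E : div (smul (sigma t) (rotation omega)) x y = omega * rot sigma t x y).
    { unfold div, pdx, pdy, smul, rotation, rot; simpl.
      rewrite (is_derive_unique _ _ (Dx sigma t x y * (- omega * y))).
      - rewrite (is_derive_unique _ _ (Dy sigma t x y * (omega * x))); [ring|].
        eapply is_derive_eq; [apply (is_derive_rmult (fun s => sigma t x s) (fun _ => omega * x)); [apply (smooth_dy sigma); auto|apply is_derive_const]|].
        unfold zero; simpl. rring.
      - eapply is_derive_eq; [apply (is_derive_rmult (fun s => sigma t s y) (fun _ => - omega * y)); [apply (smooth_dx sigma); auto|apply is_derive_const]|].
        unfold zero; simpl. rring. }
    rewrite E in Hcont. unfold mat. lra. }
  assert (D0 : forall k x, Derive (fun _ => k) x = 0) by (intros; apply Derive_const).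
  assert (D1 : forall k x, Derive (fun s => k * s) x = k).
  { intros. apply is_derive_unique. auto_derive; auto. ring. }
  (* [nabla_u v] differentiates the Cartesian component along the rotation, and [nabla_v u], with u
     linear, contributes - omega v_y here and omega v_x in the other equation. *)
  assert (HMx : forall t x y, in_disc x y -> Dt ux t x y = - omega * rot ux t x y + omega * uy t x y - c ^ 2 * Dx sigma t x y).
  { intros t x y H. specialize (Hmx t x y H).
    change (Derive (fun s => vx (v s) x y) t) with (Dt ux t x y) in Hmx.
    unfold nabla, rotation, grad in Hmx. cbn [vx vy] in Hmx. unfold pdx at 2, pdy at 2 in Hmx. rewrite D0, D1 in Hmx.
    change (pdx (vx (v t)) x y) with (Dx ux t x y) in Hmx. change (pdy (vx (v t)) x y) with (Dy ux t x y) in Hmx.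
    change (pdx (sigma t) x y) with (Dx sigma t x y) in Hmx. unfold rot, uy. lra. }
  assert (HMy : forall t x y, in_disc x y -> Dt uy t x y = - omega * rot uy t x y - omega * ux t x y - c ^ 2 * Dy sigma t x y).
  { intros t x y H. specialize (Hmy t x y H).
    change (Derive (fun s => vy (v s) x y) t) with (Dt uy t x y) in Hmy.
    unfold nabla, rotation, grad in Hmy. cbn [vx vy] in Hmy. unfold pdx at 2, pdy at 2 in Hmy. rewrite D0, D1 in Hmy.
    change (pdx (vy (v t)) x y) with (Dx uy t x y) in Hmy. change (pdy (vy (v t)) x y) with (Dy uy t x y) in Hmy.
    change (pdy (sigma t) x y) with (Dy sigma t x y) in Hmy. unfold rot, ux. lra. }
  split.
  - exact (components_bounded A B omega c sigma v HA HB Hc Hs Hvx Hvy Hbd HC HMx HMy).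
  - exact (components_sum_of_modes A B omega c sigma v HA HB Hc Hs Hvx Hvy Hbd HC HMx HMy).
Qed.
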